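(* Let $\mathcal A$ be a unital Banach $*$-algebra and let $(\mathcal N,F_0)$ be an odd $\theta_q$-summable pre-Breuer-Fredholm module for $\mathcal A$ for some $q$, $0<q\le1$. Let $r\ge0$ and $f_r(T)=|T|^{-r}e^{-|T|^{-1/q}}$. If $F_1,F_2\in\mathcal M_q=F_0+(Li_0^q)_{F_0}$, then the spectral flow along any piecewise $C^1$ path $\{F_t\}_{t\in[1,2]}$ in $\mathcal M_q$ joining $F_1$ and $F_2$ is given by $$sf(F_1,F_2)=\frac{1}{C_{r,q}}\int_1^2\tau\Big[\frac{d}{dt}(F_t)\,f_r(1-F_t^2)\Big]dt+\gamma_{r,q}(F_2)-\gamma_{r,q}(F_1),$$ where $C_{r,q}=\int_{-1}^1(1-u^2)^{-r}e^{-(1-u^2)^{-1/q}}\,du$.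
   Context: $\mathcal N$ is a semifinite von Neumann algebra (separable predual) with faithful normal semifinite trace $\tau$. For $S\in\mathcal N$, $t>0$: $\mu_t(S)=\inf\{\|SE\| : E\in\mathcal N\text{ a projection},\ \tau(1-E)\le t\}$. $Li=\{T\in\mathcal N:\mu_t(T)=O(1/\log t)\text{ as }t\to\infty\}$ with norm $\|T\|_{Li}=\sup_{x>0}\frac{\int_0^x\mu_t(T)dt}{\int_0^x(\log(t+e))^{-1}dt}$. For $0<p\le1$, $Li_0^p=\{T\in\mathcal N:\mu_t(T)=o((1/\log t)^p)\}$ with norm $\|T\|_{Li^p}=(\|\,|T|^{1/p}\|_{Li})^p$. $\mathcal K_{\mathcal N}$ is the norm-closed two-sided ideal generated by the elements of finite trace, $\pi:\mathcal N\to\mathcal N/\mathcal K_{\mathcal N}$; $T\in\mathcal N$ is Breuer-Fredholm if $\pi(T)$ is invertible. An odd $\theta_q$-summable pre-Breuer-Fredholm module for $\mathcal A$: $\mathcal A$ is continuously represented in $\mathcal N$, $F_0\in\mathcal N$ is a self-adjoint Breuer-Fredholm operator, $1-F_0^2\in Li_0^q$, $[F_0,a]\in\mathcal K_{\mathcal N}$ for all $a\in\mathcal A$ and $[F_0,a]\in Li_0^{q/2}$ for a dense set of $a\in\mathcal A$. $(Li_0^q)_{F_0}=\{X\in Li_0^{q/2}: X=X^*,\ F_0X+XF_0\in Li_0^q\}$, a real Banach space with norm $\|X\|_{Li^{q/2}}+\|XF_0+F_0X\|_{Li^q}$; $C^1$ paths in $\mathcal M_q$ are taken in this norm. Every $F\in\mathcal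 M_q$ satisfies $1-F^2\in Li_0^q$ and is Breuer-Fredholm. The function $x\mapsto x^{-r}e^{-x^{-1/q}}$ on $[0,\infty)$ is defined to be $0$ at $x=0$. For $F\in\mathcal M_q$ let $\tilde F=\operatorname{sign}(F)$ with $\operatorname{sign}(x)=1$ for $x\ge0$ and $-1$ for $x<0$ (then $\tilde F\in\mathcal M_q$), and $$\gamma_{r,q}(F)=\frac1{C_{r,q}}\int_0^1\tau\Big[\frac{d}{dt}(F_t)f_r(1-F_t^2)\Big]dt$$ along the linear path $F_t=F+t(\tilde F-F)$ (any $C^1$ path in $\mathcal M_q$ from $F$ to $\tilde F$ gives the same value). Spectral flow: for a norm-continuous path $\{F_t\}_{t\in[a,b]}$ of self-adjoint Breuer-Fredholm operators let $P_t=\chi_{[0,\infty)}(F_t)$; for a fine enough partition (so that $\pi(P_t)$, which is continuous in $t$, varies by less than $1$ on each subinterval), $sf(\{F_t\})=\sum_i\operatorname{ind}(P_{t_{i-1}}P_{t_i})$, where $\operatorname{ind}(PQ)=\tau([\operatorname{ran}Q\cap\ker P])-\tau([\ker Q\cap\operatorname{ran}P])$ is the index of $PQ:\operatorname{ran}Q\to\operatorname{ran}P$. If all $F_t\in F_a+\mathcal K_{\mathcal N}$ (as here), this equals $\operatorname{ind}(P_aP_b)$, depends only on the endpoints, and is written $sf(F_a,F_b)$. *)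

(* Defs.v *)
From HB Require Import structures.
From mathcomp Require Import all_boot all_order all_algebra.
From mathcomp Require Import complex.
From mathcomp Require Import all_classical all_reals all_analysis.

Set Implicit Arguments.
Unset Strict Implicit.
Unset Printing Implicit Defensive.

Import Order.TTheory GRing.Theory Num.Theory.
Import numFieldNormedType.Exports.

Local Open Scope classical_set_scope.
Local Open Scope ring_scope.
Local Open Scope complex_scope.

(** Operators on a Hilbert space [H] are plain functions [H -> H] (so that
    equality is pointwise, the vector space structure is pointwise and the
    product is [\o]); boundedness is the predicate [bounded_op].  Operations
    that only make sense for some operators (adjoint, functional calculus,
    ...) are total, with default value [0]. *)

Section Operators.
Context {R : realType} {H : completeNormedModType R[i]} (ip : H -> H -> R[i]).
Implicit Types T S : H -> H.

(* Linear in the first variable; [H] is complete for its norm, hence a Hilbert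
   space as soon as this holds. *)
Definition hilbert_inner_product : Prop :=
  [/\ forall (a : R[i]) (x y z : H), ip (a *: x + y) z = a * ip x z + ip y z,
      forall x y : H, ip y x = (ip x y)^* &
      forall x : H, ip x x = `|x| ^+ 2].

(* The norm of a normed space over [R[i]] takes its values in [R[i]]. *)
Definition rnorm {V : normedModType R[i]} (x : V) : R := complex.Re `|x|.

Definition bounded_op T : Prop := linear T /\ continuous T.

Definition idop : H -> H := id.

Definition opnorm T : R := sup [set rnorm (T x) | x in [set x : H | rnorm x <= 1]].

Definition adjoint T : H -> H :=
  xget 0 [set S | bounded_op S /\ forall x y, ip (T x) y = ip x (S y)].

Definition projection (E : H -> H) : Prop :=
  [/\ bounded_op E, E \o E = E & adjoint E = E].

(* In [R[i]], [0 <= z] says that [z] is real and nonnegative. *)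
Definition positive_op T : Prop := bounded_op T /\ forall x, 0 <= ip (T x) x.

Definition op_le S T : Prop := positive_op (T - S).

Definition proj_onto (V : set H) : H -> H :=
  xget 0 [set P | projection P /\ range P = V].

Definition represents (E : set R -> H -> H) (x : H)
    (m : {measure set (measurableTypeR R) -> \bar R}) : Prop :=
  forall B : set (measurableTypeR R), measurable B ->
    m B = (complex.Re (ip (E B x) x))%:E.

Definition spectral_measure T (E : set R -> H -> H) : Prop :=
  [/\ forall B : set (measurableTypeR R), measurable B -> projection (E B),
      E setT = idop,
      forall A B : set (measurableTypeR R), measurable A -> measurable B ->
        E (A `&` B) = E A \o E B &
      forall x : H, exists m : {measure set (measurableTypeR R) -> \bar R},
        [/\ represents E x m, m.-integrable setT (fun l : R => l%:E) &
            ip (T x) x = (\int[m]_(l in setT) (l : R))%:C]].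

(* For bounded self-adjoint [T], [f(T)] is determined by [<f(T)x,x> = \int f d<E x,x>]. *)
Definition funcalc T (f : R -> R) : H -> H :=
  xget 0 [set S | bounded_op S /\ exists E, spectral_measure T E /\
    forall (x : H) (m : {measure set (measurableTypeR R) -> \bar R}),
      represents E x m ->
      m.-integrable setT (fun l : R => (f l)%:E) /\
      ip (S x) x = (\int[m]_(l in setT) f l)%:C].

Definition absop T : H -> H := funcalc (adjoint T \o T) Num.sqrt.

Definition nonneg_proj T : H -> H :=
  funcalc T (fun l => if 0 <= l then 1 else 0).

Definition signop T : H -> H :=
  funcalc T (fun l => if 0 <= l then 1 else -1).

Definition commutant (A : set (H -> H)) : set (H -> H) :=
  [set T | bounded_op T /\ forall S, A S -> T \o S = S \o T].

Definition von_neumann_algebra (N : set (H -> H)) : Prop :=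
  (forall T, N T -> N (adjoint T)) /\ N = commutant (commutant N).

(* The predual consists of the functionals [T |-> \sum_n <T x_n, y_n>] with
   square-summable [x], [y], with the norm of the dual of [N]. *)
Definition normal_functional (N : set (H -> H)) (w : (H -> H) -> R[i]) : Prop :=
  exists x y : nat -> H,
    [/\ cvgn (series (fun n => rnorm (x n) ^+ 2)),
        cvgn (series (fun n => rnorm (y n) ^+ 2)) &
        forall T, N T ->
          series (fun n => ip (T (x n)) (y n) : R[i]^o) @ \oo --> (w T : R[i]^o)].

Definition separable_predual (N : set (H -> H)) : Prop :=
  exists W : nat -> (H -> H) -> R[i],
    (forall k, normal_functional N (W k)) /\
    forall w, normal_functional N w -> forall e : R, 0 < e ->
      exists k, forall T, N T -> opnorm T <= 1 ->
        rnorm (w T - W k T : R[i]^o) <= e.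

Definition pos_cone (N : set (H -> H)) : set (H -> H) :=
  [set T | N T /\ positive_op T].

Definition directed_ops (D : set (H -> H)) : Prop :=
  D !=set0 /\
  forall S T, D S -> D T -> exists U, [/\ D U, op_le S U & op_le T U].

Definition op_lub (N D : set (H -> H)) S : Prop :=
  [/\ pos_cone N S, forall T, D T -> op_le T S &
      forall U, pos_cone N U -> (forall T, D T -> op_le T U) -> op_le S U].

(* Only the values of [tau] on the positive cone of [N] are meaningful; see
   [ctrace] for the extension to trace class operators. *)
Record fns_trace (N : set (H -> H)) (tau : (H -> H) -> \bar R) : Prop := {
  trace_ge0 : forall T, pos_cone N T -> (0 <= tau T)%E;
  trace_add : forall S T, pos_cone N S -> pos_cone N T ->
    tau (S + T) = (tau S + tau T)%E;
  trace_scale : forall (a : R) T, 0 <= a -> pos_cone N T ->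
    tau (a%:C *: T) = (a%:E * tau T)%E;
  trace_tracial : forall T, N T ->
    tau (adjoint T \o T) = tau (T \o adjoint T);
  trace_faithful : forall T, pos_cone N T -> tau T = 0%E -> T = 0;
  trace_normal : forall (D : set (H -> H)) S,
    D `<=` pos_cone N -> directed_ops D -> op_lub N D S ->
    tau S = ereal_sup (tau @` D);
  trace_semifinite : forall T, pos_cone N T -> T <> 0 ->
    exists S, [/\ pos_cone N S, S <> 0, op_le S T & (tau S < +oo)%E] }.

End Operators.

Section SemifiniteAlgebra.
Context {R : realType} {H : completeNormedModType R[i]} (ip : H -> H -> R[i]).
Context (N : set (H -> H)) (tau : (H -> H) -> \bar R).
Implicit Types T S X A : H -> H.

(* The linear extension of [tau] to trace class operators: for self-adjoint
   [A] it is [tau(A_+) - tau(A_-)]. *)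
Definition rtrace A : R :=
  fine (tau (funcalc ip A (fun l => Num.max l 0))) -
  fine (tau (funcalc ip A (fun l => Num.max (- l) 0))).

Definition ctrace A : R[i] :=
  (rtrace (2^-1 *: (A + adjoint ip A)) +i*
   rtrace ((2 * 'i)^-1 *: (A - adjoint ip A)))%C.

Definition two_sided_ideal (I : set (H -> H)) : Prop :=
  [/\ I `<=` N, I 0, forall S T, I S -> I T -> I (S + T),
      forall (a : R[i]) T, I T -> I (a *: T) &
      forall S T, N S -> I T -> I (S \o T) /\ I (T \o S)].

Definition norm_closed (I : set (H -> H)) : Prop :=
  forall T, N T ->
    (forall e : R, 0 < e -> exists2 S, I S & opnorm (T - S) < e) -> I T.

(* The smallest norm-closed two-sided ideal of [N] containing the elements of
   finite trace. *)
Definition Kideal : set (H -> H) :=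
  [set T | forall I, two_sided_ideal I -> norm_closed I ->
     [set S | N S /\ (tau (absop ip S) < +oo)%E] `<=` I -> I T].

Definition quotient_norm T : R := inf [set opnorm (T - S) | S in Kideal].

(* Invertibility of the class of [T] in [N / Kideal]. *)
Definition breuer_fredholm T : Prop :=
  N T /\ exists S, [/\ N S, Kideal ((S \o T) - idop) & Kideal ((T \o S) - idop)].

Definition sing_num (t : R) S : R :=
  inf [set opnorm (S \o E) | E in
    [set E | [/\ N E, projection ip E & (tau (idop - E)%R <= t%:E)%E]]].

Definition Li0 (p : R) : set (H -> H) :=
  [set T | N T /\
    forall e : R, 0 < e ->
      \forall t \near +oo_R, sing_num t T <= e * (ln t)^-1 `^ p].

Definition Li_norm T : R :=
  sup [set (\int[lebesgue_measure]_(t in `[0, x]) sing_num t T) /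
           (\int[lebesgue_measure]_(t in `[0, x]) (ln (t + expR 1))^-1)
      | x in [set x : R | 0 < x]].

Definition Lip_norm (p : R) T : R :=
  (Li_norm (funcalc ip (absop ip T) (fun l => l `^ p^-1))) `^ p.

Definition tangent_space (F0 : H -> H) (q : R) : set (H -> H) :=
  [set X | [/\ Li0 (q / 2) X, adjoint ip X = X & Li0 q ((F0 \o X) + (X \o F0))]].

Definition tangent_norm (F0 : H -> H) (q : R) X : R :=
  Lip_norm (q / 2) X + Lip_norm q ((X \o F0) + (F0 \o X)).

Definition Mspace (F0 : H -> H) (q : R) : set (H -> H) :=
  [set F0 + X | X in tangent_space F0 q].

(* Difference quotients and derivatives only involve values of the path in
   [`[a, b]]; they are one-sided at the endpoints. *)
Definition C1_on (F0 : H -> H) (q : R) (F : R -> H -> H) (a b : R) : Prop :=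
  exists G : R -> H -> H, forall t, t \in `[a, b] ->
    [/\ Mspace F0 q (F t), tangent_space F0 q (G t),
        tangent_norm F0 q ((s - t)^-1%:C *: (F s - F t) - G t)
          @[s --> within [set` `[a, b]] (t^')] --> (0 : R) &
        tangent_norm F0 q (G s - G t)
          @[s --> within [set` `[a, b]] (nbhs t)] --> (0 : R)].

Definition piecewise_C1 (F0 : H -> H) (q : R) (F : R -> H -> H) (a b : R) : Prop :=
  exists2 s : seq R, itv_partition a b s &
    forall i, (i < size s)%N ->
      C1_on F0 q F (nth 0 (a :: s) i) (nth 0 s i).

(* Default value [0] where the two-sided derivative does not exist, in
   particular possibly at the break points of a piecewise C^1 path and at the
   endpoints; these form a null set for the integrals below. *)
Definition path_derive (F0 : H -> H) (q : R) (F : R -> H -> H) (t : R) : H -> H :=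
  xget 0 [set Y | tangent_space F0 q Y /\
    tangent_norm F0 q (h^-1%:C *: (F (t + h) - F t) - Y)
      @[h --> (0 : R)^'] --> (0 : R)].

(* The value at [0] is a convention: [0 `^ (- q^-1)] is [0] here. *)
Definition weight_fun (r q x : R) : R :=
  if x == 0 then 0 else x `^ (- r) * expR (- (x `^ (- q^-1))).

Definition weight_op (r q : R) T : H -> H :=
  funcalc ip (absop ip T) (weight_fun r q).

Definition Crq (r q : R) : R :=
  \int[lebesgue_measure]_(u in `[-1, 1]) weight_fun r q (1 - u ^+ 2).

Definition path_integral (F0 : H -> H) (r q : R) (F : R -> H -> H) (a b : R)
    : R[i] :=
  let g t := ctrace (path_derive F0 q F t \o
                     weight_op r q (idop - (F t \o F t))) in
  ((\int[lebesgue_measure]_(t in `[a, b]) complex.Re (g t)) +i*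
   (\int[lebesgue_measure]_(t in `[a, b]) complex.Im (g t)))%C.

Definition gamma (F0 : H -> H) (r q : R) F : R[i] :=
  (Crq r q)%:C^-1 *
  path_integral F0 r q (fun t => F + t%:C *: (signop ip F - F)) 0 1.

(* For projections [P], [Q]: the index of [PQ : ran Q -> ran P]. *)
Definition ind (P Q : H -> H) : R :=
  fine (tau (proj_onto ip [set x | Q x = x /\ P x = 0])) -
  fine (tau (proj_onto ip [set x | Q x = 0 /\ P x = x])).

Definition fine_partition (F : R -> H -> H) (a b : R) (s : seq R) : Prop :=
  itv_partition a b s /\
  forall i, (i < size s)%N ->
  forall u v, u \in `[nth 0 (a :: s) i, nth 0 s i] ->
    v \in `[nth 0 (a :: s) i, nth 0 s i] ->
    quotient_norm (nonneg_proj ip (F u) - nonneg_proj ip (F v)) < 1.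

Definition is_spectral_flow (F : R -> H -> H) (a b sf : R) : Prop :=
  (exists s, fine_partition F a b s) /\
  forall s, fine_partition F a b s ->
    sf = \sum_(i < size s) ind (nonneg_proj ip (F (nth 0 (a :: s) i)))
                               (nonneg_proj ip (F (nth 0 s i))).

End SemifiniteAlgebra.

Record unital_banach_star_algebra {R : realType} (A : completeNormedModType R[i])
    (mul : A -> A -> A) (one : A) (star : A -> A) : Prop := {
  bsa_mulA : associative mul;
  bsa_mul1l : left_id one mul;
  bsa_mul1r : right_id one mul;
  bsa_linl : forall b, linear (mul^~ b);
  bsa_linr : forall a, linear (mul a);
  bsa_normM : forall a b, `|mul a b| <= `|a| * `|b|;
  bsa_norm1 : `|one| = 1;
  bsa_starK : involutive star;
  bsa_starZD : forall (c : R[i]) a b, star (c *: a + b) = c^* *: star a + star b;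
  bsa_starM : forall a b, star (mul a b) = mul (star b) (star a);
  bsa_norm_star : forall a, `|star a| = `|a| }.

Record odd_pre_BF_module {R : realType} {H : completeNormedModType R[i]}
    (ip : H -> H -> R[i]) (N : set (H -> H)) (tau : (H -> H) -> \bar R)
    (A : completeNormedModType R[i]) (mul : A -> A -> A) (star : A -> A)
    (rep : A -> H -> H) (F0 : H -> H) (q : R) : Prop := {
  bfm_repN : forall a, N (rep a);
  bfm_repZD : forall (c : R[i]) a b, rep (c *: a + b) = c *: rep a + rep b;
  bfm_repM : forall a b, rep (mul a b) = rep a \o rep b;
  bfm_rep_star : forall a, rep (star a) = adjoint ip (rep a);
  bfm_rep_cont : forall a, opnorm (rep b - rep a) @[b --> a] --> (0 : R);
  bfm_F0N : N F0;
  bfm_F0_sa : adjoint ip F0 = F0;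
  bfm_F0_BF : breuer_fredholm ip N tau F0;
  bfm_F0_sq : Li0 ip N tau q (idop - (F0 \o F0));
  bfm_comm_K : forall a, Kideal ip N tau ((F0 \o rep a) - (rep a \o F0));
  bfm_comm_Li : dense [set a : A |
    Li0 ip N tau (q / 2) ((F0 \o rep a) - (rep a \o F0))] }.

(* Main.v *)
(** Let [k] be the function with [k(F)^2 = f_r(1 - F^2)] and let [J A U] be the integral over
    [0, 1] of [tau(U k(A + sU)^2) ds].  When [U] is of trace class, approximating [k^2] by
    polynomials reduces [J A U] to values of [tau((A + U)^n - A^n)], whence the exactness relation
    [J A U + J (A + U) (V - U) = J A V].  It extends to all tangent vectors by cutting [k] off near
    its zeros and [U] near [0]; the estimates come from the counting functions
    [tau(1_{|u| > l}(X))], which grow like [exp(o(l^(-1/p)))] exactly when [X] is in [Li_0^p].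
    Along a C^1 path the derivative of [t |-> J F_a (F_t - F_a)] is the integrand of the
    theorem, so that every term of the formula is a difference of values of one potential.
    It remains to compare with the index.  For symmetries [S_i = 2 P_i - 1] the operators
    [A = 1 - P_1 - P_2] and [B = P_2 - P_1] anticommute and satisfy [A^2 + B^2 = 1]; conjugation
    by the sign of [A] kills the contribution of the complement of [ker A], and on [ker A] the
    operator [B] is [+-1], with eigenspaces [ran P_2 :&: ker P_1] and [ker P_2 :&: ran P_1].
    Hence [J S_1 (S_2 - S_1) = C_{r,q} ind (P_1 P_2)], and the sum over a partition telescopes. *)

Require Import Defs.
From HB Require Import structures.
From mathcomp Require Import all_boot all_order all_algebra.
From mathcomp Require Import complex.
From mathcomp Require Import all_classical all_reals all_analysis.
From mathcomp Require Import measurable_realfun ring lra.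

Set Implicit Arguments.
Unset Strict Implicit.
Unset Printing Implicit Defensive.

Import Order.TTheory GRing.Theory Num.Theory.
Import numFieldNormedType.Exports.

Local Open Scope classical_set_scope.
Local Open Scope ring_scope.
Local Open Scope complex_scope.

(** * Bounded operators *)

(** The trace is given on the positive cone, and cyclicity only as tau(T' T) = tau(T T') with T' the
    adjoint of T. Everything is therefore reduced to real traces of self-adjoint operators: products
    under a trace are Jordan products [U W + W U], and cyclicity is used in polarized form. The
    weight is kept as a square k^2 because the difference of two squares is a Jordan product: the
    change of tau(U k^2) is bounded by an operator norm times traces, so that norm continuity of the
    functional calculus and uniform trace bounds take the place of continuity in trace norm. The
    obstacle is to have these bounds uniformly near a point of a path. Adding two operators halves
    the threshold, which at the scale L^(-p) multiplies the exponential rate of the counting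
    function by 2^(1/p). In Li_0^p every positive rate is available, so a bounded number of
    additions is harmless; k decays like exp(-L/2), and 1/3 is the rate aimed at. As [funcalc]
    chooses an arbitrary spectral measure without a support condition, uniqueness and compact
    support are proved along with existence. *)

Section NormR.
Context {R : realType} {V : normedModType R[i]}.
Implicit Types x y : V.

Lemma norm_rnorm x : `|x| = (rnorm x)%:C.
Proof. by rewrite /rnorm RRe_real// ger0_real. Qed.

Lemma rnorm_ge0 x : 0 <= rnorm x.
Proof. by rewrite -lecR -norm_rnorm normr_ge0. Qed.

Lemma rnorm0 : rnorm (0 : V) = 0.
Proof. by rewrite /rnorm normr0. Qed.

Lemma rnorm_eq0 x : rnorm x = 0 -> x = 0.
Proof. by move=> x0; apply/normr0_eq0; rewrite norm_rnorm x0. Qed.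

Lemma rnormD x y : rnorm (x + y) <= rnorm x + rnorm y.
Proof. by rewrite -lecR rmorphD/= -!norm_rnorm ler_normD. Qed.

Lemma rnormN x : rnorm (- x) = rnorm x.
Proof. by rewrite /rnorm normrN. Qed.

Lemma rnormBC x y : rnorm (x - y) = rnorm (y - x).
Proof. by rewrite -rnormN opprB. Qed.

Lemma rnormZ (a : R) x : rnorm (a%:C *: x) = `|a| * rnorm x.
Proof.
have : (rnorm (a%:C *: x))%:C = (`|a| * rnorm x)%:C.
  by rewrite -norm_rnorm normrZ norm_rnorm rmorphM/= normc_def/= expr0n/= addr0 sqrtr_sqr.
by move=> /(congr1 (@complex.Re R)).
Qed.

End NormR.

Lemma cvg_rnormP {R : realType} {V : normedModType R[i]} (u : nat -> V) l :
  u @ \oo --> l <-> rnorm (u n - l) @[n --> \oo] --> (0 : R).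
Proof.
split.
  move=> /cvgrPdist_lt ul; apply/cvgrPdist_lt => e e0.
  have eC : (0 : R[i]) < e%:C by rewrite ltcR.
  near=> n; rewrite sub0r normrN ger0_norm ?rnorm_ge0// rnormBC -ltcR -norm_rnorm.
  by near: n; apply: ul.
move=> /cvgrPdist_lt ul; apply/cvgrPdist_lt => e e0.
have [e' e'0 ->] : exists2 e' : R, 0 < e' & e = e'%:C.
  by exists (complex.Re e); [rewrite -ltcR RRe_real// gtr0_real|rewrite RRe_real// gtr0_real].
near=> n; rewrite norm_rnorm ltcR rnormBC.
have : `|0 - rnorm (u n - l)| < e' by near: n; apply: ul.
by rewrite sub0r normrN ger0_norm ?rnorm_ge0.
Unshelve. all: by end_near. Qed.

Lemma cauchy_rnorm {R : realType} {V : completeNormedModType R[i]} (u : nat -> V) :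
  (forall e : R, 0 < e -> exists N, forall m n, (N <= m)%N -> (N <= n)%N ->
     rnorm (u m - u n) < e) ->
  exists l : V, u @ \oo --> l.
Proof.
move=> h; exists (lim (u @ \oo)); apply: cauchy_cvg.
apply: cauchy_exP => e e0.
have eE : e = (complex.Re e)%:C by rewrite RRe_real// gtr0_real.
have e'0 : 0 < complex.Re e by rewrite -ltcR -eE.
have [N hN] := h _ e'0; exists (u N); exists N => // n /= Nn.
by rewrite /= -ball_normE /ball_/= eE norm_rnorm ltcR hN//=.
Qed.

(** Bundled operators form a ring and a module over the reals. Real scalars are the ones that
    preserve self-adjointness; complex ones enter the ring as the operators [csc]. *)
Record bop {R : realType} {H : completeNormedModType R[i]} :=
  Bop { bfun :> H -> H; bopP : bounded_op bfun }.
Arguments bop {R} H.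

Section BoundedOperators.
Context {R : realType} {H : completeNormedModType R[i]}.
Implicit Types A B T : bop H.

Lemma bop_eq A B : (A : H -> H) = B -> A = B.
Proof.
case: A B => [f hf] [g hg] /= e; case: _ / e in hg *.
by rewrite (Prop_irrelevance hf hg).
Qed.

Lemma bopext A B : (forall x, A x = B x) -> A = B.
Proof. by move=> h; apply: bop_eq; apply/funext. Qed.

Lemma bop_lin T : linear T. Proof. by case: (bopP T). Qed.
Lemma bop0 T : T 0 = 0.
Proof. by have := bop_lin T (-1) 0 0; rewrite scaler0 addr0 scaleN1r addNr. Qed.
Lemma bopD T x y : T (x + y) = T x + T y.
Proof. by have := bop_lin T 1 x y; rewrite !scale1r. Qed.
Lemma bopZ T a x : T (a *: x) = a *: T x.
Proof. by have := bop_lin T a x 0; rewrite !addr0 bop0 addr0. Qed.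
Lemma bopN T x : T (- x) = - T x.
Proof. by rewrite -scaleN1r bopZ scaleN1r. Qed.

Lemma bop_bounded T : exists M : R, 0 < M /\ forall x, rnorm (T x) <= M * rnorm x.
Proof.
pose f : {linear H -> H} := HB.pack (bfun T) (GRing.isLinear.Build _ _ _ _ _ (bop_lin T)).
have /linear_boundedP : bounded_near f (nbhs 0).
  by apply: continuous_linear_bounded; apply: (bopP T).2.
case=> r [+ hr] => r0.
have rE : r = (complex.Re r)%:C by rewrite RRe_real.
exists (Num.max 0 (complex.Re r) + 1).
have rlt : r < (Num.max 0 (complex.Re r) + 1)%:C.
  rewrite rE ltcR; apply: (@le_lt_trans _ _ (Num.max 0 (complex.Re r))).
    by rewrite /= le_max lexx orbT.
  by rewrite ltrDl.
split=> [|x]; first by rewrite ltr_wpDl ?le_max ?lexx.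
by have := hr _ rlt x; rewrite !norm_rnorm -rmorphM lecR.
Qed.

Lemma mk_bop (f : H -> H) (M : R) :
  linear f -> (forall x, rnorm (f x) <= M * rnorm x) -> bounded_op f.
Proof.
move=> lf hM; split=> //.
pose g : {linear H -> H} := HB.pack f (GRing.isLinear.Build _ _ _ _ _ lf).
apply: (@bounded_linear_continuous _ _ _ g).
apply/linear_boundedP; exists (M%:C); split; first by rewrite complex_real.
move=> r hr x.
rewrite /g/= !norm_rnorm; apply: le_trans (_ : (M * rnorm x)%:C <= _); first by rewrite lecR.
by rewrite rmorphM ler_wpM2r// ?ler0c ?rnorm_ge0// ltW.
Qed.

Lemma opnorm_has_sup T :
  has_sup [set rnorm (T x) | x in [set x : H | rnorm x <= 1]].
Proof.
have [M [M0 hM]] := bop_bounded T.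
split; first by exists (rnorm (T 0)); exists 0 => //=; rewrite rnorm0.
exists M => _ [x /= x1 <-]; apply: le_trans (hM x) _.
by rewrite -[leRHS]mulr1 ler_wpM2l// ltW.
Qed.

Lemma opnorm_ge0 T : 0 <= opnorm T.
Proof.
have := sup_upper_bound (opnorm_has_sup T); apply.
by exists 0; rewrite /= ?rnorm0// bop0 rnorm0.
Qed.

Lemma opnormP T x : rnorm (T x) <= opnorm T * rnorm x.
Proof.
have [->|x0] := eqVneq x 0; first by rewrite bop0 rnorm0 mulr0.
have nx : 0 < rnorm x.
  by rewrite lt_neqAle rnorm_ge0 andbT; apply/eqP => /esym/rnorm_eq0/eqP; rewrite (negPf x0).
rewrite -ler_pdivrMr//.
have -> : rnorm (T x) / rnorm x = rnorm (T ((rnorm x)^-1%:C *: x)).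
  by rewrite bopZ rnormZ ger0_norm ?invr_ge0 ?ltW// mulrC.
apply: sup_upper_bound; first exact: opnorm_has_sup.
exists ((rnorm x)^-1%:C *: x) => //=.
rewrite rnormZ ger0_norm; last by rewrite invr_ge0 ltW.
by rewrite mulVf// gt_eqF.
Qed.

Lemma opnorm_le T (M : R) : 0 <= M ->
  (forall x, rnorm (T x) <= M * rnorm x) -> opnorm T <= M.
Proof.
move=> M0 hM; apply: sup_le_ub; first by case: (opnorm_has_sup T).
move=> _ [x /= x1 <-]; apply: le_trans (hM x) _.
by rewrite -[leRHS]mulr1 ler_wpM2l.
Qed.

Lemma opnorm_eq0 T : opnorm T = 0 -> forall x, T x = 0.
Proof.
move=> T0 x; apply: rnorm_eq0; apply/eqP; rewrite eq_le rnorm_ge0 andbT.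
by have := opnormP T x; rewrite T0 mul0r.
Qed.

Fact add_bop_subproof A B : bounded_op ((A : H -> H) + B).
Proof.
have [M [_ hM]] := bop_bounded A; have [M' [_ hM']] := bop_bounded B.
apply: (@mk_bop _ (M + M')) => [a x y|x] /=.
  by rewrite /GRing.add/= !bopD !bopZ scalerDr addrACA.
by apply: le_trans (rnormD _ _) _; rewrite mulrDl lerD.
Qed.
Definition add_bop A B := Bop (add_bop_subproof A B).

Fact scale_bop_subproof (a : R) A : bounded_op (a%:C *: (A : H -> H)).
Proof.
have [M [_ hM]] := bop_bounded A.
apply: (@mk_bop _ (`|a| * M)) => [b x y|x] /=.
  have e z : (a%:C *: (A : H -> H)) z = a%:C *: A z by [].
  by rewrite !e bopD bopZ scalerDr !scalerA [b * _]mulrC.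
by rewrite /GRing.scale/= rnormZ -mulrA ler_wpM2l.
Qed.
Definition scale_bop a A := Bop (scale_bop_subproof a A).

Fact opp_bop_subproof A : bounded_op (- (A : H -> H)).
Proof.
have [M [_ hM]] := bop_bounded A.
apply: (@mk_bop _ M) => [b x y|x] /=.
  by rewrite /GRing.opp/= bopD bopZ scalerN opprD.
by rewrite /GRing.opp/= rnormN.
Qed.
Definition opp_bop A := Bop (opp_bop_subproof A).

Fact zero_bop_subproof : bounded_op (0 : H -> H).
Proof.
apply: (@mk_bop _ 0) => [b x y|x] /=; first by rewrite /= scaler0 addr0.
by rewrite rnorm0 mul0r.
Qed.
Definition zero_bop := Bop zero_bop_subproof.

Fact one_bop_subproof : bounded_op (@idop R H).
Proof. by apply: (@mk_bop _ 1) => [//|x]; rewrite mul1r. Qed.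
Definition one_bop := Bop one_bop_subproof.

Fact mul_bop_subproof A B : bounded_op (A \o B).
Proof.
have [M [M0 hM]] := bop_bounded A; have [M' [_ hM']] := bop_bounded B.
apply: (@mk_bop _ (M * M')) => [a x y|x] /=; first by rewrite !bopD !bopZ.
by apply: le_trans (hM _) _; rewrite -mulrA ler_wpM2l// ltW.
Qed.
Definition mul_bop A B := Bop (mul_bop_subproof A B).

HB.instance Definition _ := gen_eqMixin (bop H).
HB.instance Definition _ := gen_choiceMixin (bop H).

Fact bop_addA : associative add_bop.
Proof. by move=> A B D; apply: bop_eq; rewrite /= addrA. Qed.
Fact bop_addC : commutative add_bop.
Proof. by move=> A B; apply: bop_eq; rewrite /= addrC. Qed.
Fact bop_add0 : left_id zero_bop add_bop.
Proof. by move=> A; apply: bop_eq; rewrite /= add0r. Qed.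
Fact bop_addN : left_inverse zero_bop opp_bop add_bop.
Proof. by move=> A; apply: bop_eq; rewrite /= addNr. Qed.
HB.instance Definition _ := GRing.isZmodule.Build (bop H) bop_addA bop_addC bop_add0 bop_addN.

Fact bop_mulA : associative mul_bop.
Proof. by move=> A B D; apply: bop_eq. Qed.
Fact bop_mul1l : left_id one_bop mul_bop.
Proof. by move=> A; apply: bop_eq. Qed.
Fact bop_mul1r : right_id one_bop mul_bop.
Proof. by move=> A; apply: bop_eq. Qed.
Fact bop_mulDl : left_distributive mul_bop +%R.
Proof. by move=> A B D; apply: bop_eq. Qed.
Fact bop_mulDr : right_distributive mul_bop +%R.
Proof. by move=> A B D; apply: bopext => x; rewrite /= {1}/GRing.add/= bopD. Qed.
HB.instance Definition _ := GRing.Zmodule_isPzRing.Build (bop H)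
  bop_mulA bop_mul1l bop_mul1r bop_mulDl bop_mulDr.

Fact bop_scaleA (a b : R) A : scale_bop a (scale_bop b A) = scale_bop (a * b) A.
Proof. by apply: bop_eq; rewrite /= scalerA rmorphM. Qed.
Fact bop_scale1 : left_id (1 : R) scale_bop.
Proof. by move=> A; apply: bop_eq; rewrite /= scale1r. Qed.
Fact bop_scaleDr : right_distributive scale_bop +%R.
Proof. by move=> a A B; apply: bop_eq; rewrite /= scalerDr. Qed.
Fact bop_scaleDl A : {morph scale_bop^~ A : a b / a + b}.
Proof. by move=> a b; apply: bop_eq; rewrite /= rmorphD scalerDl. Qed.
HB.instance Definition _ := GRing.Zmodule_isLmodule.Build R (bop H)
  bop_scaleA bop_scale1 bop_scaleDr bop_scaleDl.

Lemma bopDE A B x : (A + B) x = A x + B x. Proof. by []. Qed.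
Lemma bopNE A x : (- A) x = - A x. Proof. by []. Qed.
Lemma bopBE A B x : (A - B) x = A x - B x. Proof. by []. Qed.
Lemma bopME A B x : (A * B) x = A (B x). Proof. by []. Qed.
Lemma bopZE (a : R) A x : (a *: A) x = a%:C *: A x. Proof. by []. Qed.
Lemma bop1E x : (1 : bop H) x = x. Proof. by []. Qed.
Lemma bop0E x : (0 : bop H) x = 0. Proof. by []. Qed.
Definition bopE := (bopDE, bopNE, bopME, bopZE, bop1E, bop0E).

Lemma bopAl (a : R) A B : a *: A * B = a *: (A * B).
Proof. exact: bopext. Qed.
Lemma bopAr (a : R) A B : A * (a *: B) = a *: (A * B).
Proof. by apply: bopext => x; rewrite !bopE bopZ. Qed.

Lemma opnorm0 : opnorm (0 : bop H) = 0.
Proof.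
apply/eqP; rewrite eq_le opnorm_ge0 andbT; apply: opnorm_le => // x.
by rewrite bop0E rnorm0 mul0r.
Qed.
Lemma opnorm1 : opnorm (1 : bop H) <= 1.
Proof. by apply: opnorm_le => // x; rewrite mul1r. Qed.
Lemma opnormD A B : opnorm (A + B) <= opnorm A + opnorm B.
Proof.
apply: opnorm_le => [|x]; first by rewrite addr_ge0 ?opnorm_ge0.
by rewrite bopE mulrDl; apply: le_trans (rnormD _ _) _; rewrite lerD ?opnormP.
Qed.
Lemma opnormM A B : opnorm (A * B) <= opnorm A * opnorm B.
Proof.
apply: opnorm_le => [|x]; first by rewrite mulr_ge0 ?opnorm_ge0.
rewrite bopE -mulrA; apply: le_trans (opnormP _ _) _.
by rewrite ler_wpM2l ?opnorm_ge0 ?opnormP.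
Qed.
Lemma opnormZ_le (a : R) A : opnorm (a *: A) <= `|a| * opnorm A.
Proof.
apply: opnorm_le => [|x]; first by rewrite mulr_ge0 ?opnorm_ge0.
by rewrite bopE rnormZ -mulrA ler_wpM2l// opnormP.
Qed.
Lemma opnormN A : opnorm (- A) = opnorm A.
Proof.
apply/eqP; rewrite eq_le; apply/andP; split; apply: opnorm_le => [|x];
  rewrite ?opnorm_ge0//; first by rewrite bopE rnormN opnormP.
by have := opnormP (- A) x; rewrite bopE rnormN.
Qed.
Lemma opnormBC A B : opnorm (A - B) = opnorm (B - A).
Proof. by rewrite -opnormN opprB. Qed.

End BoundedOperators.

(** * The real inner product *)

Section InnerProduct.
Context {R : realType} {H : completeNormedModType R[i]} (ip : H -> H -> R[i]).
Context (hip : hilbert_inner_product ip).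
Implicit Types x y z : H.

(** Real and imaginary parts of [ip] both come from this real symmetric form ([ipE]), so that
    identities and inequalities between operators can be checked by real arithmetic. *)
Definition rip x y : R := complex.Re (ip x y).

Lemma ipC x y : ip y x = (ip x y)^*. Proof. by case: hip. Qed.
Lemma ipDl x y z : ip (x + y) z = ip x z + ip y z.
Proof. by case: hip => /(_ 1 x y z); rewrite scale1r mul1r. Qed.
Lemma ip0l z : ip 0 z = 0.
Proof. by apply: (addIr (ip 0 z)); rewrite -ipDl addr0 add0r. Qed.
Lemma ipZl a x z : ip (a *: x) z = a * ip x z.
Proof. by case: hip => /(_ a x 0 z); rewrite !addr0 ip0l addr0. Qed.
Lemma ipZr a x z : ip x (a *: z) = a^* * ip x z.
Proof. by rewrite ipC ipZl rmorphM/= -ipC. Qed.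

Lemma ripC x y : rip x y = rip y x.
Proof. by rewrite /rip (ipC x y); case: (ip x y). Qed.
Lemma ripDl x y z : rip (x + y) z = rip x z + rip y z.
Proof. by rewrite /rip ipDl; case: (ip x z) (ip y z) => [? ?] [? ?]. Qed.
Lemma ripZl (a : R) x y : rip (a%:C *: x) y = a * rip x y.
Proof. by rewrite /rip ipZl; case: (ip x y) => u v /=; rewrite mul0r subr0. Qed.
Lemma ripNl x y : rip (- x) y = - rip x y.
Proof. by rewrite -mulN1r -ripZl rmorphN1 scaleN1r. Qed.
Lemma ripBl x y z : rip (x - y) z = rip x z - rip y z.
Proof. by rewrite ripDl ripNl. Qed.
Lemma ripDr x y z : rip z (x + y) = rip z x + rip z y.
Proof. by rewrite !(ripC z) ripDl. Qed.
Lemma ripZr (a : R) x y : rip x (a%:C *: y) = a * rip x y.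
Proof. by rewrite ripC ripZl ripC. Qed.
Lemma ripNr x y : rip x (- y) = - rip x y.
Proof. by rewrite ripC ripNl ripC. Qed.
Lemma rip0l y : rip 0 y = 0. Proof. by rewrite /rip ip0l. Qed.
Lemma rip0r y : rip y 0 = 0. Proof. by rewrite ripC rip0l. Qed.
Lemma ripxx x : rip x x = rnorm x ^+ 2.
Proof.
by case: hip => _ _ h; rewrite /rip h norm_rnorm -rmorphXn.
Qed.
Lemma rip_ge0 x : 0 <= rip x x. Proof. by rewrite ripxx sqr_ge0. Qed.

Lemma ipE x y : ip x y = (rip x y +i* rip x ('i *: y))%C.
Proof.
rewrite [in X in (_ +i* X)%C]/rip ipZr /rip.
by case: (ip x y) => u v /=; rewrite !(mul0r,mulN1r,opprK,sub0r,mulr0,mul1r,add0r).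
Qed.

Lemma rip_i x y : rip ('i *: x) ('i *: y) = rip x y.
Proof.
rewrite /rip ipZl ipZr; case: (ip x y) => u v /=.
by rewrite !(mul0r,mulN1r,opprK,sub0r,mulr0,mul1r,add0r,addr0,mulNr,opprK).
Qed.

(** The quadratic is evaluated at its minimum -b/c; when c = 0, an affine function bounded below is
    constant. *)
Lemma quad_discr (a b c : R) : 0 <= c ->
  (forall t, 0 <= a + 2 * b * t + c * t ^+ 2) -> b ^+ 2 <= a * c.
Proof.
move=> c0 h.
have [c00|cN0] := eqVneq c 0.
  rewrite c00 mulr0; have [->|b0] := eqVneq b 0; first by rewrite expr0n.
  have := h (- (a + 1) / (2 * b)); rewrite c00 mul0r addr0.
  have -> : a + 2 * b * (- (a + 1) / (2 * b)) = -1 by field.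
  by rewrite lerNr oppr0 ler10.
have cp : 0 < c by rewrite lt_neqAle eq_sym cN0.
have := h (- b / c).
have -> : a + 2 * b * (- b / c) + c * (- b / c) ^+ 2 = (a * c - b ^+ 2) / c by field.
by rewrite pmulr_lge0 ?invr_gt0// subr_ge0.
Qed.

Lemma rip_CS x y : `|rip x y| <= rnorm x * rnorm y.
Proof.
rewrite -(ger0_norm (rnorm_ge0 x)) -(ger0_norm (rnorm_ge0 y)) -normrM.
rewrite -ler_sqr ?nnegrE// !real_normK ?num_real// exprMn -!ripxx mulrC mulrC.
apply: quad_discr; first exact: rip_ge0.
move=> t; have := rip_ge0 (x + t%:C *: y).
rewrite !(ripDl, ripDr, ripZl, ripZr) (ripC y x); congr (_ <= _); ring.
Qed.

Lemma rnorm_rip x (M : R) : 0 <= M -> (forall y, rip x y <= M * rnorm y) -> rnorm x <= M.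
Proof.
move=> M0 /(_ x); rewrite ripxx expr2.
have [->//|] := eqVneq (rnorm x) 0.
by move=> x0; rewrite ler_pM2r// lt_neqAle eq_sym x0 rnorm_ge0.
Qed.

Lemma rip_ext x x' : (forall y, rip x y = rip x' y) -> x = x'.
Proof.
move=> h; apply/subr0_eq/rnorm_eq0/eqP.
by rewrite -sqrf_eq0 -ripxx ripBl h subrr.
Qed.

Lemma cvg_rip (u : nat -> H) (l y : H) : u @ \oo --> l ->
  rip (u n) y @[n --> \oo] --> rip l y.
Proof.
move=> /cvg_rnormP ul; apply/subr_cvg0.
apply/cvgr0Pnorm_le => e e0.
have y0 : 0 < rnorm y + 1 by rewrite ltr_wpDl ?rnorm_ge0.
move/cvgr0Pnorm_le : ul => /(_ (e / (rnorm y + 1))); rewrite divr_gt0// => /(_ isT).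
apply: filterS => n; rewrite ger0_norm ?rnorm_ge0// => hn.
rewrite -ripBl; apply: le_trans (rip_CS _ _) _.
apply: le_trans (_ : e / (rnorm y + 1) * (rnorm y + 1) <= _); last by rewrite divfK// gt_eqF.
by apply: ler_pM; rewrite ?rnorm_ge0// lerDl.
Qed.

Lemma cvg_rnorm (u : nat -> H) (l : H) : u @ \oo --> l ->
  rnorm (u n) @[n --> \oo] --> rnorm l.
Proof.
move=> /cvg_rnormP ul; apply/subr_cvg0/cvgr0Pnorm_le => e e0.
move/cvgr0Pnorm_le : ul => /(_ _ e0); apply: filterS => n.
rewrite ger0_norm ?rnorm_ge0//; apply: le_trans.
rewrite ler_norml; apply/andP; split.
  rewrite lerNl opprB lerBlDr rnormBC; apply: le_trans (rnormD _ _).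
  by rewrite subrK.
by rewrite lerBlDr; apply: le_trans (rnormD _ _); rewrite subrK.
Qed.

End InnerProduct.

Section Scalar.
Context {R : realType} {H : completeNormedModType R[i]}.
Implicit Types A : bop H.
Definition sc (a : R) : bop H := a *: (1 : bop H).
Lemma scE a x : sc a x = a%:C *: x. Proof. by []. Qed.
Lemma scMl a A : sc a * A = a *: A. Proof. exact: bopext. Qed.
Lemma scMr a A : A * sc a = a *: A. Proof. by rewrite /sc bopAr mulr1. Qed.
Lemma sc_comm a A : sc a * A = A * sc a. Proof. by rewrite scMl scMr. Qed.
Lemma scD a b : sc (a + b) = sc a + sc b. Proof. exact: scalerDl. Qed.
Lemma scN a : sc (- a) = - sc a. Proof. exact: scaleNr. Qed.
Lemma sc1 : sc 1 = 1. Proof. exact: scale1r. Qed.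
Lemma sc0 : sc 0 = 0. Proof. exact: scale0r. Qed.
Lemma opnorm_sc a : opnorm (sc a) <= `|a|.
Proof. by apply: le_trans (opnormZ_le _ _) _; rewrite ler_piMr// opnorm1. Qed.
End Scalar.

(* Operators form a noncommutative ring, out of reach of [ring]; matrix coefficients are real. *)
Ltac bopring hip :=
  apply: bopext => ?; apply: (rip_ext hip) => ?;
  rewrite ?(bopE, bopD, bopN, bopZ, bop0, scE);
  rewrite ?(ripDl hip, ripNl hip, ripZl hip, rip0l hip);
  first [ring | by field].

Lemma seq_cvg_uniq {K : numFieldType} {V : normedModType K} (u : nat -> V) (l l' : V) :
  u @ \oo --> l -> u @ \oo --> l' -> l = l'.
Proof. by move=> h h'; apply: cvg_unique h h' => //; exact: norm_hausdorff. Qed.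

(** * Positive operators and strong limits *)

Section Positive.
Context {R : realType} {H : completeNormedModType R[i]} (ip : H -> H -> R[i]).
Context (hip : hilbert_inner_product ip).
Implicit Types A B C D S T P Q : bop H.
Local Notation "<< x , y >>" := (rip ip x y).

(** Adjointness as a relation: the operators that need an adjoint always come with an explicit one,
    so the existence of adjoints is never at issue. *)
Definition adjp A B := forall x y, << A x, y >> = << x, B y >>.
Definition sa A := adjp A A.
Definition psd A := sa A /\ forall x, 0 <= << A x, x >>.

Lemma adjpC A B : adjp A B -> adjp B A.
Proof. by move=> h x y; rewrite ripC// -h ripC. Qed.
Lemma adjpD A A' B B' : adjp A A' -> adjp B B' -> adjp (A + B) (A' + B').
Proof. by move=> h h' x y; rewrite !bopE ripDl// h h' ripDr. Qed.
Lemma adjpN A A' : adjp A A' -> adjp (- A) (- A').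
Proof. by move=> h x y; rewrite !bopE ripNl// h ripNr. Qed.
Lemma adjpZ a A A' : adjp A A' -> adjp (a *: A) (a *: A').
Proof. by move=> h x y; rewrite !bopE ripZl// h ripZr. Qed.
Lemma adjpM A A' B B' : adjp A A' -> adjp B B' -> adjp (A * B) (B' * A').
Proof. by move=> h h' x y; rewrite !bopE h h'. Qed.
Lemma adjp_uniq A B B' : adjp A B -> adjp A B' -> B = B'.
Proof.
move=> h h'; apply: bopext => y; apply: (rip_ext hip) => x.
by rewrite ripC// -h h' ripC.
Qed.

Lemma sa0 : sa 0. Proof. by move=> x y; rewrite !bopE rip0l// rip0r. Qed.
Lemma sa1 : sa 1. Proof. by []. Qed.
Lemma saD A B : sa A -> sa B -> sa (A + B). Proof. exact: adjpD. Qed.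
Lemma saN A : sa A -> sa (- A). Proof. exact: adjpN. Qed.
Lemma saB A B : sa A -> sa B -> sa (A - B).
Proof. by move=> hA hB; apply: saD => //; apply: saN. Qed.
Lemma saZ a A : sa A -> sa (a *: A). Proof. exact: adjpZ. Qed.
Lemma sa_sc a : sa (sc a). Proof. by apply: saZ; exact: sa1. Qed.
Lemma saM A B : sa A -> sa B -> A * B = B * A -> sa (A * B).
Proof. by move=> hA hB e; rewrite /sa {2}e; apply: adjpM. Qed.
Lemma saX n A : sa A -> sa (A ^+ n).
Proof.
move=> hA; elim: n => [|n ih]; first by rewrite expr0; exact: sa1.
by rewrite exprS; apply: saM => //; rewrite -exprS exprSr.
Qed.
Lemma sa_sandwich A B B' : adjp B B' -> sa A -> sa (B' * A * B).
Proof.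
move=> hB hA; have := adjpM (adjpM (adjpC hB) hA) hB; by rewrite mulrA.
Qed.

Lemma psd0 : psd 0. Proof. by split=> [|x]; [exact: sa0|rewrite bopE rip0l]. Qed.
Lemma psd1 : psd 1. Proof. by split=> // x; rewrite bopE rip_ge0. Qed.
Lemma psdD A B : psd A -> psd B -> psd (A + B).
Proof.
move=> [hA pA] [hB pB]; split; first exact: saD.
by move=> x; rewrite bopE ripDl// addr_ge0.
Qed.
Lemma psdZ a A : 0 <= a -> psd A -> psd (a *: A).
Proof.
move=> a0 [hA pA]; split; first exact: saZ.
by move=> x; rewrite bopE ripZl// mulr_ge0.
Qed.
Lemma psd_sandwich A B B' : adjp B B' -> psd A -> psd (B' * A * B).
Proof.
move=> hB [hA pA]; split; first exact: sa_sandwich.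
by move=> x; rewrite !bopE (adjpC hB).
Qed.
Lemma psd_sq B B' : adjp B B' -> psd (B' * B).
Proof. by move=> hB; have := psd_sandwich hB psd1; rewrite mulr1. Qed.
Lemma psd_sqr A : sa A -> psd (A * A). Proof. exact: psd_sq. Qed.
Lemma psd_trans A B C : psd (B - A) -> psd (C - B) -> psd (C - A).
Proof. by move=> h h'; have := psdD h' h; rewrite addrA subrK. Qed.

Lemma psd_scalar (a : R) : 0 <= a -> psd (sc a).
Proof. by move=> a0; rewrite /sc; apply: psdZ => //; exact: psd1. Qed.

Lemma rip_le_opnorm A x : `|<< A x, x >>| <= opnorm A * rnorm x ^+ 2.
Proof.
apply: le_trans (rip_CS hip _ _) _; rewrite expr2 mulrA.
by rewrite ler_wpM2r ?rnorm_ge0 ?opnormP.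
Qed.

Lemma psd_opnormB A (c : R) : sa A -> opnorm A <= c -> psd (sc c - A).
Proof.
move=> hA hc; split; first by apply: saB => //; exact: sa_sc.
move=> x; rewrite !bopE ripBl// ripZl// ripxx// subr_ge0.
apply: le_trans (ler_norm _) (le_trans (rip_le_opnorm _ _) _).
by rewrite ler_wpM2r ?sqr_ge0.
Qed.

Lemma psd_opnormD A (c : R) : sa A -> opnorm A <= c -> psd (sc c + A).
Proof. by move=> hA hc; rewrite -[A]opprK; apply: psd_opnormB; [exact: saN|rewrite opnormN]. Qed.

(** Subtracting the bounds on the form at t x + y and t x - y gives, by polarization and the
    parallelogram law, 2 t <A x, y> <= c (t^2 |x|^2 + |y|^2) for all t. The discriminant of this
    quadratic bounds <A x, y>. *)
Lemma sa_opnorm_le A (c : R) : 0 <= c -> sa A ->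
  (forall x, `|<< A x, x >>| <= c * rnorm x ^+ 2) -> opnorm A <= c.
Proof.
move=> c0 hA h; apply: opnorm_le => // x; apply: (rnorm_rip hip).
  by rewrite mulr_ge0 ?rnorm_ge0.
move=> y; apply: le_trans (ler_norm _) _.
rewrite -[leRHS]ger0_norm; last by rewrite !mulr_ge0 ?rnorm_ge0.
rewrite -ler_sqr ?nnegrE// !real_normK ?num_real// -[leLHS]sqrrN.
have -> : (c * rnorm x * rnorm y) ^+ 2 = c * rnorm y ^+ 2 * (c * rnorm x ^+ 2) by ring.
apply: quad_discr; first by rewrite mulr_ge0 ?sqr_ge0.
move=> t.
have h1 := h (t%:C *: x + y); have h2 := h (t%:C *: x - y).
move: h1 h2; rewrite !ler_norml => /andP[_ h1] /andP[h2 _].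
move: h1 h2; rewrite -!(ripxx hip) !(bopD, bopN, bopZ) !(ripDl hip, ripDr hip, ripNl hip, ripNr hip, ripZl hip, ripZr hip).
have -> : << A y, x >> = << A x, y >> by rewrite hA ripC.
rewrite (ripC hip y x); lra.
Qed.

Lemma psd_norm_le A (c : R) : 0 <= c -> psd A -> psd (sc c - A) -> opnorm A <= c.
Proof.
move=> c0 [hA pA] [_ h]; apply: sa_opnorm_le => // x; rewrite ger0_norm//.
by have := h x; rewrite !bopE ripBl// ripZl// subr_ge0 ripxx.
Qed.

Lemma psd_CS A x y : psd A -> << A x, y >> ^+ 2 <= << A x, x >> * << A y, y >>.
Proof.
move=> [hA pA]; apply: quad_discr => // t.
have := pA (x + t%:C *: y); rewrite !(bopD, bopZ) !(ripDl hip, ripDr hip, ripZl hip, ripZr hip).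
have -> : << A y, x >> = << A x, y >> by rewrite hA ripC.
by move=> h; apply: le_trans h _; rewrite le_eqVlt; apply/orP; left; apply/eqP; ring.
Qed.

(** Cauchy-Schwarz for the semi-inner product of [A] at the pair x, A x. It turns convergence of
    quadratic forms into strong convergence. *)
Lemma psd_rnorm A x : psd A -> rnorm (A x) ^+ 2 <= opnorm A * << A x, x >>.
Proof.
move=> hA; have := psd_CS x (A x) hA; rewrite ripxx//.
have [->|n0] := eqVneq (rnorm (A x)) 0.
  by move=> _; rewrite expr0n/= mulr_ge0 ?opnorm_ge0//; case: hA.
move=> h; have np : 0 < rnorm (A x) ^+ 2 by rewrite exprn_gt0// lt_neqAle eq_sym n0 rnorm_ge0.
rewrite -(ler_pM2r np) -expr2; apply: le_trans h _.
rewrite [leRHS]mulrAC mulrC ler_wpM2r//; first by case: hA.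
exact: le_trans (ler_norm _) (rip_le_opnorm _ _).
Qed.

Lemma psd_anti A : psd A -> psd (- A) -> A = 0.
Proof.
move=> hA [_ h]; apply: bopext => x; apply: rnorm_eq0; apply/eqP.
rewrite -sqrf_eq0 eq_le sqr_ge0 andbT; apply: le_trans (psd_rnorm x hA) _.
have := h x; rewrite bopE ripNl// oppr_ge0 => h'.
by rewrite mulr_ge0_le0 ?opnorm_ge0.
Qed.

Definition slim (u : nat -> bop H) S := forall x, (fun n => u n x) @ \oo --> S x.
Implicit Types u v : nat -> bop H.

Lemma slim_cst S : slim (fun=> S) S. Proof. by move=> x; exact: cvg_cst. Qed.
Lemma slimD u v S T : slim u S -> slim v T -> slim (fun n => u n + v n) (S + T).
Proof. by move=> h h' x; apply: cvgD. Qed.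
Lemma slimN u S : slim u S -> slim (fun n => - u n) (- S).
Proof. by move=> h x; apply: cvgN. Qed.
Lemma slimB u v S T : slim u S -> slim v T -> slim (fun n => u n - v n) (S - T).
Proof. by move=> h h' x; apply: cvgB. Qed.
Lemma slimZ a u S : slim u S -> slim (fun n => a *: u n) (a *: S).
Proof. by move=> h x; apply: cvgZr. Qed.
Lemma slimMr u S T : slim u S -> slim (fun n => u n * T) (S * T).
Proof. by move=> h x; apply: h. Qed.
Lemma slimMl u S T : slim u S -> slim (fun n => T * u n) (T * S).
Proof.
move=> h x; apply: continuous_cvg; last exact: h.
by case: (bopP T) => _; apply.
Qed.
Lemma slim_uniq u S T : slim u S -> slim u T -> S = T.
Proof. by move=> h h'; apply: bopext => x; apply: seq_cvg_uniq (h x) (h' x). Qed.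
Lemma slim_ext u v S : (forall n, u n = v n) -> slim u S -> slim v S.
Proof. by move=> e h x; rewrite (_ : (fun n => v n x) = (fun n => u n x)) //; apply/funext => n; rewrite e. Qed.
Lemma slim_rip u S x y : slim u S -> << u n x, y >> @[n --> \oo] --> << S x, y >>.
Proof. by move=> h; apply: cvg_rip. Qed.
Lemma slimM u v S T (c : R) : (forall n, opnorm (u n) <= c) ->
  slim u S -> slim v T -> slim (fun n => u n * v n) (S * T).
Proof.
move=> hc hA hB x.
have -> : (fun n => (u n * v n) x) = (fun n => u n (v n x - T x) + u n (T x)).
  by apply/funext => n; rewrite -bopD subrK.
rewrite bopE -[S _]add0r; apply: cvgD; last exact: hA.
apply/cvg_rnormP; apply: (@squeeze_cvgr _ _ _ _ (fun=> 0) (fun n => c * rnorm (v n x - T x))).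
- near=> n; rewrite subr0 rnorm_ge0/=; apply: le_trans (opnormP _ _) _.
  by rewrite ler_wpM2r ?rnorm_ge0.
- exact: cvg_cst.
- rewrite -(mulr0 c); apply: cvgMr; exact/cvg_rnormP/hB.
Unshelve. all: by end_near. Qed.
Lemma slim_sa u S : (forall n, sa (u n)) -> slim u S -> sa S.
Proof.
move=> hA h x y; apply: (@seq_cvg_uniq _ R^o) (@slim_rip _ _ x y h) _.
rewrite (_ : (fun n => _) = (fun n => << u n y, x >>)); last first.
  by apply/funext => n; rewrite hA ripC.
by rewrite (ripC hip x); apply: slim_rip.
Qed.
Lemma slim_psd u S : (forall n, psd (u n)) -> slim u S -> psd S.
Proof.
move=> hA h; split; first by apply: slim_sa h => n; case: (hA n).
move=> x; have h' := @slim_rip _ _ x x h.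
rewrite -(cvg_lim _ h')//; apply: limr_ge; first by apply/cvg_ex; eexists; exact: h'.
by near=> n; case: (hA n).
Unshelve. all: by end_near. Qed.

Lemma slim_exists u (c : R) : (forall n, opnorm (u n) <= c) ->
  (forall x, exists l, (fun n => u n x) @ \oo --> (l : H)) -> exists S, slim u S.
Proof.
move=> hc hl; pose f x := sval (cid (hl x)).
have hf x : (fun n => u n x) @ \oo --> f x by rewrite /f; case: cid.
have bf : bounded_op f.
  apply: (@mk_bop _ _ _ c) => [a x y|x].
    apply: seq_cvg_uniq (hf _) _.
    rewrite (_ : (fun n => _) = (fun n => a *: u n x + u n y)); last first.
      by apply/funext => n; rewrite bopD bopZ.
    by apply: cvgD; [apply: cvgZr; exact: hf|exact: hf].
  have h := cvg_rnorm (hf x); rewrite -(cvg_lim _ h)//.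
  apply: limr_le; first by apply/cvg_ex; eexists; exact: h.
  near=> n; apply: le_trans (opnormP _ _) _.
  by rewrite ler_wpM2r ?rnorm_ge0.
by exists (Bop bf).
Unshelve. all: by end_near. Qed.

(** The form at each vector increases to a limit, and [psd_rnorm] bounds |(u_m - u_n) x|^2 by [K]
    times the increment of the form. One [K] serves all m and n because every difference lies below
    sc c - u_0. *)
Lemma vigier u (c : R) : (forall n, sa (u n)) -> (forall n, psd (u n.+1 - u n)) ->
  (forall n, psd (sc c - u n)) -> exists S, slim u S /\ forall n, psd (S - u n).
Proof.
move=> hsa hinc hc.
have mono m n : (n <= m)%N -> psd (u m - u n).
  move=> /subnK <-; elim: (m - n)%N => [|k ih]; first by rewrite add0n subrr; exact: psd0.
  by rewrite addSn; apply: psd_trans ih (hinc _).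
pose K := opnorm (sc c - u 0%N).
have K0 : 0 <= K by exact: opnorm_ge0.
have hK m n : (n <= m)%N -> opnorm (u m - u n) <= K.
  move=> nm; apply: psd_norm_le => //; first exact: mono.
  have h1 : psd (sc K - (sc c - u 0%N)).
    by apply: psd_opnormB => //; apply: saB => //; exact: sa_sc.
  have -> : sc K - (u m - u n) = (sc K - (sc c - u 0%N)) + ((sc c - u m) + (u n - u 0%N)).
    bopring hip.
  by apply: psdD => //; apply: psdD => //; exact: mono.
have cau x : exists l : H, (fun n => u n x) @ \oo --> l.
  apply: cauchy_rnorm => e e0.
  pose a n := << u n x, x >>.
  have a_nd : nondecreasing_seq a.
    by move=> n m nm; have [_ /(_ x)] := mono _ _ nm; rewrite bopE ripBl// subr_ge0.
  have a_ub n : a n <= c * rnorm x ^+ 2.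
    by have [_ /(_ x)] := hc n; rewrite bopE scE ripBl// ripZl// subr_ge0 ripxx.
  have ca : cvgn a.
    by apply: nondecreasing_is_cvgn => //; exists (c * rnorm x ^+ 2) => _ [n _ <-].
  have K1 : 0 < K + 1 by rewrite ltr_wpDl.
  have d0 : 0 < e ^+ 2 / (K + 1) by rewrite divr_gt0// exprn_gt0.
  have [N _ hN] : \forall n \near \oo, lim (a @ \oo) - a n < e ^+ 2 / (K + 1).
    move/cvgrPdist_lt : ca => /(_ _ d0); apply: filterS => n.
    exact: le_lt_trans (ler_norm _).
  exists N => m n; wlog nm : m n / (n <= m)%N.
    move=> hw Nm Nn; have [nm|/ltnW mn] := leqP n m; first exact: hw.
    by rewrite rnormBC; apply: hw.
  move=> Nm Nn; rewrite -(ltr_pXn2r (n:=2)) ?nnegrE ?rnorm_ge0 ?(ltW e0)//.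
  have := psd_rnorm x (mono _ _ nm); rewrite bopBE => /le_lt_trans; apply.
  rewrite ripBl// -/(a m) -/(a n).
  have am : a m <= lim (a @ \oo) by exact: nondecreasing_cvgn_le.
  have an := hN n Nn; rewrite /= in an.
  have d1 : a m - a n < e ^+ 2 / (K + 1) by apply: le_lt_trans an; rewrite lerB.
  have dn : 0 <= a m - a n by rewrite subr_ge0; exact: a_nd.
  apply: (@le_lt_trans _ _ ((K + 1) * (a m - a n))).
    rewrite ler_wpM2r//; apply: le_trans (hK _ _ nm) _; lra.
  by rewrite mulrC -ltr_pdivlMr.
have bd n : opnorm (u n) <= K + opnorm (u 0%N).
  by rewrite -[u n](subrK (u 0%N)); apply: le_trans (opnormD _ _) _; rewrite lerD2r hK.
have [S hS] := slim_exists bd cau; exists S; split=> // n.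
split; first by apply: saB => //; exact: slim_sa hS.
move=> x; rewrite bopE ripBl// subr_ge0.
have h := @slim_rip _ _ x x hS; rewrite -(cvg_lim _ h)//.
apply: limr_ge; first by apply/cvg_ex; eexists; exact: h.
near=> m; have [_ /(_ x)] : psd (u m - u n) by apply: mono; near: m; exact: nbhs_infty_ge.
by rewrite bopE ripBl// subr_ge0.
Unshelve. all: by end_near. Qed.

Lemma slim_comm u S C : slim u S -> (forall n, C * u n = u n * C) -> C * S = S * C.
Proof.
move=> h hC; apply: slim_uniq (@slimMl _ _ C h) _.
by apply: slim_ext (@slimMr _ _ C h) => n; rewrite hC.
Qed.

Lemma psd_convex A : psd A -> psd (1 - A) -> psd (A - A * A).
Proof.
move=> hA h1; have [sA _] := hA; have [s1 _] := h1.
have -> : A - A * A = A * (1 - A) * A + (1 - A) * A * (1 - A).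
  bopring hip.
by apply: psdD; apply: psd_sandwich.
Qed.

Lemma slim_shift u S : slim u S -> slim (fun n => u n.+1) S.
Proof. by move=> h x; have := h x; rewrite -(cvg_shiftS (fun n => u n x)). Qed.

Lemma psd_bound A (c : R) : psd A -> psd (sc c - A) -> opnorm A <= `|c|.
Proof.
move=> hA hc; apply: psd_norm_le => //.
have -> : sc `|c| - A = sc (`|c| - c) + (sc c - A) by rewrite scD scN; bopring hip.
by apply: psdD => //; apply: psd_scalar; rewrite subr_ge0 ler_norm.
Qed.

(* With [A_0 = A <= 1] and [A_(n+1) = A_n - A_n^2] one has
   [A = \sum_n A_n^2], so that [B A = \sum_n A_n B A_n]. *)
Lemma psdM A B : psd A -> psd B -> A * B = B * A -> psd (A * B).
Proof.
move=> hA hB AB.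
wlog A1 : A hA AB / psd (1 - A).
  move=> hw; pose c := opnorm A + 1; have c0 : 0 < c by rewrite ltr_wpDl ?opnorm_ge0.
  have -> : A * B = c *: ((c^-1 *: A) * B).
    by rewrite bopAl scalerA divff ?gt_eqF// scale1r.
  apply: psdZ; first exact: ltW.
  apply: hw.
  - by apply: psdZ => //; rewrite invr_ge0 ltW.
  - by rewrite bopAl bopAr AB.
  - have -> : 1 - c^-1 *: A = c^-1 *: (sc c - A).
      by rewrite scalerBr /sc scalerA mulVf ?gt_eqF// scale1r.
    apply: psdZ; first by rewrite invr_ge0 ltW.
    by apply: psd_opnormB; [case: hA|rewrite lerDl].
pose u := fix u n := if n is m.+1 then u m - u m * u m else A.
have uS n : u n.+1 = u n - u n * u n by [].
have hu n : [/\ psd (u n), psd (1 - u n) & B * u n = u n * B].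
  elim: n => [|n [h1 h2 h3]]; first by split.
  rewrite uS; split; first exact: psd_convex.
    have -> : 1 - (u n - u n * u n) = (1 - u n) + u n * u n by bopring hip.
    by apply: psdD => //; apply: psd_sqr; case: h1.
  by rewrite mulrBr mulrBl h3 mulrA h3 -!mulrA h3.
have un n : opnorm (u n) <= 1.
  have [h1 h2 _] := hu n; rewrite -(normr1 R); apply: psd_bound => //.
  by rewrite sc1.
have [S [hS _]] : exists S, slim (fun n => - u n) S /\ forall n, psd (S - - u n).
  apply: (@vigier _ 0) => n; have [h1 h2 _] := hu n.
  - by apply: saN; case: h1.
  - rewrite uS opprK opprB addrNK; apply: psd_sqr; by case: h1.
  - by rewrite sc0 opprK add0r.
have {}hS : slim u (- S) by apply: slim_ext (slimN hS) => n; rewrite opprK.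
have S0 : S = 0.
  have hSS := slimM un hS hS.
  have e : - S = - S - - S * - S.
    by apply: slim_uniq (slim_shift hS) _; exact: slimB hS hSS.
  have sS : sa S by rewrite -[S]opprK; apply: saN; apply: slim_sa hS => n; case: (hu n) => [[]].
  have SS : S * S = 0.
    by move/eqP: e; rewrite -subr_eq0 opprB addrCA subrr addr0 mulrNN => /eqP.
  apply: bopext => x; apply: rnorm_eq0; apply/eqP.
  by rewrite -sqrf_eq0 -(ripxx hip) sS -bopME SS bop0E rip0r.
have hp n : psd (B * (A - u n)).
  elim: n => [|n ih]; first by rewrite subrr mulr0; exact: psd0.
  have -> : B * (A - u n.+1) = B * (A - u n) + u n * B * u n.
    by have [_ _ h3] := hu n; rewrite uS -h3 -mulrA -mulrDr; congr (_ * _); bopring hip.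
  by apply: psdD => //; apply: psd_sandwich => //; case: (hu n) => [[]].
rewrite AB; apply: slim_psd hp _.
rewrite -[A in X in slim _ X]subr0; apply: slimMl.
apply: slimB; first exact: slim_cst.
by rewrite -oppr0 -S0.
Qed.

(** Membership in the bicommutant of [T], up to the complex scalars. It survives sums, products and
    strong limits, and it is how operators constructed from elements of a von Neumann algebra are
    seen to stay in it. *)
Definition bicom T S := forall C : bop H, C * T = T * C -> C * S = S * C.

Lemma bicom_refl T : bicom T T. Proof. by []. Qed.
Lemma bicom_trans S T Q : bicom T S -> bicom S Q -> bicom T Q.
Proof. by move=> h h' C /h/h'. Qed.
Lemma bicomM T S Q : bicom T S -> bicom T Q -> bicom T (S * Q).
Proof. by move=> h h' C hC; rewrite mulrA h// -mulrA h'// mulrA. Qed.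
Lemma bicomD T S Q : bicom T S -> bicom T Q -> bicom T (S + Q).
Proof. by move=> h h' C hC; rewrite mulrDr mulrDl h// h'. Qed.
Lemma bicomN T S : bicom T S -> bicom T (- S).
Proof. by move=> h C hC; rewrite mulrN mulNr h. Qed.
Lemma bicomZ T a S : bicom T S -> bicom T (a *: S).
Proof. by move=> h C hC; rewrite bopAl bopAr h. Qed.
Lemma bicom1 T : bicom T 1. Proof. by move=> C _; rewrite mulr1 mul1r. Qed.
Lemma bicomX T S n : bicom T S -> bicom T (S ^+ n).
Proof.
move=> h; elim: n => [|n ih]; first by rewrite expr0; exact: bicom1.
by rewrite exprS; exact: bicomM.
Qed.
Lemma bicom_slim T u S : (forall n, bicom T (u n)) -> slim u S -> bicom T S.
Proof. by move=> h hS C hC; apply: slim_comm hS _ => n; exact: h. Qed.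

(** For B = 1 - A between 0 and 1, the iteration u -> (B + u^2) / 2 from 0 increases and stays below
    1. Its limit S satisfies 2 S = B + S^2, that is (1 - S)^2 = A. Monotonicity rests on [psdM],
    since all iterates commute. *)
Lemma psd_sqrt A : psd A -> exists S, [/\ psd S, S * S = A & bicom A S].
Proof.
move=> hA.
wlog A1 : A hA / psd (1 - A).
  move=> hw; pose c := opnorm A + 1; have c0 : 0 < c by rewrite ltr_wpDl ?opnorm_ge0.
  case: (hw (c^-1 *: A)).
  - by apply: psdZ => //; rewrite invr_ge0 ltW.
  - have -> : 1 - c^-1 *: A = c^-1 *: (sc c - A).
      by rewrite scalerBr /sc scalerA mulVf ?gt_eqF// scale1r.
    apply: psdZ; first by rewrite invr_ge0 ltW.
    by apply: psd_opnormB; [case: hA|rewrite lerDl].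
  move=> S [pS SS bS]; exists (Num.sqrt c *: S); split.
  - by apply: psdZ => //; exact: sqrtr_ge0.
  - rewrite bopAl bopAr scalerA -expr2 sqr_sqrtr ?(ltW c0)// SS scalerA divff ?gt_eqF//.
    by rewrite scale1r.
  - by apply: bicomZ => C hC; apply: bS; rewrite bopAl bopAr hC.
pose B := 1 - A.
have B0 : psd B by [].
have B1 : psd (1 - B) by rewrite opprB addrC subrK.
pose u := fix u n := if n is m.+1 then 2^-1 *: (B + u m * u m) else (0 : bop H).
have uS n : u n.+1 = 2^-1 *: (B + u n * u n) by [].
have half0 : 0 <= (2^-1 : R) by rewrite invr_ge0.
have hu n : [/\ psd (u n), psd (1 - u n) & bicom B (u n)].
  elim: n => [|n [h1 h2 h3]].
    by split; rewrite /= ?subr0; [exact: psd0|exact: psd1|move=> C _; rewrite mulr0 mul0r].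
  rewrite uS; split.
  - by apply: psdZ => //; apply: psdD => //; apply: psd_sqr; case: h1.
  - have -> : 1 - 2^-1 *: (B + u n * u n) =
              2^-1 *: ((1 - B) + (1 - u n) * (1 + u n)).
      bopring hip.
    apply: psdZ => //; apply: psdD => //; apply: psdM => //; last bopring hip.
    by apply: psdD => //; exact: psd1.
  - by apply: bicomZ; apply: bicomD; [exact: bicom_refl|exact: bicomM].
have cuu n m : u n * u m = u m * u n.
  have [_ _ hn] := hu n; have [_ _ hm] := hu m.
  by apply: hm; rewrite -hn.
have inc n : psd (u n.+1 - u n).
  elim: n => [|n ih].
    by rewrite /= subr0 mulr0 addr0; apply: psdZ.
  have -> : u n.+2 - u n.+1 = 2^-1 *: ((u n.+1 - u n) * (u n.+1 + u n)).
    rewrite (uS n.+1) {2}(uS n) -scalerBr; congr (_ *: _).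
    by rewrite mulrBl !mulrDr (cuu n.+1 n); bopring hip.
  apply: psdZ => //; apply: psdM => //.
    by apply: psdD => //; [case: (hu n.+1)|case: (hu n)].
  by apply: commrD; apply: commr_sym; apply: commrB; rewrite /GRing.comm// cuu.
have [S [hS hSu]] : exists S, slim u S /\ forall n, psd (S - u n).
  apply: (@vigier _ 1) => // n; first by case: (hu n) => [[]].
  by rewrite sc1; case: (hu n).
have un n : opnorm (u n) <= 1.
  have [h1 h2 _] := hu n; rewrite -(normr1 R); apply: psd_bound => //.
  by rewrite sc1.
have bS : bicom B S by apply: bicom_slim hS => n; case: (hu n).
have eS : S = 2^-1 *: (B + S * S).
  apply: slim_uniq (slim_shift hS) _.
  by apply: slimZ; apply: slimD; [exact: slim_cst|exact: (slimM un hS hS)].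
exists (1 - S); split.
- by apply: slim_psd (slimB (@slim_cst 1) hS) => n; case: (hu n).
- have -> : A = 1 - B by rewrite opprB addrC subrK.
  have : 2%:R *: S = B + S * S by rewrite [in LHS]eS scalerA divff ?pnatr_eq0// scale1r.
  move=> e2; have -> : B = 2%:R *: S - S * S by rewrite e2 addrK.
  bopring hip.
- apply: bicomD; first exact: bicom1.
  apply: bicomN => C hC; apply: bS; by rewrite /B mulrBr mulrBl hC mulr1 mul1r.
Qed.

Lemma psdX A n : psd A -> psd (A ^+ n).
Proof.
move=> hA; elim: n => [|n ih]; first by rewrite expr0; exact: psd1.
by rewrite exprS; apply: psdM => //; rewrite -exprS exprSr.
Qed.

(* The strong limit of [(1 - c A^2)^n]. *)
Lemma kernel_projection A : sa A -> exists Q,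
  [/\ sa Q, Q * Q = Q, A * Q = 0, bicom A Q & forall C, C * A = 0 -> C * Q = C].
Proof.
move=> hA; pose c := (opnorm (A * A) + 1)^-1.
have c0 : 0 < c by rewrite invr_gt0 ltr_wpDl ?opnorm_ge0.
pose K := 1 - c *: (A * A).
have pAA : psd (A * A) by exact: psd_sqr.
have K0 : psd K.
  have -> : K = c *: (sc (opnorm (A * A) + 1) - A * A).
    by rewrite scalerBr /sc scalerA mulVf ?gt_eqF// ?scale1r// ltr_wpDl ?opnorm_ge0.
  apply: psdZ; first exact: ltW.
  by apply: psd_opnormB; [case: pAA|rewrite lerDl].
have K1 : psd (1 - K) by rewrite opprB addrC subrK; apply: psdZ => //; exact: ltW.
have dec n : psd (K ^+ n - K ^+ n.+1).
  rewrite exprSr -{1}[K ^+ n]mulr1 -mulrBr; apply: psdM => //; first exact: psdX.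
  by rewrite mulrBr mulrBl mulr1 mul1r -exprS exprSr.
have le1 n : psd (1 - K ^+ n).
  elim: n => [|n ih]; first by rewrite expr0 subrr; exact: psd0.
  exact: psd_trans (dec n) ih.
have Kn n : opnorm (K ^+ n) <= 1.
  by rewrite -(normr1 R); apply: psd_bound; [exact: psdX|rewrite sc1].
have [Q' [hQ' _]] : exists S, slim (fun n => - K ^+ n) S /\ forall n, psd (S - - K ^+ n).
  apply: (@vigier _ 0) => n.
  - by apply: saN; case: (psdX n K0).
  - by rewrite opprK addrC.
  - by rewrite sc0 opprK add0r; exact: psdX.
pose Q := - Q'.
have hQ : slim (fun n => K ^+ n) Q by apply: slim_ext (slimN hQ') => n; rewrite opprK.
have bK : bicom A K.
  by apply: bicomD; [exact: bicom1|apply/bicomN/bicomZ/bicomM].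
have KQ : K * Q = Q.
  apply: slim_uniq (@slimMl _ _ K hQ) _.
  by apply: slim_ext (slim_shift hQ) => n; rewrite exprS.
have sQ : sa Q by apply: slim_sa hQ => n; case: (psdX n K0).
exists Q; split=> //.
- apply: slim_uniq (@slimMl _ _ Q hQ) _.
  have QK : Q * K = Q by rewrite (@slim_comm _ _ K hQ)// in KQ => n; rewrite -exprS exprSr.
  have cQ := @slim_cst Q; apply: slim_ext cQ => n; elim: n => [|n ih]; first by rewrite expr0 mulr1.
  by rewrite exprS mulrA QK.
- have AAQ : A * A * Q = 0.
    have : c *: (A * A * Q) = 0.
      have e : c *: (A * A * Q) = Q - K * Q by rewrite [K * Q]mulrBl mul1r bopAl opprB addrC subrK.
      by rewrite e KQ subrr.
    by move=> /(congr1 (fun X => c^-1 *: X)); rewrite scaler0 scalerA mulVf ?gt_eqF// scale1r.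
  apply: bopext => x; apply: rnorm_eq0; apply/eqP.
  by rewrite -sqrf_eq0 -(ripxx hip) bopME hA -!bopME AAQ bop0E rip0r.
- by apply: bicom_slim hQ => n; exact: bicomX.
- move=> C CA; have CK : C * K = C by rewrite mulrBr mulr1 bopAr mulrA CA mul0r scaler0 subr0.
  apply: slim_uniq (@slimMl _ _ C hQ) _.
  have cC := @slim_cst C; apply: slim_ext cC => n; elim: n => [|n ih]; first by rewrite expr0 mulr1.
  by rewrite exprS mulrA CK.
Qed.

Definition isproj P := sa P /\ P * P = P.

Lemma isproj_psd P : isproj P -> psd P.
Proof. by move=> [h e]; rewrite -e; apply: psd_sqr. Qed.
Lemma isprojC P : isproj P -> isproj (1 - P).
Proof.
move=> [h e]; split; first exact: saB.
by rewrite mulrBr mulr1 mulrBl mul1r e subrr subr0.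
Qed.
Lemma isproj_rip P x : isproj P -> << P x, x >> = rnorm (P x) ^+ 2.
Proof. by move=> [h e]; rewrite -(ripxx hip) -h -bopME e. Qed.
Lemma isproj_norm P : isproj P -> opnorm P <= 1.
Proof.
move=> hP; rewrite -(normr1 R); apply: psd_bound; first exact: isproj_psd.
by rewrite sc1; apply/isproj_psd/isprojC.
Qed.

(** With S = |T|, take for P the projection onto the kernel of S + T. On its range T = -S; off its
    range T = S, because (S - T)(S + T) = 0. *)
Lemma sign_projection T : sa T -> exists P,
  [/\ isproj P, bicom T P, psd (- (T * P)) & psd (T * (1 - P))].
Proof.
move=> hT; have [S [pS SS bS]] := psd_sqrt (psd_sqr hT).
have bTS : bicom T S by apply: bicom_trans bS; exact: bicomM.
have TS : T * S = S * T by exact: bTS.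
have sS : sa S by case: pS.
have [P [sP PP AP bP hP]] := kernel_projection (saD sS hT).
have bTP : bicom T P by apply: bicom_trans bP; exact: bicomD.
have TP : T * P = P * T by exact: bTP.
have SP : S * P = P * S by apply: bTP; rewrite TS.
have pP : psd P by apply: isproj_psd.
have e1 : T * P = - (S * P).
  by apply/eqP; rewrite -addr_eq0 addrC -mulrDl AP.
have e2 : (S - T) * (1 - P) = 0.
  rewrite mulrBr mulr1 hP ?subrr//.
  by rewrite mulrDr !mulrBl TS SS; bopring hip.
exists P; split=> //.
- by rewrite e1 opprK; apply: psdM.
- have -> : T * (1 - P) = S * (1 - P).
    by apply/esym/eqP; rewrite -subr_eq0 -mulrBl e2.
  apply: psdM => //; first by apply/isproj_psd/isprojC.
  by rewrite mulrBr mulrBl mulr1 mul1r SP.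
Qed.

End Positive.

(** * Projection-valued measures *)

Section LocallyBounded.
Context {R : realType}.
Local Notation mT := (measurableTypeR R).
Implicit Types f g : R -> R.

(** The class on which the calculus of every bounded self-adjoint operator is defined. Unlike the
    bounded functions it contains the identity and is stable under composition. *)
Definition lb f := measurable_fun [set: mT] (f : mT -> R) /\
  forall M : R, exists K : R, forall u, `|u| <= M -> `|f u| <= K.

Lemma lb_cst (c : R) : lb (fun=> c).
Proof. by split=> [|M]; [exact: measurable_cst|exists `|c|]. Qed.
Lemma lb_id : lb id.
Proof. by split=> [|M]; [exact: measurable_id|exists M]. Qed.
Lemma lbD f g : lb f -> lb g -> lb (fun u => f u + g u).
Proof.
move=> [mf bf] [mg bg]; split=> [|M]; first exact: measurable_funD.
have [K hK] := bf M; have [L hL] := bg M; exists (K + L) => u uM.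
by apply: le_trans (ler_normD _ _) _; rewrite lerD ?hK ?hL.
Qed.
Lemma lbM f g : lb f -> lb g -> lb (fun u => f u * g u).
Proof.
move=> [mf bf] [mg bg]; split=> [|M]; first exact: measurable_funM.
have [K hK] := bf M; have [L hL] := bg M; exists (K * L) => u uM.
by rewrite normrM ler_pM ?hK ?hL.
Qed.
Lemma lbZ c f : lb f -> lb (fun u => c * f u).
Proof. by move=> hf; apply: lbM => //; exact: lb_cst. Qed.
Lemma lbN f : lb f -> lb (fun u => - f u).
Proof. by move=> /(lbZ (-1)); rewrite (_ : (fun u => - f u) = (fun u => -1 * f u))//; apply/funext => u; rewrite mulN1r. Qed.
Lemma lbB f g : lb f -> lb g -> lb (fun u => f u - g u).
Proof. by move=> hf hg; apply: lbD => //; exact: lbN. Qed.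
Lemma lb_comp f g : lb f -> lb g -> lb (fun u => f (g u)).
Proof.
move=> [mf bf] [mg bg]; split=> [|M]; first exact: (measurableT_comp mf mg).
have [K hK] := bg M; have [L hL] := bf K; exists L => u uM.
by apply: hL; exact: hK.
Qed.
Lemma lb_indic (A : set mT) : measurable A -> lb (\1_A : R -> R).
Proof.
move=> mA; split=> [|M]; first exact: measurable_indic.
by exists 1 => u _; rewrite indicE; case: (_ \in _); rewrite /= ?normr1 ?normr0.
Qed.
Lemma lbX f n : lb f -> lb (fun u => f u ^+ n).
Proof.
move=> hf; elim: n => [|n ih].
  have -> : (fun u => f u ^+ 0) = fun=> 1 by apply/funext=> u; rewrite expr0.
  exact: lb_cst.
have -> : (fun u => f u ^+ n.+1) = fun u => f u * f u ^+ n.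
  by apply/funext => u; rewrite exprS.
exact: lbM.
Qed.
Lemma lb_continuous f : continuous f -> lb f.
Proof.
move=> cf; split=> [|M]; first exact: continuous_measurable_fun.
have [M0|M0] := leP 0 M; last first.
  by exists 0 => u uM; have := le_lt_trans uM M0; rewrite ltNge normr_ge0.
have cf' : {within `[- M, M], continuous (fun u => `|f u|)}.
  apply: continuous_subspaceT => u; apply: continuous_comp; first exact: cf.
  exact: norm_continuous.
have MM : - M <= M by rewrite (le_trans _ M0)// oppr_le0.
have [c _ hc] := EVT_max MM cf'.
by exists `|f c| => u uM; apply: hc; rewrite in_itv/= -ler_norml.
Qed.
Lemma lb_norm f : lb f -> lb (fun u => `|f u|).
Proof. by move=> hf; apply: (@lb_comp Num.norm) => //; apply: lb_continuous => u; exact: norm_continuous. Qed.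
Lemma lb_max f g : lb f -> lb g -> lb (fun u => Num.max (f u) (g u)).
Proof.
move=> [mf bf] [mg bg]; split=> [|M].
  exact: (measurable_maxr mf mg).
have [K hK] := bf M; have [L hL] := bg M; exists (K + L) => u uM.
have := hK _ uM; have := hL _ uM => h1 h2.
have K0 := le_trans (normr_ge0 _) h2; have L0 := le_trans (normr_ge0 _) h1.
by rewrite /Num.max; case: ifP => _; [apply: le_trans h1 _|apply: le_trans h2 _]; rewrite ?lerDl ?lerDr.
Qed.

(** After an affine change f takes values in [0, 1] on [-M, M], and its binary digits write it as a
    uniform limit of combinations of indicators. A property stable under these operations need only
    be checked on indicators. *)
Lemma lb_ind (M : R) (Pr : (R -> R) -> Prop) :
  (forall A : set mT, measurable A -> Pr (\1_A)) ->
  (forall c f g, lb f -> lb g -> Pr f -> Pr g -> Pr (fun u => c * f u + g u)) ->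
  (forall f, lb f -> (forall e : R, 0 < e -> exists g,
     [/\ lb g, Pr g & forall u, `|u| <= M -> `|f u - g u| <= e]) -> Pr f) ->
  forall f, lb f -> Pr f.
Proof.
move=> Pi Pl Plim.
have P0 : Pr (\1_set0) by exact: Pi.
have l0 : lb (\1_set0 : R -> R) by exact: lb_indic.
have i0 u : (\1_set0 u : R) = 0 by rewrite indicE in_set0.
have unit n : forall f, lb f -> (forall u, `|u| <= M -> 0 <= f u <= 1) ->
    exists g, [/\ lb g, Pr g & forall u, `|u| <= M -> `|f u - g u| <= 2^-1 ^+ n].
  elim: n => [|n ih] f hf f01.
    exists (\1_set0); split=> // u uM; rewrite i0 subr0 expr0.
    by have /andP[f0 f1] := f01 u uM; rewrite ger0_norm.
  (* The first binary digit of [f] is the indicator of [A], and 2 f - 1_A again takes values in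
     [0, 1] on [-M, M]. *)
  pose A : set mT := [set u | 2^-1 <= f u].
  have mA : measurable A.
    rewrite (_ : A = f @^-1` `[2^-1, +oo[); last first.
      by apply/seteqP; split=> u /=; rewrite in_itv/= andbT.
    by rewrite -[X in measurable X]setTI; apply: hf.1.
  have lA : lb (\1_A : R -> R) by exact: lb_indic.
  have [||g [lg Pg hg]] := ih (fun u => 2 * f u - \1_A u).
  - by apply: lbB => //; exact: lbZ.
  - move=> u uM; have /andP[f0 f1] := f01 u uM; rewrite indicE.
    have [uA|uA] := boolP (u \in A).
      by move: uA; rewrite inE /A/= => uA; rewrite mulr1n; lra.
    move: uA; rewrite notin_setE /A/= => /negP; rewrite -ltNge => uA.
    by rewrite mulr0n; lra.
  exists (fun u => 2^-1 * \1_A u + (2^-1 * g u + \1_set0 u)); split.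
  - by apply: lbD; [exact: lbZ|apply: lbD => //; exact: lbZ].
  - apply: (Pl 2^-1 (\1_A) (fun u => 2^-1 * g u + \1_set0 u)) => //.
    + by apply: lbD => //; exact: lbZ.
    + exact: Pi.
    + exact: Pl.
  - move=> u uM; have := hg u uM; rewrite i0 addr0.
    have -> : f u - (2^-1 * \1_A u + 2^-1 * g u) = 2^-1 * (2 * f u - \1_A u - g u) by field.
    by rewrite normrM ger0_norm ?invr_ge0// exprS ler_pM2l ?invr_gt0.
move=> f lf; have [K0 hK0] := lf.2 M.
pose K := `|K0| + 1.
have K_gt0 : 0 < K by rewrite ltr_wpDl.
have hK u : `|u| <= M -> `|f u| <= K.
  by move=> /hK0 /le_trans; apply; rewrite /K (le_trans (ler_norm _))// lerDl.
pose f' u := (2 * K)^-1 * (f u + K).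
have lf' : lb f' by apply: lbZ; apply: lbD => //; exact: lb_cst.
have Pf' : Pr f'.
  apply: Plim => // e e0.
  have [n hn] : exists n, (2^-1 : R) ^+ n <= e.
    have : (2^-1 : R) ^+ n @[n --> \oo] --> (0 : R).
      by apply: cvg_expr; rewrite ger0_norm ?invr_ge0// invf_lt1// ltr1n.
    move=> /cvgr0Pnorm_le /(_ _ e0) [n _ /(_ n)]; rewrite /= leqnn => /(_ isT) h.
    by exists n; apply: le_trans (ler_norm _) h.
  have [|g [lg Pg hg]] := unit n f' lf'.
    move=> u /hK; rewrite ler_norml /f' => /andP[h1 h2]; apply/andP; split.
      by rewrite mulr_ge0// ?invr_ge0; lra.
    by rewrite mulrC ler_pdivrMr ?mulr_gt0//; lra.
  by exists g; split=> // u /hg /le_trans; apply.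
have -> : f = (fun u => (2 * K) * f' u + (- K * \1_[set: mT] u + \1_set0 u)).
  apply/funext => u; rewrite i0 indicT /f' addr0 mulr1 mulrA divff ?mul1r ?addrK//.
  by rewrite mulf_neq0// gt_eqF.
apply: (Pl) => //; first by apply: lbD => //; apply: lbZ; exact: lb_indic.
by apply: Pl => //; [exact: lb_indic|exact: Pi].
Qed.

Section Integral.
Context (m : {measure set mT -> \bar R}) (M : R).
Context (mM : m (~` `[- M, M]) = 0%E) (mfin : (m setT < +oo)%E).

Let mC : measurable (~` `[- M, M] : set mT).
Proof. exact: measurableC. Qed.

Lemma lb_integrable f : lb f -> m.-integrable setT (EFin \o f).
Proof.
move=> [mf bf]; have mf' : measurable_fun [set: mT] (EFin \o (f : mT -> R)) by exact/measurable_EFinP.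
apply/(negligible_integrable mC) => //.
rewrite setTD setCK; apply: measurable_bounded_integrable => //.
- by apply: le_lt_trans mfin; apply: le_measure; rewrite ?inE//.
- exact: measurable_funS mf.
- have [K hK] := bf M; exists K; split; first exact: num_real.
  move=> L KL u /=; rewrite in_itv/= -ler_norml => /hK /le_trans; apply; exact: ltW.
Qed.

Lemma lb_Rint_restrict f : lb f -> \int[m]_u f u = \int[m]_(u in `[- M, M]) f u.
Proof.
move=> lf; rewrite /Rintegral (negligible_integral mC)//; last exact: lb_integrable.
by rewrite setTD setCK.
Qed.

Lemma lb_le_Rint f g : lb f -> lb g -> (forall u, `|u| <= M -> f u <= g u) ->
  \int[m]_u f u <= \int[m]_u g u.
Proof.
move=> lf lg fg; rewrite !lb_Rint_restrict//; apply: le_Rintegral => //.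
- by apply: integrableS (lb_integrable lf).
- by apply: integrableS (lb_integrable lg).
- by move=> u /=; rewrite in_itv/= -ler_norml; exact: fg.
Qed.

Lemma lb_Rint_lin (c : R) f g : lb f -> lb g ->
  \int[m]_u (c * f u + g u) = c * \int[m]_u f u + \int[m]_u g u.
Proof.
move=> lf lg; rewrite RintegralD//; [|exact: lb_integrable (lbZ _ lf)|exact: lb_integrable].
by rewrite RintegralZl//; exact: lb_integrable.
Qed.

Lemma lb_Rint_cst (c : R) : \int[m]_u c = c * fine (m setT).
Proof. by rewrite Rintegral_cst. Qed.

Lemma lb_Rint_indic (A : set mT) : measurable A -> \int[m]_u (\1_A u : R) = fine (m A).
Proof. by move=> mA; rewrite /Rintegral integral_indic// setIT. Qed.

Lemma lb_Rint_dist f g e : lb f -> lb g -> (forall u, `|u| <= M -> `|f u - g u| <= e) ->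
  `|\int[m]_u f u - \int[m]_u g u| <= e * fine (m setT).
Proof.
move=> lf lg h; rewrite ler_norml -lb_Rint_cst; apply/andP; split.
  rewrite lerBrDl addrC -mulN1r -lb_Rint_lin//; last exact: lb_cst.
  apply: lb_le_Rint => //; first by apply: lbD => //; apply: lbZ; exact: lb_cst.
  by move=> u /h; rewrite ler_norml => /andP[h1 _]; lra.
rewrite lerBlDl addrC -[X in X + _]mul1r -lb_Rint_lin//; last exact: lb_cst.
apply: lb_le_Rint => //; first by apply: lbD => //; apply: lbZ; exact: lb_cst.
by move=> u /h; rewrite ler_norml => /andP[_ h1]; lra.
Qed.

End Integral.
End LocallyBounded.

Section Calculus.
Context {R : realType} {H : completeNormedModType R[i]} (ip : H -> H -> R[i]).
Context (hip : hilbert_inner_product ip).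
Local Notation mT := (measurableTypeR R).
Local Notation "<< x , y >>" := (rip ip x y).
Implicit Types (A B : set mT) (f g : R -> R) (S T C : bop H) (x : H).

(** A resolution of the identity with compact support. The scalar measures are part of the data, so
    that integrals against them need no construction from the projections. *)
Record pvm := Pvm {
  pE :> set mT -> bop H;
  pmu : H -> {measure set mT -> \bar R};
  pM : R;
  pvm_proj : forall B, measurable B -> isproj ip (pE B);
  pvmT : pE setT = 1;
  pvmI : forall A B, measurable A -> measurable B -> pE (A `&` B) = pE A * pE B;
  pvm_mu : forall x B, measurable B -> pmu x B = << pE B x, x >>%:E;
  pvm_supp : pE (~` `[- pM, pM]) = 0 }.

Lemma sa_form_eq S T : sa ip S -> sa ip T -> (forall x, << S x, x >> = << T x, x >>) -> S = T.
Proof.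
move=> hS hT h; apply/eqP; rewrite -subr_eq0; apply/eqP/(psd_anti hip); split.
- exact: saB.
- by move=> x; rewrite bopE ripBl// h subrr.
- by apply: saN => //; exact: saB.
- by move=> x; rewrite !bopE ripNl// ripBl// h subrr oppr0.
Qed.

Section OnePvm.
Variable E : pvm.
Local Notation mu := (pmu E).
Local Notation M := (pM E).

Lemma pmu_supp x : mu x (~` `[- M, M]) = 0%E.
Proof. by rewrite pvm_mu ?pvm_supp ?bopE ?rip0l//; exact: measurableC. Qed.
Lemma pmuT x : mu x setT = (rnorm x ^+ 2)%:E.
Proof. by rewrite pvm_mu// pvmT -(ripxx hip). Qed.
Lemma pmu_fin x : (mu x setT < +oo)%E.
Proof. by rewrite pmuT ltry. Qed.

Lemma pint_integrable x f : lb f -> (mu x).-integrable setT (EFin \o f).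
Proof. by apply: lb_integrable (pmu_supp x) (pmu_fin x) _. Qed.
Lemma pint_le x f g : lb f -> lb g -> (forall u, `|u| <= M -> f u <= g u) ->
  \int[mu x]_u f u <= \int[mu x]_u g u.
Proof. by apply: lb_le_Rint (pmu_supp x) (pmu_fin x) _ _. Qed.
Lemma pint_lin x c f g : lb f -> lb g ->
  \int[mu x]_u (c * f u + g u) = c * \int[mu x]_u f u + \int[mu x]_u g u.
Proof. by apply: lb_Rint_lin (pmu_supp x) (pmu_fin x) _ _ _. Qed.
Lemma pint_dist x f g (e : R) : lb f -> lb g -> (forall u, `|u| <= M -> `|f u - g u| <= e) ->
  `|\int[mu x]_u f u - \int[mu x]_u g u| <= e * rnorm x ^+ 2.
Proof.
have -> : rnorm x ^+ 2 = fine (mu x setT) by rewrite pmuT.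
by move=> lf lg; exact: (lb_Rint_dist (pmu_supp x) (pmu_fin x) lf lg).
Qed.
Lemma pint_indic x A : measurable A -> \int[mu x]_u (\1_A u : R) = << E A x, x >>.
Proof. by move=> mA; rewrite lb_Rint_indic ?pvm_mu. Qed.

Definition bicomp S := forall C, (forall B, measurable B -> C * E B = E B * C) -> C * S = S * C.
Definition is_fce f S :=
  [/\ sa ip S, bicomp S & forall x, << S x, x >> = \int[mu x]_u f u].

(** [lb_ind] reduces the claim to uniform limits. There the quadratic forms converge uniformly on
    the unit ball, so by [sa_opnorm_le] the operators form a Cauchy sequence in norm. *)
Lemma fce_exists f : lb f -> exists S, is_fce f S.
Proof.
move: f; apply: (@lb_ind _ M).
- move=> A mA; exists (E A); split.
  + by case: (pvm_proj E mA).
  + by move=> C; apply.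
  + by move=> x; rewrite pint_indic.
- move=> c f g lf lg [S [sS bS iS]] [T [sT bT iT]]; exists (c *: S + T); split.
  + by apply: saD => //; exact: saZ.
  + by move=> C hC; rewrite mulrDr mulrDl bopAl bopAr bS// bT.
  + by move=> x; rewrite pint_lin// !bopE ripDl// ripZl// iS iT.
move=> f lf hf.
have /choice[g hg] : forall n, exists gS : (R -> R) * bop H,
    [/\ lb gS.1, is_fce gS.1 gS.2 & forall u, `|u| <= M -> `|f u - gS.1 u| <= n.+1%:R^-1].
  move=> n; have [|g [lg [S hS] hfg]] := hf n.+1%:R^-1; first by rewrite invr_gt0.
  by exists (g, S).
pose u n := (g n).2.
have du n x : `|\int[mu x]_l f l - << u n x, x >>| <= n.+1%:R^-1 * rnorm x ^+ 2.
  by have [l1 [_ _ ->] h] := hg n; exact: pint_dist.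
have uC n m : opnorm (u n - u m) <= n.+1%:R^-1 + m.+1%:R^-1.
  have [_ [sn _ _] _] := hg n; have [_ [sm _ _] _] := hg m.
  apply: (sa_opnorm_le hip); rewrite ?addr_ge0//; first exact: saB.
  move=> x; rewrite bopE ripBl//.
  have -> : << u n x, x >> - << u m x, x >> =
    (\int[mu x]_l f l - << u m x, x >>) - (\int[mu x]_l f l - << u n x, x >>) by ring.
  by apply: le_trans (ler_normB _ _) _; rewrite mulrDl addrC lerD.
have [S hS] : exists S, slim u S.
  apply: (slim_exists (c := opnorm (u 0%N) + 2)).
    move=> n; rewrite -[u n](subrK (u 0%N)) addrC; apply: le_trans (opnormD _ _) _.
    rewrite lerD2l; apply: le_trans (uC _ _) _; rewrite invr1 lerD2r.
    by rewrite invf_le1// ler1n.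
  move=> x; apply: cauchy_rnorm => e e0.
  have d0 : 0 < e / (2 * (rnorm x + 1)).
    by rewrite divr_gt0// mulr_gt0// ltr_wpDl ?rnorm_ge0.
  have := near_infty_natSinv_lt (PosNum d0) => -[N _ hN].
  exists N => m n Nm Nn; rewrite -bopBE; apply: le_lt_trans (opnormP _ _) _.
  have x1 : 0 < rnorm x + 1 by rewrite ltr_wpDl ?rnorm_ge0.
  apply: (@le_lt_trans _ _ (opnorm (u m - u n) * (rnorm x + 1))).
    by rewrite ler_wpM2l ?opnorm_ge0// lerDl.
  rewrite -ltr_pdivlMr//; apply: le_lt_trans (uC _ _) _.
  have -> : e / (rnorm x + 1) = e / (2 * (rnorm x + 1)) + e / (2 * (rnorm x + 1)).
    by field; rewrite gt_eqF.
  by apply: ltrD; apply: hN.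
exists S; split.
- by apply: (slim_sa hip) hS => n; have [_ [] ] := hg n.
- by move=> C hC; apply: slim_comm hS _ => n; have [_ [_ h _] _] := hg n; exact: h.
- move=> x; apply: (@seq_cvg_uniq _ R^o) (@slim_rip _ _ _ hip _ _ x x hS) _.
  apply/cvgrPdist_le => e e0.
  have x1 : 0 < rnorm x ^+ 2 + 1 by rewrite ltr_wpDl ?sqr_ge0.
  have d0 : 0 < e / (rnorm x ^+ 2 + 1) by rewrite divr_gt0.
  have := near_infty_natSinv_lt (PosNum d0); apply: filterS => n /= hn.
  apply: le_trans (du n x) _; apply: (@le_trans _ _ (n.+1%:R^-1 * (rnorm x ^+ 2 + 1))).
    by rewrite ler_wpM2l// lerDl.
  by rewrite -ler_pdivlMr// ltW.
Qed.

Definition fce f : bop H := xget 0 (is_fce f).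

Lemma fceP f : lb f -> is_fce f (fce f).
Proof. by move=> /fce_exists[S hS]; apply: (xgetPex _ (ex_intro _ S hS)). Qed.
Lemma fce_sa f : lb f -> sa ip (fce f). Proof. by case/fceP. Qed.
Lemma fce_bicom f : lb f -> bicomp (fce f). Proof. by case/fceP. Qed.
Lemma fce_rip f x : lb f -> << fce f x, x >> = \int[mu x]_u f u. Proof. by case/fceP. Qed.

Lemma fce_uniq f S : lb f -> sa ip S -> (forall x, << S x, x >> = \int[mu x]_u f u) -> fce f = S.
Proof. by move=> lf sS h; apply: sa_form_eq => // [|x]; [exact: fce_sa|rewrite fce_rip]. Qed.

Lemma fce_indic A : measurable A -> fce (\1_A) = E A.
Proof.
move=> mA; apply: fce_uniq; first exact: lb_indic.
  by case: (pvm_proj E mA).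
by move=> x; rewrite pint_indic.
Qed.
Lemma fce_lin c f g : lb f -> lb g -> fce (fun u => c * f u + g u) = c *: fce f + fce g.
Proof.
move=> lf lg; apply: fce_uniq.
- by apply: lbD => //; exact: lbZ.
- by apply: saD; [|apply: saZ|] => //; exact: fce_sa.
- by move=> x; rewrite pint_lin// !bopE ripDl// ripZl// !fce_rip.
Qed.
Lemma fce_le f g : lb f -> lb g -> (forall u, `|u| <= M -> f u <= g u) ->
  psd ip (fce g - fce f).
Proof.
move=> lf lg h; split; first by apply: saB => //; exact: fce_sa.
by move=> x; rewrite bopE ripBl// !fce_rip// subr_ge0 pint_le.
Qed.
Lemma fce_eq f g : lb f -> lb g -> (forall u, `|u| <= M -> f u = g u) -> fce f = fce g.
Proof.
move=> lf lg h; apply/eqP; rewrite -subr_eq0; apply/eqP/(psd_anti hip).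
  by apply: fce_le => // u /h ->.
by rewrite opprB; apply: fce_le => // u /h ->.
Qed.
Lemma fce_cst c : fce (fun=> c) = sc c.
Proof.
apply: fce_uniq; [exact: lb_cst|exact: sa_sc|] => x.
by rewrite lb_Rint_cst scE ripZl// pmuT/= ripxx.
Qed.
Lemma fceZ c f : lb f -> fce (fun u => c * f u) = c *: fce f.
Proof.
move=> lf; have := @fce_lin c f (fun=> 0) lf (lb_cst 0); rewrite fce_cst sc0 addr0 => <-.
by congr fce; apply/funext => u; rewrite addr0.
Qed.
Lemma fceD f g : lb f -> lb g -> fce (fun u => f u + g u) = fce f + fce g.
Proof.
move=> lf lg; have := fce_lin 1 lf lg; rewrite scale1r => <-.
by congr fce; apply/funext => u; rewrite mul1r.
Qed.
Lemma fceN f : lb f -> fce (fun u => - f u) = - fce f.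
Proof.
move=> lf; rewrite -scaleN1r -fceZ//; by congr fce; apply/funext => u; rewrite mulN1r.
Qed.
Lemma fceB f g : lb f -> lb g -> fce (fun u => f u - g u) = fce f - fce g.
Proof. by move=> lf lg; rewrite fceD ?fceN//; exact: lbN. Qed.
Lemma fce_psd f : lb f -> (forall u, `|u| <= M -> 0 <= f u) -> psd ip (fce f).
Proof.
move=> lf h; have := fce_le (lb_cst 0) lf h; by rewrite fce_cst sc0 subr0.
Qed.
Lemma fce_norm f (K : R) : lb f -> 0 <= K -> (forall u, `|u| <= M -> `|f u| <= K) -> opnorm (fce f) <= K.
Proof.
move=> lf K0 h; apply: (sa_opnorm_le hip) => //; first exact: fce_sa.
move=> x; rewrite fce_rip//.
have := @pint_dist x f (fun=> 0) K lf (lb_cst 0); rewrite lb_Rint_cst mul0r subr0; apply.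
by move=> u uM; rewrite subr0 h.
Qed.

(** Bilinear extension of E(A [&] B) = E(A) E(B): [lb_ind] is applied to one factor at a time, first
    with an indicator as the other factor. *)
Lemma fceM f g : lb f -> lb g -> fce (fun u => f u * g u) = fce f * fce g.
Proof.
have lim (P : bop H) : (forall e : R, 0 < e -> opnorm P <= e) -> P = 0.
  move=> h; apply: bopext => x; rewrite bopE; apply: opnorm_eq0; apply/eqP.
  by rewrite eq_le opnorm_ge0 andbT; apply/ler_addgt0Pr => e e0; rewrite add0r h.
have half f0 : lb f0 -> (forall A, measurable A ->
      fce (fun u => f0 u * \1_A u) = fce f0 * fce (\1_A)) ->
    forall g, lb g -> fce (fun u => f0 u * g u) = fce f0 * fce g.
  move=> lf h; apply: (@lb_ind _ M).
  - exact: h.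
  - move=> c g1 g2 l1 l2 h1 h2; rewrite fce_lin// mulrDr bopAr -h1// -h2// -fce_lin; [|exact: lbM..].
    by congr fce; apply/funext => u; ring.
  - move=> {}g lg hg; apply/eqP; rewrite -subr_eq0; apply/eqP/lim => e e0.
    have [K hK] := lf.2 M.
    pose L : R := `|K| + opnorm (fce f0) + 1.
    have L0 : 0 < L by rewrite ltr_wpDl// addr_ge0// opnorm_ge0.
    have [g1 [l1 h1 hgg]] := hg (e / L) (divr_gt0 e0 L0).
    have eL : 0 <= e / L by rewrite divr_ge0// ltW.
    have -> : fce (fun u => f0 u * g u) - fce f0 * fce g =
      fce (fun u => f0 u * (g u - g1 u)) - fce f0 * fce (fun u => g u - g1 u).
      rewrite [X in _ = X - _](_ : _ = fce (fun u => f0 u * g u) - fce f0 * fce g1); last first.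
        rewrite -h1// -fceB; [|exact: lbM..].
        by congr fce; apply/funext => u; ring.
      by rewrite fceB// mulrBr opprB addrA subrK.
    apply: le_trans (opnormD _ _) _; rewrite opnormN.
    have -> : e = `|K| * (e / L) + (opnorm (fce f0) + 1) * (e / L).
      by rewrite -mulrDl addrA mulrC divfK// gt_eqF.
    apply: lerD.
      apply: fce_norm; [by apply: lbM => //; exact: lbB|by rewrite mulr_ge0|].
      move=> u uM; rewrite normrM ler_pM ?hgg//.
      by apply: le_trans (hK _ uM) _; exact: ler_norm.
    apply: le_trans (opnormM _ _) _; apply: ler_pM; rewrite ?opnorm_ge0 ?lerDl//.
    by apply: fce_norm => //; exact: lbB.
have comm f1 g1 : lb f1 -> lb g1 -> fce f1 * fce g1 = fce g1 * fce f1.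
  move=> l1 l2; apply: fce_bicom => // B mB; apply/esym.
  apply: fce_bicom => // B' mB'; rewrite -pvmI// setIC pvmI//.
have ind A : measurable A -> forall g, lb g -> fce (fun u => \1_A u * g u) = E A * fce g.
  move=> mA g0 lg0; rewrite -fce_indic//; apply: half => //; first exact: lb_indic.
  move=> B mB; rewrite !fce_indic// -pvmI// -fce_indic//; last exact: measurableI.
  by congr fce; apply/funext => u; rewrite indicI.
move=> lf lg; apply: half => // A mA.
have lA : lb (\1_A : R -> R) by exact: lb_indic.
rewrite comm// fce_indic// -ind//; congr fce; apply/funext => u; exact: mulrC.
Qed.

Lemma fceX f n : lb f -> fce (fun u => f u ^+ n) = fce f ^+ n.
Proof.
move=> lf; elim: n => [|n ih].
  by rewrite expr0 -sc1 -fce_cst; congr fce; apply/funext => u; rewrite expr0.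
rewrite exprS -ih -fceM//; last exact: lbX.
by congr fce; apply/funext => u; rewrite exprS.
Qed.

Lemma fce_comm f g : lb f -> lb g -> fce f * fce g = fce g * fce f.
Proof. by move=> lf lg; rewrite -!fceM//; congr fce; apply/funext => u; rewrite mulrC. Qed.

Lemma fce_rnorm f x : lb f -> rnorm (fce f x) ^+ 2 = \int[mu x]_u f u ^+ 2.
Proof.
move=> lf; rewrite -(ripxx hip) -(fce_sa lf) -bopME -fceM// fce_rip; last exact: lbM.
by congr fine; apply: eq_integral => u _; rewrite expr2.
Qed.
End OnePvm.

Section Push.
Context (E : pvm) (g : R -> R) (lg : lb g).
Let mg : measurable_fun [set: mT] (g : mT -> mT) := lg.1.
Let K := sval (cid (lg.2 (pM E))).
Let hK u : `|u| <= pM E -> `|g u| <= K := svalP (cid (lg.2 (pM E))) u.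

Let mpre A : measurable A -> measurable (g @^-1` A : set mT).
Proof. by move=> mA; rewrite -[X in measurable X]setTI; exact: mg. Qed.

Let muE (x : H) : {measure set mT -> \bar R} := measure_function_pushforward__canonical__measure_function_Measure (pmu E x) mg.

Fact push_supp : E (g @^-1` (~` `[- K, K])) = 0.
Proof.
have mB : measurable (g @^-1` (~` `[- K, K]) : set mT) by apply: mpre; exact: measurableC.
rewrite -fce_indic//; have -> : (0 : bop H) = fce E (fun=> 0) by rewrite fce_cst sc0.
apply: fce_eq; [exact: lb_indic|exact: lb_cst|] => u /hK.
rewrite ler_norml => uK; rewrite indicE memNset//= ; apply; rewrite /= in_itv.
Qed.

(** The image of a resolution under [g]; through [fce_push] it is the source of the composition rule
    [fc_comp]. *)
Definition push : pvm := @Pvm (fun A => E (g @^-1` A)) muE K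
  (fun B mB => pvm_proj E (mpre mB)) (pvmT E)
  (fun A B mA mB => pvmI E (mpre mA) (mpre mB))
  (fun x B mB => pvm_mu E x (mpre mB)) push_supp.

Lemma fce_push f : lb f -> fce push f = fce E (fun u => f (g u)).
Proof.
move=> lf; have lfg := lb_comp lf lg; apply: fce_uniq => //; first exact: fce_sa.
move=> x; rewrite fce_rip//; congr fine.
have := @integral_pushforward _ _ mT mT R (g : mT -> mT) mg (pmu E x) setT (EFin \o f).
rewrite preimage_setT => -> //; first by apply/measurable_EFinP; exact: lf.1.
exact: pint_integrable.
Qed.
End Push.
End Calculus.

Lemma measurable_rays (R : realType) :
  @measurable _ (measurableTypeR R) = <<s @RGenOInfty.G R >>.
Proof. exact: RGenOInfty.measurableE. Qed.

Definition ray {R : realType} (a : R) : set (measurableTypeR R) := `]a, +oo[%classic.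
Definition oc {R : realType} (a b : R) : set (measurableTypeR R) := `]a, b]%classic.

Lemma measurable_ray (R : realType) (a : R) : measurable (ray a).
Proof. exact: measurable_itv. Qed.
Lemma measurable_oc (R : realType) (a b : R) : measurable (oc a b).
Proof. exact: measurable_itv. Qed.
#[local] Hint Resolve measurable_ray measurable_oc : core.
Lemma rayE (R : realType) (a u : R) : ray a u = (a < u).
Proof. by rewrite /ray/= in_itv/= andbT. Qed.
Lemma ocE (R : realType) (a b u : R) : oc a b u = (a < u <= b).
Proof. by rewrite /oc/= in_itv/=. Qed.

Lemma ray_setI (R : realType) (a b : R) : ray a `&` ray b = ray (Num.max a b).
Proof.
apply/seteqP; split=> u /=; rewrite !rayE gt_max; first by move=> [-> ->].
by move=> /andP[].
Qed.

Lemma rays_setI (R : realType) : setI_closed (@RGenOInfty.G R).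
Proof.
move=> _ _ [a ->] [b ->]; exists (Num.max a b); exact: ray_setI.
Qed.

Lemma measure_unique_rays (R : realType) (m1 m2 : {measure set (measurableTypeR R) -> \bar R}) :
  (forall a : R, m1 (ray (a)) = m2 (ray (a))) -> (m1 setT < +oo)%E ->
  forall A, measurable A -> m1 A = m2 A.
Proof.
move=> h fin A mA.
apply: (@measure_unique _ R (measurableTypeR R) (@RGenOInfty.G R) (fun k : nat => ray (- k%:R))) => //.
- exact: measurable_rays.
- exact: rays_setI.
- by move=> k; exists (- k%:R).
- apply/seteqP; split=> // u _.
  have [k hk] : exists k : nat, - u < k%:R.
    by exists (Num.trunc `|u|).+1; apply: le_lt_trans (truncnS_gt _); rewrite -normrN ler_norm.
  by exists k => //=; rewrite rayE ltrNl.
- by move=> _ [a ->]; exact: h.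
- by move=> k; apply: le_lt_trans fin; apply: le_measure; rewrite ?inE.
Qed.

(** * The spectral theorem *)

Section SpectralFamily.
Context {R : realType} {H : completeNormedModType R[i]} (ip : H -> H -> R[i]).
Context (hip : hilbert_inner_product ip).
Local Notation mT := (measurableTypeR R).
Local Notation "<< x , y >>" := (rip ip x y).
Local Notation bicom := (@bicom R H).
Context (P : R -> bop H) (M : R) (T : bop H).
Context (M_gt0 : 0 < M).
Context (Pproj : forall a, isproj ip (P a)).
Context (Pmul : forall a b, a <= b -> P a * P b = P a).
Context (Pbicom : forall a, bicom T (P a)).
Context (Pcont : forall x (a e : R), 0 < e -> exists2 d : R, 0 < d &
  forall b : R, a <= b -> b < a + d -> << P b x, x >> <= << P a x, x >> + e).
Context (P0 : P (- M) = 0) (P1 : P M = 1).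

Let Pcomm a b : P a * P b = P b * P a.
Proof. by apply/esym/Pbicom/esym/Pbicom. Qed.
Let Pmul' a b : a <= b -> P b * P a = P a.
Proof. by move=> ab; rewrite Pcomm Pmul. Qed.

Lemma Ple x a b : a <= b -> << P a x, x >> <= << P b x, x >>.
Proof.
move=> ab; rewrite !isproj_rip// -(Pmul ab) ler_sqr ?nnegrE ?rnorm_ge0// bopME.
apply: le_trans (opnormP _ _) _; rewrite ler_piMl ?rnorm_ge0//.
exact: isproj_norm (Pproj a).
Qed.

Let F x (a : R) : R := << P a x, x >>.
Let F_nd x : nondecreasing (F x). Proof. by move=> a b; exact: Ple. Qed.
Let F_rc x : right_continuous (F x).
Proof.
move=> a; apply/cvgrPdist_le => e e0.
have [d d0 hd] := Pcont x a e0.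
near=> b; have ab : a < b by near: b; exact: nbhs_right_gt.
have h := @F_nd x _ _ (ltW ab).
rewrite ler0_norm ?subr_le0// opprB lerBlDl; apply: hd; first exact: ltW.
by near: b; apply: nbhs_right_lt; rewrite ltrDl.
Unshelve. all: by end_near. Qed.

Let cF x : cumulative R R := HB.pack (F x) (isCumulative.Build R _ R (F x) (@F_nd x) (@F_rc x)).
Let mu x : {measure set mT -> \bar R} := lebesgue_stieltjes_measure (cF x).

Let mu_itv x a b : a <= b -> mu x (oc a b) = (F x b - F x a)%:E.
Proof.
move=> ab; rewrite /mu/= /lebesgue_stieltjes_measure /measure_extension measurable_mu_extE//.
  by etransitivity; first exact: (@wlength_itv_bnd R (F x) a b false false ab).
exact: is_ocitv.
Qed.

Let PM a : M <= a -> P a = 1.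
Proof. by move=> Ma; have := Pmul Ma; rewrite P1 mul1r. Qed.
Let PN a : a <= - M -> P a = 0.
Proof. by move=> Ma; have := Pmul Ma; rewrite P0 mulr0. Qed.

Let mu_ray x a : mu x (ray (a)) = << (1 - P a) x, x >>%:E.
Proof.
have h : mu x \o (fun n : nat => (oc a (a + n%:R))) @ \oo --> mu x (\bigcup_n (oc a (a + n%:R))).
  apply: nondecreasing_cvg_mu => //; first exact: bigcup_measurable.
  move=> m n mn; apply/subsetPset => u; rewrite !ocE => /andP[-> /= /le_trans]; apply.
  by rewrite lerD2l ler_nat.
have bU : \bigcup_n (oc a (a + n%:R)) = (ray (a)).
  apply/seteqP; split=> u /=; first by move=> [n _]; rewrite ocE rayE => /andP[].
  rewrite rayE => au; exists (Num.trunc `|u - a|).+1 => //=.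
  rewrite ocE au/= -lerBlDl; apply: ltW; apply: le_lt_trans (truncnS_gt _).
  exact: ler_norm.
rewrite bU in h; rewrite -(cvg_lim _ h)//; apply: cvg_lim => //.
apply: cvg_near_cst; near=> n.
rewrite [LHS]/= mu_itv ?lerDl// /F PM; last first.
  rewrite -lerBlDl; near: n; apply: nbhs_infty_ger; exact: num_real.
by rewrite [in RHS]bopBE ripBl.
Unshelve. all: by end_near. Qed.

Let muT x : mu x setT = (rnorm x ^+ 2)%:E.
Proof.
have -> : [set: mT] = (ray (- M)) `|` `]-oo, -M]%classic.
  apply/seteqP; split=> // u _ /=; rewrite rayE in_itv/=.
  by case: (ltP (- M) u) => h; [left|right].
rewrite measureU//; last first.
  apply/seteqP; split=> // u /=; rewrite rayE in_itv/= => -[h1 h2].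
  by have := lt_le_trans h1 h2; rewrite ltxx.
rewrite [X in (X + _)%E](mu_ray x (- M)) P0 subr0 bop1E ripxx// [X in (_ + X)%E](_ : _ = 0%E) ?adde0//.
have h : mu x \o (fun n : nat => (oc (- M - n%:R) (- M))) @ \oo --> mu x (\bigcup_n (oc (- M - n%:R) (- M))).
  apply: nondecreasing_cvg_mu => //; first exact: bigcup_measurable.
  move=> m n mn; apply/subsetPset => u; rewrite !ocE => /andP[h ->]; rewrite andbT.
  by apply: le_lt_trans h; rewrite lerD2l lerN2 ler_nat.
have bU : \bigcup_n (oc (- M - n%:R) (- M)) = `]-oo, -M]%classic.
  apply/seteqP; split=> u /=; first by move=> [n _]; rewrite ocE in_itv/= => /andP[].
  rewrite in_itv/= => au; exists (Num.trunc `|u + M|).+1 => //=.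
  rewrite ocE au andbT; have := truncnS_gt `|u + M|.
  have := ler_norm (- (u + M)); rewrite normrN; lra.
suff e : mu x (\bigcup_n oc (- M - n%:R) (- M)) = 0%E by rewrite bU in e.
rewrite -(cvg_lim _ h)//; apply: cvg_lim => //.
apply: cvg_near_cst; near=> n.
by rewrite /= mu_itv ?gerBl// /F P0 PN ?gerBl// subrr.
Unshelve. all: by end_near. Qed.

Let mu_fin x : (mu x setT < +oo)%E. Proof. by rewrite muT ltry. Qed.

Let good (B : set mT) S := [/\ sa ip S, bicom T S & forall x, mu x B = << S x, x >>%:E].

(** Dynkin argument: the sets whose measures under all the [mu x] are given by the form of one
    self-adjoint operator in the bicommutant of [T] form a lambda-system, closed under disjoint
    unions by [vigier], and contain the rays. *)
Let good_exists B : measurable B -> exists S, good B S.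
Proof.
rewrite measurable_rays; move: B; apply: (@dynkin_induction _ mT (@RGenOInfty.G R)).
- exact: measurable_rays.
- exact: rays_setI.
- exists 1; split; [exact: sa1|exact: bicom1|] => x; by rewrite muT ripxx.
- move=> _ [a ->]; exists (1 - P a); split; last by move=> x; rewrite -(mu_ray x a).
    by apply: (saB hip); [exact: sa1|case: (Pproj a)].
  by apply: bicomD; [exact: bicom1|apply: bicomN; exact: Pbicom].
- move=> B mB [S [sS bS hS]]; exists (1 - S); split.
  + by apply: (saB hip).
  + by apply: bicomD; [exact: bicom1|exact: bicomN].
  + move=> x; rewrite -setTD measureD//; last exact: mu_fin.
    by rewrite setTI [X in (X - _)%E]muT [X in (_ - X)%E]hS -EFinB bopBE ripBl// -(ripxx hip).
- move=> B mB tB /choice[S hS].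
  have pS n : psd ip (S n).
    have [sn _ en] := hS n; split=> // x.
    by rewrite -lee_fin -en; exact: measure_ge0.
  pose u n := \sum_(i < n) S i.
  have mu_u n x : (\sum_(i < n) mu x (B i))%E = << u n x, x >>%:E.
    rewrite /u; elim: n => [|n ih]; first by rewrite !big_ord0 bop0E rip0l.
    by rewrite !big_ord_recr/= ih; have [_ _ ->] := hS n; rewrite -EFinD -ripDl.
  have mB' := bigcup_measurable (fun n _ => mB n).
  have cvu x : (\sum_(0 <= i < n) mu x (B i))%E @[n --> \oo] --> mu x (\bigcup_k B k).
    exact: measure_semi_sigma_additive.
  have su n : sa ip (u n).
    rewrite /u; elim: n => [|n ih]; first by rewrite big_ord0; exact: sa0.
    by rewrite big_ord_recr; apply: (saD hip) => //; case: (pS n).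
  have bu n : bicom T (u n).
    rewrite /u; elim: n => [|n ih].
      by rewrite big_ord0 => C _; rewrite mulr0 mul0r.
    by rewrite big_ord_recr; apply: bicomD => //; case: (hS n).
  have ub n : psd ip (sc 1 - u n).
    split; first by apply: (saB hip) => //; exact: (sa_sc hip).
    move=> x; rewrite sc1 bopBE ripBl// subr_ge0 bop1E ripxx// -lee_fin -muT -mu_u.
    rewrite -measure_semi_additive_ord//; last first.
    - exact: bigsetU_measurable.
    - by apply/trivIsetP => i j _ _ ij; move/trivIsetP : tB; apply.
    by apply: le_measure; rewrite ?inE//; exact: bigsetU_measurable.
  have [Su [hSu _]] : exists S, slim u S /\ forall n, psd ip (S - u n).
    apply: (@vigier _ _ _ hip _ 1) => // n.
    by rewrite /u big_ord_recr/= addrAC subrr add0r.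
  exists Su; split.
  + exact: slim_sa hSu.
  + exact: bicom_slim hSu.
  + move=> x; rewrite -(cvg_lim _ (cvu x))//; apply: cvg_lim => //.
    rewrite (_ : (fun n => _) = (fun n => (<< u n x, x >>)%:E)); last first.
      by apply/funext => n; rewrite big_mkord mu_u.
    by apply: cvg_EFin; [exact: nearW|exact: (slim_rip hip)].
Qed.

Let E (B : set mT) : bop H := xget 0 (good B).
Let EP B : measurable B -> good B (E B).
Proof. by move=> /good_exists[S hS]; apply: (xgetPex _ (ex_intro _ S hS)). Qed.

Let E_uniq B S : measurable B -> sa ip S -> (forall x, mu x B = << S x, x >>%:E) -> E B = S.
Proof.
move=> mB sS h; have [sE _ hE] := EP mB; apply: (sa_form_eq hip) => // x.
by have := hE x; rewrite h => -[].
Qed.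

Let E_ray a : E (ray (a)) = 1 - P a.
Proof.
apply: E_uniq => //.
by apply: (saB hip); [exact: sa1|case: (Pproj a)].
Qed.

Let Ecomm A B : measurable A -> measurable B -> E A * E B = E B * E A.
Proof.
move=> mA mB; have [_ bA _] := EP mA; have [_ bB _] := EP mB.
by apply: bB; apply/esym/bA.
Qed.

Let ray_proj a : isproj ip (E (ray (a))).
Proof. by rewrite E_ray; exact: isprojC. Qed.

Let E_ray_ray a b : E ((ray (a)) `&` (ray (b))) = E (ray (a)) * E (ray (b)).
Proof.
rewrite ray_setI !E_ray mulrBr mulr1 mulrBl mul1r /Num.max.
case: ltP => [/ltW ab|ba].
  by rewrite Pmul// opprB addrA subrK.
by rewrite Pmul'// subrr subr0.
Qed.

Let mI A B : measurable A -> measurable B -> measurable (A `&` B : set mT).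
Proof. exact: measurableI. Qed.

(** As functions of [B] both sides come from measures, the restriction of [mu x] to the ray and
    [mu (E (ray b) x)], which agree on rays. *)
Let E_ray_set b B : measurable B -> E (B `&` (ray (b))) = E B * E (ray (b)).
Proof.
move=> mB; have mb : measurable ((ray (b)) : set mT) by [].
have [sB _ hB] := EP mB; have [sb bb] := ray_proj b.
apply: E_uniq; [exact: mI|by apply: saM => //; exact: Ecomm|] => x.
have key : mrestr (mu x) mb B = mu (E (ray b) x) B.
  apply: measure_unique_rays mB => [a|]; last first.
    suff : (mu x (setT `&` ray b) < +oo)%E by [].
    by rewrite setTI; apply: le_lt_trans (mu_fin x); apply: le_measure; rewrite ?inE.
  have mab : measurable (ray a `&` ray b) by exact: mI.
  have ma : measurable (ray a) by [].
  rewrite /mrestr; have [_ _ hab] := EP mab; have [_ _ ha] := EP ma.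
  etransitivity; first exact: hab.
  etransitivity; last by symmetry; exact: ha.
  congr EFin; rewrite E_ray_ray -[in RHS]sb -!bopME; congr << _ x, _ >>.
  by rewrite Ecomm// -mulrA [in RHS]Ecomm// mulrA bb.
etransitivity; first exact: key.
have e : E (ray b) * E B * E (ray b) = E B * E (ray b) by rewrite -(Ecomm mB mb) -mulrA bb.
by rewrite hB -sb -!bopME e.
Qed.

(** Polarization of 4 <E(A) x, y> with y = E(B) x. The negative term is moved to the other side so
    that both sides are measures in [A], which need only be compared on rays. *)
Let E_setI A B : measurable A -> measurable B -> E (A `&` B) = E A * E B.
Proof.
move=> mA mB; have [sA _ hA] := EP mA; have [sB _ hB] := EP mB.
apply: E_uniq; [exact: mI|by apply: saM => //; exact: Ecomm|] => x.
pose y := E B x.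
have key : (mu (2%:C *: x) (A `&` B) + mu (x - y)%R A)%E = mu (x + y) A.
  suff : measure_add (mrestr (mu (2%:C *: x)) mB) (mu (x - y)) A = mu (x + y) A by rewrite measure_addE.
  apply: measure_unique_rays mA => [a|].
    have ma : measurable (ray a) by [].
    have [sa_ _ ha] := EP ma; have [_ _ hab] := EP (mI ma mB).
    rewrite [LHS]measure_addE [X in (X + _)%E]hab [X in (_ + X)%E]ha [RHS]ha.
    rewrite setIC E_ray_set// -EFinD; congr EFin.
    rewrite (Ecomm mB ma) bopME !bopZ -/y !bopD !bopN !(ripDl hip, ripDr hip, ripNl hip, ripNr hip, ripZl hip, ripZr hip).
    have -> : << E (ray a) x, y >> = << E (ray a) y, x >> by rewrite sa_ ripC.
    ring.
  rewrite [X in (X < _)%E]measure_addE [X in (_ + X)%E]muT lte_add_pinfty ?ltry//.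
  by apply: le_lt_trans (mu_fin (2%:C *: x)); apply: le_measure; rewrite ?inE//; exact: mI.
move: key; rewrite !hA; have [_ _ hAB] := EP (mI mA mB).
rewrite !hAB -EFinD => -[].
rewrite bopME !bopZ -/y !bopD !bopN !(ripDl hip, ripDr hip, ripNl hip, ripNr hip, ripZl hip, ripZr hip).
have -> : << E A x, y >> = << E A y, x >> by rewrite sA ripC.
move=> h; congr EFin; lra.
Qed.

Let E_proj B : measurable B -> isproj ip (E B).
Proof. by move=> mB; split; [case: (EP mB)|rewrite -E_setI// setIid]. Qed.

Let E_T : E setT = 1.
Proof. by apply: E_uniq => // x; rewrite muT ripxx. Qed.

Let E_supp : E (~` `[- M, M]) = 0.
Proof.
apply: E_uniq; [exact: measurableC|exact: sa0|] => x; rewrite bop0E rip0l//.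
apply/eqP; rewrite eq_le measure_ge0 andbT.
have mitv : measurable ((oc (- M) M) : set mT) by [].
apply: (@le_trans _ _ (mu x (~` (oc (- M) M)))).
  apply: le_measure; rewrite ?inE//; [exact: measurableC|exact: measurableC|].
  move=> u /=; apply: contra_not; rewrite ocE in_itv/= => /andP[h ->]; by rewrite (ltW h).
rewrite -setTD measureD//; last exact: mu_fin.
have MM : - M <= M by rewrite (le_trans (y := 0))// ?oppr_le0 ltW.
by rewrite setTI [X in (_ - X)%E](mu_itv x MM) [X in (X - _)%E]muT /F P0 P1 bop0E rip0l// bop1E subr0 (ripxx hip) -EFinB subrr.
Qed.

Lemma spectral_family_pvm : exists E' : pvm ip,
  (forall B, measurable B -> bicom T (E' B)) /\ forall a, E' (ray (a)) = 1 - P a.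
Proof.
exists (@Pvm _ _ ip E mu M E_proj E_T E_setI (fun x B mB => let: And3 _ _ h := EP mB in h x) E_supp).
split=> [B mB|a]; [by case: (EP mB)|exact: E_ray].
Qed.

End SpectralFamily.

Section SpectralTheorem.
Context {R : realType} {H : completeNormedModType R[i]} (ip : H -> H -> R[i]).
Context (hip : hilbert_inner_product ip).
Local Notation mT := (measurableTypeR R).
Local Notation "<< x , y >>" := (rip ip x y).
Implicit Types (T S : bop H) (x : H).

(* [P] and [Q] are spectral projections of [T] for (-oo, a] and (b, +oo). *)
Lemma spectral_disjoint T P Q (a b : R) : a < b -> isproj ip P -> isproj ip Q -> P * Q = Q * P ->
  psd ip (- ((T - sc a) * P)) -> psd ip ((T - sc b) * Q) -> P * Q = 0.
Proof.
move=> ab [sP PP] [sQ QQ] PQ [_ hP] [_ hQ]; apply: bopext => x.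
pose y := (P * Q) x; have Py : P y = y by rewrite /y -bopME mulrA PP.
have Qy : Q y = y by rewrite /y PQ -bopME mulrA QQ.
have := hP y; have := hQ y; rewrite !bopE ?scE Py Qy !(ripDl hip, ripNl hip, ripZl hip).
rewrite ripxx// => h1 h2; apply: rnorm_eq0; apply/eqP; rewrite -sqrf_eq0 eq_le sqr_ge0 andbT.
have : 0 <= (a - b) * rnorm y ^+ 2 by lra.
by rewrite nmulr_rge0// subr_lt0.
Qed.

(* The threshold projections of [sign_projection] are made right-continuous by
   taking [P_a = s-lim P'_(a+1/n)]. *)
Lemma spectral_theorem T : sa ip T -> exists E : pvm ip,
  (forall B, measurable B -> bicom T (E B)) /\ fce E id = T.
Proof.
move=> sT.
have sTa (a : R) : sa ip (T - sc a) by apply: (saB hip) => //; exact: (sa_sc hip).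
have /choice[P' hP'] : forall a : R, exists P, [/\ isproj ip P, bicom T P,
    psd ip (- ((T - sc a) * P)) & psd ip ((T - sc a) * (1 - P))].
  move=> a; have [P [h1 h2 h3 h4]] := sign_projection hip (sTa a).
  exists P; split=> //; apply: bicom_trans h2.
  apply: bicomD; first exact: bicom_refl.
  by apply: bicomN; apply: bicomZ; exact: bicom1.
have P'c a b : P' a * P' b = P' b * P' a.
  have [_ ba _ _] := hP' a; have [_ bb _ _] := hP' b.
  by apply: bb; apply/esym/ba.
have mono (a b : R) : a < b -> P' a * P' b = P' a.
  move=> ab; have [p1 _ h1 _] := hP' a; have [p2 _ _ h2] := hP' b.
  have : P' a * (1 - P' b) = 0.
    apply: (spectral_disjoint (T := T) ab p1 (isprojC hip p2)) => //.
    by rewrite mulrBr mulrBl mulr1 mul1r P'c.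
  by rewrite mulrBr mulr1 => /eqP; rewrite subr_eq0 => /eqP <-.
pose eps n : R := n.+1%:R^-1.
have eps_gt0 n : 0 < eps n by rewrite invr_gt0.
have eps_lt n : eps n.+1 < eps n by rewrite ltf_pV2 ?posrE// ltr_nat.
have psub (P Q : bop H) : isproj ip P -> isproj ip Q -> P * Q = P -> psd ip (Q - P).
  move=> hP hQ PQ; apply: (isproj_psd hip); have [sP PP] := hP; have [sQ QQ] := hQ; split.
    exact: (saB hip).
  have QP : Q * P = P by have h := adjpM sP sQ; rewrite PQ in h; exact: (adjp_uniq hip h sP).
  by rewrite mulrBr !mulrBl QQ PP PQ QP subrr subr0.
have lim a : exists P, slim (fun n => P' (a + eps n)) P.
  have [S [hS _]] : exists S, slim (fun n => - P' (a + eps n)) S /\ forall n, psd ip (S - - P' (a + eps n)).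
    apply: (@vigier _ _ _ hip _ 0) => n.
    - by apply: (saN hip); case: (hP' (a + eps n)) => [[]].
    - rewrite opprK addrC; apply: psub; [by case: (hP' (a + eps n.+1))|by case: (hP' (a + eps n))|].
      by apply: mono; rewrite ltrD2l.
    - by rewrite sc0 opprK add0r; apply: (isproj_psd hip); case: (hP' (a + eps n)).
  by exists (- S); apply: slim_ext (slimN hS) => n; rewrite opprK.
have /choice[P hP] := lim.
have pP a : isproj ip (P a).
  split; first by apply: (slim_sa hip) (hP a) => n; case: (hP' (a + eps n)) => [[]].
  have h : slim (fun n => P' (a + eps n) * P' (a + eps n)) (P a * P a).
    apply: (@slimM _ _ _ _ _ _ 1) => // n; apply: (isproj_norm hip); by case: (hP' (a + eps n)).
  by apply: slim_uniq h _; apply: slim_ext (hP a) => n; case: (hP' (a + eps n)) => [[]].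
have bP a : bicom T (P a).
  by apply: bicom_slim (hP a) => n; case: (hP' (a + eps n)).
have epsto : eps @ \oo --> (0 : R) by exact: cvg_harmonic.
have sclim a : slim (fun n => sc (a + eps n) : bop H) (sc a).
  move=> x; rewrite scE; under eq_fun do rewrite scE.
  apply/cvg_rnormP; under eq_fun do rewrite -scalerBl -rmorphB addrAC subrr add0r rnormZ.
  rewrite -(mul0r (rnorm x)); apply: cvgMl; rewrite -(normr0 R); exact: cvg_norm.
have scK a n : opnorm (T - sc (a + eps n) : bop H) <= opnorm T + (`|a| + 1).
  apply: le_trans (opnormD _ _) _; rewrite opnormN lerD2l; apply: le_trans (opnorm_sc _) _.
  apply: le_trans (ler_normD _ _) _; rewrite lerD2l ger0_norm; last exact: ltW.
  by rewrite /eps invf_le1// ler1n.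
have Ple a : psd ip (- ((T - sc a) * P a)).
  have h : slim (fun n => - ((T - sc (a + eps n)) * P' (a + eps n))) (- ((T - sc a) * P a)).
    by apply/slimN/(slimM (scK a)) => //; apply: slimB; [exact: slim_cst|exact: sclim].
  by apply: (slim_psd hip) h => n; case: (hP' (a + eps n)).
have Pge a : psd ip ((T - sc a) * (1 - P a)).
  have h : slim (fun n => (T - sc (a + eps n)) * (1 - P' (a + eps n))) ((T - sc a) * (1 - P a)).
    apply: (slimM (scK a)); first by apply: slimB; [exact: slim_cst|exact: sclim].
    by apply: slimB; [exact: slim_cst|exact: hP].
  by apply: (slim_psd hip) h => n; case: (hP' (a + eps n)).
have PP' (a b : R) : a < b -> P a * P' b = P a.
  move=> ab; have [p2 _ _ h2] := hP' b.
  have : P a * (1 - P' b) = 0.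
    apply: (spectral_disjoint (T := T) ab (pP a) (isprojC hip p2)) => //.
    rewrite mulrBr mulrBl mulr1 mul1r; congr (_ - _).
    by have [_ bb _ _] := hP' b; apply: bb; apply/esym/bP.
  by rewrite mulrBr mulr1 => /eqP; rewrite subr_eq0 => /eqP <-.
have Pm (a b : R) : a <= b -> P a * P b = P a.
  move=> ab; apply: slim_uniq (@slimMl _ _ _ _ (P a) (hP b)) _.
  have h := @slim_cst _ _ (P a); apply: slim_ext h => n; rewrite PP'//.
  by rewrite (le_lt_trans ab)// ltrDl.
pose M := opnorm T + 1.
have M_gt0 : 0 < M by rewrite ltr_wpDl ?opnorm_ge0.
have PN : P (- M) = 0.
  apply: bopext => x; rewrite bop0E; pose y := P (- M) x.
  have Py : P (- M) y = y by rewrite /y -bopME; case: (pP (- M)) => _ ->.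
  have [_ /(_ y)] := Ple (- M); rewrite !bopE ?scE Py ripNl// ripBl// ripZl// ripxx// oppr_ge0.
  have := rip_le_opnorm hip T y; rewrite ler_norml => /andP[h1 _] h2.
  apply: rnorm_eq0; apply/eqP; rewrite -sqrf_eq0 eq_le sqr_ge0 andbT -/y.
  by rewrite /M in h2; lra.
have PM : P M = 1.
  apply/eqP; rewrite eq_sym -subr_eq0; apply/eqP; apply: bopext => x; rewrite bop0E; pose y := (1 - P M) x.
  have Py : (1 - P M) y = y by rewrite /y -bopME; case: (isprojC hip (pP M)) => _ ->.
  have [_ /(_ y)] := Pge M; rewrite bopME Py !bopE ?scE ripBl// ripZl// ripxx//.
  have := rip_le_opnorm hip T y; rewrite ler_norml => /andP[_ h1] h2.
  apply: rnorm_eq0; apply/eqP; rewrite -sqrf_eq0 eq_le sqr_ge0 andbT -/y.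
  by rewrite /M in h2; lra.
have Pc x (a e : R) : 0 < e -> exists2 d : R, 0 < d &
    forall b : R, a <= b -> b < a + d -> << P b x, x >> <= << P a x, x >> + e.
  move=> e0; have := @slim_rip _ _ _ hip _ _ x x (hP a).
  move=> /cvgrPdist_le /(_ _ e0) [n _ /(_ n)] /= /(_ (leqnn n)) hn.
  exists (eps n) => // b ab bn; have := PP' _ _ bn => h.
  have [_ /(_ x)] : psd ip (P' (a + eps n) - P b) by apply: psub => //; case: (hP' (a + eps n)).
  rewrite bopE ripBl// subr_ge0 => /le_trans; apply.
  by move: hn; rewrite ler_norml => /andP[hn _]; lra.
have [E [bE rE]] := spectral_family_pvm hip M_gt0 pP Pm bP Pc PN PM.
exists E; split=> //.
pose S := fce E id.
have sS : sa ip S by apply: (fce_sa hip); exact: lb_id.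
have bS : bicom T S.
  by move=> C hC; apply: (fce_bicom hip (lb_id)) => B mB; exact: bE.
have TS : T * S = S * T by exact: bS.
have lr (a : R) : lb (\1_(ray a) : R -> R) by apply: lb_indic; exact: measurable_ray.
have eP a : P a = fce E (fun u => 1 - \1_(ray a) u).
  rewrite fceB//; last exact: lb_cst.
  by rewrite fce_indic ?rE ?fce_cst ?sc1 ?opprB 1?addrC ?subrK//; exact: measurable_ray.
have lP a : lb (fun u => 1 - \1_(ray a) u : R) by apply: lbB => //; exact: lb_cst.
have lid (a : R) : lb (fun u => u - a) by apply: lbB; [exact: lb_id|exact: lb_cst].
have Sa a : S - sc a = fce E (fun u => u - a).
  by rewrite fceB ?fce_cst//; [exact: lb_id|exact: lb_cst].
have Sle a : psd ip (- ((S - sc a) * P a)).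
  rewrite Sa eP -fceM// -fceN//; last exact: lbM.
  apply: fce_psd => //; first by apply: lbN; exact: lbM.
  move=> u _; rewrite indicE; have [|] := boolP (u \in ray a); rewrite /= ?mulr1n ?subrr ?mulr0 ?oppr0//.
  by rewrite notin_setE rayE => /negP; rewrite -leNgt addr0 mulr1 oppr_ge0 subr_le0.
have Sge a : psd ip ((S - sc a) * (1 - P a)).
  have e1 : 1 - P a = fce E (\1_(ray a)) by rewrite fce_indic.
  rewrite Sa e1.
  rewrite -fceM//; apply: fce_psd => //; first exact: lbM.
  move=> u _; rewrite indicE; have [|] := boolP (u \in ray a); rewrite /= ?mulr0//.
  by rewrite inE rayE mulr1 subr_ge0 => /ltW.
(* [T] and [S] satisfy the same operator inequalities on every slice, hence agree. *)
have main (A B : bop H) (e : R) : sa ip A -> sa ip B -> A * B = B * A ->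
    (forall C, C * A = A * C -> C * B = B * C -> forall a, C * P a = P a * C) ->
    (forall a, psd ip (- ((A - sc a) * P a))) ->
    (forall a, psd ip ((B - sc a) * (1 - P a))) -> 0 < e -> psd ip (sc e - (A - B)).
  move=> sA sB AB cP hA hB e0.
  have sX : sa ip (A - B - sc e) by apply: (saB hip); [exact: (saB hip)|exact: (sa_sc hip)].
  have [Q [pQ bQ h1 h2]] := sign_projection hip sX.
  pose G := 1 - Q; have pG : isproj ip G by exact: isprojC.
  have cX C : C * A = A * C -> C * B = B * C -> C * G = G * C.
    move=> cA cB; have cQ : C * Q = Q * C.
      by apply: bQ; rewrite mulrBr mulrBl -sc_comm mulrBr mulrBl cA cB.
    by rewrite /G mulrBr mulrBl mulr1 mul1r cQ.
  have cGA : A * G = G * A by apply: cX.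
  have cGB : B * G = G * B by apply: cX.
  have cG a : G * P a = P a * G by apply: cP.
  have hG (x : H) : G x = x -> << B x, x >> + e * rnorm x ^+ 2 <= << A x, x >>.
    move=> Gx; have [_ /(_ x)] := h2; rewrite bopME -/G Gx !bopE ?scE !(ripDl hip, ripNl hip, ripZl hip).
    by rewrite ripxx//; lra.
  (* On the range of [G] one has A >= B + e, while between the levels a - e/2 and a one has A <= a
     and B >= a - e/2. This slice is therefore zero, and descending by steps of e/2 from M to below
     -M leaves nothing of [G]. *)
  have step (a : R) : P a * G = P (a - e / 2) * G.
    apply/eqP; rewrite -subr_eq0 -mulrBl; apply/eqP.
    have e2 : 0 < e / 2 by rewrite divr_gt0.
    have le : a - e / 2 <= a by rewrite gerBl ltW.
    have cc : P a * P (a - e / 2) = P (a - e / 2) * P a by apply/esym/bP/esym/bP.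
    have eq1 : P a - P (a - e / 2) = P a * (1 - P (a - e / 2)).
      by rewrite mulrBr mulr1 cc Pm.
    apply: bopext => x; rewrite bop0E; pose y := ((P a - P (a - e / 2)) * G) x.
    have y1 : P a y = y.
      rewrite /y eq1 -bopME !mulrA; by case: (pP a) => _ ->.
    have y2 : (1 - P (a - e / 2)) y = y.
      rewrite /y eq1 -bopME !mulrA [X in X * _ * _](_ : _ = P a * (1 - P (a - e / 2))).
        by rewrite -[X in X * _]mulrA; case: (isprojC hip (pP (a - e / 2))) => _ ->.
      by rewrite mulrBl mulrBr mul1r mulr1 cc.
    have y3 : G y = y.
      have cgd : G * (P a - P (a - e / 2)) = (P a - P (a - e / 2)) * G.
        by rewrite [LHS]mulrBr [RHS]mulrBl !cG.
      rewrite /y -bopME mulrA cgd -mulrA; by case: pG => _ ->.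
    have g1 := hG y y3.
    have g2 : 0 <= << B y, y >> - (a - e / 2) * rnorm y ^+ 2.
      have [_ /(_ y)] := hB (a - e / 2); rewrite bopME y2 bopBE ripBl// scE ripZl//.
      by rewrite (ripxx hip).
    have g3 : 0 <= - << A y, y >> + a * rnorm y ^+ 2.
      have [_ /(_ y)] := hA a; rewrite bopNE bopME y1 bopBE ripNl// ripBl// scE ripZl//.
      by rewrite (ripxx hip) opprB addrC.
    apply: rnorm_eq0; apply/eqP; rewrite -sqrf_eq0 eq_le sqr_ge0 andbT -/y.
    have : e / 2 * rnorm y ^+ 2 <= 0 by lra.
    by rewrite pmulr_rle0.
  have steps n : P M * G = P (M - n%:R * (e / 2)) * G.
    elim: n => [|n ih]; first by rewrite mul0r subr0.
    by rewrite ih step; congr (P _ * _); rewrite -natr1; ring.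
  have G0 : G = 0.
    have [n hn] : exists n : nat, 2 * M / (e / 2) < n%:R.
      by exists (Num.trunc `|2 * M / (e / 2)|).+1; apply: le_lt_trans (truncnS_gt _); exact: ler_norm.
    have := steps n; rewrite PM mul1r => ->.
    rewrite (_ : P _ = 0) ?mul0r//.
    have := Pm (M - n%:R * (e / 2)) (- M); rewrite PN mulr0 => <- //.
    by move: hn; rewrite ltr_pdivrMr ?divr_gt0//; lra.
  have Q1 : Q = 1 by apply/eqP; rewrite eq_sym -subr_eq0 -/G G0.
  by move: h1; rewrite Q1 mulr1 opprB.
have closed (A : bop H) : (forall e : R, 0 < e -> psd ip (sc e - A)) -> forall x, << A x, x >> <= 0.
  move=> h x; apply/ler_addgt0Pr => e e0; rewrite add0r.
  have x1 : 0 < rnorm x ^+ 2 + 1 by rewrite ltr_wpDl ?sqr_ge0.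
  have [_ /(_ x)] := h _ (divr_gt0 e0 x1); rewrite bopE scE ripBl// ripZl// ripxx// subr_ge0.
  move=> /le_trans; apply; rewrite mulrAC ler_pdivrMr// ler_wpM2l ?ltW//.
  by rewrite ltrDl.
apply: (sa_form_eq hip) => // x.
have h1 := closed (T - S); have h2 := closed (S - T).
have {}h1 := h1 (fun e e0 => main T S e sT sS TS (fun C c1 _ a => bP a C c1) Ple Sge e0).
have {}h2 := h2 (fun e e0 => main S T e sS sT (esym TS) (fun C _ c1 a => bP a C c1) Sle Pge e0).
have := h1 x; have := h2 x; rewrite !bopBE !ripBl// -/S; lra.
Qed.

End SpectralTheorem.

(** * Functional calculus *)

Section DefsLink.
Context {R : realType} {H : completeNormedModType R[i]} (ip : H -> H -> R[i]).
Context (hip : hilbert_inner_product ip).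
Local Notation "<< x , y >>" := (rip ip x y).
Implicit Types (A B T S : bop H) (x y : H).

Lemma rip_iN x y : << 'i *: x, y >> = - << x, 'i *: y >>.
Proof.
by rewrite -(rip_i hip) scalerA -expr2 sqr_i scaleN1r ripNl.
Qed.

Lemma adjp_ip A B x y : adjp ip A B -> ip (A x) y = ip x (B y).
Proof. by move=> h; rewrite !(ipE hip) h h bopZ. Qed.

Lemma adjointE A B : adjp ip A B -> adjoint ip A = B.
Proof.
move=> h; rewrite /adjoint; case: xgetP => [S _ [bS hS]|/(_ B)].
  have hS' : adjp ip A (Bop bS) by move=> x y; rewrite /rip hS.
  have := adjp_uniq hip hS' h.
  by move=> /(congr1 (@bfun R H)).
by case; split; [exact: bopP|move=> x y; exact: adjp_ip].
Qed.

Lemma adjoint_sa T : adjoint ip T = T -> sa ip T.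
Proof.
rewrite /adjoint; case: xgetP => [S _ [bS hS] eS|_ e0].
  by move=> x y; rewrite /rip hS eS.
(* No adjoint exists here, so [adjoint] has its default value 0 and the hypothesis reads T = 0. *)
have -> : T = 0 by apply: bop_eq; rewrite -e0.
exact: sa0.
Qed.

Lemma isproj_projection P : isproj ip P -> projection ip (P : bop H).
Proof.
move=> [sP PP]; split; [exact: bopP|by rewrite -[in RHS]PP|exact: adjointE].
Qed.

Lemma projection_isproj P : projection ip P -> exists2 Q : bop H, P = Q & isproj ip Q.
Proof.
move=> [bP PP aP]; exists (Bop bP) => //; split; first exact: adjoint_sa.
exact: bop_eq.
Qed.

Lemma sa_ip_real T x : sa ip T -> ip (T x) x = (<< T x, x >>)%:C.
Proof.
move=> hT; rewrite ipE//; congr (_ +i* _)%C.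
have h : << T x, 'i *: x >> = - << T x, 'i *: x >>.
  by rewrite -{1}rip_iN -bopZ hT ripC.
lra.
Qed.

(** The hypothesis at u + v gives <T u, i v> = - <T v, i u>; replacing v by i v turns this into
    symmetry. *)
Lemma real_form_sa T : (forall x, << T x, 'i *: x >> = 0) -> sa ip T.
Proof.
move=> h x y.
have p u v : << T u, 'i *: v >> = - << T v, 'i *: u >>.
  have := h (u + v); rewrite bopD scalerDr !(ripDl hip, ripDr hip) !h; lra.
have := p x ('i *: y); rewrite scalerA -expr2 sqr_i scaleN1r ripNr// bopZ rip_i//.
by move=> /oppr_inj ->; rewrite ripC.
Qed.

Lemma psd_positive T : psd ip T <-> positive_op ip T.
Proof.
split=> [[sT pT]|[bT pT]].
  by split; [exact: bopP|move=> x; rewrite sa_ip_real// lecR].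
have h x : << T x, 'i *: x >> = 0 /\ 0 <= << T x, x >>.
  have := pT x; rewrite ipE// lecE/= => /andP[/eqP -> ->]; by split.
by split; [apply: real_form_sa => x; case: (h x)|move=> x; case: (h x)].
Qed.

Lemma positive_psd (T : H -> H) : positive_op ip T -> exists2 S : bop H, T = S & psd ip S.
Proof. by move=> hT; have [bT _] := hT; exists (Bop bT) => //; apply/psd_positive. Qed.

End DefsLink.

(** * Uniqueness of the resolution of the identity *)

Section Uniqueness.
Context {R : realType} {H : completeNormedModType R[i]} (ip : H -> H -> R[i]).
Context (hip : hilbert_inner_product ip).
Local Notation mT := (measurableTypeR R).
Local Notation "<< x , y >>" := (rip ip x y).
Implicit Types (A B : set mT) (T S : bop H) (x y : H).

Lemma pvm_rayC (E : pvm ip) (a : R) : E (~` ray a) = 1 - E (ray a).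
Proof.
have mr := measurable_ray a; rewrite -!(fce_indic hip)//; last exact: measurableC.
rewrite -sc1 -(fce_cst hip E) -fceB//; [|exact: lb_cst|exact: lb_indic].
by congr fce; apply/funext => u; rewrite !indicE in_setC; case: (u \in ray a); rewrite /= ?subrr ?subr0.
Qed.

Lemma pvm_le (E : pvm ip) (a : R) : psd ip (- ((fce E id - sc a) * E (~` ray a))).
Proof.
have mr := measurable_ray a; have mrC := measurableC mr.
have lid : lb (fun u : R => u - a) by apply: lbB; [exact: lb_id|exact: lb_cst].
have lr : lb (\1_(~` ray a) : R -> R) by exact: lb_indic.
rewrite -(fce_indic hip)// -(fce_cst hip E) -fceB//; [|exact: lb_id|exact: lb_cst].
rewrite -fceM// -fceN//; last exact: lbM.
apply: fce_psd => //; first by apply: lbN; exact: lbM.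
move=> u _; rewrite indicE in_setC; have [|] := boolP (u \in ray a); rewrite /= ?mulr0 ?oppr0//.
by rewrite notin_setE rayE => /negP; rewrite -leNgt mulr1 oppr_ge0 subr_le0.
Qed.

Lemma pvm_ge (E : pvm ip) (a : R) : psd ip ((fce E id - sc a) * E (ray a)).
Proof.
have mr := measurable_ray a.
have lid : lb (fun u : R => u - a) by apply: lbB; [exact: lb_id|exact: lb_cst].
have lr : lb (\1_(ray a) : R -> R) by exact: lb_indic.
rewrite -(fce_indic hip)// -(fce_cst hip E) -fceB//; [|exact: lb_id|exact: lb_cst].
rewrite -fceM//; apply: fce_psd => //; first exact: lbM.
move=> u _; rewrite indicE; have [|] := boolP (u \in ray a); rewrite /= ?mulr0//.
by rewrite inE rayE mulr1 subr_ge0 => /ltW.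
Qed.

Lemma ray_cvg (E : pvm ip) x (a : R) :
  (fun n : nat => << E (ray (a + n.+1%:R^-1)) x, x >>) @ \oo --> << E (ray a) x, x >>.
Proof.
have mr (b : R) := measurable_ray b.
have h : pmu E x \o (fun n : nat => ray (a + n.+1%:R^-1)) @ \oo --> pmu E x (\bigcup_n ray (a + n.+1%:R^-1)).
  apply: nondecreasing_cvg_mu => //; first exact: bigcup_measurable.
  move=> m n mn; apply/subsetPset => u; rewrite !rayE; apply: le_lt_trans.
  by rewrite lerD2l lef_pV2 ?posrE// ler_nat ltnS.
have bU : \bigcup_n ray (a + n.+1%:R^-1) = ray a.
  apply/seteqP; split=> u /=.
    by move=> [n _]; rewrite !rayE; apply: lt_trans; rewrite ltrDl invr_gt0.
  rewrite rayE -subr_gt0 => au; have := near_infty_natSinv_lt (PosNum au) => -[n _ /(_ n)] /= /(_ (leqnn n)) h'.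
  by exists n => //; rewrite rayE -ltrBrDl.
rewrite bU in h; rewrite pvm_mu// in h.
move/fine_cvg : h; apply: cvg_trans; apply: near_eq_cvg; near=> n.
by rewrite /= pvm_mu.
Unshelve. all: by end_near. Qed.

(** For b > a the projection of [E] above b and that of [E'] up to a have product zero, so the
    former lies below that of [E'] above a. Then b decreases to a. *)
Let half (E E' : pvm ip) : fce E id = fce E' id ->
  (forall A B, measurable A -> measurable B -> E A * E' B = E' B * E A) ->
  forall (a : R) x, << E (ray a) x, x >> <= << E' (ray a) x, x >>.
Proof.
move=> ee cc a x; have mr (b : R) := measurable_ray b.
suff h n : << E (ray (a + n.+1%:R^-1)) x, x >> <= << E' (ray a) x, x >>.
  have := @ray_cvg E x a => h'; rewrite -(cvg_lim _ h')//; apply: limr_le.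
    by apply/cvg_ex; eexists; exact: h'.
  exact: nearW.
set b := a + _; have ab : a < b by rewrite ltrDl invr_gt0.
have e0 : E' (~` ray a) * E (ray b) = 0.
  apply: (spectral_disjoint hip (T := fce E id) ab).
  - by apply: pvm_proj; exact: measurableC.
  - exact: pvm_proj.
  - by apply/esym/cc => //; exact: measurableC.
  - by rewrite ee; exact: pvm_le.
  - exact: pvm_ge.
have e1 : E (ray b) = E' (ray a) * E (ray b).
  apply/eqP; rewrite -subr_eq0 -{1}[E _]mul1r -mulrBl -pvm_rayC e0//.
rewrite !(isproj_rip hip)//; [|exact: pvm_proj..].
rewrite e1 (esym (cc _ _ (mr b) (mr a))) bopME ler_sqr ?nnegrE ?rnorm_ge0//.
apply: le_trans (opnormP _ _) _; rewrite ler_piMl ?rnorm_ge0//.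
by apply: (isproj_norm hip); exact: pvm_proj.
Qed.

Lemma pvm_comm_uniq (E E' : pvm ip) : fce E id = fce E' id ->
  (forall A B, measurable A -> measurable B -> E A * E' B = E' B * E A) ->
  forall A, measurable A -> E A = E' A.
Proof.
move=> ee cc A mA; apply: (sa_form_eq hip) => [| |x].
- by case: (pvm_proj E mA).
- by case: (pvm_proj E' mA).
suff : pmu E x A = pmu E' x A by rewrite !pvm_mu// => -[].
apply: measure_unique_rays mA => [a|]; last exact: pmu_fin.
have mr := measurable_ray a; have cc' A0 B0 (mA0 : measurable A0) (mB0 : measurable B0) := esym (cc _ _ mB0 mA0).
have h : pmu E x (ray a) = pmu E' x (ray a).
  by rewrite !pvm_mu//; congr EFin; apply/eqP; rewrite eq_le !half.
exact: h.
Qed.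

(** The resolution given by [spectral_theorem] lies in the bicommutant of the operator, hence
    commutes with every other resolution. Comparing both with it avoids having to know that they
    commute with each other. *)
Lemma pvm_uniq (E E' : pvm ip) : fce E id = fce E' id -> forall A, measurable A -> E A = E' A.
Proof.
have sT : sa ip (fce E id) by apply: fce_sa => //; exact: lb_id.
have [E0 [b0 e0]] := spectral_theorem hip sT.
have key (F : pvm ip) : fce F id = fce E id -> forall A, measurable A -> E0 A = F A.
  move=> eF; apply: pvm_comm_uniq; first by rewrite e0.
  move=> A B mA mB; apply/esym/(b0 _ mA); rewrite -eF -(fce_indic hip)//.
  by apply: fce_comm => //; [exact: lb_indic|exact: lb_id].
by move=> e A mA; rewrite -(key E)// -(key E').
Qed.

Lemma pvm_fce_uniq (E E' : pvm ip) f : fce E id = fce E' id -> lb f -> fce E f = fce E' f.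
Proof.
move=> e lf; apply: fce_uniq => //; first exact: fce_sa.
move=> x; rewrite fce_rip//; congr fine; apply: eq_measure_integral => A mA _.
by rewrite !pvm_mu// (pvm_uniq e).
Qed.

(* A resolution of a bounded operator is supported in [-|T| - 1, |T| + 1]. *)
Lemma spec_exists T : sa ip T -> exists E : pvm ip,
  [/\ fce E id = T, forall B, measurable B -> bicom T (E B) & pM E = opnorm T + 1].
Proof.
move=> sT; have [E [bE eE]] := spectral_theorem hip sT.
pose c := opnorm T + 1; have mr (a : R) := measurable_ray a.
have mrC (a : R) := measurableC (mr a).
have n0 x : 0 <= opnorm T * rnorm x ^+ 2 by rewrite mulr_ge0 ?opnorm_ge0 ?sqr_ge0.
have E1 : E (ray c) = 0.
  apply: bopext => x; rewrite bop0E; pose y := E (ray c) x.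
  have Ey : E (ray c) y = y by rewrite /y -bopME; case: (pvm_proj E (mr c)) => _ ->.
  have [_ /(_ y)] := pvm_ge E c; rewrite eE bopME Ey bopBE ripBl// scE ripZl// (ripxx hip).
  have := rip_le_opnorm hip T y; rewrite ler_norml => /andP[_ h1] h2.
  by apply: rnorm_eq0; apply/eqP; rewrite -sqrf_eq0 eq_le sqr_ge0 andbT -/y; rewrite /c in h2; lra.
have E2 : E (~` ray (- c)) = 0.
  apply: bopext => x; rewrite bop0E; pose y := E (~` ray (- c)) x.
  have Ey : E (~` ray (- c)) y = y by rewrite /y -bopME; case: (pvm_proj E (mrC (- c))) => _ ->.
  have [_ /(_ y)] := pvm_le E (- c); rewrite eE bopNE bopME Ey ripNl// bopBE ripBl// scE ripZl// (ripxx hip).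
  have := rip_le_opnorm hip T y; rewrite ler_norml => /andP[h1 _] h2.
  by apply: rnorm_eq0; apply/eqP; rewrite -sqrf_eq0 eq_le sqr_ge0 andbT -/y; rewrite /c in h2; lra.
have supp : E (~` `[- c, c]) = 0.
  pose D : set mT := ~` `[- c, c].
  have mC : measurable D by exact: measurableC.
  rewrite -/D.
  have m2 := measurableU _ _ (mr c) (mrC (- c)).
  apply: (sa_form_eq hip); [by case: (pvm_proj E mC)|exact: sa0|] => x.
  rewrite bop0E rip0l//.
  suff : (pmu E x D <= 0)%E.
    by rewrite pvm_mu// lee_fin isproj_rip//; [move=> h; apply/eqP; rewrite eq_le h sqr_ge0|exact: pvm_proj].
  apply: (@le_trans _ _ (pmu E x (ray c `|` ~` ray (- c)))).
    apply: le_measure; rewrite ?inE// => u /= /negP; rewrite in_itv/= negb_and -!ltNge => /orP[h|h].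
      by right => /=; rewrite rayE; apply/negP; rewrite -leNgt ltW.
    by left; rewrite rayE.
  apply: le_trans (measureU2 _ _ _) _ => //.
  rewrite -[leRHS]adde0; apply: leeD.
    by have := pvm_mu E x (mr c); rewrite E1 bop0E rip0l// => h; rewrite [leLHS]h.
  by have := pvm_mu E x (mrC (- c)); rewrite E2 bop0E rip0l// => h; rewrite [leLHS]h.
pose E' : pvm ip := @Pvm _ _ ip E (pmu E) c (@pvm_proj _ _ _ E) (pvmT E) (@pvmI _ _ _ E) (@pvm_mu _ _ _ E) supp.
by exists E'; split.
Qed.

End Uniqueness.

Section FunctionalCalculus.
Context {R : realType} {H : completeNormedModType R[i]} (ip : H -> H -> R[i]).
Context (hip : hilbert_inner_product ip).
Local Notation mT := (measurableTypeR R).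
Local Notation "<< x , y >>" := (rip ip x y).
Implicit Types (A B : set mT) (f g : R -> R) (T S C : bop H) (x y : H).

(** The choice of the resolution is immaterial by [pvm_fce_uniq]. Its prescribed support is what
    allows hypotheses on functions to be checked only for |u| <= opnorm T + 1. *)
Definition fc T f : bop H := xget 0 [set S | exists2 E : pvm ip,
  [/\ fce E id = T, forall B, measurable B -> bicom T (E B) & pM E = opnorm T + 1] & S = fce E f].

Lemma fc_fce (E : pvm ip) f : lb f -> fc (fce E id) f = fce E f.
Proof.
move=> lf; have sT : sa ip (fce E id) by apply: fce_sa => //; exact: lb_id.
rewrite /fc; case: xgetP => [S _ [E' [eE _ _] ->]|]; first exact: pvm_fce_uniq.
have [E' hE'] := spec_exists hip sT.
by move=> /(_ (fce E' f)); case; exists E'.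
Qed.

Lemma fc_spec T : sa ip T -> exists2 E : pvm ip,
  [/\ fce E id = T, forall B, measurable B -> bicom T (E B) & pM E = opnorm T + 1] &
  forall f, lb f -> fc T f = fce E f.
Proof.
by move=> /(spec_exists hip)[E [e b p]]; exists E => // f lf; rewrite -e fc_fce.
Qed.

Section OneOp.
Context (T : bop H) (sT : sa ip T).
Let M := opnorm T + 1.

Lemma fc_sa f : lb f -> sa ip (fc T f).
Proof. by move=> lf; have [E _ ->] := fc_spec sT; [exact: fce_sa|]. Qed.
Lemma fc_bicom f : lb f -> bicom T (fc T f).
Proof.
move=> lf; have [E [_ bE _] ->//] := fc_spec sT.
by move=> C hC; apply: (fce_bicom hip) => // B mB; exact: bE.
Qed.
Lemma fc_id : fc T id = T.
Proof. by have [E [e _ _] ->] := fc_spec sT; last exact: lb_id. Qed.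
Lemma fc_cst (c : R) : fc T (fun=> c) = sc c.
Proof. by have [E _ ->] := fc_spec sT; [exact: fce_cst|exact: lb_cst]. Qed.
Lemma fcZ c f : lb f -> fc T (fun u => c * f u) = c *: fc T f.
Proof. by move=> lf; have [E _ h] := fc_spec sT; rewrite !h ?fceZ//; exact: lbZ. Qed.
Lemma fcD f g : lb f -> lb g -> fc T (fun u => f u + g u) = fc T f + fc T g.
Proof. by move=> lf lg; have [E _ h] := fc_spec sT; rewrite !h ?fceD//; exact: lbD. Qed.
Lemma fcN f : lb f -> fc T (fun u => - f u) = - fc T f.
Proof. by move=> lf; have [E _ h] := fc_spec sT; rewrite !h ?fceN//; exact: lbN. Qed.
Lemma fcB f g : lb f -> lb g -> fc T (fun u => f u - g u) = fc T f - fc T g.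
Proof. by move=> lf lg; have [E _ h] := fc_spec sT; rewrite !h ?fceB//; exact: lbB. Qed.
Lemma fcM f g : lb f -> lb g -> fc T (fun u => f u * g u) = fc T f * fc T g.
Proof. by move=> lf lg; have [E _ h] := fc_spec sT; rewrite !h ?fceM//; exact: lbM. Qed.
Lemma fcX f n : lb f -> fc T (fun u => f u ^+ n) = fc T f ^+ n.
Proof. by move=> lf; have [E _ h] := fc_spec sT; rewrite !h ?fceX//; exact: lbX. Qed.
Lemma fc_commT f : lb f -> T * fc T f = fc T f * T.
Proof. by move=> lf; apply: fc_bicom. Qed.
Lemma fc_le f g : lb f -> lb g -> (forall u, `|u| <= M -> f u <= g u) ->
  psd ip (fc T g - fc T f).
Proof. by move=> lf lg h'; have [E [_ _ p] h] := fc_spec sT; rewrite !h//; apply: fce_le; rewrite ?p. Qed.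
Lemma fc_eq f g : lb f -> lb g -> (forall u, `|u| <= M -> f u = g u) -> fc T f = fc T g.
Proof. by move=> lf lg h'; have [E [_ _ p] h] := fc_spec sT; rewrite !h//; apply: fce_eq; rewrite ?p. Qed.
Lemma fc_psd f : lb f -> (forall u, `|u| <= M -> 0 <= f u) -> psd ip (fc T f).
Proof. by move=> lf h'; have [E [_ _ p] h] := fc_spec sT; rewrite !h//; apply: fce_psd; rewrite ?p. Qed.
Lemma fc_norm f (K : R) : lb f -> 0 <= K -> (forall u, `|u| <= M -> `|f u| <= K) -> opnorm (fc T f) <= K.
Proof. by move=> lf K0 h'; have [E [_ _ p] h] := fc_spec sT; rewrite !h//; apply: fce_norm; rewrite ?p. Qed.
Lemma fc_comp f g : lb f -> lb g -> fc (fc T g) f = fc T (fun u => f (g u)).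
Proof.
move=> lf lg; have [E _ h] := fc_spec sT; rewrite !h//; last exact: lb_comp.
have <- : fce (push hip E lg) id = fce E g by rewrite fce_push //; exact: lb_id.
by rewrite fc_fce// fce_push.
Qed.
Lemma fc_proj A : measurable A -> isproj ip (fc T (\1_A)).
Proof.
move=> mA; have lA : lb (\1_A : R -> R) by exact: lb_indic.
split; first exact: fc_sa.
rewrite -fcM//; apply: fc_eq => //; first exact: lbM.
by move=> u _; rewrite indicE; case: (_ \in _); rewrite /= ?mul1r ?mul0r.
Qed.
End OneOp.

(** No support condition is part of [spectral_measure]. If s u >= c on B, with s = 1 or -1 and c =
    opnorm T + 1, a nonzero vector in the range of the projection of B would give the form of [T] a
    value exceeding its norm. Hence the projection of the complement of [-c, c] vanishes. *)
Lemma spectral_measure_pvm T E0 : sa ip T -> spectral_measure ip T E0 ->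
  exists E : pvm ip, [/\ fce E id = T, forall B, measurable B -> E0 B = E B &
    forall x (m : {measure set mT -> \bar R}), represents ip E0 x m ->
      forall B, measurable B -> m B = pmu E x B].
Proof.
move=> sT [hE hT hI hm].
have /choice[Q hQ] : forall B : set mT, exists Q : bop H, measurable B -> E0 B = Q /\ isproj ip Q.
  move=> B; have [mB|nB] := pselect (measurable B); last by exists 0.
  by have [Q eQ pQ] := projection_isproj hip (hE B mB); exists Q.
have QE B : measurable B -> E0 B = Q B by move=> /hQ[].
have Qp B : measurable B -> isproj ip (Q B) by move=> /hQ[].
have QT : Q setT = 1 by apply: bop_eq; rewrite -QE.
have QI A B : measurable A -> measurable B -> Q (A `&` B) = Q A * Q B.
  by move=> mA mB; apply: bop_eq; rewrite -QE ?hI ?QE//; exact: measurableI.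
have /choice[mu hmu] := hm.
have mur x B : measurable B -> mu x B = << Q B x, x >>%:E.
  by move=> mB; have [h _ _] := hmu x; rewrite h// QE.
have muT x : mu x setT = (rnorm x ^+ 2)%:E by rewrite mur// QT (ripxx hip).
have Tint x : << T x, x >> = \int[mu x]_u u.
  by have [_ _] := hmu x; rewrite (sa_ip_real hip)// => -[].
have Q0 : Q set0 = 0.
  apply: (sa_form_eq hip); [by case: (Qp set0 measurable0)|exact: sa0|] => x.
  by rewrite bop0E rip0l//; have := mur x set0 measurable0; rewrite measure0 => -[].
pose c := opnorm T + 1.
have vanish B (s : R) : measurable B -> `|s| = 1 -> (forall u, B u -> c <= s * u) -> Q B = 0.
  move=> mB s1 hB; apply: bopext => x; pose y := Q B x; rewrite bop0E -/y.
  have mBC := measurableC mB.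
  have yC : mu y (~` B) = 0%E.
    by rewrite mur// /y -bopME -QI// setICl Q0 bop0E rip0l.
  have [_ iy _] := hmu y.
  have mid : measurable_fun [set: mT] (id : mT -> R) by exact: measurable_id.
  have isy : (mu y).-integrable setT (EFin \o (fun u => s * u)).
    have -> : EFin \o (fun u : R => s * u) = (fun u : mT => (s%:E * (u : R)%:E)%E).
      by apply/funext => u /=; rewrite EFinM.
    exact: integrableZl.
  have e1 : s * << T y, y >> = \int[mu y]_(u in B) (s * u).
    rewrite Tint -RintegralZl// /Rintegral (negligible_integral mBC)//.
    by rewrite setTD setCK.
  have muB : mu y B = (rnorm y ^+ 2)%:E.
    by rewrite mur// /y -(bopME (Q B)); case: (Qp B mB) => sB BB; rewrite BB (ripxx hip).
  have e2 : c * rnorm y ^+ 2 <= \int[mu y]_(u in B) (s * u).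
    have -> : c * rnorm y ^+ 2 = \int[mu y]_(u in B) c by rewrite Rintegral_cst// [X in fine X]muB.
    apply: le_Rintegral => //.
    - apply: measurable_bounded_integrable => //; first by rewrite [X in (X < _)%E]muB ltry.
      exact: bounded_cst.
    - exact: integrableS isy.
  have e3 : s * << T y, y >> <= opnorm T * rnorm y ^+ 2.
    apply: le_trans (ler_norm _) _; rewrite normrM s1 mul1r; exact: rip_le_opnorm.
  apply: rnorm_eq0; apply/eqP; rewrite -sqrf_eq0 eq_le sqr_ge0 andbT.
  by move: e2; rewrite -e1 /c; lra.
have supp : Q (~` `[- c, c]) = 0.
  pose N0 : set mT := `]-oo, - c[%classic.
  have m1 := @measurable_ray R c; have m2 : measurable N0 by exact: measurable_itv.
  have e : ~` `[- c, c] = ray c `|` N0.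
    rewrite /N0; apply/seteqP; split=> u /=; rewrite rayE !in_itv/=.
      by move=> /negP; rewrite negb_and -!ltNge => /orP[->|->]; [right|left].
    by move=> [h|h] /andP[h1 h2]; [have := lt_le_trans h h2|have := lt_le_trans h h1]; rewrite ltxx.
  have v1 : Q (ray c) = 0.
    by apply: (vanish _ 1); rewrite ?normr1// => u; rewrite rayE mul1r => /ltW.
  have v2 : Q N0 = 0.
    apply: (vanish _ (-1)); rewrite ?normrN1// => u; rewrite /N0/= in_itv/= mulN1r => h.
    by rewrite lerNr ltW.
  pose D : set mT := ~` `[- c, c]; rewrite -/D.
  have mD : measurable D by exact: measurableC.
  apply: (sa_form_eq hip); [by case: (Qp _ mD)|exact: sa0|] => x.
  rewrite bop0E rip0l//.
  suff : (mu x D <= 0)%E.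
    rewrite mur// lee_fin (isproj_rip hip) => [h|]; last exact: Qp.
    by apply/eqP; rewrite eq_le h sqr_ge0.
  rewrite /D e; apply: le_trans (measureU2 _ _ _) _ => //.
  rewrite -[leRHS]adde0; apply: leeD.
    by have := mur x _ m1; rewrite v1 bop0E rip0l// => h; rewrite [leLHS]h.
  by have := mur x _ m2; rewrite v2 bop0E rip0l// => h; rewrite [leLHS]h.
pose E : pvm ip := @Pvm _ _ ip Q mu c Qp QT QI mur supp.
exists E; split=> //.
  by apply: fce_uniq => //; exact: lb_id.
by move=> x m rm B mB; rewrite rm// QE// pvm_mu.
Qed.

(** [xget] may return any admissible operator built from any spectral measure. Both ambiguities
    disappear: the resolution is unique, and an operator is determined by its quadratic form. *)
Lemma funcalcE T f : sa ip T -> lb f -> funcalc ip T f = fc T f.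
Proof.
move=> sT lf; rewrite /funcalc; case: xgetP => [S _ [bS [E0 [hE0 hS]]]|/(_ (fc T f : bop H))].
  have [E [eE QE rE]] := spectral_measure_pvm sT hE0.
  have rep x : represents ip E0 x (pmu E x).
    by move=> B mB; rewrite QE// pvm_mu.
  have hS' x : ip (S x) x = (\int[pmu E x]_u f u)%:C by have [_ ->] := hS x _ (rep x).
  pose S' := Bop bS; suff -> : fc T f = S' by [].
  have rS x : << S' x, x >> = \int[pmu E x]_u f u by rewrite /rip hS'.
  rewrite -eE fc_fce//; apply: fce_uniq => //.
  apply: (real_form_sa hip) => x; have := hS' x; rewrite (ipE hip) => /eqP.
  by rewrite eq_complex/= => /andP[_ /eqP].
case; split; first exact: bopP.
have [E [eE bE _] hE] := fc_spec sT.
exists (fun B => E B : H -> H); split; last first.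
  move=> x m rm.
  have mE B : measurable B -> m B = pmu E x B by move=> mB; rewrite rm// pvm_mu.
  have mM : m (~` `[- pM E, pM E]) = 0%E by rewrite mE ?pmu_supp//; exact: measurableC.
  have mfin : (m setT < +oo)%E by rewrite mE// pmu_fin.
  split; first exact: (lb_integrable mM mfin).
  rewrite (sa_ip_real hip); last exact: fc_sa.
  rewrite hE// fce_rip//; congr (_%:C); congr fine.
  by apply: eq_measure_integral => B mB _; rewrite mE.
split.
- by move=> B mB; apply: (isproj_projection hip); exact: pvm_proj.
- by rewrite pvmT.
- by move=> A B mA mB; rewrite pvmI.
- move=> x; exists (pmu E x); split.
  + by move=> B mB; rewrite pvm_mu.
  + have h := @pint_integrable _ _ _ hip E x id lb_id; exact: h.
  + by rewrite (sa_ip_real hip)// -[in LHS]eE fce_rip//; exact: lb_id.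
Qed.

End FunctionalCalculus.

Opaque fc.

(** * The trace on a semifinite algebra *)

Section VonNeumann.
Context {R : realType} {H : completeNormedModType R[i]} (ip : H -> H -> R[i]).
Context (hip : hilbert_inner_product ip).
Context (N : set (H -> H)) (hN : von_neumann_algebra ip N).
Local Notation "<< x , y >>" := (rip ip x y).
Local Notation sa := (sa ip).
Local Notation psd := (psd ip).
Local Notation adjp := (adjp ip).
Local Notation fc := (fc ip).
Implicit Types (A B T S C U W X Z Y G K : bop H) (x y : H).

Lemma N_commP A : N A <-> forall C, commutant N C -> A * C = C * A.
Proof.
have [_ eN] := hN; split.
  by move=> nA C hC; move: nA; rewrite eN => -[_ h]; apply: bop_eq; exact: h.
move=> h; rewrite eN; split; first exact: bopP.
move=> S [bS hS].
by have := h (Bop bS) (conj bS hS) => /(congr1 (@bfun R H)).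
Qed.

Lemma N_bop (T : H -> H) : N T -> exists A : bop H, T = A.
Proof. by have [_ ->] := hN => -[bT _]; exists (Bop bT). Qed.

Lemma N_bicom A B : N A -> bicom A B -> N B.
Proof.
move=> hA hB; apply/N_commP => C hC; apply/esym/hB/esym; exact: ((N_commP A).1 hA).
Qed.
Lemma ND A B : N A -> N B -> N (A + B)%R.
Proof.
move=> /N_commP hA /N_commP hB; apply/N_commP => C hC.
by rewrite mulrDl mulrDr hA// hB.
Qed.
Lemma NM A B : N A -> N B -> N (A * B)%R.
Proof.
move=> /N_commP hA /N_commP hB; apply/N_commP => C hC.
by rewrite -mulrA hB// mulrA hA// mulrA.
Qed.
Lemma NZ a A : N A -> N (a *: A)%R.
Proof. by move=> /N_commP hA; apply/N_commP => C hC; rewrite bopAl bopAr hA. Qed.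
Lemma NN A : N A -> N (- A)%R.
Proof. by move=> hA; have := NZ (-1) hA; rewrite scaleN1r. Qed.
Lemma NB A B : N A -> N B -> N (A - B)%R.
Proof. by move=> hA hB; apply: ND => //; exact: NN. Qed.
Lemma N1 : N (1 : bop H)%R.
Proof. by apply/N_commP => C _; rewrite mul1r mulr1. Qed.
Lemma N0 : N (0 : bop H)%R.
Proof. by apply/N_commP => C _; rewrite mul0r mulr0. Qed.
Lemma NX A n : N A -> N (A ^+ n)%R.
Proof.
move=> hA; elim: n => [|n ih]; first by rewrite expr0; exact: N1.
by rewrite exprS; exact: NM.
Qed.
Lemma N_adj A A' : adjp A A' -> N A -> N A'.
Proof. by move=> h hA; rewrite -(adjointE hip h); apply: hN.1. Qed.
Lemma N_fc T f : N T -> sa T -> lb f -> N (fc T f).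
Proof. by move=> hT sT lf; apply: N_bicom hT _; exact: fc_bicom. Qed.

Definition NP A := N A /\ psd A.

Lemma NP_sqrt A : NP A -> exists G, [/\ N G, psd G & G * G = A].
Proof.
move=> [hA pA]; have [G [pG e b]] := psd_sqrt hip pA.
by exists G; split=> //; exact: N_bicom b.
Qed.
Lemma NPD A B : NP A -> NP B -> NP (A + B).
Proof. by move=> [nA pA] [nB pB]; split; [exact: ND|exact: psdD]. Qed.
Lemma NPZ a A : 0 <= a -> NP A -> NP (a *: A).
Proof. by move=> a0 [nA pA]; split; [exact: NZ|exact: psdZ]. Qed.
Lemma NP0 : NP 0. Proof. by split; [exact: N0|exact: psd0]. Qed.
Lemma NP_sand A Z Z' : adjp Z Z' -> N Z -> NP A -> NP (Z * A * Z').
Proof.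
move=> h nZ [nA pA]; split; last by apply: psd_sandwich => //; exact: adjpC.
by apply: NM; [exact: NM|exact: N_adj h nZ].
Qed.
Lemma NP_fc T f : N T -> sa T -> lb f -> (forall u, `|u| <= opnorm T + 1 -> 0 <= f u) -> NP (fc T f).
Proof. by move=> nT sT lf h; split; [exact: N_fc|exact: fc_psd]. Qed.

Context (tau : (H -> H) -> \bar R) (htau : fns_trace ip N tau).

Lemma NP_cone A : NP A -> pos_cone ip N A.
Proof. by move=> [nA pA]; split=> //; apply/psd_positive. Qed.

Lemma tau_ge0 A : NP A -> (0 <= tau A)%E.
Proof. by move=> h; apply: (trace_ge0 htau); exact: NP_cone. Qed.
Lemma tauD A B : NP A -> NP B -> tau (A + B)%R = (tau A + tau B)%E.
Proof. by move=> hA hB; apply: (trace_add htau); exact: NP_cone. Qed.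
Lemma tauZ a A : 0 <= a -> NP A -> tau (a *: A)%R = (a%:E * tau A)%E.
Proof. by move=> a0 hA; apply: (trace_scale htau) => //; exact: NP_cone. Qed.
Lemma tau0 : tau (0 : bop H)%R = 0%E.
Proof. by have := tauZ (lexx 0) NP0; rewrite scale0r mul0e. Qed.
Lemma tau_le A B : NP A -> NP B -> psd (B - A) -> (tau A <= tau B)%E.
Proof.
move=> hA hB h; rewrite -[B](subrK A) tauD//; last by split=> //; apply: NB; [case: hB|case: hA].
by rewrite leeDr//; apply: tau_ge0; split=> //; apply: NB; [case: hB|case: hA].
Qed.
Lemma tau_comm Z Z' : adjp Z Z' -> N Z -> tau (Z' * Z)%R = tau (Z * Z')%R.
Proof.
by move=> h nZ; have := trace_tracial htau nZ; rewrite (adjointE hip h).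
Qed.
(** Traciality for the operator Z G, whose two products with its adjoint G Z' are the operators
    under the traces. *)
Lemma tau_sand A G Z Z' : adjp Z Z' -> N Z -> N G -> psd G -> G * G = A ->
  tau (Z * A * Z')%R = tau (G * (Z' * Z) * G)%R.
Proof.
move=> h nZ nG [sG pG] <-.
have hGZ : adjp (Z * G) (G * Z') by exact: adjpM.
have := tau_comm hGZ (NM nZ nG) => e.
rewrite (_ : (Z * (G * G) * Z')%R = (Z * G * (G * Z'))%R); last by rewrite !mulrA.
by rewrite -e !mulrA.
Qed.

Lemma psd_GXG G X c : psd G -> sa X -> opnorm X <= c ->
  psd (c *: (G * G) - G * X * G) /\ psd (c *: (G * G) + G * X * G).
Proof.
move=> [sG _] sX hc.
have h1 := psd_sandwich hip sG (psd_opnormB hip sX hc).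
have h2 := psd_sandwich hip sG (psd_opnormD hip sX hc).
move: h1 h2; rewrite !mulrBr !mulrBl !mulrDr !mulrDl scMr bopAl.
by split.
Qed.

Lemma opnorm_adj Z Z' : adjp Z Z' -> opnorm Z' <= opnorm Z.
Proof.
move=> h; apply: opnorm_le; first exact: opnorm_ge0.
move=> x; apply: (rnorm_rip hip); first by rewrite mulr_ge0 ?opnorm_ge0 ?rnorm_ge0.
move=> y; rewrite (adjpC hip h)//; apply: le_trans (ler_norm _) (le_trans (rip_CS hip _ _) _).
by rewrite [leRHS]mulrAC mulrC ler_wpM2r ?rnorm_ge0// opnormP.
Qed.

Lemma tau_sand_le A Z Z' : adjp Z Z' -> N Z -> NP A ->
  (tau (Z * A * Z')%R <= (opnorm Z ^+ 2)%:E * tau A)%E.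
Proof.
move=> h nZ hA; have [G [nG pG GG]] := NP_sqrt hA.
have nZ' := N_adj h nZ.
rewrite (tau_sand h nZ nG pG GG) -tauZ ?sqr_ge0//.
have sG : sa G by case: pG.
apply: tau_le.
- by apply: NP_sand => //; split; [exact: NM|apply: psd_sq].
- by apply: NPZ => //; exact: sqr_ge0.
have sZ : sa (Z' * Z) by case: (psd_sq hip h).
have [||h1 _] := @psd_GXG G (Z' * Z) (opnorm Z ^+ 2) pG => //.
  apply: le_trans (opnormM _ _) _; rewrite expr2 ler_wpM2r ?opnorm_ge0//.
  exact: opnorm_adj.
by rewrite -GG.
Qed.

Definition FT A := NP A /\ (tau A < +oo)%E.

Lemma FT_fin A : FT A -> tau A = (fine (tau A))%:E.
Proof. by move=> [hA fA]; rewrite fineK// ge0_fin_numE// tau_ge0. Qed.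
Lemma FT_ge0 A : FT A -> 0 <= fine (tau A).
Proof. by move=> [hA _]; apply: fine_ge0; exact: tau_ge0. Qed.
Lemma FTD A B : FT A -> FT B -> FT (A + B).
Proof. by move=> [hA fA] [hB fB]; split; [exact: NPD|rewrite tauD// lte_add_pinfty]. Qed.
Lemma FTZ a A : 0 <= a -> FT A -> FT (a *: A).
Proof.
move=> a0 hA; split; first by apply: NPZ => //; case: hA.
by rewrite tauZ//; [rewrite FT_fin// -EFinM ltry|case: hA].
Qed.
Lemma FT_le A B : NP A -> FT B -> psd (B - A) -> FT A.
Proof. by move=> hA [hB fB] h; split=> //; apply: le_lt_trans fB; exact: tau_le. Qed.
Lemma FT0 : FT 0. Proof. by split; [exact: NP0|rewrite tau0 ltry]. Qed.
Lemma FT_sand A Z Z' : adjp Z Z' -> N Z -> FT A -> FT (Z * A * Z').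
Proof.
move=> h nZ hA; split; first by apply: NP_sand => //; case: hA.
apply: le_lt_trans (tau_sand_le h nZ _) _; first by case: hA.
by rewrite FT_fin// -EFinM ltry.
Qed.

Definition ft A : R := fine (tau A).
Lemma ftD A B : FT A -> FT B -> ft (A + B) = ft A + ft B.
Proof.
move=> hA hB; rewrite /ft tauD; [|by case: hA|by case: hB].
by rewrite (FT_fin hA) (FT_fin hB).
Qed.
Lemma ftZ a A : 0 <= a -> FT A -> ft (a *: A) = a * ft A.
Proof. by move=> a0 hA; rewrite /ft tauZ//; [rewrite (FT_fin hA)|case: hA]. Qed.
Lemma ft_le A B : FT A -> FT B -> psd (B - A) -> ft A <= ft B.
Proof.
move=> hA hB h; rewrite -lee_fin /ft -!FT_fin//; apply: tau_le => //; [by case: hA|by case: hB].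
Qed.
Lemma ft0 : ft 0 = 0. Proof. by rewrite /ft tau0. Qed.

Let pos_part (u : R) := Num.max u 0.
Let neg_part (u : R) := Num.max (- u) 0.
Let lb_pos : lb pos_part.
Proof. by apply: lb_max; [exact: lb_id|exact: lb_cst]. Qed.
Let lb_neg : lb neg_part.
Proof. by apply: lb_max; [apply: lbN; exact: lb_id|exact: lb_cst]. Qed.

(** Trace class operators that are self-adjoint; the real-valued trace [rtr] is linear on them. *)
Definition TC A := [/\ N A, sa A, FT (fc A pos_part) & FT (fc A neg_part)].
Definition rtr A : R := rtrace ip tau A.
Definition tnorm A : R := ft (fc A pos_part) + ft (fc A neg_part).

Lemma rtrE A : sa A -> rtr A = ft (fc A pos_part) - ft (fc A neg_part).
Proof. by move=> sA; rewrite /rtr /rtrace !(funcalcE hip). Qed.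

Lemma pos_negE A : sa A -> fc A pos_part - fc A neg_part = A.
Proof.
move=> sA; rewrite -fcB// -[RHS](fc_id hip sA); congr fc; apply/funext => u.
rewrite /pos_part /neg_part /Num.max; case: ltP => h1; case: ltP => h2 /=; lra.
Qed.

(** With P the spectral projection of A for the positive half-line, the positive part of A is P A P
    = P B P - P C P, which lies below P B P. *)
Let lt_cut A B C : N A -> sa A -> A = B - C -> FT B -> NP C ->
  FT (fc A pos_part).
Proof.
move=> nA sA e hB [nC pC].
have mr := @measurable_ray R 0.
have lr : lb (\1_(ray 0) : R -> R) by exact: lb_indic.
pose P := fc A (\1_(ray 0)).
have [sP PP] : isproj ip P by exact: fc_proj.
have nP : N P by exact: N_fc.
have nA' : NP (fc A pos_part).
  by apply: NP_fc => // u _; rewrite /pos_part le_max lexx orbT.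
apply: (FT_le nA' (FT_sand sP nP hB)).
have -> : fc A pos_part = P * A * P.
  rewrite -[X in P * X * P](fc_id hip sA) /P -fcM//; last exact: lb_id.
  rewrite -fcM//; last by apply: lbM => //; exact: lb_id.
  apply: fc_eq => //; first by apply: lbM => //; apply: lbM => //; exact: lb_id.
  move=> u _; rewrite /pos_part indicE /Num.max; have [|] := boolP (u \in ray 0).
    by rewrite inE rayE => h; rewrite mul1r mulr1 ltNge (ltW h).
  rewrite notin_setE rayE => /negP; rewrite -leNgt => h; rewrite mul0r mul0r.
  by case: ltP => // h'; apply/eqP; rewrite eq_le h.
by rewrite -mulrBl -mulrBr e opprB addrC subrK; exact: psd_sandwich.
Qed.

Lemma fc_opp A f : sa A -> lb f -> fc (- A) f = fc A (fun u => f (- u)).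
Proof.
move=> sA lf; have h := fc_comp hip sA lf (lbN lb_id).
by rewrite -h fcN ?fc_id//; exact: lb_id.
Qed.

(** Since A_+ - A_- = B - C, the positive operators A_+ + C and A_- + B coincide. Additivity on the
    cone then makes the trace independent of the decomposition; this gives all linearity of
    [rtr]. *)
Lemma rtr_diff A B C : FT B -> FT C -> A = B - C -> TC A /\ rtr A = ft B - ft C.
Proof.
move=> hB hC e; have [[nB [sB pB]] fB] := hB; have [[nC [sC pC]] fC] := hC.
have nA : N A by rewrite e; exact: NB.
have sA : sa A by rewrite e; exact: saB.
have h1 : FT (fc A pos_part) by apply: (lt_cut nA sA e).
have h2 : FT (fc A neg_part).
  rewrite -(fc_opp sA lb_pos); apply: (lt_cut (NN nA) (saN hip sA) _ hC hB.1).
  by rewrite e opprB.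
split; first by split.
rewrite rtrE//; have : ft (fc A pos_part + C) = ft (fc A neg_part + B).
  congr ft; have := pos_negE sA => e'.
  have -> : fc A pos_part = A + fc A neg_part by rewrite -{2}e' addrC subrKC || rewrite -{2}e' subrK.
  by rewrite {1}e; bopring hip.
rewrite (ftD h1 hC) (ftD h2 hB); lra.
Qed.

Lemma TC_split A : TC A -> exists B C, [/\ FT B, FT C, A = B - C & tnorm A = ft B + ft C].
Proof.
move=> [nA sA h1 h2]; exists (fc A pos_part), (fc A neg_part); split=> //.
by rewrite pos_negE.
Qed.
Lemma FT_TC A : FT A -> TC A /\ rtr A = ft A.
Proof.
move=> hA; have := @rtr_diff A A 0 hA FT0; rewrite subr0 => /(_ erefl)[h ->].
by rewrite ft0 subr0.
Qed.
Lemma rtrD A B : TC A -> TC B -> TC (A + B) /\ rtr (A + B) = rtr A + rtr B.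
Proof.
move=> /TC_split[P [Q [hP hQ eA _]]] /TC_split[P' [Q' [hP' hQ' eB _]]].
have [_ ->] := rtr_diff hP hQ eA; have [_ ->] := rtr_diff hP' hQ' eB.
have [|h ->] := rtr_diff (FTD hP hP') (FTD hQ hQ') (A := A + B).
  by rewrite eA eB opprD addrACA.
by rewrite !ftD//; split=> //; ring.
Qed.
Lemma rtrN A : TC A -> TC (- A) /\ rtr (- A) = - rtr A.
Proof.
move=> /TC_split[P [Q [hP hQ eA _]]].
have [_ ->] := rtr_diff hP hQ eA.
have [|h ->] := rtr_diff hQ hP (A := - A); first by rewrite eA opprB.
by split=> //; ring.
Qed.
Lemma rtrB A B : TC A -> TC B -> TC (A - B) /\ rtr (A - B) = rtr A - rtr B.
Proof. by move=> hA hB; have [h e] := rtrN hB; have := rtrD hA h; rewrite e. Qed.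
Lemma rtrZ a A : TC A -> TC (a *: A) /\ rtr (a *: A) = a * rtr A.
Proof.
move=> hA; have pos b : 0 <= b -> TC (b *: A) /\ rtr (b *: A) = b * rtr A.
  move=> b0; have /TC_split[P [Q [hP hQ eA _]]] := hA.
  have [_ ->] := rtr_diff hP hQ eA.
  have [|h ->] := rtr_diff (FTZ b0 hP) (FTZ b0 hQ) (A := b *: A).
    by rewrite eA scalerBr.
  by rewrite !ftZ//; split=> //; ring.
have [a0|a0] := leP 0 a; first exact: pos.
have [h1 h2] := pos (- a) ltac:(by rewrite oppr_ge0 ltW).
have := rtrN h1; rewrite h2 scaleNr opprK mulNr opprK; by [].
Qed.
Lemma TC0 : TC 0. Proof. by case: (FT_TC FT0). Qed.
Lemma rtr0 : rtr 0 = 0. Proof. by have [_ ->] := FT_TC FT0; rewrite ft0. Qed.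

Lemma rtr_psd A : TC A -> psd A -> 0 <= rtr A.
Proof.
move=> hA pA; have /TC_split[P [Q [hP hQ eA _]]] := hA.
have [_ ->] := rtr_diff hP hQ eA; rewrite subr_ge0; apply: ft_le => //.
by rewrite -eA.
Qed.
Lemma rtr_abs A B : TC A -> FT B -> psd (B - A) -> psd (B + A) -> `|rtr A| <= ft B.
Proof.
move=> hA hB h1 h2; have [tB rB] := FT_TC hB.
have [t1 r1] := rtrB tB hA; have [t2 r2] := rtrD tB hA.
have := rtr_psd t1 h1; have := rtr_psd t2 h2; rewrite r1 r2 rB => g1 g2.
rewrite ler_norml; apply/andP; split; lra.
Qed.

(* Polarization of [tau (Z S Z') = tau (G Z' Z G)], where [S = G^2]. *)
Lemma rtr_polar S G Z Z' Y Y' : adjp Z Z' -> adjp Y Y' -> N Z -> N Y -> FT S ->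
  N G -> psd G -> G * G = S ->
  [/\ TC (Z * S * Y' + Y * S * Z'), TC (G * (Y' * Z + Z' * Y) * G) &
      rtr (Z * S * Y' + Y * S * Z') = rtr (G * (Y' * Z + Z' * Y) * G)].
Proof.
move=> hZ hY nZ nY hS nG pG GG; have sG : sa G by case: pG.
have q X X' : adjp X X' -> N X -> [/\ FT (X * S * X'), FT (G * (X' * X) * G) &
    ft (X * S * X') = ft (G * (X' * X) * G)].
  move=> hX nX; have h1 := FT_sand hX nX hS; have e := tau_sand hX nX nG pG GG.
  split=> //; last by rewrite /ft e.
  split; last by rewrite -e; case: h1.
  apply: NP_sand => //; split; last exact: psd_sq.
  by apply: NM => //; exact: N_adj hX nX.
have [a1 b1 e1] := q _ _ hZ nZ; have [a2 b2 e2] := q _ _ hY nY.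
have [a3 b3 e3] := q _ _ (adjpD hip hZ hY) (ND nZ nY).
have [|t1 ->] := rtr_diff a3 (FTD a1 a2) (A := Z * S * Y' + Y * S * Z').
  by bopring hip.
have [|t2 ->] := rtr_diff b3 (FTD b1 b2) (A := G * (Y' * Z + Z' * Y) * G).
  by bopring hip.
by split=> //; rewrite !ftD// e1 e2 e3.
Qed.

(** For S = G^2 both traces equal that of G (Y' Z + Z' Y) G, by [rtr_polar] for the pairs (Z, Y) and
    (Y' Z, 1). The general case follows by taking differences. *)
Lemma rtr_cyc S Z Z' Y Y' : adjp Z Z' -> adjp Y Y' -> N Z -> N Y -> TC S ->
  [/\ TC (Z * S * Y' + Y * S * Z'), TC (Y' * Z * S + S * (Z' * Y)) &
      rtr (Z * S * Y' + Y * S * Z') = rtr (Y' * Z * S + S * (Z' * Y))].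
Proof.
move=> hZ hY nZ nY hS.
have pos P : FT P -> [/\ TC (Z * P * Y' + Y * P * Z'), TC (Y' * Z * P + P * (Z' * Y)) &
      rtr (Z * P * Y' + Y * P * Z') = rtr (Y' * Z * P + P * (Z' * Y))].
  move=> hP; have [G [nG pG GG]] : exists G, [/\ N G, psd G & G * G = P] by apply: NP_sqrt; case: hP.
  have [t1 t2 e] := rtr_polar hZ hY nZ nY hP nG pG GG.
  have hYZ : adjp (Y' * Z) (Z' * Y) by apply: adjpM => //; exact: adjpC.
  have nYZ : N (Y' * Z)%R by apply: NM => //; exact: N_adj hY nY.
  have [t3 t4 e'] := rtr_polar hYZ (sa1 ip) nYZ N1 hP nG pG GG.
  move: t3 e'; rewrite !mulr1 !mul1r => t3 e'.
  by split=> //; rewrite e e' addrC.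
have /TC_split[P [Q [hP hQ eA _]]] := hS.
have [t1 t2 e] := pos _ hP; have [t1' t2' e'] := pos _ hQ.
have [t3 r3] := rtrB t1 t1'; have [t4 r4] := rtrB t2 t2'.
have -> : Z * S * Y' + Y * S * Z' = Z * P * Y' + Y * P * Z' - (Z * Q * Y' + Y * Q * Z').
  by rewrite eA; bopring hip.
have -> : Y' * Z * S + S * (Z' * Y) = Y' * Z * P + P * (Z' * Y) - (Y' * Z * Q + Q * (Z' * Y)).
  by rewrite eA; bopring hip.
by split=> //; rewrite r3 r4 e e'.
Qed.

Lemma rtr_GXG S G X : sa X -> N X -> FT S -> N G -> psd G -> G * G = S ->
  TC (G * X * G) /\ `|rtr (G * X * G)| <= opnorm X * ft S.
Proof.
move=> sX nX hS nG pG GG.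
have [_ t _] := rtr_polar (adjpZ hip 2^-1 sX) (sa1 ip) (NZ _ nX) N1 hS nG pG GG.
have e : 1 * (2^-1 *: X) + 2^-1 *: X * 1 = X by rewrite mul1r mulr1; bopring hip.
rewrite e in t; split=> //; rewrite -ftZ ?opnorm_ge0//.
have [h1 h2] := psd_GXG pG sX (lexx (opnorm X)).
rewrite GG in h1 h2.
by apply: rtr_abs => //; apply: FTZ => //; exact: opnorm_ge0.
Qed.

(** The real part of tau(U W), with the product symmetrized so that only traces of self-adjoint
    operators occur. *)
Definition beta U W : R := 2^-1 * rtr (U * W + W * U).

Lemma beta_FT U W : sa U -> N U -> FT W -> TC (U * W + W * U) /\ `|beta U W| <= opnorm U * ft W.
Proof.
move=> sU nU hW; have [G [nG pG GG]] : exists G, [/\ N G, psd G & G * G = W] by apply: NP_sqrt; case: hW.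
have [t1 t2 e] := rtr_polar sU (sa1 ip) nU N1 hW nG pG GG.
move: t1 t2 e; rewrite !mulr1 !mul1r => t1 t2 e; split=> //.
have [t3 b] := rtr_GXG sU nU hW nG pG GG.
rewrite /beta e (_ : G * (U + U) * G = 2 *: (G * U * G)); last by bopring hip.
by have [_ ->] := rtrZ 2 t3; rewrite mulrA mulVf// mul1r.
Qed.

Lemma beta_TC U W : sa U -> N U -> TC W -> TC (U * W + W * U) /\ `|beta U W| <= opnorm U * tnorm W.
Proof.
move=> sU nU hW; have /TC_split[P [Q [hP hQ eA ->]]] := hW.
have [t1 b1] := beta_FT sU nU hP; have [t2 b2] := beta_FT sU nU hQ.
have [t r] := rtrB t1 t2.
have e : U * W + W * U = U * P + P * U - (U * Q + Q * U) by rewrite eA; bopring hip.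
rewrite e; split=> //; rewrite /beta e r mulrBr [leRHS]mulrDr.
by apply: le_trans (ler_normB _ _) _; exact: lerD.
Qed.

Lemma betaDl U V W : TC (U * W + W * U) -> TC (V * W + W * V) ->
  beta (U + V) W = beta U W + beta V W.
Proof.
move=> t1 t2; have [_ r] := rtrD t1 t2; rewrite /beta.
rewrite (_ : (U + V) * W + W * (U + V) = U * W + W * U + (V * W + W * V)); last by bopring hip.
by rewrite r mulrDr.
Qed.
Lemma betaDr U W W' : TC (U * W + W * U) -> TC (U * W' + W' * U) ->
  beta U (W + W') = beta U W + beta U W'.
Proof.
move=> t1 t2; have [_ r] := rtrD t1 t2; rewrite /beta.
rewrite (_ : U * (W + W') + (W + W') * U = U * W + W * U + (U * W' + W' * U)); last by bopring hip.
by rewrite r mulrDr.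
Qed.
Lemma betaZl a U W : TC (U * W + W * U) -> beta (a *: U) W = a * beta U W.
Proof.
move=> t1; have [_ r] := rtrZ a t1; rewrite /beta bopAl bopAr -scalerDr r; ring.
Qed.
Lemma betaZr a U W : TC (U * W + W * U) -> beta U (a *: W) = a * beta U W.
Proof.
move=> t1; have [_ r] := rtrZ a t1; rewrite /beta bopAl bopAr -scalerDr r; ring.
Qed.
Lemma betaC U W : beta U W = beta W U.
Proof. by rewrite /beta addrC. Qed.

(* [k1^2 - k2^2] is the Jordan product of [k1 - k2] and [k1 + k2]. *)
Lemma beta_sqr_dist U k1 k2 : sa U -> N U -> FT k1 -> FT k2 -> FT (k1 * k1) -> FT (k2 * k2) ->
  `|beta U (k1 * k1) - beta U (k2 * k2)| <= opnorm U * opnorm (k1 - k2) * (ft k1 + ft k2).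
Proof.
move=> sU nU h1 h2 q1 q2; have [t1 _] := beta_FT sU nU q1; have [t2 _] := beta_FT sU nU q2.
have [_ r] := rtrB t1 t2.
have hS := FTD h1 h2; set S := k1 + k2 in hS; pose D := k1 - k2.
have [G [nG pG GG]] : exists G, [/\ N G, psd G & G * G = S] by apply: NP_sqrt; case: hS.
have [[n1 [s1 _]] _] := h1; have [[n2 [s2 _]] _] := h2.
have nD : N D by exact: NB. have sD : sa D by exact: saB.
have [ta tb e1] := rtr_polar (adjpM sU sD) (sa1 ip) (NM nU nD) N1 hS nG pG GG.
have [tc td e2] := rtr_polar sU sD nU nD hS nG pG GG.
move: ta tb e1 tc td e2; rewrite !mulr1 !mul1r => ta tb e1 tc td e2.
pose X := D * U + U * D.
have sX : sa X by move: (adjpD hip (adjpM sD sU) (adjpM sU sD)); rewrite /sa /X [in X in adjp _ X]addrC.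
have nX : N X by apply: ND; apply: NM.
have [tX bX] := rtr_GXG sX nX hS nG pG GG.
have -> : beta U (k1 * k1) - beta U (k2 * k2) = 2^-1 * rtr (G * X * G).
  rewrite /beta -mulrBr -r; congr (_ * _).
  have [tsum rsum] := rtrD ta tc.
  have e : U * (k1 * k1) + k1 * k1 * U - (U * (k2 * k2) + k2 * k2 * U) =
    2^-1 *: (U * D * S + S * (D * U) + (U * S * D + D * S * U)).
    by rewrite /D /S; bopring hip.
  rewrite e; have [_ ->] := rtrZ 2^-1 tsum; rewrite rsum e1 e2.
  have -> : G * (U * D + D * U) * G = G * X * G by rewrite /X addrC.
  by rewrite /X; field.
rewrite normrM ger0_norm ?invr_ge0//.
apply: (@le_trans _ _ (2^-1 * (opnorm X * ft S))); first by rewrite ler_wpM2l ?invr_ge0.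
rewrite -ftD// mulrA ler_wpM2r//; first exact: (FT_ge0 hS).
rewrite mulrC ler_pdivrMr//; apply: le_trans (opnormD _ _) _.
have h3 := opnormM D U; have h4 := opnormM U D; rewrite -/D; lra.
Qed.

End VonNeumann.

(** * Counting functions and the ideals Li *)

Section Tame.
Context {R : realType} {H : completeNormedModType R[i]} (ip : H -> H -> R[i]).
Context (hip : hilbert_inner_product ip).
Context (N : set (H -> H)) (hN : von_neumann_algebra ip N).
Context (tau : (H -> H) -> \bar R) (htau : fns_trace ip N tau).
Local Notation "<< x , y >>" := (rip ip x y).
Local Notation sa := (sa ip).
Local Notation psd := (psd ip).
Local Notation fc := (fc ip).
Local Notation NP := (NP ip N).
Local Notation FT := (FT ip N tau).
Local Notation ft := (ft tau).
Implicit Types (A B T S C U W X Y Z G K : bop H) (x y : H) (p e l L c : R).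

Lemma op_leE A B : op_le ip A B <-> psd (B - A).
Proof. by rewrite (psd_positive hip). Qed.

(** An increasing sequence is a directed set whose least upper bound in the cone is its strong
    limit, so normality of the trace applies. *)
Lemma tau_slim_le (u : nat -> bop H) S (c : R) : (forall n, NP (u n)) ->
  (forall n, psd (u n.+1 - u n)) -> slim u S -> NP S ->
  (forall n, (tau (u n) <= c%:E)%E) -> (tau S <= c%:E)%E.
Proof.
move=> hu inc lu nS hc.
have mono m n : (m <= n)%N -> psd (u n - u m).
  elim: n => [|n ih]; first by rewrite leqn0 => /eqP ->; rewrite subrr; exact: (psd0 hip).
  rewrite leq_eqVlt => /orP[/eqP ->|]; first by rewrite subrr; exact: (psd0 hip).
  by rewrite ltnS => /ih h; exact: (psd_trans hip h).
have upper n : psd (S - u n).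
  have h : slim (fun k => u (k + n)%N - u n) (S - u n).
    apply: slimB; last exact: slim_cst.
    by move=> x; have := lu x; rewrite -(cvg_shiftn n).
  by apply: (slim_psd hip _ h) => k; apply: mono; exact: leq_addl.
have -> : tau S = ereal_sup (tau @` [set (u n : H -> H) | n in setT]).
  apply: (trace_normal htau).
  - by move=> _ [n _ <-]; exact: (NP_cone hip).
  - split; first by exists (u 0%N), 0%N.
    move=> _ _ [m _ <-] [n _ <-]; exists (u (maxn m n)); split; first by exists (maxn m n).
    + by apply/op_leE/mono; exact: leq_maxl.
    + by apply/op_leE/mono; exact: leq_maxr.
  - split; first exact: (NP_cone hip).
    + by move=> _ [n _ <-]; apply/op_leE.
    + move=> V [nV /(positive_psd hip)[W -> pW]] hV; apply/op_leE.
      have h : slim (fun n => W - u n) (W - S) by apply: slimB => //; exact: slim_cst.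
      by apply: (slim_psd hip _ h) => k; apply/op_leE/hV; exists k.
by apply: ge_ereal_sup => _ [_ [n _ <-] <-].
Qed.

Lemma FT_slim_le (u : nat -> bop H) S (c : R) : (forall n, FT (u n)) ->
  (forall n, psd (u n.+1 - u n)) -> slim u S -> NP S ->
  (forall n, ft (u n) <= c) -> FT S /\ ft S <= c.
Proof.
move=> hu inc lu nS hc.
have h : (tau S <= c%:E)%E.
  apply: (tau_slim_le _ inc lu nS) => [n|n]; first by case: (hu n).
  by rewrite (FT_fin hip htau (hu n)) lee_fin; exact: hc.
have f : FT S by split=> //; apply: le_lt_trans h _; rewrite ltry.
by split=> //; rewrite -lee_fin /ft -(FT_fin hip htau f).
Qed.

Lemma slim_norm (u : nat -> bop H) S : opnorm (u n - S) @[n --> \oo] --> (0 : R) -> slim u S.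
Proof.
move=> h x; apply: (cvg_rnormP _ _).2.
have h' : opnorm (u n - S) * rnorm x @[n --> \oo] --> (0 : R).
  by rewrite -[X in _ --> X](mul0r (rnorm x)); apply: cvgM => //; exact: cvg_cst.
apply: (squeeze_cvgr _ (cvg_cst (0 : R)) h'); near=> n.
by rewrite rnorm_ge0/= -[u n x - S x]/((u n - S) x) opnormP.
Unshelve. all: end_near. Qed.

Definition chi l (u : R) : R := if l < `|u| then 1 else 0.

Lemma chiE l : chi l = \1_([set u : R | l < `|u|]) :> (R -> R).
Proof.
apply/funext => u; rewrite indicE /chi; case: ifPn => h; first by rewrite mem_set.
by rewrite memNset//; exact/negP.
Qed.

Lemma measurable_absgt l : measurable ([set u : R | l < `|u|] : set (measurableTypeR R)).
Proof.
have -> : [set u : R | l < `|u|] = (fun u : measurableTypeR R => `|u| : measurableTypeR R) @^-1` ray l.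
  by apply/seteqP; split=> u; rewrite /= rayE.
have [mf _] := @lb_norm R id (@lb_id R).
by rewrite -[X in measurable X]setTI; apply: mf => //; exact: measurable_ray.
Qed.

Lemma lb_chi l : lb (chi l).
Proof. by rewrite chiE; apply: lb_indic; exact: measurable_absgt. Qed.
Lemma chi_ge0 l u : 0 <= chi l u. Proof. by rewrite /chi; case: ifP. Qed.

Definition gcut l A := fc A (chi l).

Lemma cut_proj l A : sa A -> isproj ip (gcut l A).
Proof. by move=> sA; rewrite /gcut chiE; apply: (fc_proj hip) => //; exact: measurable_absgt. Qed.
Lemma NP_cut l A : N A -> sa A -> NP (gcut l A).
Proof. by move=> nA sA; apply: (NP_fc hip hN) => //; [exact: lb_chi|move=> u _; exact: chi_ge0]. Qed.

(** Compressing A <= c + K by the spectral projection Q of A above l gives (l - c) Q <= Q K Q, a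
    Chebyshev inequality. *)
Lemma key_ray A K c l : N A -> sa A -> FT K -> c < l -> psd (sc c + K - A) ->
  FT (fc A (\1_(ray l))) /\ (l - c) * ft (fc A (\1_(ray l))) <= ft K.
Proof.
move=> nA sA hK cl h; have lr : lb (\1_(ray l) : R -> R) by apply: lb_indic; exact: measurable_ray.
pose Q := fc A (\1_(ray l)); have pQ : isproj ip Q by apply: (fc_proj hip) => //; exact: measurable_ray.
have [sQ QQ] := pQ.
have nQ : N Q by exact: (N_fc hip hN).
have nK : NP K by case: hK.
have hQKQ : FT (Q * K * Q) by apply: (FT_sand hip hN htau).
have fQKQ : ft (Q * K * Q) <= ft K.
  have := tau_sand_le hip hN htau sQ nQ nK; rewrite (FT_fin hip htau hQKQ) (FT_fin hip htau hK) -EFinM lee_fin.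
  move=> /le_trans; apply; rewrite ler_piMl ?(FT_ge0 hip htau hK)//.
  by rewrite expr_le1 ?opnorm_ge0//; exact: (isproj_norm hip).
have h1 : psd (A * Q - l *: Q).
  rewrite -[A in A * Q](fc_id hip sA) /Q -(fcM hip)//; last exact: lb_id.
  rewrite -(fcZ hip)// -(fcB hip)//; [|by apply: lbM => //; exact: lb_id|exact: lbZ].
  apply: (fc_psd hip) => //.
    by apply: lbB; [apply: lbM => //; exact: lb_id|exact: lbZ].
  move=> u _; rewrite -mulrBl indicE; have [|] := boolP (u \in ray l).
    by rewrite inE rayE mulr1 => /ltW; rewrite subr_ge0.
  by rewrite mulr0.
have AQ : Q * A * Q = A * Q by rewrite -(fc_commT hip sA lr) -mulrA QQ.
have h2 : psd (Q * K * Q - (l - c) *: Q).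
  have := psdD hip h1 (psd_sandwich hip sQ h); congr psd.
  rewrite mulrBr mulrBl AQ mulrDr mulrDl scMr bopAl QQ scalerBl; bopring hip.
have l0 : 0 < l - c by rewrite subr_gt0.
have nQ' : NP Q by split=> //; exact: (isproj_psd hip).
have hlQ : FT ((l - c) *: Q).
  by apply: (FT_le hip hN htau _ hQKQ h2); apply: (NPZ hip hN) => //; exact: ltW.
have hQ : FT Q.
  have := FTZ hip hN htau (_ : 0 <= (l - c)^-1) hlQ.
  by rewrite scalerA mulVf ?gt_eqF// scale1r; apply; rewrite invr_ge0 ltW.
split=> //; rewrite -(ftZ hip htau (ltW l0) hQ); apply: le_trans fQKQ.
exact: (ft_le hip hN htau).
Qed.

Lemma key_cut A K c l : N A -> sa A -> FT K -> 0 <= l -> c < l ->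
  psd (sc c + K - A) -> psd (sc c + K + A) ->
  FT (gcut l A) /\ (l - c) * ft (gcut l A) <= 2 * ft K.
Proof.
move=> nA sA hK l0 cl h1 h2.
have lr : lb (\1_(ray l) : R -> R) by apply: lb_indic; exact: measurable_ray.
have [f1 b1] := key_ray nA sA hK cl h1.
have [|f2 b2] := key_ray (NN hN nA) (saN hip sA) hK cl; first by rewrite opprK.
have e : gcut l A = fc A (\1_(ray l)) + fc (- A) (\1_(ray l)).
  rewrite (fc_opp hip sA lr) -(fcD hip)//; last exact: lb_comp lr (lbN (@lb_id R)).
  congr fc; apply/funext => u; rewrite /chi !indicE.
  have r v : (v \in ray l) = (l < v) by apply/idP/idP; rewrite inE rayE.
  by rewrite !r ltr_normr; case: (ltP l u) => h; case: (ltP l (- u)) => h' /=; lra.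
rewrite e; split; first exact: (FTD hip hN htau).
by rewrite (ftD hip htau)//; lra.
Qed.

Lemma cut_dom l A : 0 <= l -> sa A -> psd (sc l + (opnorm A + 1) *: gcut l A - A) /\
  psd (sc l + (opnorm A + 1) *: gcut l A + A).
Proof.
move=> l0 sA; have lc := lb_chi l.
have e : sc l + (opnorm A + 1) *: gcut l A = fc A (fun u => l + (opnorm A + 1) * chi l u).
  by rewrite (fcD hip)// ?(fcZ hip)// ?(fc_cst hip)//; [exact: lb_cst|exact: lbZ].
have lf : lb (fun u => l + (opnorm A + 1) * chi l u).
  by apply: lbD; [exact: lb_cst|exact: lbZ].
have hb u : `|u| <= opnorm A + 1 -> `|u| <= l + (opnorm A + 1) * chi l u.
  by rewrite /chi; case: ifPn; rewrite -?leNgt => h1 h2; have := normr_ge0 u; lra.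
rewrite e; split.
  rewrite -[A in _ - A](fc_id hip sA); apply: (fc_le hip) => //; first exact: lb_id.
  by move=> u /hb; apply: le_trans; exact: ler_norm.
have -> : fc A (fun u => l + (opnorm A + 1) * chi l u) + A =
    fc A (fun u => l + (opnorm A + 1) * chi l u) - fc A (fun u => - u).
  by rewrite (fcN hip sA (@lb_id R)) (fc_id hip)// opprK.
apply: (fc_le hip) => //; first exact: lbN (@lb_id R).
by move=> u /hb; apply: le_trans; rewrite -normrN; exact: ler_norm.
Qed.

Lemma FT_cut_le l l' A : N A -> sa A -> l <= l' -> FT (gcut l A) ->
  FT (gcut l' A) /\ ft (gcut l' A) <= ft (gcut l A).
Proof.
move=> nA sA ll h; have d : psd (gcut l A - gcut l' A).
  apply: (fc_le hip) => //; [exact: lb_chi|exact: lb_chi|move=> u _].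
  by rewrite /chi; case: ifP => h1; case: ifP => h2 //; lra.
have f : FT (gcut l' A) by apply: (FT_le hip hN htau _ h d); exact: NP_cut.
by split=> //; exact: (ft_le hip hN htau).
Qed.

(* The eigenvalue counting functions are controlled at the scale
   [l = L ^ (-p)], so that [1 / (log t) ^ p] decay reads as exponential growth. *)
Definition eb p e c A := forall L, 1 <= L ->
  FT (gcut (L `^ (- p)) A) /\ ft (gcut (L `^ (- p)) A) <= c * expR (e * L).

(** Domination of A and -A by a threshold plus an operator of controlled trace. Unlike a bound on
    counting functions, it adds up and passes to dominated operators; [eb_fb] and [fb_eb] translate
    between the two. *)
Definition fb p e c A := forall L, 1 <= L -> exists K, [/\ FT K,
  ft K <= c * expR (e * L), psd (sc (L `^ (- p)) + K - A) & psd (sc (L `^ (- p)) + K + A)].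

Lemma fb_mono p e c e' c' A : 0 <= c -> e <= e' -> c <= c' -> fb p e c A -> fb p e' c' A.
Proof.
move=> c0 ee cc h L L1; have [K [f b p1 p2]] := h L L1; exists K; split=> //.
apply: (le_trans b); apply: ler_pM => //.
by rewrite ler_expR ler_wpM2r// (le_trans _ L1).
Qed.

Lemma eb_fb p e c A : N A -> sa A -> eb p e c A -> fb p e ((opnorm A + 1) * c) A.
Proof.
move=> nA sA h L L1; have [f b] := h L L1; have [h1 h2] := cut_dom (powR_ge0 L (- p)) sA.
have o0 : 0 <= opnorm A + 1 by rewrite addr_ge0 ?opnorm_ge0.
exists ((opnorm A + 1) *: gcut (L `^ (- p)) A); split=> //; first exact: (FTZ hip hN htau).
by rewrite (ftZ hip htau)// -mulrA ler_wpM2l.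
Qed.

(** The factor on L that halves the threshold L^(-p). It is the price, in the exponential rate, of
    adding two operators. *)
Definition dbl p : R := 2 `^ p^-1.
Lemma dbl_ge1 p : 0 < p -> 1 <= dbl p.
Proof. by move=> p0; rewrite /dbl -[X in X <= _](powRr0 2); apply: ler_powR; rewrite ?ler1n// invr_ge0 ltW. Qed.
Lemma dblE p L : 0 < p -> 0 <= L -> 2 * (dbl p * L) `^ (- p) = L `^ (- p).
Proof.
move=> p0 L0; rewrite powRM ?powR_ge0// mulrA -powRrM mulrN mulVf ?gt_eqF//.
by rewrite powR_inv1// divff// mul1r.
Qed.

Lemma fb_comb p e c c' A B X : 0 < p -> 
  (forall l K1 K2, psd (sc l + K1 - A) -> psd (sc l + K1 + A) ->
     psd (sc l + K2 - B) -> psd (sc l + K2 + B) ->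
     psd (sc (2 * l) + (K1 + K2) - X) /\ psd (sc (2 * l) + (K1 + K2) + X)) ->
  fb p e c A -> fb p e c' B -> fb p (dbl p * e) (c + c') X.
Proof.
move=> p0 h hA hB L L1; have L0 : 0 <= L by exact: le_trans L1.
have d1 := dbl_ge1 p0; have d0 : 0 <= dbl p by exact: le_trans d1.
have L1' : 1 <= dbl p * L by rewrite -[1]mulr1 ler_pM.
have [K [f b h1 h2]] := hA _ L1'; have [K' [f' b' h1' h2']] := hB _ L1'.
have := h _ _ _ h1 h2 h1' h2'; rewrite dblE// => -[g1 g2].
exists (K + K'); split=> //; first exact: (FTD hip hN htau).
rewrite (ftD hip htau)// mulrDl (mulrC (dbl p)) -mulrA; exact: lerD.
Qed.

Lemma fbD p e c c' A B : 0 < p -> fb p e c A -> fb p e c' B ->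
  fb p (dbl p * e) (c + c') (A + B).
Proof.
move=> p0; apply: fb_comb => // l K1 K2 h1 h2 h3 h4.
rewrite mulrDl mul1r scD; split.
  by have := psdD hip h1 h3; congr psd; bopring hip.
by have := psdD hip h2 h4; congr psd; bopring hip.
Qed.

Lemma fb_dom p e c c' A B X : 0 < p -> psd (A + B - X) -> psd (A + B + X) ->
  fb p e c A -> fb p e c' B -> fb p (dbl p * e) (c + c') X.
Proof.
move=> p0 g1 g2; apply: fb_comb => // l K1 K2 h1 h2 h3 h4.
rewrite mulrDl mul1r scD; split.
  by have := psdD hip g1 (psdD hip h1 h3); congr psd; bopring hip.
by have := psdD hip g2 (psdD hip h1 h3); congr psd; bopring hip.
Qed.

(** For |s| <= 1 the operator s A is a convex combination of A and -A, so the same K serves. *)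
Lemma fbZ p e c s A : `|s| <= 1 -> fb p e c A -> fb p e c (s *: A).
Proof.
rewrite ler_norml => /andP[s1 s2] h L L1; have [K [f b h1 h2]] := h L L1.
exists K; split=> //.
  have := psdD hip (psdZ hip (_ : 0 <= 2^-1 * (1 + s)) h1) (psdZ hip (_ : 0 <= 2^-1 * (1 - s)) h2).
  move=> /(_ ltac:(lra) ltac:(lra)); congr psd.
  move: (sc _ + K) => V; rewrite !scalerDr scalerN addrACA -!scalerDl -scaleNr -scalerDl.
  rewrite (_ : 2^-1 * (1 + s) + 2^-1 * (1 - s) = 1); last by field.
  rewrite (_ : - (2^-1 * (1 + s)) + 2^-1 * (1 - s) = - s); last by field.
  by rewrite scale1r scaleNr.
have := psdD hip (psdZ hip (_ : 0 <= 2^-1 * (1 - s)) h1) (psdZ hip (_ : 0 <= 2^-1 * (1 + s)) h2).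
move=> /(_ ltac:(lra) ltac:(lra)); congr psd.
move: (sc _ + K) => V; rewrite !scalerDr scalerN addrACA -!scalerDl -scaleNr -scalerDl.
rewrite (_ : 2^-1 * (1 - s) + 2^-1 * (1 + s) = 1); last by field.
rewrite (_ : - (2^-1 * (1 - s)) + 2^-1 * (1 + s) = s); last by field.
by rewrite scale1r.
Qed.

Lemma fb_half p e c A : 0 < p -> fb p e c A -> fb (p / 2) e c A.
Proof.
move=> p0 h L L1; have [K [f b h1 h2]] := h L L1; exists K; split=> //.
  have := psdD hip h1 (psd_scalar hip (_ : 0 <= L `^ (- (p / 2)) - L `^ (- p))).
  move=> /(_ _)/wrap[]; first by rewrite subr_ge0; apply: ler_powR => //; lra.
  by congr psd; rewrite scD scN; bopring hip.
have := psdD hip h2 (psd_scalar hip (_ : 0 <= L `^ (- (p / 2)) - L `^ (- p))).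
move=> /(_ _)/wrap[]; first by rewrite subr_ge0; apply: ler_powR => //; lra.
by congr psd; rewrite scD scN; bopring hip.
Qed.

Lemma expR_absorb e L : 0 < e -> 0 <= L -> L <= expR (e * L) / e.
Proof.
move=> e0 L0; rewrite ler_pdivlMr// mulrC; apply: le_trans (expR_ge1Dx _); lra.
Qed.

(** [key_cut] at the threshold l = L^(-p), with domination at l/2, leaves the factor 2/l = 2 L^p; as
    p <= 1, L^p is absorbed by exp(e' L) / e'. The other factor 2 counts the two tails of A. *)
Lemma fb_eb p e e' c A : N A -> sa A -> 0 < p -> p <= 1 -> 0 < e' -> 0 <= c ->
  fb p e c A -> eb p (dbl p * e + e') (4 * c / e') A.
Proof.
move=> nA sA p0 p1 e'0 c0 h L L1; have L0 : 0 < L by exact: lt_le_trans L1.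
have d1 := dbl_ge1 p0; have d0 : 0 <= dbl p by exact: le_trans d1.
have L1' : 1 <= dbl p * L by rewrite -[1]mulr1 ler_pM// ltW.
have [K [f b h1 h2]] := h _ L1'; set l := L `^ (- p).
have l0 : 0 < l by exact: powR_gt0.
have lE : (dbl p * L) `^ (- p) = l / 2 by rewrite /l -(dblE p0 (ltW L0)); field.
rewrite lE in h1 h2.
have [|g1 g2] := key_cut nA sA f (ltW l0) _ h1 h2; first by lra.
split=> //.
have Lp : L `^ p * l = 1 by rewrite /l powRN divff// gt_eqF// powR_gt0.
have Lp0 : 0 <= L `^ p by exact: powR_ge0.
have LL : L `^ p <= expR (e' * L) / e'.
  by apply: le_trans (expR_absorb e'0 (ltW L0)); rewrite -{2}[L](powRr1 (ltW L0)) ler_powR.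
have t0 := FT_ge0 hip htau g1; rewrite -/(ft _) in t0.
have -> : ft (gcut l A) = L `^ p * (2 * ((l - l / 2) * ft (gcut l A))).
  by rewrite (_ : _ * (2 * _) = (L `^ p * l) * ft (gcut l A)); [rewrite Lp mul1r|field].
apply: (@le_trans _ _ ((expR (e' * L) / e') * (2 * (2 * (c * expR (e * (dbl p * L))))))).
  apply: ler_pM => //; first by rewrite mulr_ge0// mulr_ge0//; lra.
  by rewrite ler_pM2l//; apply: (le_trans g2); rewrite ler_pM2l.
rewrite (mulrDl (dbl p * e)) expRD (_ : dbl p * e * L = e * (dbl p * L)); last by ring.
by rewrite le_eqVlt; apply/orP; left; apply/eqP; field; rewrite gt_eqF.
Qed.

(* The self-adjoint part of [Li_0^p], see [Li0_tame] and [tame_Li0]. *)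
Definition tame p A := [/\ N A, sa A & forall e, 0 < e -> exists2 c, 0 <= c & fb p e c A].

Lemma tame_eb p e A : 0 < p -> p <= 1 -> 0 < e -> tame p A -> exists2 c, 0 <= c & eb p e c A.
Proof.
move=> p0 p1 e0 [nA sA h]; have d1 := dbl_ge1 p0.
have d0 : 0 < dbl p by exact: lt_le_trans d1.
have [|c c0 hc] := h (e / 2 / dbl p); first by rewrite !divr_gt0.
have e20 : 0 < e / 2 by rewrite divr_gt0.
have := fb_eb nA sA p0 p1 e20 c0 hc.
rewrite (_ : dbl p * _ + _ = e); last by field; rewrite gt_eqF.
by move=> hh; exists (4 * c / (e / 2)) => //; rewrite divr_ge0 ?mulr_ge0// ltW.
Qed.

Lemma tame_of_eb p A : N A -> sa A -> (forall e, 0 < e -> exists2 c, 0 <= c & eb p e c A) -> tame p A.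
Proof.
move=> nA sA h; split=> // e /h[c c0 hc]; exists ((opnorm A + 1) * c).
  by rewrite mulr_ge0// addr_ge0// opnorm_ge0.
exact: eb_fb.
Qed.

Let tame2 p A B X : 0 < p -> N X -> sa X -> 
  (forall e c c', fb p e c A -> fb p e c' B -> fb p (dbl p * e) (c + c') X) ->
  tame p A -> tame p B -> tame p X.
Proof.
move=> p0 nX sX h [nA sA hA] [nB sB hB]; split=> // e e0; have d1 := dbl_ge1 p0.
have d0 : 0 < dbl p by exact: lt_le_trans d1.
have e1 : 0 < e / dbl p by exact: divr_gt0.
have [c c0 hc] := hA _ e1; have [c' c0' hc'] := hB _ e1.
exists (c + c'); first exact: addr_ge0.
by have := h _ _ _ hc hc'; rewrite mulrCA divff ?mulr1// gt_eqF.
Qed.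

Lemma tameD p A B : 0 < p -> tame p A -> tame p B -> tame p (A + B).
Proof.
move=> p0 hA hB; apply: (tame2 p0 _ _ _ hA hB).
- by case: hA => nA _ _; case: hB => nB _ _; exact: (ND hN).
- by case: hA => _ sA _; case: hB => _ sB _; exact: (saD hip).
- by move=> e c c'; exact: fbD.
Qed.

Lemma tame_dom p A B X : 0 < p -> N X -> sa X -> psd (A + B - X) -> psd (A + B + X) ->
  tame p A -> tame p B -> tame p X.
Proof. by move=> p0 nX sX h1 h2; apply: tame2 => // e c c'; exact: fb_dom. Qed.

Let tameZ1 p s A : `|s| <= 1 -> tame p A -> tame p (s *: A).
Proof.
move=> s1 [nA sA h]; split; [exact: (NZ hN)|exact: (saZ hip)|].
by move=> e /h[c c0 hc]; exists c => //; exact: fbZ.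
Qed.

Lemma tameZ p s A : 0 < p -> tame p A -> tame p (s *: A).
Proof.
move=> p0 hA; have [n hn] : exists n : nat, `|s| <= 2 ^+ n.
  exists (Num.truncn `|s|).+1; apply: ltW; apply: lt_le_trans (truncnS_gt _) _.
  by rewrite -natrX ler_nat ltnW// ltn_expl.
have e : s *: A = 2 ^+ n *: ((s / 2 ^+ n) *: A).
  by rewrite scalerA mulrC divfK// expf_neq0.
have hs : tame p ((s / 2 ^+ n) *: A).
  by apply: tameZ1 => //; rewrite normrM normfV (ger0_norm (exprn_ge0 _ _))// ler_pdivrMr ?exprn_gt0// mul1r.
rewrite e; elim: n {hn e} (_ *: A) hs => [|n ih] X hX; first by rewrite expr0 scale1r.
rewrite exprSr -scalerA; apply: ih; rewrite scaler_nat mulr2n; exact: tameD.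
Qed.

Lemma tameN p A : tame p A -> tame p (- A).
Proof. by move=> h; rewrite -scaleN1r; apply: tameZ1 => //; rewrite normrN1. Qed.
Lemma tameB p A B : 0 < p -> tame p A -> tame p B -> tame p (A - B).
Proof. by move=> p0 hA hB; apply: tameD => //; exact: tameN. Qed.
Lemma tame0 p : tame p 0.
Proof.
split; [exact: (N0 hN)|exact: (sa0 hip)|move=> e e0; exists 0 => // L L1].
exists 0; rewrite mul0r (ft0 hip hN htau) lexx; split=> //; first exact: (FT0 hip hN htau).
  by rewrite addr0 subr0; apply: (psd_scalar hip); exact: powR_ge0.
by rewrite !addr0; apply: (psd_scalar hip); exact: powR_ge0.
Qed.

Lemma tame_half p A : 0 < p -> tame p A -> tame (p / 2) A.
Proof. by move=> p0 [nA sA h]; split=> // e /h[c c0 hc]; exists c => //; exact: fb_half. Qed.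

Lemma cut_sq l A : sa A -> 0 <= l -> gcut (l ^+ 2) (A * A) = gcut l A.
Proof.
move=> sA l0; rewrite -expr2 -[X in gcut _ (X ^+ 2)](fc_id hip sA) -(fcX hip)//; last exact: lb_id.
rewrite /gcut (fc_comp hip)//; [|exact: lb_chi|by apply: lbX; exact: lb_id].
congr fc; apply/funext => u; rewrite /chi normrX.
by rewrite ltr_pXn2r ?nnegrE.
Qed.

(** Squaring the operator squares the threshold and leaves the spectral projection unchanged. *)
Lemma eb_sq p e c A : sa A -> eb (p / 2) e c A -> eb p e c (A * A).
Proof.
move=> sA h L L1; have [f b] := h L L1.
have e1 : L `^ (- p) = (L `^ (- (p / 2))) ^+ 2.
  by rewrite -powR_mulrn ?powR_ge0// -powRrM; congr (_ `^ _); field.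
by rewrite e1 cut_sq// ?powR_ge0.
Qed.

Lemma tame_sq p A : 0 < p -> p <= 1 -> tame (p / 2) A -> tame p (A * A).
Proof.
move=> p0 p1 hA; have [nA sA _] := hA; apply: tame_of_eb; [exact: (NM hN)|by apply: saM|].
move=> e e0; have [||c c0 hc] := tame_eb _ _ e0 hA; [lra|lra|].
by exists c; [exact: c0|exact: (eb_sq sA hc)].
Qed.

Lemma psd_anticomm X Y : sa X -> sa Y ->
  psd (X * X + Y * Y - (X * Y + Y * X)) /\ psd (X * X + Y * Y + (X * Y + Y * X)).
Proof.
move=> sX sY; split.
  by have := psd_sqr hip (saB hip sX sY); congr psd; bopring hip.
by have := psd_sqr hip (saD hip sX sY); congr psd; bopring hip.
Qed.

Lemma tame_anticomm p X Y : 0 < p -> p <= 1 -> tame (p / 2) X -> tame (p / 2) Y ->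
  tame p (X * Y + Y * X).
Proof.
move=> p0 p1 hX hY; have [nX sX _] := hX; have [nY sY _] := hY.
have [h1 h2] := psd_anticomm sX sY.
apply: (tame_dom p0 _ _ h1 h2); [|by move=> x y; rewrite !bopE (ripDl hip) (ripDr hip) sX sY sY sX addrC|exact: tame_sq|exact: tame_sq].
by apply: (ND hN); exact: (NM hN).
Qed.

Lemma tame_fc p (F : bop H) g h : 0 < p -> p <= 1 -> N F -> sa F -> lb g -> lb h ->
  (forall u, `|u| <= opnorm F + 1 -> `|g u| <= `|h u|) -> tame p (fc F h) -> tame p (fc F g).
Proof.
move=> p0 p1 nF sF lg lh gh hh.
have [nh sh _] := hh; have ng : N (fc F g) by exact: (N_fc hip hN).
have sg : sa (fc F g) by exact: (fc_sa hip).
apply: tame_of_eb => // e e0; have [c c0 hc] := tame_eb p0 p1 e0 hh.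
exists c; [exact: c0|move=> L L1]; have [f b] := hc L L1.
have d : psd (gcut (L `^ (- p)) (fc F h) - gcut (L `^ (- p)) (fc F g)).
  rewrite /gcut !(fc_comp hip)//; try exact: lb_chi.
  apply: (fc_le hip) => //; [exact: lb_comp (lb_chi _) _|exact: lb_comp (lb_chi _) _|].
  move=> u /gh gu; rewrite /chi; case: ifPn => h1; case: ifPn => h2 //.
  by move: h2; rewrite (lt_le_trans h1 gu).
have fg : FT (gcut (L `^ (- p)) (fc F g)) by apply: (FT_le hip hN htau _ f d); exact: NP_cut.
split; first exact: fg.
by apply: (le_trans _ b); apply: (ft_le hip hN htau fg f d).
Qed.

End Tame.

(** * Integrals on intervals and the comparison function 1/log *)

Section IntervalIntegral.
Context {R : realType}.
Implicit Types (a b c x t : R) (f g : R -> R).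
Local Notation mu := (@lebesgue_measure R).

Lemma itv_integrable f a b c : measurable_fun (`[a, b] : set (measurableTypeR R)) (f : measurableTypeR R -> measurableTypeR R) ->
  (forall t, a <= t <= b -> `|f t| <= c) -> mu.-integrable `[a, b] (EFin \o f).
Proof.
move=> mf hf; apply: measurable_bounded_integrable => //.
  rewrite /= lebesgue_measure_itv /=; case: ifP => // _.
  by rewrite -EFinB ltry.
exists c; split; first exact: num_real.
move=> y cy t; rewrite /= in_itv /= => /hf/le_trans; apply; exact: ltW.
Qed.

Lemma itv_integral_le f g a b : mu.-integrable `[a, b] (EFin \o f) ->
  mu.-integrable `[a, b] (EFin \o g) -> (forall t, a <= t <= b -> f t <= g t) ->
  \int[mu]_(t in `[a, b]) f t <= \int[mu]_(t in `[a, b]) g t.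
Proof. by move=> hf hg h; apply: le_Rintegral => // t; rewrite /= in_itv/=; exact: h. Qed.

Lemma itv_integral_cst a b c : a <= b -> \int[mu]_(t in `[a, b]) c = c * (b - a).
Proof.
move=> ab; rewrite Rintegral_cst//= lebesgue_measure_itv /= lte_fin.
case: ltP => h; first by rewrite -EFinB.
by rewrite (@le_anti _ _ a b) ?ab// subrr.
Qed.

Lemma itv_cst_integrable a b c : mu.-integrable `[a, b] (EFin \o (fun=> c)).
Proof. by apply: (itv_integrable (c := `|c|)) => // t _; rewrite lexx. Qed.

Lemma ln_le_id x : 0 < x -> ln x <= x.
Proof. by move=> x0; have := expR_ge1Dx (ln x); rewrite lnK ?posrE//; lra. Qed.

Lemma expR1_le4 : expR 1 <= 4 :> R.
Proof.
have h : 2^-1 <= expR (- 2^-1) :> R by apply: le_trans (expR_ge1Dx _); lra.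
have h2 : expR 2^-1 <= 2 :> R.
  by rewrite -[expR _]invrK -expRN -[leRHS]invrK lef_pV2// posrE ?expR_gt0.
rewrite [X in expR X](_ : 1 = 2^-1 + 2^-1); last by field.
by rewrite expRD (_ : 4 = 2 * 2); [apply: ler_pM => //; exact: expR_ge0|ring].
Qed.

Definition lnw t : R := (ln (t + expR 1))^-1.

Lemma ln_e_ge1 t : 0 <= t -> 1 <= ln (t + expR 1).
Proof.
move=> t0; rewrite -[X in X <= _](expRK 1) ler_ln ?posrE ?expR_gt0//; first by rewrite lerDr.
by rewrite ltr_wpDl// expR_gt0.
Qed.

Lemma lnw_itv t : 0 <= t -> 0 < lnw t <= 1.
Proof.
move=> t0; have h := ln_e_ge1 t0; have h0 : 0 < ln (t + expR 1) by exact: lt_le_trans h.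
by rewrite /lnw invr_gt0 h0/= invf_le1.
Qed.

Lemma lnw_anti t t' : 0 <= t -> t <= t' -> lnw t' <= lnw t.
Proof.
move=> t0 tt; have t'0 := le_trans t0 tt.
have h : 0 < ln (t + expR 1) by apply: lt_le_trans (ln_e_ge1 t0).
have h' : 0 < ln (t' + expR 1) by apply: lt_le_trans (ln_e_ge1 t'0).
rewrite /lnw lef_pV2 ?posrE// ler_ln ?posrE ?lerD2r//.
  by rewrite ltr_wpDl// expR_gt0.
by rewrite ltr_wpDl// expR_gt0.
Qed.

Lemma measurable_anti f a b : 0 <= a -> (forall t t', 0 <= t -> t <= t' -> f t' <= f t) ->
  measurable_fun (`[a, b] : set (measurableTypeR R)) (f : measurableTypeR R -> measurableTypeR R).
Proof.
move=> a0 h; apply: (eq_measurable_fun (fun t => f (Num.max t 0))).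
  by move=> t; rewrite inE /= in_itv /= => /andP[at_ _]; rewrite max_l// (le_trans a0).
apply: nonincreasing_measurable => // s t st; apply: h; first by rewrite le_max lexx orbT.
by rewrite ge_max !le_max st lexx orbT.
Qed.

Lemma lnw_integrable a b : 0 <= a -> mu.-integrable `[a, b] (EFin \o lnw).
Proof.
move=> a0; apply: (itv_integrable (c := 1)); first exact: measurable_anti a0 lnw_anti.
move=> t /andP[at_ _]; have /andP[h1 h2] := lnw_itv (le_trans a0 at_).
by rewrite ger0_norm// ltW.
Qed.

(** The integral is split at s = sqrt(x). Below s the integrand is at most 1, and s <= 6 x lnw(x)
    because x + expR 1 <= (3 s)^2. Above s it is at most lnw(s) <= 2 lnw(x), because (s + expR 1)^2
    >= x + expR 1. Hence 8 = 6 + 2. *)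
Lemma lnw_integral_le x : 1 <= x -> \int[mu]_(t in `[0, x]) lnw t <= 8 * x * lnw x.
Proof.
move=> x1; have x0 : 0 <= x by exact: le_trans x1.
pose s := Num.sqrt x; have s1 : 1 <= s by rewrite -sqrtr1 ler_sqrt ?ltr01 // (lt_le_trans _ x1).
have ss : s * s = x by rewrite -expr2 sqr_sqrtr.
have s0 : 0 <= s by exact: le_trans s1.
have sx : s <= x by rewrite -ss ler_peMr.
have /andP[w0 w1] := lnw_itv x0.
have e0 := @expR_gt0 R 1.
have lx0 : 0 < ln (x + expR 1) by rewrite -invr_gt0.
have hs : lnw s <= 2 * lnw x.
  rewrite /lnw -[leRHS]invrK invfM invrK lef_pV2 ?posrE; last 2 first.
  - by apply: lt_le_trans (ln_e_ge1 s0).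
  - by rewrite mulr_gt0 ?invr_gt0.
  rewrite mulrC ler_pdivrMr// mulr_natr -lnXn; last by rewrite ltr_wpDl.
  rewrite ler_ln ?posrE ?exprn_gt0 ?ltr_wpDl// expr2 mulrDl !mulrDr ss.
  have : expR 1 <= s * expR 1 by rewrite ler_peMl// ltW.
  have : 0 <= expR 1 * s by rewrite mulr_ge0// ltW.
  have : 0 <= expR 1 * expR 1 :> R by rewrite mulr_ge0// ltW.
  lra.
have hl : s <= 6 * x * lnw x.
  rewrite /lnw ler_pdivlMr//; apply: (@le_trans _ _ (s * (6 * s))); last by rewrite mulrCA ss.
  rewrite ler_wpM2l//.
  have : ln (x + expR 1) <= ln ((3 * s) ^+ 2).
    rewrite ler_ln ?posrE ?exprn_gt0 ?ltr_wpDl//; last by rewrite mulr_gt0// (lt_le_trans _ s1).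
    by rewrite exprMn [s ^+ 2]expr2 ss; have := expR1_le4; lra.
  have s30 : 0 < 3 * s by rewrite mulr_gt0// (lt_le_trans _ s1).
  by rewrite lnXn// mulr2n; have := ln_le_id s30; lra.
have split_ : \int[mu]_(t in `[0, x]) lnw t = \int[mu]_(t in `[0, s]) lnw t + \int[mu]_(t in `]s, x]) lnw t.
  have := @Rintegral_itvB R lnw (BLeft 0) (BRight x) s (lnw_integrable x (lexx 0)).
  rewrite !bnd_simp => /(_ s0 sx) <-; by rewrite addrC subrK.
rewrite split_.
have i1 : \int[mu]_(t in `[0, s]) lnw t <= s.
  rewrite -[leRHS]mul1r -[X in _ * X]subr0 -itv_integral_cst//; apply: itv_integral_le.
  - exact: lnw_integrable.
  - exact: itv_cst_integrable.
  - by move=> t /andP[t0 _]; case/andP: (lnw_itv t0).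
have i2 : \int[mu]_(t in `]s, x]) lnw t <= 2 * lnw x * (x - s).
  rewrite Rintegral_itv_obnd_cbnd; last first.
    apply: integrableS (lnw_integrable x (lexx 0)) => //.
    by apply: subset_itv; rewrite bnd_simp.
  rewrite -itv_integral_cst//; apply: itv_integral_le.
  - exact: lnw_integrable.
  - exact: itv_cst_integrable.
  - by move=> t /andP[st _]; apply: le_trans hs; exact: lnw_anti.
have : 0 <= 2 * lnw x * s by rewrite mulr_ge0// mulr_ge0// ltW.
move: i1 i2 hl; rewrite mulrBr; lra.
Qed.

Lemma lnw_integral_gt0 x : 0 < x -> 0 < \int[mu]_(t in `[0, x]) lnw t.
Proof.
move=> x0; have /andP[w0 _] := lnw_itv (ltW x0).
apply: (@lt_le_trans _ _ (lnw x * (x - 0))); first by rewrite subr0 mulr_gt0.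
rewrite -(itv_integral_cst _ (ltW x0)); apply: itv_integral_le.
- exact: itv_cst_integrable.
- exact: lnw_integrable.
- by move=> t /andP[t0 tx]; exact: lnw_anti.
Qed.

End IntervalIntegral.

(** * Singular numbers and the norms of Li *)

Section SingularNumbers.
Context {R : realType} {H : completeNormedModType R[i]} (ip : H -> H -> R[i]).
Context (hip : hilbert_inner_product ip).
Context (N : set (H -> H)) (hN : von_neumann_algebra ip N).
Context (tau : (H -> H) -> \bar R) (htau : fns_trace ip N tau).
Local Notation "<< x , y >>" := (rip ip x y).
Local Notation sa := (sa ip).
Local Notation psd := (psd ip).
Local Notation fc := (fc ip).
Local Notation NP := (NP ip N).
Local Notation FT := (FT ip N tau).
Local Notation ft := (ft tau).
Local Notation gcut := (gcut ip).
Local Notation eb := (eb ip N tau).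
Local Notation tame := (tame ip N tau).
Local Notation sing_num := (sing_num ip N tau).
Implicit Types (A B T S C U W X Y Z G K Q V : bop H) (x y : H) (p e l L c t : R).

Lemma comp_bop S T : (S : H -> H) \o T = (S * T)%R :> (H -> H).
Proof. by []. Qed.
Lemma sub_bop S T : (S : H -> H) - T = (S - T)%R :> (H -> H).
Proof. by []. Qed.

Let sset t (S : H -> H) := [set opnorm (S \o E) | E in
    [set E : H -> H | [/\ N E, projection ip E & (tau (idop - E)%R <= t%:E)%E]]].

Let sset_ge0 t S : lbound (sset t S) 0.
Proof.
move=> _ [E [_ /(projection_isproj hip)[Q -> _] _] <-].
exact: (opnorm_ge0 (S * Q)%R).
Qed.

Let sset_bop t S Q : N Q -> isproj ip Q -> (tau (1 - Q)%R <= t%:E)%E -> sset t S (opnorm (S * Q)).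
Proof. by move=> nQ pQ tQ; exists (Q : H -> H) => //; split=> //; exact: (isproj_projection hip). Qed.

Let sset_ne t S : 0 <= t -> sset t S (opnorm S).
Proof.
move=> t0; rewrite -[S]mulr1; apply: sset_bop; first exact: (N1 hN).
  by split; [exact: sa1|rewrite mulr1].
by rewrite subrr (tau0 hip hN htau) lee_fin.
Qed.

Lemma sing_num_ge0 t S : 0 <= sing_num t S.
Proof.
rewrite /Defs.sing_num -/(sset t S).
by have [->|/set0P ne] := eqVneq (sset t S) set0; [rewrite inf0|exact: lb_le_inf].
Qed.

Lemma sing_num_le_opnorm t S : 0 <= t -> sing_num t S <= opnorm S.
Proof. by move=> t0; apply: ge_inf; [exists 0; exact: sset_ge0|exact: sset_ne]. Qed.

Lemma sing_num_anti t t' S : 0 <= t -> t <= t' -> sing_num t' S <= sing_num t S.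
Proof.
move=> t0 tt; apply: lb_le_inf; first by exists (opnorm S); exact: sset_ne.
move=> _ [E [nE pE tE] <-]; apply: ge_inf; first by exists 0; exact: sset_ge0.
by exists E => //; split=> //; apply: le_trans tE _; rewrite lee_fin.
Qed.

(** The complement of the cut projection competes in the infimum, and on its range |S| is at most
    l. *)
Lemma sing_num_le t l S : N S -> sa S -> 0 <= l -> FT (gcut l S) -> ft (gcut l S) <= t ->
  sing_num t S <= l.
Proof.
move=> nS sS l0 hF ht; pose Q := gcut l S.
have pQ : isproj ip Q by exact: (cut_proj hip).
have nQ : N Q by case: hF => -[].
apply: (@le_trans _ _ (opnorm (S * (1 - Q)))).
  apply: ge_inf; first by exists 0; exact: sset_ge0.
  apply: sset_bop; [exact: (NB hN) (N1 hN) nQ|exact: (isprojC hip)|].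
  by rewrite opprB addrCA subrr addr0 (FT_fin hip htau)// lee_fin.
have lc := lb_chi l; have l1 : lb (fun u : R => 1 - chi l u) by apply: lbB => //; exact: lb_cst.
have -> : S * (1 - Q) = fc S (fun u => u * (1 - chi l u)).
  rewrite (fcM hip)//; last exact: lb_id.
  by rewrite (fc_id hip)// (fcB hip)//; [rewrite (fc_cst hip)// sc1|exact: lb_cst].
apply: (fc_norm hip) => //; first by apply: lbM => //; exact: lb_id.
move=> u _; rewrite /chi; case: ifPn; first by rewrite subrr mulr0 normr0.
by rewrite -leNgt subr0 mulr1.
Qed.

(** A projection Q with |S Q| < l/4 and tau(1 - Q) <= t gives |S x| <= (l/4) |x| + |S| |(1 - Q) x|,
    hence S^2 <= l^2/8 + 2 |S|^2 (1 - Q). Then [key_cut] applies to S^2 at the threshold l^2; its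
    constant 32/7 is rounded up to 5. *)
Lemma sing_num_lt t l S : N S -> sa S -> 0 < l -> 0 <= t -> sing_num t S < l / 4 ->
  FT (gcut l S) /\ ft (gcut l S) * l ^+ 2 <= 5 * opnorm S ^+ 2 * t.
Proof.
move=> nS sS l0 t0 h; have ne : (sset t S !=set0) by exists (opnorm S); exact: sset_ne.
have [_ [E [nE pE tE] <-]] := inf_lt ne h.
have [Q eQ pQ] := projection_isproj hip pE; subst E.
rewrite comp_bop => hl.
have [sQ QQ] := pQ; have pQ' := isprojC hip pQ; have [sQ' QQ'] := pQ'.
have nQ' : N (1 - Q)%R by exact: (NB hN) (N1 hN) nE.
have fQ : FT (1 - Q) by split; [split=> //; exact: (isproj_psd hip)|apply: le_lt_trans tE _; rewrite ltry].
have tQ : ft (1 - Q) <= t by rewrite -lee_fin /ft -(FT_fin hip htau).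
pose c := 2 * opnorm S ^+ 2; have c0 : 0 <= c by rewrite mulr_ge0// sqr_ge0.
pose K := c *: (1 - Q); have fK : FT K by exact: (FTZ hip hN htau).
have l20 : 0 <= l ^+ 2 / 8 by rewrite divr_ge0// sqr_ge0.
have sSS : sa (S * S) by exact: saM.
have h2 : psd (sc (l ^+ 2 / 8) + K + S * S).
  apply: (psdD hip); last exact: (psd_sqr hip).
  by apply: (psdD hip); [exact: (psd_scalar hip)|case: fK => -[]].
have sK : sa K by exact: (saZ hip).
have h1 : psd (sc (l ^+ 2 / 8) + K - S * S).
  split; first by apply: (saB hip) => //; apply: (saD hip) => //; exact: (sa_sc hip).
  move=> x; rewrite /K !bopE (ripBl hip)// (ripDl hip)// !(ripZl hip)// sS.
  have e : S x = (S * Q) x + (S * (1 - Q)) x by rewrite -[RHS]bopE -mulrDr addrC subrK mulr1.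
  have n1 : rnorm (S x) <= l / 4 * rnorm x + opnorm S * rnorm ((1 - Q) x).
    rewrite {1}e; apply: le_trans (rnormD _ _) _; apply: lerD.
      by apply: le_trans (opnormP _ _) _; rewrite ler_wpM2r ?rnorm_ge0// ltW.
    exact: (opnormP S ((1 - Q)%R x)).
  have e2 : << (1 - Q) x, x >> = rnorm ((1 - Q) x) ^+ 2 by exact: (isproj_rip hip).
  have e3 : << x - Q x, x >> = rnorm ((1 - Q) x) ^+ 2 by rewrite -e2 !bopE.
  rewrite e3 !(ripxx hip)//.
  set a := rnorm x in n1 *; set b := rnorm ((1 - Q) x) in n1 *; set d := rnorm (S x) in n1 *.
  have d0 : 0 <= d by exact: rnorm_ge0.
  have : d ^+ 2 <= (l / 4 * a + opnorm S * b) ^+ 2 by rewrite ler_pXn2r// nnegrE (le_trans d0).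
  have : 0 <= (l / 4 * a - opnorm S * b) ^+ 2 by exact: sqr_ge0.
  rewrite /c; nra.
have [|g1 g2] := key_cut hip hN htau (NM hN nS nS) sSS fK (sqr_ge0 l) _ h1 h2.
  by have := exprn_gt0 2 l0; lra.
rewrite (cut_sq hip sS (ltW l0)) in g1 g2; split; first exact: g1.
have f0 := FT_ge0 hip htau g1; rewrite -/(ft _) in f0.
rewrite (ftZ hip htau)// in g2.
have : c * ft (1 - Q) <= c * t by rewrite ler_wpM2l.
have : 0 <= l ^+ 2 * ft (gcut l S) by rewrite mulr_ge0// sqr_ge0.
rewrite -/c in g2 *; rewrite /c in g2 *; move: g2; nra.
Qed.

Lemma tame_FT_cut p l A : 0 < p -> p <= 1 -> 0 < l -> tame p A -> FT (gcut l A).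
Proof.
move=> p0 p1 l0 hA; have [nA sA _] := hA.
have [c c0 hc] := tame_eb hip hN htau p0 p1 ltr01 hA.
pose L := Num.max 1 (l `^ (- p^-1)); have L1 : 1 <= L by rewrite le_max lexx.
have [f _] := hc L L1; have [] // := FT_cut_le hip hN htau nA sA _ f (l' := l).
rewrite -[leRHS](powRr1 (ltW l0)) (_ : 1 = (- p^-1) * (- p)); last by rewrite mulrNN mulVf// gt_eqF.
rewrite powRrM !powRN lef_pV2 ?posrE ?powR_gt0 ?invr_gt0 ?powR_gt0//; last by rewrite (lt_le_trans _ L1).
rewrite -powRN; apply: ge0_ler_powR.
- exact: ltW.
- by rewrite nnegrE powR_ge0.
- by rewrite nnegrE (le_trans ler01).
- by rewrite le_max lexx orbT.
Qed.

Lemma sqr_absorb e L : 0 < e -> 0 <= L -> L ^+ 2 <= (16 / e ^+ 2) * expR (e / 2 * L).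
Proof.
move=> e0 L0; have e40 : 0 < e / 4 by rewrite divr_gt0.
have h1 := expR_absorb e40 L0.
have -> : expR (e / 2 * L) = expR (e / 4 * L) ^+ 2 by rewrite -expRM_natl; congr expR; field.
have -> : 16 / e ^+ 2 * expR (e / 4 * L) ^+ 2 = (expR (e / 4 * L) / (e / 4)) ^+ 2 by field; rewrite gt_eqF.
by rewrite ler_pXn2r// nnegrE// divr_ge0 ?expR_ge0// ltW.
Qed.

(** At t of size exp(e L / 2) the decay of singular numbers puts them below L^(-p) / 4, and
    [sing_num_lt] bounds the counting function by t L^(2p). Since p <= 1, the power is at most L^2,
    which a second factor exp(e L / 2) absorbs. *)
Lemma Li0_tame p T : 0 < p -> p <= 1 -> sa T -> Li0 ip N tau p T -> tame p T.
Proof.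
move=> p0 p1 sT [nT h]; apply: (tame_of_eb hip hN htau) => // e e0.
(* This makes e' (e L / 2)^(-p) equal to L^(-p) / 8. The constant [C] below only ensures that t lies
   in the range where the decay hypothesis applies. *)
pose e' := (e / 2) `^ p / 8.
have e'0 : 0 < e' by rewrite /e' divr_gt0// powR_gt0// divr_gt0.
have [M [_ hM]] := h _ e'0.
pose C := Num.max M 1 + 1; have C1 : 1 <= C by rewrite /C ler_wpDl// le_max ler01 orbT.
have CM : M < C by rewrite /C ltr_pwDr// le_max lexx.
have C0 : 0 < C by exact: lt_le_trans C1.
exists (5 * opnorm T ^+ 2 * C * (16 / e ^+ 2)) => [|L L1].
  apply: mulr_ge0; last by rewrite divr_ge0// sqr_ge0.
  by apply: mulr_ge0; [rewrite mulr_ge0// sqr_ge0|exact: ltW].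
have L0 : 0 < L by exact: lt_le_trans L1.
set l := L `^ (- p); have l0 : 0 < l by exact: powR_gt0.
pose t := C * expR (e / 2 * L).
have ex1 : 1 <= expR (e / 2 * L) by rewrite -expR0 ler_expR mulr_ge0// ?divr_ge0// ltW.
have tM : M < t by apply: (lt_le_trans CM); rewrite ler_peMr// ltW.
have t0 : 0 < t by rewrite mulr_gt0// expR_gt0.
have lt_ : e / 2 * L <= ln t.
  by rewrite lnM ?posrE ?expR_gt0// expRK lerDr ln_ge0.
have eL0 : 0 < e / 2 * L by rewrite mulr_gt0// divr_gt0.
have sn : sing_num t T < l / 4.
  apply: le_lt_trans (hM t tM) _.
  apply: (@le_lt_trans _ _ (l / 8)); last by lra.
  have : ((ln t)^-1 `^ p) <= (e / 2 * L)^-1 `^ p.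
    have lt0 : 0 < ln t by exact: lt_le_trans lt_.
    apply: ge0_ler_powR; [exact: ltW|by rewrite nnegrE invr_ge0 ltW|by rewrite nnegrE invr_ge0 ltW|].
    by rewrite lef_pV2 ?posrE.
  move=> /(ler_wpM2l (ltW e'0))/le_trans; apply.
  rewrite invfM powRM; [|by rewrite invr_ge0 ltW// divr_gt0|by rewrite invr_ge0 ltW].
  have -> : (e / 2)^-1 `^ p = ((e / 2) `^ p)^-1 by rewrite -powR_inv1 ?ltW ?divr_gt0// -powRrM mulN1r powRN.
  have -> : L^-1 `^ p = l by rewrite -powR_inv1 ?ltW// -powRrM mulN1r.
  rewrite /e' le_eqVlt; apply/orP; left; apply/eqP; field.
  by rewrite gt_eqF// powR_gt0// divr_gt0.
have [f b] := sing_num_lt nT sT l0 (ltW t0) sn; split=> //.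
have lL : 1 <= l * L.
  rewrite /l -[X in _ * X](powRr1 (ltW L0)) -powRD; last by rewrite (gt_eqF L0) implybT.
  by rewrite -[leLHS](powRr0 L) ler_powR//; lra.
have LL := sqr_absorb e0 (ltW L0).
have f0 := FT_ge0 hip htau f; rewrite -/(ft _) in f0.
apply: (@le_trans _ _ (ft (gcut l T) * l ^+ 2 * L ^+ 2)).
  rewrite -mulrA -exprMn ler_peMr//; exact: exprn_ege1.
apply: (@le_trans _ _ ((5 * opnorm T ^+ 2 * t) * (16 / e ^+ 2 * expR (e / 2 * L)))).
  by apply: ler_pM => //; [rewrite mulr_ge0// sqr_ge0|exact: sqr_ge0].
rewrite /t (_ : expR (e * L) = expR (e / 2 * L) * expR (e / 2 * L)); last first.
  by rewrite -expRD; congr expR; field.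
by rewrite le_eqVlt; apply/orP; left; apply/eqP; ring.
Qed.

(** The constant [a] makes (a ln t)^(-p) equal to e (ln t)^(-p). At L = a ln t the rate 1/(2 a)
    bounds the counting function by c sqrt(t), which is at most t once t exceeds c^2. *)
Lemma tame_Li0 p T : 0 < p -> p <= 1 -> tame p T -> Li0 ip N tau p T.
Proof.
move=> p0 p1 hT; have [nT sT _] := hT; split=> // e e0.
pose a := e `^ (- p^-1); have a0 : 0 < a by exact: powR_gt0.
have a20 : 0 < (2 * a)^-1 by rewrite invr_gt0 mulr_gt0.
have [c c0 hc] := tame_eb hip hN htau p0 p1 a20 hT.
have M0 : 0 < expR a^-1 by exact: expR_gt0.
exists (Num.max (expR a^-1) (c ^+ 2)); split; first exact: num_real.
move=> t; rewrite gt_max => /andP[t1 t2].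
have t0 : 0 < t by exact: lt_trans t1.
have lt_ : a^-1 < ln t by rewrite -[a^-1]expRK ltr_ln ?posrE.
have lt0 : 0 < ln t by apply: lt_trans lt_; rewrite invr_gt0.
pose L := a * ln t; have L1 : 1 <= L by rewrite /L mulrC -ler_pdivrMr// div1r ltW.
have [f b] := hc L L1.
have e1 : L `^ (- p) = e * (ln t)^-1 `^ p.
  rewrite powRM ?ltW// /a -powRrM mulrNN mulVf ?gt_eqF// powRr1 ?ltW//.
  by rewrite -[(ln t)^-1]powR_inv1 ?ltW// -powRrM mulN1r.
rewrite -e1; apply: sing_num_le => //; first exact: powR_ge0.
apply: (le_trans b).
have -> : (2 * a)^-1 * L = ln t / 2 by rewrite /L; field; rewrite gt_eqF.
have et : expR (ln t / 2) ^+ 2 = t by rewrite -expRM_natl mulrC divfK// lnK ?posrE.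
have ex0 : 0 <= expR (ln t / 2) := expR_ge0 _.
rewrite -{2}et expr2 ler_wpM2r//.
by rewrite -(ler_pXn2r (_ : 0 < 2)%N)// ?nnegrE// et ltW.
Qed.

Lemma absopE T : sa T -> absop ip T = fc T (fun u => `|u|).
Proof.
move=> sT; rewrite /absop (adjointE hip sT).
have lq : lb (@Num.sqrt R) by apply: lb_continuous; exact: sqrt_continuous.
rewrite comp_bop (funcalcE hip)//; last by apply: saM.
congr bfun; rewrite -expr2 -[X in fc (X ^+ 2)](fc_id hip sT) -(fcX hip)//; last exact: lb_id.
rewrite (fc_comp hip)//; last by apply: lbX; exact: lb_id.
by congr fc; apply/funext => u; rewrite sqrtr_sqr.
Qed.

(** Removing the spectrum of U in [-l, l] leaves an operator of finite trace within l of U in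
    norm. *)
Lemma tame_Kideal p U : 0 < p -> p <= 1 -> tame p U -> Kideal ip N tau U.
Proof.
move=> p0 p1 hU I hI cI fI; have [nU sU _] := hU.
apply: cI => // e e0; pose l := e / 2; have l0 : 0 < l by rewrite divr_gt0.
have f := tame_FT_cut p0 p1 l0 hU.
have lc := lb_chi l.
have lg : lb (fun u : R => u * chi l u) by apply: lbM => //; exact: lb_id.
have o0 : 0 <= opnorm U + 1 by rewrite addr_ge0 ?opnorm_ge0.
pose V := fc U (fun u => u * chi l u).
exists V.
  apply: fI; split; first exact: (N_fc hip hN).
  have sV : sa V by exact: (fc_sa hip).
  rewrite absopE// /V (fc_comp hip)//; last by apply: lb_norm; exact: lb_id.
  have ln_ : lb (fun u : R => `|u * chi l u|) by exact: lb_norm.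
  have h : FT ((opnorm U + 1) *: gcut l U) by exact: (FTZ hip hN htau).
  have [] // := FT_le hip hN htau _ h (A := fc U (fun u => `|u * chi l u|)).
    by apply: (NP_fc hip hN) => // u _; exact: normr_ge0.
  rewrite -(fcZ hip)//; apply: (fc_le hip) => //; first exact: lbZ.
  by move=> u hu; rewrite normrM [X in _ * X]ger0_norm ?chi_ge0// ler_wpM2r// chi_ge0.
apply: (@le_lt_trans _ _ l); last by rewrite /l; lra.
rewrite sub_bop -{1}(fc_id hip sU) -(fcB hip)//; last exact: lb_id.
apply: (fc_norm hip) => //; [by apply: lbB => //; exact: lb_id|exact: ltW|].
move=> u _; rewrite /chi; case: ifPn; first by rewrite mulr1 subrr normr0 ltW.
by rewrite -leNgt mulr0 subr0.
Qed.

Fact csc_subproof (a : R[i]) : bounded_op (fun x : H => a *: x).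
Proof.
apply: (@mk_bop _ _ _ (complex.Re `|a|)) => [k u v|x]; first by rewrite scalerDr !scalerA mulrC.
rewrite /rnorm normrZ -[`|a|]RRe_real ?normr_real// -[`|x|]RRe_real ?normr_real//.
by rewrite -rmorphM.
Qed.
(* The scale of [bop H] as a module is by reals, hence these complex scalars. *)
Definition csc (a : R[i]) : bop H := Bop (csc_subproof a).

Lemma N_csc a : N (csc a).
Proof. by apply/(N_commP hN) => C _; apply: bopext => x; rewrite !bopE /= bopZ. Qed.

(** The algebra itself is a norm-closed ideal containing the generators. This makes the quotient
    norm an infimum of norms of bounded operators. *)
Lemma Kideal_N (T : H -> H) : Kideal ip N tau T -> N T.
Proof.
apply; [split=> //|by []|by move=> S []].
- exact: (N0 hN).
- by move=> S V nS nV; have [A eA] := N_bop hN nS; have [B eB] := N_bop hN nV; subst; exact: (ND hN nS nV).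
- by move=> a S nS; have [A eA] := N_bop hN nS; subst; exact: (NM hN (N_csc a) nS).
- by move=> S V nS nV; have [A eA] := N_bop hN nS; have [B eB] := N_bop hN nV; subst; split; [exact: (NM hN nS nV)|exact: (NM hN nV nS)].
Qed.

Lemma tame_quotient_norm p U : 0 < p -> p <= 1 -> tame p U -> quotient_norm ip N tau U <= 0.
Proof.
move=> p0 p1 hU; have KU := tame_Kideal p0 p1 hU.
apply: ge_inf; last by exists (U : H -> H) => //; rewrite sub_bop subrr opnorm0.
exists 0 => _ [S /Kideal_N/(N_bop hN)[B ->] <-]; exact: (opnorm_ge0 (U - B)%R).
Qed.

(** For large t the counting function at L = ln(t + expR 1) / 2 is at most c sqrt(t + expR 1), hence
    at most t. The bound makes the set of quotients in [Li_norm] bounded, so that its [sup] is a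
    genuine one. *)
Lemma sing_num_lnw S : tame 1 S -> exists K : R, forall t, 0 <= t -> sing_num t S <= K * lnw t.
Proof.
move=> hS; have [nS sS _] := hS; have [c c0 hc] := tame_eb hip hN htau ltr01 (lexx 1) ltr01 hS.
pose t1 : R := 2 * c ^+ 2 + 8 + expR 2.
have c20 : 0 <= c ^+ 2 by exact: sqr_ge0.
have e20 : 0 < expR 2 :> R by exact: expR_gt0.
have t10 : 0 <= t1 by rewrite /t1; lra.
have /andP[w0 _] := lnw_itv t10.
exists (2 + opnorm S / lnw t1) => t t0; have /andP[wt0 wt1] := lnw_itv t0.
have o0 : 0 <= opnorm S / lnw t1 by rewrite divr_ge0 ?opnorm_ge0// ltW.
have [tt1|t1t] := leP t t1.
  apply: (le_trans (sing_num_le_opnorm _ t0)).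
  apply: (@le_trans _ _ (opnorm S / lnw t1 * lnw t)); last by rewrite (ler_wpM2r (ltW wt0))//; lra.
  by rewrite -mulrA ler_peMr ?opnorm_ge0// mulrC ler_pdivlMr// mul1r lnw_anti.
pose y := t + expR 1; have y0 : 0 < y by rewrite ltr_wpDl// expR_gt0.
have ly : 2 <= ln y.
  rewrite -[2](expRK 2) ler_ln ?posrE// /y; have := @expR_gt0 R 1; rewrite /t1 in t1t; lra.
pose L := ln y / 2; have L1 : 1 <= L by rewrite /L; lra.
have [f b] := hc L L1.
have lL : L `^ (- 1) = 2 * lnw t.
  by rewrite powR_inv1; [rewrite /L invfM invrK mulrC|rewrite /L; lra].
rewrite lL in f b.
apply: (@le_trans _ _ (2 * lnw t)); last by rewrite (ler_wpM2r (ltW wt0))//; lra.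
apply: sing_num_le => //; first by rewrite mulr_ge0// ltW.
apply: (le_trans b); rewrite mul1r -(ler_pXn2r (_ : 0 < 2)%N)// ?nnegrE ?mulr_ge0 ?expR_ge0//.
have -> : (c * expR L) ^+ 2 = c ^+ 2 * y.
  by rewrite exprMn -expRM_natl (_ : 2 * L = ln y) ?lnK ?posrE// /L; field.
rewrite /y.
have := @expR1_le4 R; rewrite /t1 in t1t; nra.
Qed.

Lemma sing_num_integrable S (x : R) : 0 <= x ->
  (@lebesgue_measure R).-integrable `[0, x] (EFin \o (fun t => sing_num t S)).
Proof.
move=> x0; apply: (itv_integrable (c := opnorm S)).
  by apply: measurable_anti => // t t' t0 tt; exact: sing_num_anti.
by move=> t /andP[t0 _]; rewrite ger0_norm ?sing_num_ge0// sing_num_le_opnorm.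
Qed.

Lemma Li_norm_ub S (x : R) : tame 1 S -> 0 < x ->
  \int[lebesgue_measure]_(t in `[0, x]) sing_num t S <=
  Li_norm ip N tau S * \int[lebesgue_measure]_(t in `[0, x]) lnw t.
Proof.
move=> hS x0; have [K hK] := sing_num_lnw hS.
have K0 : 0 <= K.
  have /andP[w0 _] := @lnw_itv R 0 (lexx 0).
  by have := le_trans (sing_num_ge0 0 S) (hK 0 (lexx 0)); rewrite pmulr_lge0.
rewrite -ler_pdivrMr ?lnw_integral_gt0//; apply: ub_le_sup; last by exists x.
exists K => _ [z z0 <-]; rewrite ler_pdivrMr ?lnw_integral_gt0//.
have hw := lnw_integrable z (lexx (0 : R)).
rewrite -RintegralZl//; apply: itv_integral_le.
- by apply: sing_num_integrable; exact: ltW.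
- apply: (itv_integrable (c := K)); first apply: measurable_anti => // t t' t0 tt.
    by rewrite (ler_wpM2l K0)// lnw_anti.
  move=> t /andP[t0 _]; have /andP[h1 h2] := lnw_itv t0.
  by rewrite ger0_norm ?mulr_ge0 ?(ltW h1)// ler_piMr.
- by move=> t /andP[t0 _]; exact: hK.
Qed.

Lemma sing_num_Li S (x : R) : tame 1 S -> 0 < x ->
  x * sing_num x S <= Li_norm ip N tau S * \int[lebesgue_measure]_(t in `[0, x]) lnw t.
Proof.
move=> hS x0; apply: le_trans (Li_norm_ub hS x0).
rewrite mulrC -[X in _ * X]subr0 -(itv_integral_cst _ (ltW x0)); apply: itv_integral_le.
- exact: itv_cst_integrable.
- by apply: sing_num_integrable; exact: ltW.
- by move=> t /andP[t0 tx]; exact: sing_num_anti.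
Qed.

Lemma Li_norm_ge0 S : tame 1 S -> 0 <= Li_norm ip N tau S.
Proof.
move=> hS; have := sing_num_Li hS ltr01; rewrite mul1r => /(le_trans (sing_num_ge0 1 S)).
by rewrite pmulr_lge0// lnw_integral_gt0.
Qed.

Lemma sing_num_le_Li S (x : R) : tame 1 S -> 0 < x -> sing_num x S <= Li_norm ip N tau S.
Proof.
move=> hS x0; rewrite -(ler_pM2l x0); apply: (le_trans (sing_num_Li hS x0)).
rewrite mulrC ler_wpM2r ?Li_norm_ge0// -[leRHS]mul1r -[X in _ * X]subr0.
rewrite -(itv_integral_cst _ (ltW x0)); apply: itv_integral_le.
- exact: lnw_integrable.
- exact: itv_cst_integrable.
- by move=> t /andP[t0 _]; case/andP: (lnw_itv t0).
Qed.

Lemma sing_num_Li_lnw S (x : R) : tame 1 S -> 1 <= x -> sing_num x S <= 8 * Li_norm ip N tau S * lnw x.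
Proof.
move=> hS x1; have x0 : 0 < x by exact: lt_le_trans x1.
rewrite -(ler_pM2l x0); apply: (le_trans (sing_num_Li hS x0)).
have := ler_wpM2l (Li_norm_ge0 hS) (lnw_integral_le x1); move/le_trans; apply.
by rewrite le_eqVlt; apply/orP; left; apply/eqP; ring.
Qed.

(** The singular numbers at every t > 0 are at most the Li norm, hence below l/4, so [sing_num_lt]
    bounds the trace of the cut by a multiple of every t > 0. It vanishes, and the trace is
    faithful. *)
Lemma gcut_Li S l : tame 1 S -> 4 * Li_norm ip N tau S < l -> gcut l S = 0.
Proof.
move=> hS hl; have [nS sS _] := hS; have Li0 := Li_norm_ge0 hS.
have l0 : 0 < l by apply: le_lt_trans hl; rewrite mulr_ge0.
have h t : 0 < t -> FT (gcut l S) /\ ft (gcut l S) * l ^+ 2 <= 5 * opnorm S ^+ 2 * t.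
  move=> t0; apply: sing_num_lt => //; first exact: ltW.
  by apply: le_lt_trans (sing_num_le_Li hS t0) _; rewrite ltr_pdivlMr// mulrC.
have [f _] := h 1 ltr01; have f0 := FT_ge0 hip htau f; rewrite -/(ft _) in f0.
have z : ft (gcut l S) * l ^+ 2 <= 0.
  rewrite leNgt; apply/negP => a0; set a := ft _ * _ in a0 h.
  pose b := 5 * opnorm S ^+ 2; have b0 : 0 <= b by rewrite mulr_ge0// sqr_ge0.
  have [|_] := h (a / (2 * (b + 1))); first by rewrite divr_gt0// mulr_gt0//; lra.
  rewrite -/b leNgt => /negP; apply.
  rewrite mulrA ltr_pdivrMr; last by rewrite mulr_gt0//; lra.
  have : 0 <= b * a by rewrite mulr_ge0// ltW.
  nra.
have z' : ft (gcut l S) = 0.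
  by apply/eqP; rewrite eq_le f0 andbT; move: z; rewrite pmulr_lle0// exprn_gt0.
apply: bop_eq; apply: (trace_faithful htau); first by apply: (NP_cone hip); case: f.
by rewrite (FT_fin hip htau f) -/(ft _) z'.
Qed.

Lemma opnorm_gcut0 T l : 0 <= l -> sa T -> gcut l T = 0 -> opnorm T <= l.
Proof.
move=> l0 sT e; have [h1 h2] := cut_dom hip l0 sT; move: h1 h2; rewrite e scaler0 addr0 => h1 h2.
apply: (sa_opnorm_le hip) => // x; have := h1.2 x; have := h2.2 x.
rewrite !bopE (ripBl hip)// (ripDl hip)// (ripZl hip)// (ripxx hip)// => g1 g2.
by rewrite ler_norml; apply/andP; split; lra.
Qed.

Definition rootp p (u : R) : R := `|u| `^ p^-1.

Lemma lb_powR (a : R) : 0 <= a -> lb (fun u : R => u `^ a).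
Proof.
move=> a0; split; first exact: measurable_powR.
move=> M; exists (Num.max 1 (M `^ a)) => u uM.
rewrite ger0_norm ?powR_ge0//; have [u0|u0] := ltP u 0.
  by rewrite /powR lt_eqF// ln0 ?(ltW u0)// mulr0 expR0 le_max lexx.
rewrite le_max; apply/orP; right; apply: ge0_ler_powR => //.
  by rewrite nnegrE (le_trans (normr_ge0 u)).
exact: le_trans (ler_norm u) uM.
Qed.

Lemma lb_rootp p : 0 < p -> lb (rootp p).
Proof.
move=> p0; apply: (lb_comp (lb_powR _) (lb_norm (@lb_id R))).
by rewrite invr_ge0 ltW.
Qed.

Lemma Lip_normE p T : 0 < p -> sa T -> Lip_norm ip N tau p T = Li_norm ip N tau (fc T (rootp p)) `^ p.
Proof.
move=> p0 sT; rewrite /Lip_norm (absopE sT); have ln_ : lb (fun u : R => `|u|) by exact: lb_norm (@lb_id R).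
have lp : lb (fun u : R => u `^ p^-1) by apply: lb_powR; rewrite invr_ge0 ltW.
by rewrite (funcalcE hip (fc_sa hip sT ln_) lp) (fc_comp hip sT lp ln_).
Qed.

Lemma gcut_rootp p T l : 0 < p -> sa T -> 0 <= l -> gcut l (fc T (rootp p)) = gcut (l `^ p) T.
Proof.
move=> p0 sT l0; rewrite /gcut (fc_comp hip)//; [|exact: lb_chi|exact: lb_rootp].
congr fc; apply/funext => u; rewrite /chi ger0_norm ?powR_ge0//.
have e : l = (l `^ p) `^ p^-1 by rewrite -powRrM divff ?gt_eqF// powRr1.
have pi0 : 0 < p^-1 by rewrite invr_gt0.
have -> // : (l < rootp p u) = (l `^ p < `|u|).
rewrite /rootp {1}e; apply/idP/idP => h; last first.
  by apply: gt0_ltr_powR; rewrite ?nnegrE ?powR_ge0.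
rewrite ltNge; apply/negP => h'; move: h; rewrite ltNge => /negP; apply.
by apply: ge0_ler_powR; rewrite ?nnegrE ?powR_ge0 ?normr_ge0// ltW.
Qed.

Lemma tame_rootp p T : 0 < p -> p <= 1 -> tame p T -> tame 1 (fc T (rootp p)).
Proof.
move=> p0 p1 hT; have [nT sT _] := hT; have lr := lb_rootp p0.
apply: (tame_of_eb hip hN htau); [exact: (N_fc hip hN)|exact: (fc_sa hip)|move=> e e0].
have [c c0 hc] := tame_eb hip hN htau p0 p1 e0 hT; exists c; first exact: c0.
move=> L L1; rewrite gcut_rootp ?powR_ge0// -powRrM mulN1r; exact: hc.
Qed.

Lemma Lip_norm_ge0 p T : 0 <= Lip_norm ip N tau p T.
Proof. exact: powR_ge0. Qed.

(** With S = |T|^(1/p) and c the Li norm of S, [gcut_Li] leaves no spectrum of |T| beyond (4 c)^p,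
    and (4 c)^p <= 4 c^p since p <= 1. Convergence in tangent norm therefore implies convergence in
    operator norm. *)
Lemma opnorm_Lip p T : 0 < p -> p <= 1 -> tame p T -> opnorm T <= 4 * Lip_norm ip N tau p T.
Proof.
move=> p0 p1 hT; have [nT sT _] := hT; have hS := tame_rootp p0 p1 hT.
rewrite Lip_normE//; set c := Li_norm ip N tau _; have c0 : 0 <= c by exact: Li_norm_ge0.
apply: (@le_trans _ _ ((4 * c) `^ p)); last first.
  by rewrite powRM// ler_wpM2r ?powR_ge0// -[leRHS]powRr1// ler_powR// ler1n.
rewrite leNgt; apply/negP => h; set m := opnorm T `^ p^-1.
have pi0 : 0 < p^-1 by rewrite invr_gt0.
have em : m `^ p = opnorm T by rewrite /m -powRrM mulVf ?gt_eqF// powRr1// opnorm_ge0.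
have h4 : 4 * c < m.
  have -> : 4 * c = ((4 * c) `^ p) `^ p^-1.
    by rewrite -powRrM divff ?(gt_eqF p0)// powRr1// mulr_ge0.
  by apply: gt0_ltr_powR; rewrite ?nnegrE ?powR_ge0 ?opnorm_ge0.
pose l := (4 * c + m) / 2.
have l0 : 0 <= l by rewrite /l divr_ge0// addr_ge0 ?mulr_ge0 ?powR_ge0.
have z : gcut (l `^ p) T = 0.
  by rewrite -gcut_rootp//; apply: gcut_Li => //; rewrite -/c /l; lra.
have := opnorm_gcut0 (powR_ge0 l p) sT z; rewrite -em leNgt => /negP; apply.
by apply: gt0_ltr_powR; rewrite ?nnegrE ?powR_ge0// /l; lra.
Qed.

(** The point is uniformity: one d and one c serve every T of small norm. [sing_num_Li_lnw] bounds
    the singular numbers of S = |T|^(1/p) by the norm alone, and [sing_num_lt] at x = exp(e L / 2)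
    converts this into a counting bound. *)
Lemma Lip_small p e : 0 < p -> p <= 1 -> 0 < e -> exists d c, [/\ 0 < d, 0 <= c &
  forall T, tame p T -> Lip_norm ip N tau p T < d -> fb ip N tau p e c T].
Proof.
(* With the Li norm below c', the singular number at exp(e L / 2) is at most 8 c' * 2 / (e L) =
   (16/66) / L, and 16/66 < 1/4 as [sing_num_lt] requires. *)
move=> p0 p1 e0; pose c' := e / 66; have c'0 : 0 < c' by rewrite divr_gt0.
pose d := c' `^ p; have d0 : 0 < d by exact: powR_gt0.
pose c := 5 * (4 * c') ^+ 2 * (16 / e ^+ 2).
have c0 : 0 <= c.
  by rewrite /c mulr_ge0//; [rewrite mulr_ge0// sqr_ge0|rewrite divr_ge0// sqr_ge0].
exists d, ((4 * d + 1) * c); split=> //.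
  by rewrite mulr_ge0// addr_ge0// mulr_ge0// ltW.
move=> T hT hd; have [nT sT _] := hT; have hS := tame_rootp p0 p1 hT.
have oT : opnorm T <= 4 * d by apply: le_trans (opnorm_Lip p0 p1 hT) _; rewrite ler_pM2l// ltW.
have hb : eb p e c T.
  move=> L L1; have L0 : 0 < L by exact: lt_le_trans L1.
  rewrite Lip_normE// in hd; set S := fc T (rootp p) in hS hd.
  have [nS sS _] := hS; have Li0 := Li_norm_ge0 hS.
  have LiC : Li_norm ip N tau S < c'.
    rewrite ltNge; apply/negP => h; move: hd; rewrite ltNge => /negP; apply.
    by apply: ge0_ler_powR; rewrite ?nnegrE ?(ltW c'0)// ltW.
  have oS : opnorm S <= 4 * c'.
    apply: opnorm_gcut0 => //; first by rewrite mulr_ge0// ltW.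
    by apply: gcut_Li => //; rewrite ltr_pM2l.
  pose x := expR (e / 2 * L).
  have x0 : 0 < x by exact: expR_gt0.
  have eL0 : 0 < e / 2 * L by rewrite mulr_gt0// divr_gt0.
  have x1 : 1 <= x by rewrite -expR0 ler_expR ltW.
  have wx : lnw x <= (e / 2 * L)^-1.
    rewrite /lnw lef_pV2 ?posrE//.
      by rewrite -[leLHS]expRK ler_ln ?posrE ?ltr_wpDl ?expR_gt0 ?lerDl ?expR_ge0 ?ltW.
    by apply: lt_le_trans (ln_e_ge1 (ltW x0)).
  have sn : sing_num x S < L^-1 / 4.
    apply: (le_lt_trans (sing_num_Li_lnw hS x1)).
    apply: (@le_lt_trans _ _ (8 * c' * (e / 2 * L)^-1)).
      apply: ler_pM => //; first by rewrite mulr_ge0.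
      - by case/andP: (lnw_itv (ltW x0)) => /ltW.
      - by rewrite ler_pM2l// ltW.
    rewrite (_ : 8 * c' * _ = L^-1 * (16 / 66)); last by rewrite /c'; field; rewrite !gt_eqF.
    by rewrite ltr_pM2l ?invr_gt0//; lra.
  have Li0' : 0 < L^-1 by rewrite invr_gt0.
  have [f b] := sing_num_lt nS sS Li0' (ltW x0) sn.
  have eq1 : gcut (L `^ (- p)) T = gcut L^-1 S.
    have <- : L^-1 `^ p = L `^ (- p) by rewrite -powR_inv1 ?(ltW L0)// -powRrM mulN1r.
    exact: (esym (gcut_rootp p0 sT (ltW Li0'))).
  rewrite eq1; split=> //; have f0 := FT_ge0 hip htau f; rewrite -/(ft _) in f0.
  have LL := sqr_absorb e0 (ltW L0).
  have -> : ft (gcut L^-1 S) = ft (gcut L^-1 S) * L^-1 ^+ 2 * L ^+ 2.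
    by rewrite -mulrA -exprMn mulVf ?gt_eqF// expr1n mulr1.
  apply: (@le_trans _ _ ((5 * opnorm S ^+ 2 * x) * (16 / e ^+ 2 * expR (e / 2 * L)))).
    by apply: ler_pM => //; [rewrite mulr_ge0// sqr_ge0|exact: sqr_ge0].
  have -> : c * expR (e * L) = (5 * (4 * c') ^+ 2 * x) * (16 / e ^+ 2 * expR (e / 2 * L)).
    rewrite /c /x (_ : expR (e * L) = expR (e / 2 * L) * expR (e / 2 * L)); first by ring.
    by rewrite -expRD; congr expR; field.
  have z0 : 0 <= 16 / e ^+ 2 * expR (e / 2 * L) by apply: (le_trans _ LL); exact: sqr_ge0.
  rewrite (ler_wpM2r z0)//.
  rewrite ler_wpM2r ?(ltW x0)// ler_pM2l// ler_pXn2r// nnegrE ?opnorm_ge0//.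
  by rewrite mulr_ge0// ltW.
apply: (fb_mono _ (lexx e) _ (eb_fb hip hN htau nT sT hb)).
  by rewrite mulr_ge0// addr_ge0 ?opnorm_ge0.
by rewrite ler_wpM2r// lerD2r.
Qed.

End SingularNumbers.

(** * The weight *)

Section Weight.
Context {R : realType}.
Implicit Types (x u L e : R).

Lemma powX_absorb (m : nat) e L : 0 < e -> 0 <= L ->
  L ^+ m.+1 <= (m.+1%:R / e) ^+ m.+1 * expR (e * L).
Proof.
move=> e0 L0; have em0 : 0 < e / m.+1%:R by rewrite divr_gt0.
have h : L <= m.+1%:R / e * expR (e / m.+1%:R * L).
  have h1 := expR_ge1Dx (e / m.+1%:R * L).
  have h2 : e / m.+1%:R * L <= expR (e / m.+1%:R * L).
    by apply: le_trans h1; rewrite lerDr.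
  have me0 : 0 <= m.+1%:R / e by rewrite divr_ge0// ltW.
  have := ler_wpM2l me0 h2; rewrite !mulrA.
  rewrite (_ : m.+1%:R / e * e / m.+1%:R = 1) ?mul1r; last by rewrite divfK ?gt_eqF// divff// pnatr_eq0.
  by [].
have -> : expR (e * L) = expR (e / m.+1%:R * L) ^+ m.+1.
  by rewrite -expRM_natl; congr expR; rewrite mulrA mulrCA divff ?pnatr_eq0// mulr1.
by rewrite -exprMn ler_pXn2r// nnegrE// (le_trans L0).
Qed.

Context (r q : R) (hq0 : 0 < q) (hq1 : q <= 1) (hr : 0 <= r).
Local Notation w := (weight_fun r q).

Lemma weight_ge0 x : 0 <= w x.
Proof. by rewrite /weight_fun; case: ifP => // _; rewrite mulr_ge0 ?powR_ge0 ?expR_ge0. Qed.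

(** The inverse of the scale L -> L^(-q): at x = L^(-q) the weight is L^(q r) exp(-L). *)
Definition rate x : R := x `^ (- q^-1).

Lemma rate_gt0 x : 0 < x -> 0 < rate x.
Proof. exact: powR_gt0. Qed.
Lemma rateK x : 0 < x -> rate x `^ (- q) = x.
Proof. by move=> x0; rewrite /rate -powRrM mulrNN mulVf ?gt_eqF// powRr1// ltW. Qed.
Lemma rate_lt x L : 0 < x -> 0 < L -> L `^ (- q) < x -> rate x < L.
Proof.
move=> x0 L0 h; rewrite ltNge; apply/negP => h'; move: h; rewrite ltNge => /negP; apply.
rewrite -[X in X <= _](rateK x0) !powRN lef_pV2 ?posrE ?powR_gt0 ?rate_gt0//.
by apply: ge0_ler_powR; rewrite ?nnegrE ?(ltW hq0) ?(ltW L0)// ltW// rate_gt0.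
Qed.
Lemma rate_ge x L : 0 < x -> 0 < L -> x <= L `^ (- q) -> L <= rate x.
Proof.
move=> x0 L0 h; rewrite leNgt; apply/negP => h'; move: h; rewrite leNgt => /negP; apply.
rewrite -[X in _ < X](rateK x0) !powRN ltf_pV2 ?posrE ?powR_gt0 ?rate_gt0//.
by apply: gt0_ltr_powR; rewrite ?nnegrE ?(ltW L0)// ltW// rate_gt0.
Qed.

Lemma weight_rate x : 0 < x -> w x = rate x `^ (q * r) * expR (- rate x).
Proof.
move=> x0; rewrite /weight_fun gt_eqF// /rate -powRrM; congr (_ `^ _ * _).
by field; rewrite gt_eqF.
Qed.

Definition rexp : nat := (Num.truncn r).+1.
Lemma powR_rexp L : 1 <= L -> L `^ (q * r) <= L ^+ rexp.
Proof.
move=> L1; rewrite -powR_mulrn ?(le_trans _ L1)//; apply: ler_powR => //.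
have : r < rexp%:R by exact: truncnS_gt.
have : q * r <= r by rewrite ler_piMl.
lra.
Qed.

Lemma weight_le1 x : 1 <= x -> w x <= 1.
Proof.
move=> x1; have x0 : 0 < x by exact: lt_le_trans x1.
rewrite /weight_fun gt_eqF// -[leRHS]mulr1; apply: ler_pM; rewrite ?powR_ge0 ?expR_ge0//.
  by rewrite -[leRHS](powRr0 x) ler_powR// oppr_le0.
by rewrite -expR0 ler_expR oppr_le0 powR_ge0.
Qed.

(** A bound for L^m exp(-L) on L >= 0 with m = rexp + 1, from [powX_absorb] at rate 1. *)
Definition wcst : R := (rexp.+1%:R / 1) ^+ rexp.+1.

(** With L = rate x the weight is at most L^rexp exp(-L) <= wcst / L, and 1/L <= L^(-q) = x because
    q <= 1. This gives continuity of the weight at 0. *)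
Lemma weight_le_lin x : 0 <= x -> x <= 1 -> w x <= wcst * x.
Proof.
rewrite le_eqVlt => /orP[/eqP <- _|x0 x1]; first by rewrite /weight_fun eqxx mulr0.
have L1 : 1 <= rate x by apply: rate_ge => //; rewrite powR1.
have L0 : 0 < rate x by exact: lt_le_trans L1.
have h := powX_absorb rexp ltr01 (ltW L0); rewrite -/wcst mul1r in h.
have c0 : 0 <= wcst by rewrite /wcst exprn_ge0// divr_ge0.
have hx : (rate x)^-1 <= x.
  rewrite -powR_inv1 ?(ltW L0)// -[leRHS](rateK x0); by apply: ler_powR; [exact: L1|rewrite lerN2; exact: hq1].
apply: (@le_trans _ _ (wcst * (rate x)^-1)); last by rewrite ler_wpM2l.
rewrite weight_rate// ler_pdivlMr//.
apply: (@le_trans _ _ (rate x ^+ rexp * expR (- rate x) * rate x)).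
  by rewrite !ler_wpM2r ?(ltW L0) ?expR_ge0// powR_rexp.
rewrite mulrAC -exprSr expRN ler_pdivrMr ?expR_gt0//.
Qed.

Lemma continuous_powR_pos (a x : R) : 0 < x -> {for x, continuous (fun y : R => y `^ a)}.
Proof.
move=> x0; apply: differentiable_continuous; apply/derivable1_diffP.
by have [] := is_derive1_powR a x0.
Qed.

Lemma weight_abs_continuous : continuous (fun u : R => w `|u|).
Proof.
move=> u; have [->|u0] := eqVneq u 0.
  rewrite /continuous_at normr0 {2}/weight_fun eqxx; apply/cvgrPdist_lt => e e0.
  have c0 : 0 < wcst + 1 by rewrite ltr_wpDl// /wcst exprn_ge0// divr_ge0.
  apply/nbhs_ballP; exists (Num.min 1 (e / (wcst + 1))) => [|v]; first by rewrite /= lt_min ltr01 divr_gt0.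
  rewrite /ball/= sub0r normrN lt_min => /andP[v1 v2].
  rewrite sub0r normrN ger0_norm ?weight_ge0//.
  apply: (le_lt_trans (weight_le_lin (normr_ge0 v) (ltW v1))).
  apply: (@le_lt_trans _ _ ((wcst + 1) * `|v|)); first by rewrite ler_wpM2r// lerDl.
  by rewrite mulrC -ltr_pdivlMr.
have au0 : 0 < `|u| by rewrite normr_gt0.
apply: (@cvg_trans _ ((fun v : R => `|v| `^ (- r) * expR (- (`|v| `^ (- q^-1)))) @ u)).
  apply: near_eq_cvg; near=> v; rewrite /weight_fun ifF//; apply/negbTE; rewrite normr_eq0.
  near: v; exact: (nbhs_neq u0) || exact: open_neq.
have -> : w `|u| = `|u| `^ (- r) * expR (- (`|u| `^ (- q^-1))) by rewrite /weight_fun (gt_eqF au0).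
have nc : `|v| @[v --> u] --> `|u| by exact: norm_continuous.
suff h : `|v| `^ (- r) * expR (- (`|v| `^ (- q^-1))) @[v --> u] --> `|u| `^ (- r) * expR (- (`|u| `^ (- q^-1))) by exact: h.
have pc a : `|v| `^ a @[v --> u] --> `|u| `^ a := cvg_comp _ _ nc (@continuous_powR_pos a _ au0).
apply: cvgM; first exact: pc.
exact: (cvg_comp _ _ (cvgN (pc (- q^-1))) (@continuous_expR R _)).
Unshelve. all: end_near. Qed.

(** The square root of the weight, made even so that kap(T)^2 is the weight of |T| for every
    self-adjoint T. *)
Definition kap u : R := Num.sqrt (w `|u|).

Lemma kap_ge0 u : 0 <= kap u. Proof. exact: sqrtr_ge0. Qed.
Lemma kap_sq u : kap u ^+ 2 = w `|u|. Proof. by rewrite sqr_sqrtr ?weight_ge0. Qed.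
Lemma kap0 : kap 0 = 0. Proof. by rewrite /kap /weight_fun normr0 eqxx sqrtr0. Qed.
Lemma kap_continuous : continuous kap.
Proof.
move=> u; have := @continuous_comp _ _ _ (fun u : R => w `|u|) (@Num.sqrt R) u.
by apply; [exact: weight_abs_continuous|exact: sqrt_continuous].
Qed.
Lemma lb_kap : lb kap. Proof. exact: lb_continuous kap_continuous. Qed.

Lemma kap_le1 u : 1 <= `|u| -> kap u <= 1.
Proof. by move=> h; rewrite /kap -sqrtr1 ler_wsqrtr// weight_le1. Qed.

Lemma kap_block (n : nat) u : n.+2%:R `^ (- q) < `|u| -> `|u| <= n.+1%:R `^ (- q) ->
  kap u <= n.+2%:R ^+ rexp * expR (- (n.+1%:R / 2)).
Proof.
move=> h1 h2; have u0 : 0 < `|u| by apply: le_lt_trans h1; exact: powR_ge0.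
have L1 : rate `|u| < n.+2%:R by apply: rate_lt.
have L2 : n.+1%:R <= rate `|u| by apply: rate_ge.
have L0 : 1 <= rate `|u| by apply: le_trans L2; rewrite ler1n.
have p0 : 0 <= n.+2%:R ^+ rexp * expR (- (n.+1%:R / 2)) :> R.
  by rewrite mulr_ge0 ?expR_ge0// exprn_ge0.
rewrite /kap -[X in _ <= X](ger0_norm p0) -[X in _ <= X]sqrtr_sqr.
apply: ler_wsqrtr; rewrite (weight_rate u0) exprMn -expRM_natl.
rewrite (_ : 2 * - (n.+1%:R / 2) = - n.+1%:R); last by field.
apply: ler_pM; rewrite ?powR_ge0 ?expR_ge0//; last by rewrite ler_expR lerN2.
apply: (le_trans (powR_rexp L0)); apply: (@le_trans _ _ (n.+2%:R ^+ rexp)).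
  by rewrite ler_pXn2r// ?nnegrE ?(le_trans _ L0)// ltW.
by rewrite ler_eXn2l// || (rewrite -exprM; apply: ler_weXn2l; rewrite ?ler1n// muln2 -addnn leq_addl).
Qed.

End Weight.

(** * Finiteness of the trace of the square root of the weight *)

Section FiniteTraceWeight.
Context {R : realType} {H : completeNormedModType R[i]} (ip : H -> H -> R[i]).
Context (hip : hilbert_inner_product ip).
Context (N : set (H -> H)) (hN : von_neumann_algebra ip N).
Context (tau : (H -> H) -> \bar R) (htau : fns_trace ip N tau).
Context (r q : R) (hq0 : 0 < q) (hq1 : q <= 1) (hr : 0 <= r).
Local Notation "<< x , y >>" := (rip ip x y).
Local Notation sa := (sa ip).
Local Notation psd := (psd ip).
Local Notation fc := (fc ip).
Local Notation NP := (NP ip N).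
Local Notation FT := (FT ip N tau).
Local Notation ft := (ft tau).
Local Notation gcut := (gcut ip).
Local Notation eb := (eb ip N tau).
Local Notation fb := (fb ip N tau).
Local Notation tame := (tame ip N tau).
Local Notation kap := (kap r q).
Local Notation rexp := (rexp r).
Implicit Types (A B T S C U W X Y Z G K Q V D F : bop H) (x y : H) (p e l L c t : R).

(** In [kcst_block], with L = n + 2, the block factor L^rexp exp(-(n+1)/2) meets the counting bound
    exp(L/3) and the two extra powers of L that make the series telescope. What remains is
    L^(rexp+2) exp(1/2 - L/6), bounded by [powX_absorb] at rate 1/6. *)
Definition kcst : R := (rexp.+2%:R / (1 / 6)) ^+ rexp.+2 * expR (1 / 2).

Lemma kcst_ge : expR (1 / 3) <= kcst.
Proof.
rewrite /kcst -[leLHS]mul1r; apply: ler_pM; rewrite ?expR_ge0//; last by rewrite ler_expR; lra.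
rewrite exprn_ege1// ler_pdivlMr//; have : (1 : R) <= rexp.+2%:R by rewrite ler1n.
lra.
Qed.

Lemma kcst_block (n : nat) : n.+2%:R ^+ rexp * expR (- (n.+1%:R / 2)) * expR (1 / 3 * n.+2%:R)
  <= kcst * (n.+1%:R^-1 - n.+2%:R^-1).
Proof.
have n0 : 0 < n.+1%:R :> R by [].
have n1 : 0 < n.+2%:R :> R by [].
have en : n.+2%:R = n.+1%:R + 1 :> R by rewrite -[n.+2]addn1 natrD.
rewrite (_ : n.+1%:R^-1 - n.+2%:R^-1 = (n.+1%:R * n.+2%:R)^-1 :> R); last first.
  move: en n0 n1; move: (n.+1%:R : R) (n.+2%:R : R) => a b -> a0 b0.
  by field; rewrite !gt_eqF.
rewrite ler_pdivlMr ?mulr_gt0//.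
have e60 : 0 < 1 / 6 :> R by lra.
have h := powX_absorb rexp.+1 e60 (ltW n1).
apply: (@le_trans _ _ (n.+2%:R ^+ rexp.+2 * expR (1 / 2 - 1 / 6 * n.+2%:R))).
  have -> : expR (1 / 2 - 1 / 6 * n.+2%:R) = expR (- (n.+1%:R / 2)) * expR (1 / 3 * n.+2%:R) :> R.
    by rewrite -expRD; congr expR; rewrite en; field.
  have -> : n.+2%:R ^+ rexp * expR (- (n.+1%:R / 2)) * expR (1 / 3 * n.+2%:R) * (n.+1%:R * n.+2%:R)
     = (n.+2%:R ^+ rexp * (n.+1%:R * n.+2%:R)) * (expR (- (n.+1%:R / 2)) * expR (1 / 3 * n.+2%:R)) :> R by ring.
  rewrite ler_wpM2r ?mulr_ge0 ?expR_ge0// exprSr exprSr -mulrA ler_wpM2l ?exprn_ge0//.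
  by rewrite ler_wpM2r// ler_nat.
rewrite /kcst expRD expRN mulrCA mulrA ler_pdivrMr ?expR_gt0//.
by rewrite mulrC [leRHS]mulrAC ler_wpM2r ?expR_ge0.
Qed.

(** The spectrum of |D| is cut at the levels (n+1)^(-q). Between consecutive levels kap is at most a
    power of n times exp(-(n+1)/2), against a trace of at most c exp((n+2)/3). The partial sums stay
    below 2 c kcst, and normality of the trace passes to the limit. *)
Lemma FT_kap D c : N D -> sa D -> 0 <= c -> eb q (1 / 3) c D ->
  FT (fc D kap) /\ ft (fc D kap) <= c * kcst * 2.
Proof.
move=> nD sD c0 hD; have lk := lb_kap hq0 hq1 hr.
have lkc l : lb (fun u : R => kap u * chi l u) by apply: lbM => //; exact: lb_chi.
have kc0 l u : 0 <= kap u * chi l u by rewrite mulr_ge0 ?kap_ge0 ?chi_ge0.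
pose lam (n : nat) : R := n.+1%:R `^ (- q).
have lam_anti n : lam n.+1 <= lam n.
  rewrite /lam !powRN lef_pV2 ?posrE ?powR_gt0//.
  by apply: ge0_ler_powR; rewrite ?nnegrE ?(ltW hq0)// ler_nat.
pose K n := fc D (fun u => kap u * chi (lam n) u).
have k0 : 0 <= kcst by apply: le_trans kcst_ge; exact: expR_ge0.
have nK n : NP (K n) by apply: (NP_fc hip hN).
have incK n : psd (K n.+1 - K n).
  apply: (fc_le hip) => // u _; rewrite ler_wpM2l ?kap_ge0// /chi.
  by case: ifPn => h1; case: ifPn => // h2; move: h2; rewrite (le_lt_trans (lam_anti n) h1).
have hb n : FT (gcut (lam n) D) /\ ft (gcut (lam n) D) <= c * expR (1 / 3 * n.+1%:R).
  by apply: hD; rewrite ler1n.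
have hK n : FT (K n) /\ ft (K n) <= c * kcst * (2 - n.+1%:R^-1).
  elim: n => [|n [ih1 ih2]].
    have [f b] := hb 0%N.
    have d : psd (gcut (lam 0%N) D - K 0%N).
      apply: (fc_le hip) => //; first exact: lb_chi.
      move=> u _; rewrite /lam powR1 /chi; case: ifPn => h; last by rewrite mulr0.
      by rewrite mulr1 (@kap_le1 R r q hr u (ltW h)).
    have fK := FT_le hip hN htau (nK 0%N) f d; split; first exact: fK.
    apply: (le_trans (ft_le hip hN htau fK f d)); apply: (le_trans b).
    rewrite mulr1 invr1 (_ : 2 - 1 = 1); last by lra.
    by rewrite mulr1 ler_wpM2l// kcst_ge.
  have [f b] := hb n.+1; set a := n.+2%:R ^+ rexp * expR (- (n.+1%:R / 2)) : R.
  have a0 : 0 <= a by rewrite mulr_ge0 ?expR_ge0// exprn_ge0.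
  have fa := FTZ hip hN htau a0 f; have fs := FTD hip hN htau ih1 fa.
  have d : psd (K n + a *: gcut (lam n.+1) D - K n.+1).
    have lc := lb_chi (lam n.+1).
    rewrite -(fcZ hip)// -(fcD hip)//; last exact: lbZ.
    apply: (fc_le hip) => //; first by apply: lbD => //; exact: lbZ.
    move=> u _; rewrite /chi; case: ifPn => h1; last first.
      by rewrite mulr0 addr_ge0 ?mulr_ge0 ?kap_ge0//; case: ifP.
    rewrite !mulr1; case: ifPn => h2; first by rewrite mulr1 lerDl.
    by rewrite mulr0 add0r; apply: (kap_block hq0 hq1 hr) => //; rewrite leNgt.
  have fK := FT_le hip hN htau (nK n.+1) fs d; split; first exact: fK.
  apply: (le_trans (ft_le hip hN htau fK fs d)); rewrite (ftD hip htau)// (ftZ hip htau)//.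
  have h := ler_wpM2l a0 b; have h' := ler_wpM2l c0 (kcst_block n).
  have -> : c * kcst * (2 - n.+2%:R^-1) = c * kcst * (2 - n.+1%:R^-1) + c * (kcst * (n.+1%:R^-1 - n.+2%:R^-1)) by ring.
  apply: lerD => //; apply: (le_trans h); apply: (le_trans _ h').
  by rewrite /a le_eqVlt; apply/orP; left; apply/eqP; ring.
apply: (FT_slim_le hip htau (u := K)) => //.
- by move=> n; case: (hK n).
- apply: slim_norm; apply/cvgrPdist_le => e e0.
  have := kap_continuous hq0 hq1 hr (x := 0); move=> /cvgrPdist_lt/(_ e e0).
  rewrite kap0 => /nbhs_ballP[d /= d0 hd].
  near=> n; rewrite sub0r normrN sub_bop ger0_norm ?opnorm_ge0//.
  have ln : lam n < d.
    have : (d `^ (- q^-1)) < n.+1%:R.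
      near: n; exists (Num.truncn (d `^ (- q^-1))) => // n /= hn.
      by apply: (lt_le_trans (truncnS_gt _)); rewrite ler_nat.
    move=> h; rewrite ltNge; apply/negP => h'.
    by move: h; rewrite ltNge => /negP; apply; exact: (rate_ge hq0).
  have -> : K n - fc D kap = fc D (fun u => kap u * chi (lam n) u - kap u) by rewrite (fcB hip sD (lkc _) lk).
  apply: (fc_norm hip sD (lbB (lkc _) lk) (ltW e0)).
  move=> u _; rewrite /chi; case: ifPn => h; first by rewrite mulr1 subrr normr0 ltW.
  rewrite mulr0 sub0r normrN; apply: ltW; have := hd u; rewrite sub0r normrN; apply.
  by rewrite /ball/= sub0r normrN (le_lt_trans _ ln)// leNgt.
- by apply: (NP_fc hip hN) => // u _; exact: kap_ge0.
- move=> n; case: (hK n) => _ /le_trans; apply.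
  apply: ler_wpM2l; first exact: mulr_ge0.
  by rewrite lerBlDr lerDl invr_ge0.
Unshelve. all: end_near. Qed.

End FiniteTraceWeight.

(** * The tangent space *)

Section TangentSpace.
Context {R : realType} {H : completeNormedModType R[i]} (ip : H -> H -> R[i]).
Context (hip : hilbert_inner_product ip).
Context (N : set (H -> H)) (hN : von_neumann_algebra ip N).
Context (tau : (H -> H) -> \bar R) (htau : fns_trace ip N tau).
Context (r q : R) (hq0 : 0 < q) (hq1 : q <= 1) (hr : 0 <= r).
Local Notation "<< x , y >>" := (rip ip x y).
Local Notation sa := (sa ip).
Local Notation psd := (psd ip).
Local Notation fc := (fc ip).
Local Notation NP := (NP ip N).
Local Notation FT := (FT ip N tau).
Local Notation ft := (ft tau).
Local Notation gcut := (gcut ip).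
Local Notation eb := (eb ip N tau).
Local Notation fb := (fb ip N tau).
Local Notation tame := (tame ip N tau).
Local Notation kap := (kap r q).
Context (F0 : bop H) (nF0 : N F0) (sF0 : sa F0) (hF0 : tame q (1 - F0 * F0)).
Implicit Types (A B T S C U W X Y Z G K Q V D F : bop H) (x y : H) (p e l L c t : R).

Let q20 : 0 < q / 2. Proof. by rewrite divr_gt0. Qed.
Let q21 : q / 2 <= 1. Proof. by move: hq0 hq1; lra. Qed.

Definition tang X := tame (q / 2) X /\ tame q (F0 * X + X * F0).

Lemma tangD X Y : tang X -> tang Y -> tang (X + Y).
Proof.
move=> [x1 x2] [y1 y2]; split; first exact: (tameD hip hN htau).
by rewrite (_ : _ + _ = F0 * X + X * F0 + (F0 * Y + Y * F0)); [exact: (tameD hip hN htau)|bopring hip].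
Qed.
Lemma tangZ s X : tang X -> tang (s *: X).
Proof.
move=> [x1 x2]; split; first exact: (tameZ hip hN htau).
by rewrite bopAl bopAr -scalerDr; exact: (tameZ hip hN htau).
Qed.
Lemma tangB X Y : tang X -> tang Y -> tang (X - Y).
Proof. by move=> hX hY; apply: tangD => //; rewrite -scaleN1r; exact: tangZ. Qed.
Lemma tang0 : tang 0.
Proof. by split; rewrite ?mulr0 ?mul0r ?addr0; exact: (tame0 hip hN htau). Qed.
Lemma tang_N X : tang X -> N X. Proof. by case=> -[]. Qed.
Lemma tang_sa X : tang X -> sa X. Proof. by case=> -[]. Qed.

Lemma tangentP (T : H -> H) : tangent_space ip N tau F0 q T <-> exists2 X : bop H, T = X & tang X.
Proof.
split.
  move=> [[nT hT] aT h2]; have [X eX] := N_bop hN nT; subst T.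
  have sX : sa X by exact: (adjoint_sa hip).
  exists X => //; split; first by apply: (Li0_tame hip hN htau).
  apply: (Li0_tame hip hN htau) => //.
  by move=> x y; rewrite !bopE (ripDl hip)// (ripDr hip)// sF0 sX sX sF0 addrC.
move=> [X -> [h1 h2]]; have [nX sX _] := h1; split; first exact: (tame_Li0 hip hN htau).
- exact: (adjointE hip).
- exact: (tame_Li0 hip hN htau hq0 hq1 h2).
Qed.

Definition Msp F := tang (F - F0).

Lemma MspP (T : H -> H) : Mspace ip N tau F0 q T <-> exists2 F : bop H, T = F & Msp F.
Proof.
split.
  move=> [_ /tangentP[X -> hX] <-]; exists (F0 + X) => //.
  by rewrite /Msp addrAC subrr add0r.
move=> [F -> hF]; exists (F - F0 : bop H); first by apply/tangentP; exists (F - F0).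
by rewrite -[RHS]/(bfun F) -[in RHS](subrKC F0 F) || (congr bfun; rewrite addrC subrK).
Qed.

Lemma Msp_tang F X : Msp F -> tang X -> Msp (F + X).
Proof. by move=> hF hX; rewrite /Msp addrAC; exact: tangD. Qed.
Lemma Msp_diff F F' : Msp F -> Msp F' -> tang (F' - F).
Proof.
move=> hF hF'; have -> : F' - F = (F' - F0) - (F - F0) by rewrite opprB addrA subrK.
exact: tangB.
Qed.
Lemma Msp_sa F : Msp F -> sa F.
Proof. by move=> /tang_sa h; rewrite -(subrK F0 F); exact: (saD hip). Qed.
Lemma Msp_N F : Msp F -> N F.
Proof. by move=> /tang_N h; rewrite -(subrK F0 F); exact: (ND hN). Qed.

Lemma Msp_sq F : Msp F -> tame q (1 - F * F).
Proof.
move=> hF; have [hX1 hX2] := hF; set X := F - F0 in hX1 hX2.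
have -> : 1 - F * F = 1 - F0 * F0 - (F0 * X + X * F0) - X * X by rewrite /X; bopring hip.
by apply: (tameB hip hN htau) => //; [exact: (tameB hip hN htau)|exact: (tame_sq hip hN htau)].
Qed.

Lemma tangent_normE X : tangent_norm ip N tau F0 q X =
  Lip_norm ip N tau (q / 2) X + Lip_norm ip N tau q (F0 * X + X * F0)%R.
Proof.
rewrite /tangent_norm.
by have -> : ((X : H -> H) \o F0) + (F0 \o X) = (F0 * X + X * F0)%R by rewrite addrC.
Qed.

Lemma opnorm_tangent X : tang X -> opnorm X <= 4 * tangent_norm ip N tau F0 q X.
Proof.
move=> [h1 h2]; apply: (le_trans (opnorm_Lip hip hN htau q20 q21 h1)).
by rewrite ler_pM2l// tangent_normE lerDl; exact: powR_ge0.
Qed.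

Definition kapF F : bop H := fc F (fun u => kap (1 - u ^+ 2)).

Let lb_1sq : lb (fun u : R => 1 - u ^+ 2).
Proof. by apply: lbB; [exact: lb_cst|apply: lbX; exact: lb_id]. Qed.

Lemma fc_1sq F : sa F -> fc F (fun u => 1 - u ^+ 2) = 1 - F * F.
Proof.
move=> sF; have lx : lb (fun u : R => u ^+ 2) by apply: lbX; exact: lb_id.
rewrite (fcB hip sF (@lb_cst R 1) lx) (fc_cst hip)// sc1 (fcX hip sF 2 (@lb_id R)) (fc_id hip)//.
Qed.

Lemma kapFE F : sa F -> kapF F = fc (1 - F * F) kap.
Proof. by move=> sF; rewrite -(fc_1sq sF) (fc_comp hip sF (lb_kap hq0 hq1 hr) lb_1sq). Qed.

(** V is what [FT_segment] leaves of 1 - (F + s (G + Z))^2 once 1 - F^2 and the anticommutators of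
    F0 with G and Z are split off. The bound contains the varying Z only through Z^2, and the
    grouping of the four copies matches two uses of [fbD]. *)
Lemma psd_quadratic X G Z (s : R) : sa X -> sa G -> sa Z -> `|s| <= 1 ->
  let Y := G + Z in let V := s *: (X * Y + Y * X) + s ^+ 2 *: (Y * Y) in
  let Q := X * X + 4 *: (G * G) + (Z * Z + Z * Z + (Z * Z + Z * Z)) in
  psd (Q - V) /\ psd (Q + V).
Proof.
move=> sX sG sZ s1 Y V Q; have sY : sa Y by exact: (saD hip).
have [p1 p2] := psd_anticomm hip sX sY; have pY : psd (Y * Y) by exact: (psd_sqr hip).
have pGZ : psd ((G - Z) * (G - Z)) by apply: (psd_sqr hip); exact: (saB hip).
have s2 : 0 <= 1 - s ^+ 2 by rewrite subr_ge0 -[s ^+ 2]ger0_norm ?sqr_ge0// normrX expr_le1.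
have s2' : 0 <= 1 + s ^+ 2 by rewrite addr_ge0// sqr_ge0.
move: s1; rewrite ler_norml => /andP[sm sp].
have h1 : 0 <= (1 + s) / 2 by lra.
have h2 : 0 <= (1 - s) / 2 by lra.
have h3 : 0 <= 2 :> R by [].
split.
  have := psdD hip (psdD hip (psdD hip (psdZ hip h1 p1) (psdZ hip h2 p2)) (psdZ hip s2 pY)) (psdZ hip h3 pGZ).
  by congr psd; rewrite /Q /V /Y; bopring hip.
have := psdD hip (psdD hip (psdD hip (psdZ hip h2 p1) (psdZ hip h1 p2)) (psdZ hip s2' pY)) (psdZ hip h3 pGZ).
by congr psd; rewrite /Q /V /Y; bopring hip.
Qed.

(** The bound c depends neither on Z nor on s: continuity and differentiability along paths rest on
    this uniformity. Z ranges over a ball of the tangent norm because there [Lip_small] controls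
    both Z and F0 Z + Z F0. *)
Lemma FT_segment F G : Msp F -> tang G -> exists d c : R, [/\ 0 < d, 0 <= c &
  forall Z (s : R), tang Z -> tangent_norm ip N tau F0 q Z < d -> `|s| <= 1 ->
    FT (kapF (F + s *: (G + Z))) /\ ft (kapF (F + s *: (G + Z))) <= c].
Proof.
move=> hF hG; have k1 := dbl_ge1 hq0; have k'1 := dbl_ge1 q20.
set k := dbl q in k1; set k' := dbl (q / 2) in k'1.
have k0 : 0 < k by exact: lt_le_trans k1.
have k'0 : 0 < k' by exact: lt_le_trans k'1.
(* The rate is multiplied by k in four nested additions and once more in [fb_eb]. It ends at k^5 e0
   = 1/6, and the allowance 1/6 spent in [fb_eb] brings it to the 1/3 required by [FT_kap]. *)
pose e0 := (6 * k ^+ 5)^-1.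
have e00 : 0 < e0 by rewrite invr_gt0 mulr_gt0// exprn_gt0.
have ek n : e0 <= k ^+ n * e0 by rewrite ler_peMl ?exprn_ege1// ltW.
have ekS n : k * (k ^+ n * e0) = k ^+ n.+1 * e0 by rewrite mulrA -exprS.
have [hX1 hX2] := hF; set X := F - F0 in hX1 hX2.
have [hG1 hG2] := hG.
have tX2 := tame_sq hip hN htau hq0 hq1 hX1; have tG2 := tame_sq hip hN htau hq0 hq1 hG1.
have e20 : 0 < k ^+ 2 * e0 by rewrite mulr_gt0// exprn_gt0.
have [cD cD0 hD] := (let: And3 _ _ h := Msp_sq hF in h) _ e00.
have [cG cG0 hcG] := (let: And3 _ _ h := hG2 in h) _ e00.
have tA1 : tame q (X * X + 4 *: (G * G)) by apply: (tameD hip hN htau) => //; exact: (tameZ hip hN htau).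
have [cA cA0 hcA] := (let: And3 _ _ h := tA1 in h) _ e20.
have [dW [cW [dW0 cW0 hW]]] := Lip_small hip hN htau hq0 hq1 e00.
(* At the exponent q/2, [fb_eb] turns the rate e1 into k' e1 + e0/2 = e0, and squaring Z keeps this
   rate at the exponent q. *)
pose e1 := e0 / 2 / k'; have e10 : 0 < e1 by rewrite !divr_gt0.
have [dZ [cZ [dZ0 cZ0 hZ]]] := Lip_small hip hN htau q20 q21 e10.
have e0h : 0 < e0 / 2 by rewrite divr_gt0.
pose cZ' := ((4 * dZ) ^+ 2 + 1) * (4 * cZ / (e0 / 2)).
have cZe : 0 <= 4 * cZ / (e0 / 2) by rewrite divr_ge0 ?mulr_ge0// ltW.
have cZ'0 : 0 <= cZ' by rewrite mulr_ge0// addr_ge0// sqr_ge0.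
pose cT := cD + cG + cW + (cA + (cZ' + cZ' + (cZ' + cZ'))).
have cT0 : 0 <= cT by rewrite !addr_ge0.
pose cF := 4 * cT / (1 / 6).
have cF0 : 0 <= cF by rewrite divr_ge0 ?mulr_ge0// divr_ge0.
exists (Num.min dW dZ), (cF * kcst r * 2); split.
- by rewrite lt_min dW0.
- rewrite mulr_ge0//; apply: mulr_ge0 => //; exact: le_trans (expR_ge0 _) (kcst_ge r).
move=> Z s hZt; rewrite lt_min => /andP[n1 n2] s1; have [hZ1 hZ2] := hZt.
have nW : Lip_norm ip N tau q (F0 * Z + Z * F0) < dW.
  by apply: le_lt_trans n1; rewrite tangent_normE lerDr; exact: powR_ge0.
have nZ : Lip_norm ip N tau (q / 2) Z < dZ.
  by apply: le_lt_trans n2; rewrite tangent_normE lerDl; exact: powR_ge0.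
have [nZ' sZ _] := hZ1; have [nG' sG _] := hG1; have [nX sX _] := hX1.
have oZ : opnorm Z <= 4 * dZ.
  by apply: (le_trans (opnorm_Lip hip hN htau q20 q21 hZ1)); rewrite ler_pM2l// ltW.
have fZ2 : fb q e0 cZ' (Z * Z).
  have h := fb_eb hip hN htau nZ' sZ q20 q21 e0h cZ0 (hZ _ hZ1 nZ).
  rewrite -/k' (_ : k' * e1 + e0 / 2 = e0) in h; last by rewrite /e1; field; rewrite gt_eqF.
  have sZZ : sa (Z * Z) by apply: saM.
  have h2 := eb_fb hip hN htau (NM hN nZ' nZ') sZZ (eb_sq hip sZ h).
  apply: (fb_mono _ (lexx e0) _ h2); first by rewrite mulr_ge0// addr_ge0// opnorm_ge0.
  rewrite ler_wpM2r// lerD2r; apply: (le_trans (opnormM _ _)); rewrite expr2.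
  by apply: ler_pM; rewrite ?opnorm_ge0.
set Y := G + Z; have sY : sa Y by exact: (saD hip).
pose V := s *: (X * Y + Y * X) + s ^+ 2 *: (Y * Y).
have fV : fb q (k ^+ 3 * e0) (cA + (cZ' + cZ' + (cZ' + cZ'))) V.
  have f2 := fbD hip hN htau hq0 fZ2 fZ2; rewrite -/k in f2.
  have f4 := fbD hip hN htau hq0 f2 f2; rewrite -/k mulrA -expr2 in f4.
  have [g1 g2] := psd_quadratic sX sG sZ s1.
  rewrite (_ : k ^+ 3 * e0 = k * (k ^+ 2 * e0)); last by rewrite ekS.
  exact: (fb_dom hip hN htau hq0 g1 g2 hcA f4).
have nY : N Y by exact: (ND hN).
have sFs : sa (F + s *: Y) by apply: (saD hip); [exact: Msp_sa|exact: (saZ hip)].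
have nFs : N (F + s *: Y) by apply: (ND hN); [exact: Msp_N|exact: (NZ hN)].
have eD : 1 - (F + s *: Y) * (F + s *: Y) =
    1 - F * F + - s *: (F0 * G + G * F0) + - s *: (F0 * Z + Z * F0) + -1 *: V.
  by rewrite /V /Y /X; bopring hip.
have s1' : `|- s| <= 1 by rewrite normrN.
have n1' : `|-1 : R| <= 1 by rewrite normrN1.
have fD : fb q (k ^+ 4 * e0) cT (1 - (F + s *: Y) * (F + s *: Y)).
  rewrite eD -ekS; apply: (fbD hip hN htau hq0 _ (fbZ hip n1' fV)).
  rewrite -ekS; apply: (fbD hip hN htau hq0); last exact: (fb_mono cW0 (ek 2%N) (lexx _) (fbZ hip s1' (hW _ hZ2 nW))).
  rewrite expr2 -mulrA; apply: (fb_mono _ _ (lexx _) (fbD hip hN htau hq0 hD (fbZ hip s1' hcG))).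
    exact: addr_ge0.
  by rewrite -/k ler_wpM2l ?(ltW k0)// ler_peMl// ltW.
have sD : sa (1 - (F + s *: Y) * (F + s *: Y)) by apply: (saB hip); [exact: sa1|apply: saM].
have nD : N (1 - (F + s *: Y) * (F + s *: Y))%R by apply: (NB hN); [exact: (N1 hN)|exact: (NM hN)].
have e60 : 0 < 1 / 6 :> R by rewrite divr_gt0.
have := fb_eb hip hN htau nD sD hq0 hq1 e60 cT0 fD; rewrite -/k ekS -/cF.
rewrite (_ : k ^+ 5 * e0 + 1 / 6 = 1 / 3); last by rewrite /e0; field; rewrite gt_eqF.
by move=> hb; rewrite kapFE//; exact: (FT_kap hip hN htau hq0 hq1 hr nD sD cF0 hb).
Qed.

Lemma FT_kapF F : Msp F -> FT (kapF F).
Proof.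
move=> hF; have sF := Msp_sa hF; have hD := Msp_sq hF; have [nD sD _] := hD.
have e30 : 0 < 1 / 3 :> R by rewrite divr_gt0.
have [c c0 hb] := tame_eb hip hN htau hq0 hq1 e30 hD.
by rewrite (kapFE sF); have [] := FT_kap hip hN htau hq0 hq1 hr nD sD c0 hb.
Qed.

Lemma fc0 f : lb f -> fc 0 f = sc (f 0).
Proof.
move=> lf; have s0 : sa (0 : bop H) by exact: (sa0 hip).
have e : fc 0 (fun=> 0) = 0 by rewrite (fc_cst hip)// sc0.
by rewrite -{1}e (fc_comp hip s0 lf (lb_cst 0)) (fc_cst hip s0).
Qed.

Lemma Lip_norm0 p : 0 < p -> Lip_norm ip N tau p (0 : bop H) = 0.
Proof.
move=> p0; rewrite (@Lip_normE _ _ _ hip N tau p (0 : bop H) p0 (sa0 hip)) fc0; last exact: lb_rootp.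
rewrite /rootp normr0 powR0 ?invr_eq0 ?gt_eqF// sc0.
have mu0 t : 0 <= t -> sing_num ip N tau t (0 : bop H) = 0.
  move=> t0; apply/eqP; rewrite eq_le (sing_num_ge0 hip) andbT.
  by apply: (le_trans (sing_num_le_opnorm hip hN htau _ t0)); rewrite opnorm0.
rewrite (_ : Li_norm ip N tau (0 : bop H) = 0) ?powR0 ?gt_eqF//.
rewrite /Li_norm (_ : [set _ | x in _] = [set 0]) ?sup1//.
apply/seteqP; split=> [_ [x x0 <-]|_ ->].
  rewrite (_ : \int[_]_(t in _) sing_num _ _ _ _ _ = 0) ?mul0r//.
  rewrite -[RHS](mul0r (x - 0)) -(itv_integral_cst 0 (ltW x0)).
  apply: eq_Rintegral => t; rewrite inE /= in_itv/= => /andP[t0 _]; exact: mu0.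
exists 1; rewrite /= ?ltr01//.
rewrite (_ : \int[_]_(t in _) sing_num _ _ _ _ _ = 0) ?mul0r//.
rewrite -[RHS](mul0r (1 - 0)) -(itv_integral_cst 0 ler01).
by apply: eq_Rintegral => t; rewrite inE /= in_itv/= => /andP[t0 _]; exact: mu0.
Qed.

Lemma tangent_norm0 : tangent_norm ip N tau F0 q (0 : bop H) = 0.
Proof.
by rewrite tangent_normE mulr0 mul0r addr0 !Lip_norm0// addr0.
Qed.

Lemma FT_segment0 F G : Msp F -> tang G -> exists2 c : R, 0 <= c &
  forall s : R, `|s| <= 1 -> FT (kapF (F + s *: G)) /\ ft (kapF (F + s *: G)) <= c.
Proof.
move=> hF hG; have [d [c [d0 c0 h]]] := FT_segment hF hG; exists c => // s s1.
by have := h 0 s tang0 _ s1; rewrite tangent_norm0 addr0; apply.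
Qed.

Definition sgnf (u : R) : R := if 0 <= u then 1 else -1.

Lemma lb_sgnf : lb sgnf.
Proof.
have -> : sgnf = fun u => 1 - 2 * \1_(ray 0) (- u).
  apply/funext => u; rewrite /sgnf indicE.
  have -> : (- u \in ray (0 : R)) = ~~ (0 <= u) by apply/idP/idP; rewrite inE rayE oppr_gt0 -ltNge.
  by case: leP => _ /=; lra.
apply: lbB; [exact: lb_cst|apply: lbZ; apply: (lb_comp _ (lbN (@lb_id R)))].
by apply: lb_indic; exact: measurable_ray.
Qed.

(** Since |sgnf u - u| <= |1 - u^2|, the operator B = sgnf(F) - F has the decay of 1 - F^2, which is
    better than a tangent vector needs. Its anticommutator with F0 is the one with F, a function of
    F dominated by a multiple of 1 - F^2, minus X B + B X for X = F - F0. *)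
Lemma Msp_sign F : Msp F -> Msp (fc F sgnf).
Proof.
move=> hF; have sF := Msp_sa hF; have nF := Msp_N hF.
have ls := lb_sgnf; have lid := @lb_id R.
pose h u : R := sgnf u - u; have lh : lb h by exact: lbB.
pose B := fc F h; have eB : B = fc F sgnf - F by rewrite /B (fcB hip sF ls lid) (fc_id hip).
have hsq u : `|h u| <= `|1 - u ^+ 2|.
  rewrite /h /sgnf; case: ifPn => u0.
    rewrite (_ : 1 - u ^+ 2 = (1 - u) * (1 + u)); last by ring.
    by rewrite normrM ler_peMr// ger0_norm; lra.
  rewrite (_ : 1 - u ^+ 2 = (-1 - u) * (u - 1)); last by ring.
  rewrite normrM ler_peMr// ler0_norm; move: u0; rewrite -ltNge; lra.
have tD : tame q (fc F (fun u => 1 - u ^+ 2)) by rewrite (fc_1sq sF); exact: Msp_sq.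
have tB : tame q B by apply: (tame_fc hip hN htau hq0 hq1 nF sF lh lb_1sq) => // u _; exact: hsq.
have tB2 : tame (q / 2) B by exact: (tame_half hip).
have -> : fc F sgnf = F + B by rewrite eB addrC subrK.
apply: Msp_tang => //; split; first exact: tB2.
have [hX _] := hF; set X := F - F0 in hX.
have -> : F0 * B + B * F0 = F * B + B * F - (X * B + B * X) by rewrite /X; bopring hip.
apply: (tameB hip hN htau) => //; last exact: (tame_anticomm hip hN htau).
pose m := opnorm F + 1; have m0 : 0 <= m by rewrite addr_ge0 ?opnorm_ge0.
have lg : lb (fun u : R => 2 * (u * h u)) by apply: lbZ; exact: lbM.
have -> : F * B + B * F = fc F (fun u => 2 * (u * h u)).
  rewrite (fcZ hip sF 2 (lbM lid lh)) (fcM hip sF lid lh) (fc_id hip sF) -/B -(fc_commT hip sF lh).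
  by rewrite scaler_nat mulr2n.
apply: (tame_fc hip hN htau hq0 hq1 nF sF lg (lbZ (2 * m) lb_1sq)).
  move=> u um; rewrite !normrM -!mulrA ler_pM2l ?normr_gt0//.
  by apply: ler_pM; rewrite ?normr_ge0 ?(ger0_norm m0) ?hsq.
by rewrite (fcZ hip sF _ lb_1sq); exact: (tameZ hip hN htau).
Qed.

End TangentSpace.

(** * Uniform approximation *)

Section RealTools.
Context {R : realType}.
Implicit Types (a b s t e : R) (f g : R -> R).
Local Notation mu := (@lebesgue_measure R).

Definition cont_on f a b := forall t, a <= t <= b -> forall e, 0 < e ->
  exists2 d, 0 < d & forall s, a <= s <= b -> `|s - t| < d -> `|f s - f t| <= e.

Lemma cont_on_within f a b : cont_on f a b -> {within `[a, b], continuous f}.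
Proof.
move=> h; apply/subspace_continuousP => t; rewrite /= in_itv/= => tab.
apply/cvgrPdist_le => e e0; have [d d0 hd] := h t tab e e0.
rewrite /within/=; apply/nbhs_ballP; exists d => //= s; rewrite /ball/= => st sab.
by rewrite distrC; apply: hd; [rewrite in_itv/= in sab|rewrite distrC].
Qed.

Lemma cont_on_integrable f a b : cont_on f a b -> mu.-integrable `[a, b] (EFin \o f).
Proof.
move=> h; apply: continuous_compact_integrable; first exact: segment_compact.
exact: cont_on_within.
Qed.

(** Differentiability and continuity are relative to the closed interval, so that the end points
    supply the one-sided limits which the fundamental theorem requires. *)
Lemma FTC_eps (F f : R -> R) a b : a < b -> cont_on f a b ->
  (forall t, a <= t <= b -> forall e, 0 < e -> exists2 d, 0 < d & forall s,
     a <= s <= b -> `|s - t| < d -> `|F s - F t - (s - t) * f t| <= e * `|s - t|) ->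
  \int[mu]_(t in `[a, b]) f t = F b - F a.
Proof.
move=> ab cf h.
have near_F t : a <= t <= b -> forall e, 0 < e -> exists2 d, 0 < d &
    forall s, a <= s <= b -> `|s - t| < d -> `|F s - F t| <= e.
  move=> tab e e0; have [d d0 hd] := h t tab 1 ltr01.
  have m0 : 0 < 1 + `|f t| by rewrite ltr_pwDl.
  exists (Num.min d (e / (1 + `|f t|))) => [|s sab]; first by rewrite lt_min d0 divr_gt0.
  rewrite lt_min => /andP[h1 h2]; have := hd s sab h1; rewrite mul1r => h3.
  have -> : F s - F t = (F s - F t - (s - t) * f t) + (s - t) * f t by rewrite subrK.
  apply: (le_trans (ler_normD _ _)); rewrite normrM.
  apply: (@le_trans _ _ (`|s - t| * (1 + `|f t|))); first by rewrite mulrDr mulr1 lerD2r.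
  by rewrite -ler_pdivlMr// ltW.
have dF t : t \in `]a, b[ -> is_derive t 1 (F : R -> R) (f t).
  rewrite in_itv/= => /andP[at_ tb]; have tab : a <= t <= b by rewrite !ltW.
  have hc : h0^-1 *: (F (h0 *: 1 + t) - F t) @[h0 --> 0^'] --> f t.
    apply/cvgrPdist_le => e e0; have [d d0 hd] := h t tab e e0.
    rewrite /= near_withinE; apply/nbhs_ballP.
    exists (Num.min d (Num.min (t - a) (b - t))) => [|k].
      by rewrite /= !lt_min d0 !subr_gt0 at_ tb.
    rewrite /ball/= sub0r normrN !lt_min => /and3P[k1 k2 k3] k0.
    have ktab : a <= k + t <= b.
      move: k2 k3; rewrite !ltr_norml => /andP[k2 _] /andP[_ k3].
      by apply/andP; split; lra.
    have := hd (k + t) ktab; rewrite addrK => /(_ k1) => hk.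
    have kn0 : 0 < `|k| by rewrite normr_gt0.
    rewrite distrC [k *: 1](mulr1) -[leRHS](mulfK (lt0r_neq0 kn0)) ler_pdivlMr//.
    rewrite -normrM mulrBl; apply: le_trans hk.
    rewrite le_eqVlt; apply/orP; left; apply/eqP; congr `|_|.
    by rewrite -[_ *: _]/(_ * _) mulrAC mulVf// mul1r [k * _]mulrC.
  have dv : derivable (F : R -> R) t 1 by apply/cvg_ex; exists (f t).
  by apply: DeriveDef => //; apply: (cvg_lim _ hc).
have e : (\int[mu]_(x in `[a, b]) (f x)%:E = (F b)%:E - (F a)%:E)%E.
  apply: (continuous_FTC2 ab (cont_on_within cf)).
    split.
    - by move=> t /dF[].
    - have aab : a <= a <= b by rewrite lexx ltW.
      apply/cvgrPdist_le => e e0; have [d d0 hd] := near_F a aab e e0.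
      rewrite /at_right near_withinE; apply/nbhs_ballP; exists (Num.min d (b - a)).
        by rewrite /= lt_min d0 subr_gt0.
      move=> s; rewrite /ball/= lt_min => /andP[s1 s2] as_; rewrite distrC; apply: hd.
        rewrite ltW//=; move: s2; rewrite distrC ltr_norml => /andP[_]; lra.
      by rewrite distrC.
    - have bab : a <= b <= b by rewrite lexx ltW.
      apply/cvgrPdist_le => e e0; have [d d0 hd] := near_F b bab e e0.
      rewrite /at_left near_withinE; apply/nbhs_ballP; exists (Num.min d (b - a)).
        by rewrite /= lt_min d0 subr_gt0.
      move=> s; rewrite /ball/= lt_min => /andP[s1 s2] sb; rewrite distrC; apply: hd.
        rewrite (ltW sb) andbT; move: s2; rewrite ltr_norml => /andP[_]; lra.
      by rewrite distrC.
  by move=> t /dF tF; rewrite derive1E derive_val.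
by rewrite /Rintegral e.
Qed.

Lemma unif_cont f a b : (forall t, a <= t <= b -> {for t, continuous f}) -> forall e, 0 < e ->
  exists2 d, 0 < d & forall s t, a <= s <= b -> a <= t <= b -> `|s - t| < d -> `|f s - f t| <= e.
Proof.
move=> cf e e0; pose P d x := forall y, `|x - y| < d -> `|f x - f y| <= e.
have hP x : `[a, b]%classic x -> \forall x' \near x & i \near (0 : R)^'+, P i x'.
  move: x; move=> x; rewrite /= in_itv/= => xab.
  have e20 : 0 < e / 2 by rewrite divr_gt0.
  have := cf x xab; move=> /cvgrPdist_le/(_ _ e20)/nbhs_ballP[d /= d0 hd].
  exists (ball x (d / 2), [set k | k < d / 2]) => /=.
    split; first by apply/nbhs_ballP; exists (d / 2) => //=; rewrite divr_gt0.
    by apply: nbhs_right_lt; rewrite divr_gt0.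
  move=> [x' k] /= [x'x kd] y x'y.
  have h1 : `|f x - f x'| <= e / 2.
    by apply: hd; rewrite /ball/=; apply: lt_trans x'x _; lra.
  have h2 : `|f x - f y| <= e / 2.
    apply: hd; rewrite /ball/=; apply: (le_lt_trans (ler_distD x' _ _)).
    by move: x'x x'y kd; rewrite /ball/=; lra.
  apply: (le_trans (ler_distD (f x) _ _)); rewrite distrC; lra.
have := (compact_near_coveringP _).1 (@segment_compact R a b) R (0^'+) P _ hP.
move=> /(_ ltac:(exact _)); rewrite /at_right near_withinE => /nbhs_ballP[d /= d0 hd].
exists (d / 2) => [|s t sab tab st]; first by rewrite divr_gt0.
apply: (hd (d / 2) _ _ s _ t st).
- by rewrite /ball/= sub0r normrN ger0_norm; lra.
- by rewrite /=; lra.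
- by rewrite /= in_itv.
Qed.

(* [bern n c] is the n-th Bernstein polynomial with nodes [c 0, ..., c n]. *)
Fixpoint bern n (c : nat -> R) : {poly R} :=
  if n is m.+1 then (1 - 'X) * bern m c + 'X * bern m (fun k => c k.+1) else (c 0%N)%:P.

Lemma bernS n c x : (bern n.+1 c).[x] = (1 - x) * (bern n c).[x] + x * (bern n (fun i => c i.+1)).[x].
Proof. by rewrite /= !hornerE. Qed.

Lemma bern_lin n k c c' x : (bern n (fun i => k * c i + c' i)).[x] = k * (bern n c).[x] + (bern n c').[x].
Proof.
elim: n c c' => [|n ih] c c'; first by rewrite /= !hornerC.
by rewrite !bernS (ih c c') (ih (fun i => c i.+1) (fun i => c' i.+1)); ring.
Qed.
Lemma bern_le n c c' x : 0 <= x -> x <= 1 -> (forall i, (i <= n)%N -> c i <= c' i) ->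
  (bern n c).[x] <= (bern n c').[x].
Proof.
move=> x0 x1; elim: n c c' => [|n ih] c c' h /=; first by rewrite !hornerC; exact: h.
rewrite !hornerE; apply: lerD.
  by rewrite ler_wpM2l ?subr_ge0// ih// => i ni; rewrite h// (leq_trans ni).
by rewrite ler_wpM2l// ih// => i ni; rewrite h.
Qed.
Lemma bern_cst n k x : (bern n (fun=> k)).[x] = k.
Proof. by elim: n => [|n ih] /=; rewrite ?hornerC// !hornerE ih; ring. Qed.
(** The second moment of the binomial law about an arbitrary point. The shift [a] makes the
    induction close: moving the nodes by one replaces a by 1 + a. *)
Lemma bern_sq n a x : (bern n (fun i => (i%:R + a) ^+ 2)).[x] =
  n%:R * x * (1 - x) + (n%:R * x + a) ^+ 2.
Proof.
elim: n a => [|n ih] a /=; first by rewrite hornerC !mul0r !add0r.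
rewrite !hornerE ih.
have -> : (fun k : nat => (k.+1%:R + a) ^+ 2) = (fun k : nat => (k%:R + (1 + a)) ^+ 2).
  by apply/funext => k; rewrite -addn1 natrD addrA.
by rewrite ih -[n.+1]addn1 natrD; ring.
Qed.

(** Bernstein's argument: |f x - f y| <= e/2 + A (x - y)^2 on [0, 1], while forming Bernstein
    polynomials preserves inequalities between the node values, and the nodes (x - i/m)^2 produce
    the value x (1 - x) / m at x. *)
Lemma weierstrass01 f : (forall t, 0 <= t <= 1 -> {for t, continuous f}) -> forall e, 0 < e ->
  exists p : {poly R}, forall x, 0 <= x <= 1 -> `|f x - p.[x]| <= e.
Proof.
move=> cf e e0; have e20 : 0 < e / 2 by rewrite divr_gt0.
have [d d0 hd] := unif_cont cf e20.
have [K hK] : exists K, forall x, 0 <= x <= 1 -> `|f x| <= K.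
  have : compact (f @` `[0, 1]).
    apply: continuous_compact; last exact: segment_compact.
    by apply: cont_on_within => t tab k k0; have [d' d'0 h] := unif_cont cf k0; exists d' => // s sab; exact: h.
  move=> /compact_bounded[M [_ hM]]; exists (M + 1) => x xab.
  by apply: (hM (M + 1)); [rewrite ltrDl|exists x => //=; rewrite in_itv].
have K0 : 0 <= K by apply: le_trans (normr_ge0 _) (hK 0 _); rewrite lexx ler01.
(* Points at distance at least d then satisfy 2 K <= A (x - y)^2, which covers the case where
   uniform continuity says nothing. *)
pose A := 2 * K / d ^+ 2; have A0 : 0 <= A.
  by rewrite /A divr_ge0//; [rewrite mulr_ge0|rewrite sqr_ge0].
have fxy x y : 0 <= x <= 1 -> 0 <= y <= 1 -> `|f x - f y| <= e / 2 + A * (x - y) ^+ 2.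
  move=> xab yab; have [h|h] := ltP `|x - y| d.
    by apply: (le_trans (hd _ _ xab yab h)); rewrite lerDl mulr_ge0// sqr_ge0.
  have h2 : d ^+ 2 <= (x - y) ^+ 2 by rewrite -[leRHS]real_normK ?num_real// ler_pXn2r// nnegrE ltW.
  have h3 : 2 * K <= A * (x - y) ^+ 2.
    rewrite /A mulrAC ler_pdivlMr ?exprn_gt0//.
    by rewrite ler_wpM2l// mulr_ge0.
  apply: (le_trans (ler_normB _ _)); have := hK x xab; have := hK y yab; lra.
have [n hn] : exists n : nat, A / (e / 2) < n.+1%:R by exists (Num.truncn (A / (e / 2))); exact: truncnS_gt.
pose m : R := n.+1%:R; have m0 : 0 < m by [].
pose c (i : nat) := f (i%:R / m); exists (bern n.+1 c) => x xab; have /andP[x0 x1] := xab.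
have B : (bern n.+1 (fun i => e / 2 + A * (x - i%:R / m) ^+ 2)).[x] <= e.
  have -> : (fun i : nat => e / 2 + A * (x - i%:R / m) ^+ 2) =
      (fun i : nat => A / m ^+ 2 * (i%:R + (- (m * x))) ^+ 2 + e / 2).
    by apply/funext => i; field; rewrite gt_eqF.
  rewrite (bern_lin _ _ (fun i => (i%:R + (- (m * x))) ^+ 2) (fun=> e / 2)) bern_cst bern_sq -/m subrr expr0n/= addr0.
  have -> : A / m ^+ 2 * (m * x * (1 - x)) = A * (x * (1 - x)) / m by field; rewrite gt_eqF.
  have h1 : A * (x * (1 - x)) <= A.
    rewrite ler_piMr// -[leRHS]mulr1; apply: ler_pM => //; first by rewrite subr_ge0.
    by rewrite gerBl.
  have : A * (x * (1 - x)) / m <= e / 2.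
    rewrite ler_pdivrMr//; apply: (le_trans h1).
    by rewrite -ler_pdivrMl// mulrC ltW.
  by move=> h2; rewrite [leRHS]splitr lerD2r.
have cb i : (i <= n.+1)%N -> 0 <= i%:R / m <= 1.
  by move=> ni; apply/andP; split; [rewrite divr_ge0// ltW|rewrite ler_pdivrMr// mul1r ler_nat].
have up : (bern n.+1 c).[x] - f x <= e.
  apply: le_trans B; have -> : (bern n.+1 c).[x] - f x = (bern n.+1 (fun i => 1 * c i + (- f x))).[x].
    by rewrite (bern_lin _ _ c (fun=> - f x)) bern_cst mul1r.
  apply: bern_le => // i /cb ib; rewrite mul1r /c.
  by apply: le_trans (fxy _ _ xab ib); rewrite distrC ler_norm.
have dn : f x - (bern n.+1 c).[x] <= e.
  apply: le_trans B; have -> : f x - (bern n.+1 c).[x] = (bern n.+1 (fun i => (-1) * c i + f x)).[x].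
    by rewrite (bern_lin _ _ c (fun=> f x)) bern_cst mulN1r addrC.
  apply: bern_le => // i /cb ib; rewrite mulN1r /c addrC.
  by apply: le_trans (fxy _ _ xab ib); rewrite ler_norm.
by rewrite ler_norml; apply/andP; split; lra.
Qed.

Lemma weierstrass f (M : R) : continuous f -> forall e, 0 < e ->
  exists p : {poly R}, forall x, `|x| <= M -> `|f x - p.[x]| <= e.
Proof.
move=> cf e e0; pose m := `|M| + 1; have m0 : 0 < m by rewrite ltr_wpDl.
have cg : forall t, 0 <= t <= 1 -> {for t, continuous (fun t => f (2 * m * t - m))}.
  move=> t _; apply: (@continuous_comp _ _ _ (fun t => 2 * m * t - m) f); last exact: cf.
  by apply: cvgB; [apply: cvgM; [exact: cvg_cst|exact: cvg_id]|exact: cvg_cst].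
have [p hp] := weierstrass01 cg e0.
exists (p \Po ((2 * m)^-1 *: ('X + m%:P))) => x xM.
have xm : `|x| <= m by apply: (le_trans xM); apply: (le_trans (ler_norm M)); rewrite lerDl.
pose y := (x + m) / (2 * m).
rewrite horner_comp (_ : (_ *: _).[x] = y); last by rewrite /y !hornerE mulrC.
have -> : x = 2 * m * y - m by rewrite /y; field; rewrite gt_eqF.
apply: hp; move: xm; rewrite ler_norml => /andP[h1 h2]; rewrite /y; apply/andP; split.
  by rewrite divr_ge0 ?mulr_ge0 ?(ltW m0)//; lra.
by rewrite ler_pdivrMr ?mulr_gt0//; lra.
Qed.

End RealTools.

(** * Norm continuity of the functional calculus *)

Section NormContinuity.
Context {R : realType} {H : completeNormedModType R[i]} (ip : H -> H -> R[i]).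
Context (hip : hilbert_inner_product ip).
Local Notation sa := (sa ip).
Local Notation fc := (fc ip).
Implicit Types (A B T S C U W X Y Z G K Q V D F : bop H) (M e : R) (f g : R -> R).

Lemma lb_horner (p : {poly R}) : lb (fun u : R => p.[u]).
Proof. by apply: lb_continuous; exact: continuous_horner. Qed.

Lemma fc_horner_lip (p : {poly R}) M : 0 <= M -> exists2 c, 0 <= c & forall A B, sa A -> sa B ->
  opnorm A <= M -> opnorm B <= M ->
  opnorm (fc B (fun u => p.[u])) <= c /\
  opnorm (fc A (fun u => p.[u]) - fc B (fun u => p.[u])) <= c * opnorm (A - B).
Proof.
move=> M0; elim/poly_ind: p => [|p k [c c0 ih]].
  exists 0 => // A B sA sB _ _.
  have e T : sa T -> fc T (fun u => (0 : {poly R}).[u]) = 0.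
    by move=> sT; rewrite -sc0 -(fc_cst hip sT); congr fc; apply/funext => u; rewrite horner0.
  by rewrite !e// subrr opnorm0 mul0r.
exists (c * M + `|k| + c); first by rewrite !addr_ge0// mulr_ge0.
move=> A B sA sB hA hB; have [h1 h2] := ih A B sA sB hA hB.
have [h1' _] := ih B A sB sA hB hA.
have lid := @lb_id R.
have e T : sa T -> fc T (fun u => (p * 'X + k%:P).[u]) = fc T (fun u => p.[u]) * T + sc k.
  move=> sT; have lp := lb_horner p.
  have -> : (fun u => (p * 'X + k%:P).[u]) = (fun u => p.[u] * u + k).
    by apply/funext => u; rewrite !hornerE.
  by rewrite (fcD hip sT (lbM lp lid) (lb_cst k)) (fcM hip sT lp lid) (fc_id hip sT) (fc_cst hip sT).
rewrite !e//; set P := fc A _ in h2 h1' *; set Q := fc B _ in h1 h2 *.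
have o0 := opnorm_ge0 (A - B); split.
  apply: (le_trans (opnormD _ _)); apply: (le_trans (lerD (opnormM _ _) (opnorm_sc _))).
  apply: (@le_trans _ _ (c * M + `|k|)); last by rewrite lerDl.
  by rewrite lerD2r; apply: ler_pM => //; exact: opnorm_ge0.
have -> : P * A + sc k - (Q * B + sc k) = (P - Q) * A + Q * (A - B).
  by rewrite mulrBl mulrBr opprD addrACA subrr addr0 addrA subrK.
apply: (le_trans (opnormD _ _)); apply: (le_trans (lerD (opnormM _ _) (opnormM _ _))).
apply: (@le_trans _ _ (c * opnorm (A - B) * M + c * opnorm (A - B))).
  by apply: lerD; apply: ler_pM => //; exact: opnorm_ge0.
have : 0 <= `|k| * opnorm (A - B) by rewrite mulr_ge0.
rewrite !mulrDl [c * opnorm _ * M]mulrAC; lra.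
Qed.

Lemma fc_norm_cont f M e : continuous f -> 0 < e -> exists2 d, 0 < d & forall A B, sa A -> sa B ->
  opnorm A <= M -> opnorm B <= M -> opnorm (A - B) < d -> opnorm (fc A f - fc B f) <= e.
Proof.
move=> cf e0; have lf := lb_continuous cf.
have [M0|M0] := ltP M 0; first by exists 1 => // A B _ _ /le_lt_trans/(_ M0); rewrite ltNge opnorm_ge0.
have e30 : 0 < e / 3 by rewrite divr_gt0.
have [p hp] := weierstrass (M + 1) cf e30; have lp := lb_horner p.
have [c c0 hc] := fc_horner_lip p M0.
have c10 : 0 < c + 1 by rewrite ltr_wpDl.
exists (e / 3 / (c + 1)) => [|A B sA sB hA hB hAB]; first by rewrite !divr_gt0.
have app T : sa T -> opnorm T <= M -> opnorm (fc T f - fc T (fun u => p.[u])) <= e / 3.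
  move=> sT hT; rewrite -(fcB hip sT lf lp); apply: (fc_norm hip sT (lbB lf lp) (ltW e30)) => u hu.
  by apply: hp; apply: (le_trans hu); rewrite lerD2r.
have [_ h] := hc A B sA sB hA hB.
have h' : opnorm (fc A (fun u => p.[u]) - fc B (fun u => p.[u])) <= e / 3.
  apply: (le_trans h); apply: (@le_trans _ _ ((c + 1) * opnorm (A - B))).
    by rewrite ler_wpM2r ?opnorm_ge0// lerDl.
  by rewrite mulrC -ler_pdivlMr// ltW.
have -> : fc A f - fc B f = (fc A f - fc A (fun u => p.[u])) +
    (fc A (fun u => p.[u]) - fc B (fun u => p.[u])) - (fc B f - fc B (fun u => p.[u])).
  by rewrite opprB !addrA !subrK.
apply: (le_trans (opnormD _ _)); rewrite opnormN (_ : e = e / 3 + e / 3 + e / 3); last by field.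
apply: lerD; last exact: app.
by apply: (le_trans (opnormD _ _)); apply: lerD => //; exact: app.
Qed.

End NormContinuity.

(** * Integrals along segments *)

Section JIntegral.
Context {R : realType} {H : completeNormedModType R[i]} (ip : H -> H -> R[i]).
Context (hip : hilbert_inner_product ip).
Context (N : set (H -> H)) (hN : von_neumann_algebra ip N).
Context (tau : (H -> H) -> \bar R) (htau : fns_trace ip N tau).
Local Notation "<< x , y >>" := (rip ip x y).
Local Notation sa := (sa ip).
Local Notation psd := (psd ip).
Local Notation fc := (fc ip).
Local Notation NP := (NP ip N).
Local Notation FT := (FT ip N tau).
Local Notation TC := (TC ip N tau).
Local Notation ft := (ft tau).
Local Notation rtr := (rtr ip tau).
Local Notation tnorm := (tnorm ip tau).
Local Notation beta := (beta ip tau).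
Implicit Types (A B T S U W X Y Z G K Q V D F : bop H) (h f g : R -> R) (e c M s : R).

Lemma FT_sqr K : FT K -> FT (K * K) /\ ft (K * K) <= opnorm K * ft K.
Proof.
move=> hK; have [[nK pK] _] := hK; have [sK _] := pK.
have [G [nG pG GG]] := NP_sqrt hip hN hK.1; have [sG _] := pG.
have o0 := opnorm_ge0 K.
have d : psd (opnorm K *: K - K * K).
  have := psd_sandwich hip sG (psd_opnormB hip sK (lexx (opnorm K))); congr psd.
  by rewrite mulrBr mulrBl scMr bopAl GG -{3}GG !mulrA -GG !mulrA.
have n2 : NP (K * K) by split; [exact: (NM hN)|exact: (psd_sqr hip)].
have f := FT_le hip hN htau n2 (FTZ hip hN htau o0 hK) d; split; first exact: f.
by rewrite -(ftZ hip htau)//; exact: (ft_le hip hN htau f (FTZ hip hN htau o0 hK) d).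
Qed.

(* The integral of the one-form along the segment from [A] to [A + U], where [h^2] plays the
   role of the weight [f_r(1 - x^2)]. *)
Definition integrand h A U (s : R) : R := beta U (fc (A + s *: U) h * fc (A + s *: U) h).
Definition J h A U : R := \int[lebesgue_measure]_(s in `[0, 1]) integrand h A U s.

Definition adm h A U c := [/\ N A, sa A, N U, sa U &
  forall s, 0 <= s <= 1 -> FT (fc (A + s *: U) h) /\ ft (fc (A + s *: U) h) <= c].

(** Only operator norms of differences and trace bounds on K and K' enter; neither U - U' nor K - K'
    has to be small in trace norm. *)
Lemma beta_sqr_diff U U' K K' c m : sa U -> N U -> sa U' -> N U' -> FT K -> FT K' ->
  ft K <= c -> ft K' <= c -> opnorm K <= m ->
  `|beta U (K * K) - beta U' (K' * K')| <=
    opnorm (U - U') * (m * c) + opnorm U' * opnorm (K - K') * (2 * c).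
Proof.
move=> sU nU sU' nU' fK fK' kc kc' km.
have [f2 b2] := FT_sqr fK; have [f2' b2'] := FT_sqr fK'.
have [t1 _] := beta_FT hip hN htau sU nU f2; have [t2 _] := beta_FT hip hN htau sU' nU' f2.
have sD := saB hip sU sU'; have nD := NB hN nU nU'.
have [t3 b3] := beta_FT hip hN htau sD nD f2.
have e : beta U (K * K) = beta (U - U') (K * K) + beta U' (K * K).
  by rewrite -(betaDl hip hN htau)// subrK.
have -> : beta U (K * K) - beta U' (K' * K') =
    beta (U - U') (K * K) + (beta U' (K * K) - beta U' (K' * K')) by rewrite e addrA.
apply: (le_trans (ler_normD _ _)); apply: lerD.
  apply: (le_trans b3); rewrite ler_wpM2l ?opnorm_ge0//; apply: (le_trans b2).
  by apply: ler_pM; rewrite ?opnorm_ge0//; exact: (FT_ge0 hip htau) fK.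
apply: (le_trans (beta_sqr_dist hip hN htau sU' nU' fK fK' f2 f2')).
rewrite ler_wpM2l ?mulr_ge0 ?opnorm_ge0// mulrDl mul1r; exact: lerD.
Qed.

Lemma seg_sa A U s : sa A -> sa U -> sa (A + s *: U).
Proof. by move=> sA sU; apply: (saD hip) => //; exact: (saZ hip). Qed.
Lemma seg_norm A U s : 0 <= s <= 1 -> opnorm (A + s *: U) <= opnorm A + opnorm U.
Proof.
move=> /andP[s0 s1]; apply: (le_trans (opnormD _ _)); rewrite lerD2l.
apply: (le_trans (opnormZ_le _ _)); rewrite ger0_norm//.
by rewrite ler_piMl// opnorm_ge0.
Qed.
Lemma seg_dist A U s t : opnorm (A + s *: U - (A + t *: U)) <= `|s - t| * opnorm U.
Proof.
rewrite opprD addrACA subrr add0r -scalerBl; exact: opnormZ_le.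
Qed.

Lemma fc_seg_cont h A U : continuous h -> sa A -> sa U -> forall e, 0 < e ->
  exists2 d, 0 < d & forall s t, 0 <= s <= 1 -> 0 <= t <= 1 -> `|s - t| < d ->
    opnorm (fc (A + s *: U) h - fc (A + t *: U) h) <= e.
Proof.
move=> ch sA sU e e0; have [d d0 hd] := fc_norm_cont hip (opnorm A + opnorm U) ch e0.
have u0 : 0 < opnorm U + 1 by rewrite ltr_wpDl ?opnorm_ge0.
exists (d / (opnorm U + 1)) => [|s t s01 t01 st]; first exact: divr_gt0.
apply: hd; [exact: seg_sa|exact: seg_sa|exact: seg_norm|exact: seg_norm|].
apply: (le_lt_trans (seg_dist _ _ _ _)).
apply: (@le_lt_trans _ _ (`|s - t| * (opnorm U + 1))); first by rewrite ler_wpM2l// lerDl.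
by rewrite -ltr_pdivlMr.
Qed.

Lemma integrand_cont h A U c : continuous h -> adm h A U c -> cont_on (integrand h A U) 0 1.
Proof.
move=> ch [nA sA nU sU hf] t t01 e e0.
have c0 : 0 <= c by have [f b] := hf t t01; apply: le_trans b; exact: (FT_ge0 hip htau) f.
pose w := opnorm U * (2 * c) + 1; have w0 : 0 < w.
  by rewrite ltr_wpDl// mulr_ge0 ?opnorm_ge0// mulr_ge0.
have [d d0 hd] := fc_seg_cont ch sA sU (divr_gt0 e0 w0).
exists d => // s s01 st; have [f1 b1] := hf s s01; have [f2 b2] := hf t t01.
apply: (le_trans (beta_sqr_diff sU nU sU nU f1 f2 b1 b2 (lexx _))).
rewrite subrr opnorm0 mul0r add0r; have := hd s t s01 t01 st; rewrite ler_pdivlMr// => h1.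
apply: le_trans h1; rewrite mulrAC mulrC ler_wpM2l ?opnorm_ge0// lerDl.
exact: ler01.
Qed.

Lemma J_dist h h' A U A' U' c m e : continuous h -> continuous h' -> adm h A U c -> adm h' A' U' c ->
  (forall s, 0 <= s <= 1 -> opnorm (fc (A + s *: U) h) <= m) ->
  (forall s, 0 <= s <= 1 -> opnorm (fc (A + s *: U) h - fc (A' + s *: U') h') <= e) ->
  `|J h A U - J h' A' U'| <= opnorm (U - U') * (m * c) + opnorm U' * e * (2 * c).
Proof.
move=> ch ch' a a' hm he; have i1 := cont_on_integrable (integrand_cont ch a).
have i2 := cont_on_integrable (integrand_cont ch' a').
have [nA sA nU sU hf] := a; have [nA' sA' nU' sU' hf'] := a'.
have mI : measurable (`[(0 : R), 1]%classic : set (measurableTypeR R)) by [].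
have bd s : 0 <= s <= 1 -> `|integrand h A U s - integrand h' A' U' s| <=
    opnorm (U - U') * (m * c) + opnorm U' * e * (2 * c).
  move=> s01; have [f1 b1] := hf s s01; have [f2 b2] := hf' s s01.
  apply: (le_trans (beta_sqr_diff sU nU sU' nU' f1 f2 b1 b2 (hm s s01))).
  rewrite lerD2l; have c0 : 0 <= c by apply: le_trans b1; exact: (FT_ge0 hip htau) f1.
  by rewrite ler_wpM2r ?mulr_ge0// ler_wpM2l ?opnorm_ge0// he.
rewrite /J -RintegralB//.
have i3 : (@lebesgue_measure R).-integrable `[0, 1] (EFin \o (fun s => integrand h A U s - integrand h' A' U' s)).
  by have := integrableB mI i1 i2.
apply: (le_trans (le_normr_Rintegral mI i3)).
set C := opnorm (U - U') * _ + _ in bd *.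
have -> : C = \int[lebesgue_measure]_(s in `[(0 : R), 1]) C.
  by rewrite itv_integral_cst// subr0 mulr1.
apply: itv_integral_le => //; [by have := integrable_norm i3|exact: itv_cst_integrable].
Qed.

Lemma rtr_sym_bound U X X' : TC U -> adjp ip X X' -> N X ->
  TC (X * U + U * X') /\ `|rtr (X * U + U * X')| <= 2 * opnorm X * tnorm U.
Proof.
move=> tU hX nX; have [sXX nX'] : sa (X + X') /\ N X'.
  by split; [move=> x y; rewrite !bopE (ripDl hip)// (ripDr hip)// hX (adjpC hip hX) addrC|exact: (N_adj hip hN) hX nX].
have pos P : FT P -> TC (X * P + P * X') /\ `|rtr (X * P + P * X')| <= 2 * opnorm X * ft P.
  move=> hP; have [G [nG pG GG]] := NP_sqrt hip hN hP.1.
  have [t1 t2 e] := rtr_polar hip hN htau hX (sa1 ip) nX (N1 hN) hP nG pG GG.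
  move: t1 t2 e; rewrite !mulr1 !mul1r => t1 t2 e; split; first exact: t1.
  rewrite e; have [_ b] := rtr_GXG hip hN htau sXX (ND hN nX nX') hP nG pG GG.
  apply: (le_trans b); rewrite ler_wpM2r ?(FT_ge0 hip htau hP)//.
  apply: (le_trans (opnormD _ _)); rewrite mulr_natl mulr2n lerD2l; exact: (opnorm_adj hip) hX.
have [P [Q [hP hQ eU ->]]] := TC_split hip tU.
have [t1 b1] := pos P hP; have [t2 b2] := pos Q hQ; have [t3 r3] := rtrB hip hN htau t1 t2.
have -> : X * U + U * X' = X * P + P * X' - (X * Q + Q * X') by rewrite eU; bopring hip.
split; first exact: t3.
rewrite r3 mulrDr; apply: (le_trans (ler_normB _ _)); exact: lerD.
Qed.

Lemma rtr_sum n (F : nat -> bop H) : (forall i, (i < n)%N -> TC (F i)) ->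
  TC (\sum_(i < n) F i) /\ rtr (\sum_(i < n) F i) = \sum_(i < n) rtr (F i).
Proof.
elim: n => [|n ih] h; first by rewrite !big_ord0; split; [exact: (TC0 hip hN htau)|exact: (rtr0 hip hN htau)].
have [t1 r1] := ih (fun i hi => h i (ltnW hi)).
by rewrite !big_ord_recr /=; have [t2 r2] := rtrD hip hN htau t1 (h n (ltnSn n)); rewrite r2 r1.
Qed.

Lemma telescope_exp B V n :
  (B + V) ^+ n - B ^+ n = \sum_(j < n) (B + V) ^+ j * V * B ^+ (n.-1 - j)%N.
Proof.
elim: n => [|n ih]; first by rewrite big_ord0 !expr0 subrr.
rewrite big_ord_recr /= subnn expr0 mulr1.
have -> : \sum_(i < n) (B + V) ^+ i * V * B ^+ (n - i)%N = (\sum_(i < n) (B + V) ^+ i * V * B ^+ (n.-1 - i)%N) * B.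
  rewrite mulr_suml; apply: eq_bigr => i _; rewrite -[RHS]mulrA -exprSr; congr (_ * _ ^+ _).
  by case: n i {ih} => [[]//|n i] /=; rewrite subSn// -ltnS.
rewrite -ih !exprSr mulrBl mulrDr; move: (_ ^+ n * B) => X; move: (B ^+ n * B) (_ * V) => Y Z.
by rewrite addrAC.
Qed.

Lemma telescope_expr B V n :
  (B + V) ^+ n - B ^+ n = \sum_(j < n) B ^+ (n.-1 - j)%N * V * (B + V) ^+ j.
Proof.
elim: n => [|n ih]; first by rewrite big_ord0 !expr0 subrr.
rewrite big_ord_recr /= subnn expr0 mul1r.
have -> : \sum_(i < n) B ^+ (n - i)%N * V * (B + V) ^+ i = B * (\sum_(i < n) B ^+ (n.-1 - i)%N * V * (B + V) ^+ i).
  rewrite mulr_sumr; apply: eq_bigr => i _; rewrite !mulrA -exprS; congr (_ ^+ _ * _ * _).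
  by case: n i {ih} => [[]//|n i] /=; rewrite subSn// -ltnS.
rewrite -ih !exprS mulrBr mulrDl; move: (B * (_ ^+ n)) (B * B ^+ n) (V * _) => X Y Z.
by rewrite addrAC.
Qed.

Lemma opnorm_exp B n M : 1 <= M -> opnorm B <= M -> opnorm (B ^+ n) <= M ^+ n.
Proof.
move=> M1 hB; have M0 : 0 <= M by exact: le_trans M1.
elim: n => [|n ih]; first by rewrite !expr0 opnorm1.
rewrite !exprS; apply: (le_trans (opnormM _ _)).
by apply: ler_pM => //; exact: opnorm_ge0.
Qed.

Lemma opnorm_exp_dist B B' n M : 1 <= M -> opnorm B <= M -> opnorm B' <= M ->
  opnorm (B' ^+ n - B ^+ n) <= n%:R * M ^+ n * opnorm (B' - B).
Proof.
move=> M1 hB hB'; have M0 : 0 <= M by exact: le_trans M1.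
have o0 := opnorm_ge0 (B' - B).
elim: n => [|n ih]; first by rewrite !expr0 subrr opnorm0 !mul0r.
have -> : B' ^+ n.+1 - B ^+ n.+1 = (B' ^+ n - B ^+ n) * B' + B ^+ n * (B' - B).
  by rewrite mulrBl mulrBr !exprSr addrA subrK.
apply: (le_trans (opnormD _ _)); apply: (le_trans (lerD (opnormM _ _) (opnormM _ _))).
apply: (@le_trans _ _ (n%:R * M ^+ n * opnorm (B' - B) * M + M ^+ n * opnorm (B' - B))).
  by apply: lerD; apply: ler_pM; rewrite ?opnorm_ge0//; exact: opnorm_exp.
have h : M ^+ n * opnorm (B' - B) <= M ^+ n.+1 * opnorm (B' - B).
  by rewrite ler_wpM2r// ler_weXn2l.
apply: (le_trans (lerD (lexx _) h)).
rewrite le_eqVlt; apply/orP; left; apply/eqP; rewrite exprSr -[n.+1]addn1 natrD; ring.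
Qed.

(** With B' = B + s U, averaging the two telescoping expansions of B'^(n+1) - B^(n+1) makes every
    term self-adjoint. [rtr_cyc] brings the powers to one side of U, and replacing their product by
    B^n costs a further factor s. *)
Lemma rtr_exp_diff B U (s : R) n M : sa B -> N B -> TC U -> 1 <= M ->
  opnorm B <= M -> opnorm (B + s *: U) <= M ->
  TC ((B + s *: U) ^+ n.+1 - B ^+ n.+1) /\
  `|rtr ((B + s *: U) ^+ n.+1 - B ^+ n.+1) - s * (n.+1%:R * beta U (B ^+ n))| <=
     s ^+ 2 * (n.+1%:R * (n%:R * M ^+ n) * opnorm U * tnorm U).
Proof.
move=> sB nB tU M1 hB; set B' := B + s *: U => hB'.
have [nU sU _ _] := tU; have sB' : sa B' by exact: seg_sa.
have nB' : N B' by apply: (ND hN) => //; exact: (NZ hN).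
have M0 : 0 <= M by exact: le_trans M1.
pose X (j : nat) := B ^+ (n - j)%N * B' ^+ j; pose X' (j : nat) := B' ^+ j * B ^+ (n - j)%N.
have aX j : adjp ip (X j) (X' j) by apply: adjpM; exact: saX.
have nX j : N (X j) by apply: (NM hN); exact: (NX hN).
have cyc j : [/\ TC (B' ^+ j * U * B ^+ (n - j)%N + B ^+ (n - j)%N * U * B' ^+ j), TC (X j * U + U * X' j) &
    rtr (B' ^+ j * U * B ^+ (n - j)%N + B ^+ (n - j)%N * U * B' ^+ j) = rtr (X j * U + U * X' j)].
  have s1 : sa (B' ^+ j) by exact: saX.
  have s2 : sa (B ^+ (n - j)) by exact: saX.
  exact: (rtr_cyc hip hN htau s1 s2 (NX hN _ nB') (NX hN _ nB) tU).
have eD : B' ^+ n.+1 - B ^+ n.+1 =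
    (2^-1 * s) *: \sum_(j < n.+1) (B' ^+ j * U * B ^+ (n - j)%N + B ^+ (n - j)%N * U * B' ^+ j).
  rewrite big_split/=; have e1 := telescope_exp B (s *: U) n.+1; have e2 := telescope_expr B (s *: U) n.+1.
  rewrite -/B' in e1 e2.
  have e1' : B' ^+ n.+1 - B ^+ n.+1 = s *: \sum_(j < n.+1) (B' ^+ j * U * B ^+ (n - j)%N).
    by rewrite e1 scaler_sumr; apply: eq_bigr => j _; rewrite bopAr bopAl.
  have e2' : B' ^+ n.+1 - B ^+ n.+1 = s *: \sum_(j < n.+1) (B ^+ (n - j)%N * U * B' ^+ j).
    by rewrite e2 scaler_sumr; apply: eq_bigr => j _; rewrite bopAr bopAl.
  rewrite scalerDr -!scalerA -e1' -e2' -scalerDl (_ : 2^-1 + 2^-1 = 1) ?scale1r//.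
  by field.
have [tS rS] := rtr_sum (F := fun j => B' ^+ j * U * B ^+ (n - j)%N + B ^+ (n - j)%N * U * B' ^+ j)
   (n := n.+1) (fun j _ => let: And3 h _ _ := cyc j in h).
rewrite eD; have [tR rR] := rtrZ hip hN htau (2^-1 * s) tS; split; first exact: tR.
rewrite rR rS.
have -> : \sum_(i < n.+1) rtr (B' ^+ i * U * B ^+ (n - i) + B ^+ (n - i) * U * B' ^+ i) =
    \sum_(i < n.+1) rtr (X i * U + U * X' i).
  by apply: eq_bigr => i _; have [_ _] := cyc i.
have -> : n.+1%:R * beta U (B ^+ n) = 2^-1 * \sum_(i < n.+1) rtr (B ^+ n * U + U * B ^+ n).
  by rewrite sumr_const card_ord /beta [U * _ + _]addrC -mulr_natl; ring.
rewrite [s * _]mulrA [s * 2^-1]mulrC -mulrBr -sumrB normrM.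
have b (i : 'I_n.+1) : `|rtr (X i * U + U * X' i) - rtr (B ^+ n * U + U * B ^+ n)| <=
     2 * (n%:R * M ^+ n * (`|s| * opnorm U)) * tnorm U.
  have sBn : sa (B ^+ n) by exact: saX.
  have nBn : N (B ^+ n)%R by exact: (NX hN).
  have [_ t1 _] := cyc i; have [t2 _] := rtr_sym_bound tU sBn nBn.
  have aD : adjp ip (X i - B ^+ n) (X' i - B ^+ n) by apply: (adjpD hip) => //; exact: (adjpN hip).
  have [_ b] := rtr_sym_bound tU aD (NB hN (nX i) nBn).
  have [_ <-] := rtrB hip hN htau t1 t2.
  have -> : X i * U + U * X' i - (B ^+ n * U + U * B ^+ n) = (X i - B ^+ n) * U + U * (X' i - B ^+ n).
    by rewrite mulrBl mulrBr opprD addrACA.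
  apply: (le_trans b).
  have tn0 : 0 <= tnorm U by case: tU => _ _ f1 f2; rewrite addr_ge0 ?(FT_ge0 hip htau f1) ?(FT_ge0 hip htau f2).
  rewrite ler_wpM2r// ler_pM2l//.
  have ei : B ^+ n = B ^+ (n - i) * B ^+ i by rewrite -exprD subnK// -ltnS.
  rewrite ei /X -mulrBr; apply: (le_trans (opnormM _ _)).
  have h1 := opnorm_exp (n - i) M1 hB; have h2 := opnorm_exp_dist i M1 hB hB'.
  have h3 : opnorm (B' - B) <= `|s| * opnorm U by rewrite /B' addrAC subrr add0r; exact: opnormZ_le.
  apply: (@le_trans _ _ (M ^+ (n - i) * (i%:R * M ^+ i * (`|s| * opnorm U)))).
    apply: ler_pM; rewrite ?opnorm_ge0//; apply: (le_trans h2).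
    by rewrite ler_wpM2l// mulr_ge0// exprn_ge0.
  have eM : M ^+ (n - i) * M ^+ i = M ^+ n by rewrite -exprD subnK// -ltnS.
  have -> : M ^+ (n - i) * (i%:R * M ^+ i * (`|s| * opnorm U)) = i%:R * (M ^+ n * (`|s| * opnorm U)).
    by rewrite -eM; ring.
  rewrite -[leRHS]mulrA; apply: ler_wpM2r; last by rewrite ler_nat -ltnS.
  by apply: mulr_ge0; [exact: exprn_ge0|apply: mulr_ge0; [exact: normr_ge0|exact: opnorm_ge0]].
apply: (@le_trans _ _ (`|2^-1 * s| * \sum_(i < n.+1) (2 * (n%:R * M ^+ n * (`|s| * opnorm U)) * tnorm U))).
  rewrite ler_wpM2l//; apply: (le_trans (ler_norm_sum _ _ _)); apply: ler_sum => i _; exact: b.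
have h0 : 0 <= (2^-1 : R) by rewrite invr_ge0 ler0n.
rewrite sumr_const card_ord -[X in _ * X]mulr_natl [`|2^-1 * s|]normrM (ger0_norm h0) -[s ^+ 2]real_normK ?num_real//.
rewrite le_eqVlt; apply/orP; left; apply/eqP; move: (`|s|) (n.+1%:R) => a k; field.
exact: isT.
Qed.

Definition Jt g A U : R := \int[lebesgue_measure]_(s in `[0, 1]) beta U (fc (A + s *: U) g).

Lemma tnorm_ge0 U : TC U -> 0 <= tnorm U.
Proof. by case=> _ _ f1 f2; rewrite addr_ge0 ?(FT_ge0 hip htau f1) ?(FT_ge0 hip htau f2). Qed.

Lemma beta_TC_diff U W W' : TC U -> sa W -> N W -> sa W' -> N W' ->
  [/\ TC (U * W + W * U), `|beta U W| <= opnorm W * tnorm U &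
   `|beta U W - beta U W'| <= opnorm (W - W') * tnorm U].
Proof.
move=> tU sW nW sW' nW'; have [t1 b1] := beta_TC hip hN htau sW nW tU; have [t2 _] := beta_TC hip hN htau sW' nW' tU.
have [t3 b3] := beta_TC hip hN htau (saB hip sW sW') (NB hN nW nW') tU.
split; [by rewrite addrC|by rewrite betaC|].
rewrite [beta U W]betaC [beta U W']betaC -[W in beta W U](subrK W') (betaDl hip hN htau)// addrK.
exact: b3.
Qed.

Lemma Jt_cont g A U : continuous g -> N A -> sa A -> TC U ->
  cont_on (fun s => beta U (fc (A + s *: U) g)) 0 1.
Proof.
move=> cg nA sA tU t t01 e e0; have [nU sU _ _] := tU; have lg := lb_continuous cg.
have w0 : 0 < tnorm U + 1 by rewrite ltr_wpDl// tnorm_ge0.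
have [d d0 hd] := fc_seg_cont cg sA sU (divr_gt0 e0 w0).
exists d => // s s01 st.
have nB z : N (A + z *: U)%R by apply: (ND hN) => //; exact: (NZ hN).
have sB z : sa (A + z *: U) by exact: seg_sa.
have [_ _ b] := beta_TC_diff tU (fc_sa hip (sB s) lg) (N_fc hip hN (nB s) (sB s) lg) (fc_sa hip (sB t) lg) (N_fc hip hN (nB t) (sB t) lg).
apply: (le_trans b); have := hd s t s01 t01 st; rewrite ler_pdivlMr//; apply: le_trans.
by rewrite ler_wpM2l ?opnorm_ge0// lerDl.
Qed.

(** The difference of powers is of trace class even if the powers are not, and the derivative in s
    of its trace at A + s U is n + 1 times [beta U] of the n-th power of A + s U. *)
Lemma Jt_pow n A U : N A -> sa A -> TC U ->
  Jt (fun u => u ^+ n) A U = n.+1%:R^-1 * rtr ((A + U) ^+ n.+1 - A ^+ n.+1) /\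
  TC ((A + U) ^+ n.+1 - A ^+ n.+1).
Proof.
move=> nA sA tU; have [nU sU _ _] := tU; have lid := @lb_id R.
have cp : continuous (fun u : R => u ^+ n) by move=> u; exact: exprn_continuous.
have nB z : N (A + z *: U)%R by apply: (ND hN) => //; exact: (NZ hN).
have sB z : sa (A + z *: U) by exact: seg_sa.
pose M := opnorm A + opnorm U + 1.
have M1 : 1 <= M by rewrite lerDr addr_ge0// opnorm_ge0.
have hM s : 0 <= s <= 1 -> opnorm (A + s *: U) <= M.
  by move=> s01; apply: (le_trans (seg_norm A U s01)); rewrite lerDl.
have step s t : A + s *: U = A + t *: U + (s - t) *: U by rewrite scalerBl addrA addrK || rewrite -addrA -scalerDl subrKC.
have M2 s t : 0 <= s <= 1 -> opnorm (A + t *: U + (s - t) *: U) <= M by rewrite -step; exact: hM.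
have T s t : 0 <= s <= 1 -> 0 <= t <= 1 -> TC ((A + s *: U) ^+ n.+1 - (A + t *: U) ^+ n.+1).
  move=> s01 t01; have [h _] := rtr_exp_diff n (sB t) (nB t) tU M1 (hM t t01) (M2 s t s01).
  by rewrite -step in h.
have i0 : 0 <= (0 : R) <= 1 by rewrite lexx ler01.
have i1 : 0 <= (1 : R) <= 1 by rewrite lexx ler01.
have T1 : TC ((A + U) ^+ n.+1 - A ^+ n.+1) by have := T 1 0 i1 i0; rewrite scale1r scale0r addr0.
split; last exact: T1.
pose F s := n.+1%:R^-1 * rtr ((A + s *: U) ^+ n.+1 - A ^+ n.+1).
have ej s : fc (A + s *: U) (fun u => u ^+ n) = (A + s *: U) ^+ n.
  by rewrite (fcX hip (sB s) n lid) (fc_id hip).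
have := @FTC_eps R F (fun s => beta U (fc (A + s *: U) (fun u => u ^+ n))) 0 1 ltr01 (Jt_cont cp nA sA tU).
rewrite /Jt => ->.
  rewrite /F scale1r scale0r addr0 subrr.
  by rewrite (rtr0 hip hN htau) mulr0 subr0.
move=> t t01 e e0; pose C := n.+1%:R * (n%:R * M ^+ n) * opnorm U * tnorm U.
have C0 : 0 <= C.
  rewrite /C !mulr_ge0 ?opnorm_ge0 ?tnorm_ge0//; exact: exprn_ge0 (le_trans ler01 M1).
have C1 : 0 < C + 1 by rewrite ltr_wpDl.
exists (e / (C + 1)) => [|s s01 st]; first exact: divr_gt0.
have [_ b] := rtr_exp_diff n (sB t) (nB t) tU M1 (hM t t01) (M2 s t s01).
rewrite -step -/C in b.
have t1 : TC ((A + s *: U) ^+ n.+1 - A ^+ n.+1) by have := T s 0 s01 i0; rewrite scale0r addr0.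
have t2 : TC ((A + t *: U) ^+ n.+1 - A ^+ n.+1) by have := T t 0 t01 i0; rewrite scale0r addr0.
have -> : F s - F t - (s - t) * beta U (fc (A + t *: U) (fun u => u ^+ n)) =
   n.+1%:R^-1 * (rtr ((A + s *: U) ^+ n.+1 - (A + t *: U) ^+ n.+1) - (s - t) * (n.+1%:R * beta U ((A + t *: U) ^+ n))).
  have [_ r] := rtrB hip hN htau t1 t2; rewrite ej /F.
  have -> : (A + s *: U) ^+ n.+1 - (A + t *: U) ^+ n.+1 = (A + s *: U) ^+ n.+1 - A ^+ n.+1 - ((A + t *: U) ^+ n.+1 - A ^+ n.+1).
    by rewrite opprB addrA subrK.
  by rewrite r !mulrBr (mulrCA _ (s - t)) mulKf// pnatr_eq0.
rewrite normrM normfV (ger0_norm (ler0n R n.+1)).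
apply: (@le_trans _ _ (1 * ((s - t) ^+ 2 * C))).
  by apply: ler_pM; rewrite ?invr_ge0// invf_le1// ler1n.
rewrite mul1r -[(s - t) ^+ 2]real_normK ?num_real// expr2 mulrAC -mulrA mulrC -mulrA.
rewrite mulrA ler_wpM2r//; apply: (@le_trans _ _ (`|s - t| * (C + 1))).
  by rewrite mulrC ler_wpM2l// lerDl.
by rewrite -ler_pdivlMr// ltW.
Qed.

Definition exact_for g := forall A U V, N A -> sa A -> TC U -> TC V ->
  Jt g A U + Jt g (A + U) (V - U) = Jt g A V.

Lemma exact_pow n : exact_for (fun u => u ^+ n).
Proof.
move=> A U V nA sA tU tV; have [nU sU _ _] := tU.
have [tVU _] := rtrB hip hN htau tV tU.
have [e1 t1] := Jt_pow n nA sA tU; have [e2 t2] := Jt_pow n (ND hN nA nU) (saD hip sA sU) tVU.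
have [e3 t3] := Jt_pow n nA sA tV; rewrite e1 e2 e3 -mulrDr; congr (_ * _).
have [_ <-] := rtrD hip hN htau t1 t2; congr (rtr _).
have -> : A + U + (V - U) = A + V by bopring hip.
by rewrite addrC addrA subrK.
Qed.

Lemma Jt_lin k g g' A U : continuous g -> continuous g' -> N A -> sa A -> TC U ->
  Jt (fun u => k * g u + g' u) A U = k * Jt g A U + Jt g' A U.
Proof.
move=> cg cg' nA sA tU; have [nU sU _ _] := tU.
have lg := lb_continuous cg; have lg' := lb_continuous cg'.
have i1 := cont_on_integrable (Jt_cont cg nA sA tU).
have i2 := cont_on_integrable (Jt_cont cg' nA sA tU).
have mI : measurable (`[(0 : R), 1]%classic : set (measurableTypeR R)) by [].
have i3 : (@lebesgue_measure R).-integrable `[0, 1] (EFin \o (fun s => k * beta U (fc (A + s *: U) g))).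
  by have := integrableZl mI k i1.
rewrite /Jt -(RintegralZl k mI i1) -(RintegralD mI i3 i2).
apply: eq_Rintegral => s _.
have sB := seg_sa s sA sU; have nB : N (A + s *: U)%R by apply: (ND hN) => //; exact: (NZ hN).
rewrite (fcD hip sB (lbZ k lg) lg') (fcZ hip sB k lg).
have [t1 _ _] := beta_TC_diff tU (fc_sa hip sB lg) (N_fc hip hN nB sB lg) (fc_sa hip sB lg) (N_fc hip hN nB sB lg).
have [t2 _ _] := beta_TC_diff tU (fc_sa hip sB lg') (N_fc hip hN nB sB lg') (fc_sa hip sB lg) (N_fc hip hN nB sB lg).
have t3 : TC (U * (k *: fc (A + s *: U) g) + (k *: fc (A + s *: U) g) * U).
  by rewrite bopAr bopAl -scalerDr; case: (rtrZ hip hN htau k t1).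
by rewrite (betaDr hip hN htau)// (betaZr hip hN htau).
Qed.

Lemma exact_lin k g g' : continuous g -> continuous g' -> exact_for g -> exact_for g' ->
  exact_for (fun u => k * g u + g' u).
Proof.
move=> cg cg' h h' A U V nA sA tU tV; have [nU sU _ _] := tU.
have [tVU _] := rtrB hip hN htau tV tU.
have nAU : N (A + U)%R by exact: (ND hN). have sAU : sa (A + U) by exact: (saD hip).
rewrite (Jt_lin k cg cg' nA sA tU) (Jt_lin k cg cg' nAU sAU tVU) (Jt_lin k cg cg' nA sA tV).
rewrite -(h A U V nA sA tU tV) -(h' A U V nA sA tU tV).
move: (Jt g A U) (Jt g (A + U) (V - U)) (Jt g' A U) (Jt g' (A + U) (V - U)) => a b c d; ring.
Qed.

Lemma exact_horner (p : {poly R}) : exact_for (fun u => p.[u]).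
Proof.
pose g n u : R := \sum_(i < n) p`_i * u ^+ i.
suff h n : continuous (g n) /\ exact_for (g n).
  have -> : (fun u => p.[u]) = g (size p) by apply/funext => u; rewrite horner_coef.
  by case: (h (size p)).
elim: n => [|n [c1 e1]].
  have -> : g 0%N = fun u => 0 * u ^+ 0 + (-1 * u ^+ 0 + u ^+ 0).
    by apply/funext => u; rewrite /g big_ord0 expr0; ring.
  have c0 : continuous (fun u : R => u ^+ 0) by move=> u; exact: exprn_continuous.
  have c2 : continuous (fun u : R => -1 * u ^+ 0 + u ^+ 0).
    by move=> u; apply: cvgD; [apply: cvgM; [exact: cvg_cst|exact: c0]|exact: c0].
  split; first by move=> u; apply: cvgD; [apply: cvgM; [exact: cvg_cst|exact: c0]|exact: c2].
  have h1 := exact_lin (-1) c0 c0 (exact_pow 0) (exact_pow 0).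
  by have := exact_lin 0 c0 c2 (exact_pow 0) h1.
have -> : g n.+1 = fun u => p`_n * u ^+ n + g n u.
  by apply/funext => u; rewrite /g big_ord_recr /= addrC.
have cn : continuous (fun u : R => u ^+ n) by move=> u; exact: exprn_continuous.
split; first by move=> u; apply: cvgD; [apply: cvgM; [exact: cvg_cst|exact: cn]|exact: c1].
by have := exact_lin p`_n cn c1 (exact_pow n) e1.
Qed.

Lemma Jt_dist g g' A U e M : continuous g -> continuous g' -> N A -> sa A -> TC U -> 0 <= e ->
  opnorm A + opnorm U <= M -> (forall u, `|u| <= M + 1 -> `|g u - g' u| <= e) ->
  `|Jt g A U - Jt g' A U| <= e * tnorm U.
Proof.
move=> cg cg' nA sA tU e0 hM he; have [nU sU _ _] := tU.
have lg := lb_continuous cg; have lg' := lb_continuous cg'.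
have i1 := cont_on_integrable (Jt_cont cg nA sA tU).
have i2 := cont_on_integrable (Jt_cont cg' nA sA tU).
have mI : measurable (`[(0 : R), 1]%classic : set (measurableTypeR R)) by [].
rewrite /Jt -(RintegralB mI i1 i2).
set f := fun s => _ - _.
have i3 : (@lebesgue_measure R).-integrable `[0, 1] (EFin \o f) by have := integrableB mI i1 i2.
apply: (le_trans (le_normr_Rintegral mI i3)).
have -> : e * tnorm U = \int[lebesgue_measure]_(s in `[(0 : R), 1]) (e * tnorm U).
  by rewrite itv_integral_cst// subr0 mulr1.
apply: itv_integral_le; [by have := integrable_norm i3|exact: itv_cst_integrable|].
move=> s s01; rewrite /f.
have sB := seg_sa s sA sU; have nB : N (A + s *: U)%R by apply: (ND hN) => //; exact: (NZ hN).
have [_ _ b] := beta_TC_diff tU (fc_sa hip sB lg) (N_fc hip hN nB sB lg) (fc_sa hip sB lg') (N_fc hip hN nB sB lg').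
apply: (le_trans b); rewrite ler_wpM2r ?tnorm_ge0// -(fcB hip sB lg lg').
apply: (fc_norm hip sB (lbB lg lg') e0) => u hu; apply: he; apply: (le_trans hu).
by rewrite lerD2r (le_trans (seg_norm A U s01)).
Qed.

Lemma exact_continuous g : continuous g -> exact_for g.
Proof.
move=> cg A U V nA sA tU tV; have [nU sU _ _] := tU; have [nV sV _ _] := tV.
have [tVU _] := rtrB hip hN htau tV tU.
have nAU : N (A + U)%R by exact: (ND hN). have sAU : sa (A + U) by exact: (saD hip).
pose M := opnorm A + opnorm U + opnorm (V - U) + opnorm V.
have o1 := opnorm_ge0 A; have o2 := opnorm_ge0 U; have o3 := opnorm_ge0 (V - U); have o4 := opnorm_ge0 V.
pose C := tnorm U + tnorm (V - U) + tnorm V + 1.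
have C0 : 0 < C.
  apply: ltr_wpDl ltr01; apply: addr_ge0 (tnorm_ge0 tV).
  exact: addr_ge0 (tnorm_ge0 tU) (tnorm_ge0 tVU).
apply/eqP; rewrite -subr_eq0 -normr_le0; apply/ler_addgt0Pr => e e0; rewrite add0r.
have e10 : 0 < e / C by exact: divr_gt0.
have [p hp] := weierstrass (M + 1) cg e10.
have cp : continuous (fun u => p.[u]) by exact: continuous_horner.
have d1 := Jt_dist cg cp nA sA tU (ltW e10) (_ : _ <= M) hp.
have d2 := Jt_dist cg cp nAU sAU tVU (ltW e10) (_ : _ <= M) hp.
have d3 := Jt_dist cg cp nA sA tV (ltW e10) (_ : _ <= M) hp.
have m1 : opnorm A + opnorm U <= M by rewrite /M -addrA lerDl addr_ge0.
have m3 : opnorm A + opnorm V <= M.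
  by rewrite /M lerD2r -addrA lerDl addr_ge0.
have m2 : opnorm (A + U) + opnorm (V - U) <= M.
  rewrite /M; apply: (@le_trans _ _ (opnorm A + opnorm U + opnorm (V - U))); last by rewrite lerDl.
  by rewrite lerD2r; exact: opnormD.
have {}d1 := d1 m1; have {}d2 := d2 m2; have {}d3 := d3 m3.
have ex := exact_horner p nA sA tU tV.
have ee (a b c a' b' c' : R) : a' + b' = c' -> a + b - c = a - a' + (b - b') - (c - c').
  by move=> <-; ring.
rewrite (ee _ _ _ _ _ _ ex).
apply: (@le_trans _ _ (e / C * tnorm U + e / C * tnorm (V - U) + e / C * tnorm V)).
  apply: (le_trans (ler_normB _ _)); apply: lerD => //.
  by apply: (le_trans (ler_normD _ _)); exact: lerD.
rewrite -!mulrDr -mulrA ler_piMr ?(ltW e0)// mulrC ler_pdivrMr// mul1r /C lerDl; exact: ler01.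
Qed.

Lemma J_Jt h A U : continuous h -> sa A -> sa U -> J h A U = Jt (fun u => h u * h u) A U.
Proof.
move=> ch sA sU; have lh := lb_continuous ch; apply: eq_Rintegral => s _.
by rewrite /integrand (fcM hip (seg_sa s sA sU) lh lh).
Qed.

Lemma J_exact_TC h A U V : continuous h -> N A -> sa A -> TC U -> TC V ->
  J h A U + J h (A + U) (V - U) = J h A V.
Proof.
move=> ch nA sA tU tV; have [nU sU _ _] := tU; have [nV sV _ _] := tV.
rewrite !J_Jt//; [|exact: (saD hip)|exact: (saB hip)].
apply: exact_continuous => // u; apply: cvgM; exact: ch.
Qed.

End JIntegral.

Lemma thirds_lt (K : realFieldType) (w : K) : 0 < w -> w / 3 < w /\ w / 3 + w / 3 < w.
Proof. by move=> w0; split; lra. Qed.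
Lemma lerD_add1 (K : realFieldType) (a b a0 b0 : K) : a <= a0 + 1 -> b <= b0 + 1 -> a + b <= a0 + b0 + 2.
Proof. by move=> *; lra. Qed.
Lemma ltrD_halves (K : realFieldType) (w a b : K) : a < w / 2 -> b < w / 2 -> a + b < w.
Proof. by move=> *; lra. Qed.
Lemma thirdsE (K : realFieldType) (e : K) : e / 3 + e / 3 + e / 3 = e.
Proof. by field. Qed.

(** * Exactness for tangent vectors that are not of trace class *)

Section Exactness.
Context {R : realType} {H : completeNormedModType R[i]} (ip : H -> H -> R[i]).
Context (hip : hilbert_inner_product ip).
Context (N : set (H -> H)) (hN : von_neumann_algebra ip N).
Context (tau : (H -> H) -> \bar R) (htau : fns_trace ip N tau).
Context (r q : R) (hq0 : 0 < q) (hq1 : q <= 1) (hr : 0 <= r).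
Local Notation "<< x , y >>" := (rip ip x y).
Local Notation sa := (sa ip).
Local Notation psd := (psd ip).
Local Notation fc := (fc ip).
Local Notation NP := (NP ip N).
Local Notation FT := (FT ip N tau).
Local Notation TC := (TC ip N tau).
Local Notation ft := (ft tau).
Local Notation gcut := (gcut ip).
Local Notation tame := (tame ip N tau).
Local Notation kap := (kap r q).
Local Notation J := (J ip tau).
Local Notation adm := (adm ip N tau).
Implicit Types (A B T S C U W X Y Z G K Q V D F : bop H) (x y : H) (p e l L c t d s : R).

Definition kmax : R := wcst r + 1.
Lemma kmax_ge1 : 1 <= kmax.
Proof. by rewrite /kmax lerDr /wcst exprn_ge0// divr_ge0// ler0n. Qed.
Lemma kap_max u : kap u <= kmax.
Proof.
have k1 := kmax_ge1; have k0 : 0 <= kmax := le_trans ler01 k1.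
have [u1|u1] := leP 1 `|u|; first exact: le_trans (@kap_le1 R r q hr u u1) k1.
have w0 : 0 <= wcst r by move: k0 k1; rewrite /kmax lerDr.
rewrite -(@ler_pXn2r _ 2%N)// ?nnegrE ?kap_ge0// kap_sq.
apply: (le_trans (weight_le_lin hq0 hq1 hr (normr_ge0 u) (ltW u1))).
apply: (@le_trans _ _ (wcst r * 1)); first by rewrite ler_wpM2l// ltW.
by rewrite mulr1 /kmax; move: w0; move: (wcst r) => w w0; nra.
Qed.

(** The function k of the overview: the square of [k1 u] is the weight at |1 - u^2|. *)
Definition k1 (u : R) : R := kap (1 - u ^+ 2).
Lemma k1_ge0 u : 0 <= k1 u. Proof. exact: kap_ge0. Qed.
Lemma k1_continuous : continuous k1.
Proof.
move=> u; have c1 : {for u, continuous (fun v : R => 1 - v ^+ 2)}.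
  by apply: cvgB; [exact: cvg_cst|exact: exprn_continuous].
have := @continuous_comp _ _ _ (fun v : R => 1 - v ^+ 2) kap u c1; apply; exact: (kap_continuous hq0 hq1 hr).
Qed.
Lemma lb_k1 : lb k1. Proof. exact: lb_continuous k1_continuous. Qed.

(* Cutting [k1] off near its zeros makes [kd d] of any operator close to [B] trace class, with a
   bound depending only on [k1(B)]. *)
Definition kd d (u : R) : R := Num.max (k1 u - d) 0.
Lemma kd_continuous d : continuous (kd d).
Proof.
move=> u; have := @continuous_max R R (fun u => k1 u - d) (fun=> 0) u; apply; last exact: cvg_cst.
by apply: cvgB; [exact: k1_continuous|exact: cvg_cst].
Qed.
Lemma lb_kd d : lb (kd d). Proof. exact: lb_continuous (kd_continuous (d := d)). Qed.
Lemma kd_ge0 d u : 0 <= kd d u. Proof. by rewrite /kd le_max lexx orbT. Qed.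
Lemma kd_le d u : 0 <= d -> kd d u <= k1 u.
Proof. by move=> d0; rewrite /kd ge_max k1_ge0 andbT lerBlDr lerDl. Qed.
Lemma kd_dist d u : 0 <= d -> `|k1 u - kd d u| <= d.
Proof.
move=> d0; have := k1_ge0 u; rewrite ger0_norm ?subr_ge0 ?kd_le// /kd.
by case: (leP (k1 u - d) 0); move: (k1 u) => k; lra.
Qed.
Lemma kd_norm d u : 0 <= d -> `|kd d u| <= kmax.
Proof. by move=> d0; rewrite ger0_norm ?kd_ge0//; apply: (le_trans (kd_le u d0)); exact: kap_max. Qed.

Lemma FT_kd_le d B : N B -> sa B -> 0 <= d -> FT (fc B k1) ->
  FT (fc B (kd d)) /\ ft (fc B (kd d)) <= ft (fc B k1).
Proof.
move=> nB sB d0 hf; have n2 : NP (fc B (kd d)).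
  by apply: (NP_fc hip hN nB sB (lb_kd d)) => u _; exact: kd_ge0.
have p : psd (fc B k1 - fc B (kd d)).
  by apply: (fc_le hip sB (lb_kd d) lb_k1) => u _; exact: kd_le.
have h := FT_le hip hN htau n2 hf p; split; first exact: h.
exact: (ft_le hip hN htau h hf p).
Qed.

(** Up to the factor kmax, [kd d] lies below the indicator of k1 > d. As k1(B) and k1(B') are within
    d/2 in norm, [key_cut] bounds the trace of that indicator at B' by the trace of k1(B). *)
Lemma FT_kd d B B' : N B -> sa B -> N B' -> sa B' -> 0 < d -> FT (fc B k1) ->
  opnorm (fc B k1 - fc B' k1) <= d / 2 ->
  FT (fc B' (kd d)) /\ ft (fc B' (kd d)) <= kmax * (4 / d) * ft (fc B k1).
Proof.
move=> nB sB nB' sB' d0 hf hd; have km := le_trans ler01 kmax_ge1.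
have nK' := N_fc hip hN nB' sB' lb_k1; have sK' := fc_sa hip sB' lb_k1.
have sK := fc_sa hip sB lb_k1.
have pK : psd (fc B k1) by case: hf.1.
have pK' : psd (fc B' k1) by apply: (fc_psd hip sB' lb_k1) => u _; exact: k1_ge0.
have d2 : d / 2 < d by move: d0; lra.
have p1 : psd (sc (d / 2) + fc B k1 - fc B' k1).
  by rewrite -addrA; apply: (psd_opnormD hip (saB hip sK sK') hd).
have p2 : psd (sc (d / 2) + fc B k1 + fc B' k1).
  apply: (psdD hip) => //; apply: (psdD hip) => //; apply: (psd_scalar hip); exact: ltW (divr_gt0 d0 (ltr0Sn _ 1)).
have [f1 f2] := key_cut hip hN htau nK' sK' hf (ltW d0) d2 p1 p2.
have eg : gcut d (fc B' k1) = fc B' (fun u => chi d (k1 u)) by rewrite /gcut (fc_comp hip sB' (lb_chi d) lb_k1).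
have n2 : NP (fc B' (kd d)).
  by apply: (NP_fc hip hN nB' sB' (lb_kd d)) => u _; exact: kd_ge0.
have lc := lb_comp (lb_chi d) lb_k1.
have p : psd (kmax *: gcut d (fc B' k1) - fc B' (kd d)).
  rewrite eg -(fcZ hip sB' kmax lc); apply: (fc_le hip sB' (lb_kd d) (lbZ kmax lc)) => u _.
  rewrite /chi (ger0_norm (k1_ge0 u)); case: ltP => h.
    by rewrite mulr1; apply: (le_trans (kd_le u (ltW d0))); exact: kap_max.
  by rewrite mulr0 /kd ge_max lexx andbT subr_le0.
have fZ := FTZ hip hN htau km f1; have h := FT_le hip hN htau n2 fZ p; split; first exact: h.
apply: (le_trans (ft_le hip hN htau h fZ p)); rewrite (ftZ hip htau km f1) -[leRHS]mulrA ler_wpM2l//.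
have aux (a b : R) : (d - d / 2) * a <= 2 * b -> a <= 4 / d * b.
  by move=> h'; rewrite mulrAC ler_pdivlMr//; move: h'; lra.
exact: (aux _ _ f2).
Qed.

(** A' and U' are close to A and U in operator norm only. No trace bound on k1(A' + s U') is at
    hand, and the cut-off at d > 0 supplies one for [kd d]. *)
Lemma J_kd_approx A U c d e : 0 < d -> 0 < e -> adm k1 A U c ->
  exists2 w, 0 < w & forall A' U', N A' -> sa A' -> N U' -> sa U' ->
    opnorm (A - A') < w -> opnorm (U - U') < w ->
    `|J (kd d) A U - J (kd d) A' U'| <= e.
Proof.
move=> d0 e0 [nA sA nU sU ad]; have km := kmax_ge1; have km0 := le_trans ler01 km.
have c0 : 0 <= c.
  have [|f b] := ad 0; first by rewrite lexx ler01.
  by apply: le_trans b; exact: (FT_ge0 hip htau) f.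
pose M := opnorm A + opnorm U + 2.
have oA := opnorm_ge0 A; have oU := opnorm_ge0 U.
have d2 : 0 < d / 2 by exact: divr_gt0.
have [w1 w10 hw1] := fc_norm_cont hip M k1_continuous d2.
pose c' := kmax * (4 / d) * c + c.
have k4 : 0 <= kmax * (4 / d) by rewrite mulr_ge0// divr_ge0// ltW.
have c'c : c <= c' by rewrite /c' lerDr mulr_ge0.
have c'0 : 0 <= c' := le_trans c0 c'c.
pose a2 := (opnorm U + 1) * (2 * c') + 1.
have a20 : 0 < a2 by rewrite ltr_wpDl// mulr_ge0 ?mulr_ge0// addr_ge0.
pose e2 := e / 2 / a2.
have e20 : 0 < e2 by rewrite !divr_gt0.
have [w2 w20 hw2] := fc_norm_cont hip M (kd_continuous (d := d)) e20.
pose a3 := kmax * c' + 1.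
have a30 : 0 < a3 by rewrite ltr_wpDl// mulr_ge0.
pose e3 := e / 2 / a3.
have e30 : 0 < e3 by rewrite !divr_gt0.
exists (Num.min (Num.min (w1 / 2) (w2 / 2)) (Num.min e3 1)).
  by rewrite !lt_min !divr_gt0// ltr01.
move=> A' U' nA' sA' nU' sU'.
rewrite !lt_min => /andP[/andP[a1 a2'] /andP[a3' a4]] /andP[/andP[b1 b2] /andP[b3 b4]].
have near s : 0 <= s <= 1 -> opnorm (A + s *: U - (A' + s *: U')) <= opnorm (A - A') + opnorm (U - U').
  move=> s01; rewrite opprD addrACA -scalerBr; exact: (seg_norm (A - A') (U - U') s01).
have nU'le : opnorm U' <= opnorm U + 1.
  rewrite -[U'](subrK U) addrC; apply: (le_trans (opnormD _ _)); rewrite lerD2l opnormBC; exact: ltW.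
have nA'le : opnorm A' <= opnorm A + 1.
  rewrite -[A'](subrK A) addrC; apply: (le_trans (opnormD _ _)); rewrite lerD2l opnormBC; exact: ltW.
have m1 s : 0 <= s <= 1 -> opnorm (A + s *: U) <= M.
  by move=> s01; apply: (le_trans (seg_norm A U s01)); rewrite lerDl.
have m2 s : 0 <= s <= 1 -> opnorm (A' + s *: U') <= M.
  move=> s01; apply: (le_trans (seg_norm A' U' s01)); rewrite /M.
  exact: (lerD_add1 nA'le nU'le).
have sB s : sa (A + s *: U) by exact: (seg_sa hip).
have sB' s : sa (A' + s *: U') by exact: (seg_sa hip).
have nB s : N (A + s *: U)%R by apply: (ND hN) => //; exact: (NZ hN).
have nB' s : N (A' + s *: U')%R by apply: (ND hN) => //; exact: (NZ hN).
have ad1 : adm (kd d) A U c'.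
  split => // s s01; have [f b] := ad s s01.
  have [f' b'] := FT_kd_le (nB s) (sB s) (ltW d0) f; split; first exact: f'.
  exact: le_trans b' (le_trans b c'c).
have ad2 : adm (kd d) A' U' c'.
  split => // s s01; have [f b] := ad s s01.
  have hh : opnorm (fc (A + s *: U) k1 - fc (A' + s *: U') k1) <= d / 2.
    apply: (hw1 _ _ (sB s) (sB' s) (m1 s s01) (m2 s s01)).
    exact: le_lt_trans (near s s01) (ltrD_halves a1 b1).
  have [f' b'] := FT_kd (nB s) (sB s) (nB' s) (sB' s) d0 f hh; split; first exact: f'.
  apply: (le_trans b'); rewrite /c' -[leLHS]addr0; apply: lerD => //; exact: ler_wpM2l.
have hm s : 0 <= s <= 1 -> opnorm (fc (A + s *: U) (kd d)) <= kmax.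
  by move=> _; apply: (fc_norm hip (sB s) (lb_kd d) km0) => u _; exact: kd_norm (ltW d0).
have he s : 0 <= s <= 1 -> opnorm (fc (A + s *: U) (kd d) - fc (A' + s *: U') (kd d)) <= e2.
  move=> s01; apply: (hw2 _ _ (sB s) (sB' s) (m1 s s01) (m2 s s01)).
  exact: le_lt_trans (near s s01) (ltrD_halves a2' b2).
have := J_dist hip hN htau (kd_continuous (d := d)) (kd_continuous (d := d)) ad1 ad2 hm he.
move/le_trans; apply; rewrite [leRHS]splitr; apply: lerD.
  apply: (@le_trans _ _ (e3 * a3)); last by rewrite /e3 divfK// gt_eqF.
  apply: ler_pM => //; [exact: opnorm_ge0|exact: mulr_ge0|exact: ltW|by rewrite /a3 lerDl].
apply: (@le_trans _ _ (e2 * a2)); last by rewrite /e2 divfK// gt_eqF.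
rewrite [_ * e2]mulrC -mulrA; apply: ler_wpM2l; first exact: ltW.
rewrite /a2; apply: (@le_trans _ _ ((opnorm U + 1) * (2 * c'))); last by rewrite lerDl.
by apply: ler_wpM2r => //; rewrite mulr_ge0.
Qed.

(** Removal of the spectrum near 0: the result is of trace class for tame U and within e of U in
    operator norm, which is the only closeness provided here. *)
Definition trunc e U := fc U (fun u => u * chi e u).

Lemma trunc_dist e U : 0 <= e -> sa U -> opnorm (U - trunc e U) <= e.
Proof.
move=> e0 sU; have l1 := lbM (@lb_id R) (lb_chi e).
rewrite -[X in X - _](fc_id hip sU) -(fcB hip sU (@lb_id R) l1).
apply: (fc_norm hip sU (lbB (@lb_id R) l1) e0) => u _; rewrite /chi /=.
by case: ltP => h; rewrite ?mulr1 ?mulr0 ?subrr ?normr0 ?subr0.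
Qed.

Lemma trunc_TC p e U : 0 < p -> p <= 1 -> 0 < e -> tame p U -> TC (trunc e U).
Proof.
move=> p0 p1 e0 tU; have [nU sU _] := tU.
have f0 := tame_FT_cut hip hN htau p0 p1 e0 tU; have lc := lb_chi e.
have o1 : 0 <= opnorm U + 1 by rewrite addr_ge0// opnorm_ge0.
have fZ := FTZ hip hN htau o1 f0.
have pos (g : R -> R) : lb g -> (forall u, 0 <= g u) -> (forall u, g u <= `|u|) ->
    FT (fc U (fun u => g u * chi e u)).
  move=> lg g0 gle; have l1 := lbM lg lc.
  have n1 : NP (fc U (fun u => g u * chi e u)).
    by apply: (NP_fc hip hN nU sU l1) => u _; rewrite mulr_ge0// chi_ge0.
  apply: (FT_le hip hN htau n1 fZ); rewrite /gcut -(fcZ hip sU _ lc).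
  apply: (fc_le hip sU l1 (lbZ _ lc)) => u hu; apply: ler_wpM2r; first exact: chi_ge0.
  exact: le_trans (gle u) hu.
have lp : lb (fun u : R => Num.max u 0) by exact: lb_max (@lb_id R) (lb_cst 0).
have ln : lb (fun u : R => Num.max (- u) 0) by exact: lb_max (lbN (@lb_id R)) (lb_cst 0).
have f1 : FT (fc U (fun u => Num.max u 0 * chi e u)).
  apply: (pos _ lp) => u; first by rewrite le_max lexx orbT.
  by rewrite ge_max ler_norm normr_ge0.
have f2 : FT (fc U (fun u => Num.max (- u) 0 * chi e u)).
  apply: (pos _ ln) => u; first by rewrite le_max lexx orbT.
  by rewrite ge_max -normrN ler_norm normr_ge0.
have [|h _] := rtr_diff hip hN htau (A := trunc e U) f1 f2; last exact: h.
rewrite /trunc -(fcB hip sU (lbM lp lc) (lbM ln lc)); congr fc; apply/funext => u.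
rewrite -mulrBl; congr (_ * _).
by case: leP => h; case: leP => h'; move: h h'; lra.
Qed.

Section Tangent.
Context (F0 : bop H) (nF0 : N F0) (sF0 : sa F0) (hF0 : tame q (1 - F0 * F0)).
Local Notation tang := (tang ip N tau q F0).
Local Notation Msp := (Msp ip N tau q F0).

Lemma adm_tang A U : Msp A -> tang U -> exists c, adm k1 A U c.
Proof.
move=> mA tU; have [c _ h] := FT_segment0 hip hN htau hq0 hq1 hr nF0 sF0 hF0 mA tU.
exists c; split; [exact: (Msp_N hN nF0 mA)|exact: (Msp_sa hip sF0 mA)|exact: tang_N tU|exact: tang_sa tU|].
by move=> s /andP[s0 s1]; apply: h; rewrite ger0_norm.
Qed.

Lemma J_kd_exact d A U V : 0 < d -> Msp A -> tang U -> tang V ->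
  J (kd d) A U + J (kd d) (A + U) (V - U) = J (kd d) A V.
Proof.
move=> d0 mA tU tV; have [cU aU] := adm_tang mA tU; have [cV aV] := adm_tang mA tV.
have mAU : Msp (A + U) by exact: (Msp_tang hip hN htau hq0).
have [cW aW] := adm_tang mAU (tangB hip hN htau hq0 tV tU).
have q20 : 0 < q / 2 by exact: divr_gt0.
have q21 : q / 2 <= 1.
  by rewrite ler_pdivrMr// mul1r (le_trans hq1)// ler1n.
have [nA sA nU sU _] := aU; have [_ _ nV sV _] := aV.
apply/eqP; rewrite -subr_eq0 -normr_le0; apply/ler_addgt0Pr => e e0; rewrite add0r.
have e3 : 0 < e / 3 by exact: divr_gt0.
have [w1 w10 h1] := J_kd_approx d0 e3 aU.
have [w2 w20 h2] := J_kd_approx d0 e3 aV.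
have [w3 w30 h3] := J_kd_approx d0 e3 aW.
pose w := Num.min (Num.min w1 w2) w3; have w0 : 0 < w by rewrite !lt_min w10 w20 w30.
(* The difference V - U may move by 2 v under truncation, which must still be below w. *)
pose v := w / 3; have v0 : 0 < v by exact: divr_gt0.
have [lt1 lt2] : v < w /\ v + v < w by exact: thirds_lt.
have [ww1 ww2 ww3] : [/\ w <= w1, w <= w2 & w <= w3] by rewrite /w !ge_min !lexx !orbT.
pose U' := trunc v U; pose V' := trunc v V.
have tU' : TC U' by apply: (trunc_TC q20 q21 v0 tU.1).
have tV' : TC V' by apply: (trunc_TC q20 q21 v0 tV.1).
have [nU' sU' _ _] := tU'; have [nV' sV' _ _] := tV'.
have dU : opnorm (U - U') <= v by exact: trunc_dist (ltW v0) sU.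
have dV : opnorm (V - V') <= v by exact: trunc_dist (ltW v0) sV.
have dA : opnorm (A - A) < w by rewrite subrr opnorm0.
have ex := J_exact_TC hip hN htau (kd_continuous (d := d)) nA sA tU' tV'.
have b1 := h1 A U' nA sA nU' sU' (lt_le_trans dA ww1) (le_lt_trans dU (lt_le_trans lt1 ww1)).
have b2 := h2 A V' nA sA nV' sV' (lt_le_trans dA ww2) (le_lt_trans dV (lt_le_trans lt1 ww2)).
have dAU : opnorm (A + U - (A + U')) <= v.
  by rewrite opprD addrACA subrr add0r.
have dVU : opnorm (V - U - (V' - U')) <= v + v.
  have -> : V - U - (V' - U') = V - V' + (U' - U) by bopring hip.
  by apply: (le_trans (opnormD _ _)); apply: lerD => //; rewrite opnormBC.
have b3 := h3 (A + U') (V' - U') (ND hN nA nU') (saD hip sA sU') (NB hN nV' nU') (saB hip sV' sU')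
  (le_lt_trans dAU (lt_le_trans lt1 ww3)) (le_lt_trans dVU (lt_le_trans lt2 ww3)).
have ee (a b c a' b' c' : R) : a' + b' = c' -> a + b - c = a - a' + (b - b') - (c - c').
  by move=> <-; ring.
rewrite (ee _ _ _ _ _ _ ex).
rewrite -[leRHS]thirdsE.
apply: (le_trans (ler_normB _ _)); apply: lerD; last exact: b2.
apply: (le_trans (ler_normD _ _)); apply: lerD; [exact: b1|exact: b3].
Qed.

Lemma J_kd_dist d A U c : 0 < d -> adm k1 A U c ->
  `|J k1 A U - J (kd d) A U| <= opnorm U * d * (2 * c).
Proof.
move=> d0 a; have [nA sA nU sU ad] := a; have km0 := le_trans ler01 kmax_ge1.
have sB s : sa (A + s *: U) by exact: (seg_sa hip).
have nB s : N (A + s *: U)%R by apply: (ND hN) => //; exact: (NZ hN).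
have ad1 : adm (kd d) A U c.
  split => // s s01; have [f b] := ad s s01.
  have [f' b'] := FT_kd_le (nB s) (sB s) (ltW d0) f; split; first exact: f'.
  exact: le_trans b' b.
have hm s : 0 <= s <= 1 -> opnorm (fc (A + s *: U) k1) <= kmax.
  move=> _; apply: (fc_norm hip (sB s) lb_k1 km0) => u _.
  by rewrite (ger0_norm (k1_ge0 u)); exact: kap_max.
have he s : 0 <= s <= 1 -> opnorm (fc (A + s *: U) k1 - fc (A + s *: U) (kd d)) <= d.
  move=> _; rewrite -(fcB hip (sB s) lb_k1 (lb_kd d)).
  by apply: (fc_norm hip (sB s) (lbB lb_k1 (lb_kd d)) (ltW d0)) => u _; exact: kd_dist (ltW d0).
have := J_dist hip hN htau k1_continuous (kd_continuous (d := d)) a ad1 hm he.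
have -> : opnorm (U - U) * (kmax * c) = 0 by rewrite subrr opnorm0 mul0r.
by rewrite add0r; apply.
Qed.

(** The trace bounds on the three segments are fixed while d is free, so replacing k1 by [kd d]
    moves each of the three integrals by O(d). *)
Lemma J_exact A U V : Msp A -> tang U -> tang V ->
  J k1 A U + J k1 (A + U) (V - U) = J k1 A V.
Proof.
move=> mA tU tV; have [cU aU] := adm_tang mA tU; have [cV aV] := adm_tang mA tV.
have mAU : Msp (A + U) by exact: (Msp_tang hip hN htau hq0).
have [cW aW] := adm_tang mAU (tangB hip hN htau hq0 tV tU).
apply/eqP; rewrite -subr_eq0 -normr_le0; apply/ler_addgt0Pr => e e0; rewrite add0r.
pose K X c := opnorm X * (2 * `|c|).
have K0 X c : 0 <= K X c by apply: mulr_ge0; [exact: opnorm_ge0|apply: mulr_ge0; [exact: ler0n|exact: normr_ge0]].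
pose C := K U cU + K (V - U) cW + K V cV + 1.
have C0 : 0 < C by apply: ltr_wpDl ltr01; apply: addr_ge0 (K0 _ _); exact: addr_ge0 (K0 _ _) (K0 _ _).
pose d := e / C; have d0 : 0 < d by exact: divr_gt0.
have bd X c (x : R) : `|x| <= opnorm X * d * (2 * c) -> `|x| <= d * K X c.
  move/le_trans; apply; rewrite /K [_ * d]mulrC -mulrA; apply: ler_wpM2l; first exact: ltW.
  by apply: ler_wpM2l; [exact: opnorm_ge0|apply: ler_wpM2l; [exact: ler0n|exact: ler_norm]].
have b1 := bd _ _ _ (J_kd_dist d0 aU); have b2 := bd _ _ _ (J_kd_dist d0 aW); have b3 := bd _ _ _ (J_kd_dist d0 aV).
have ex := J_kd_exact d0 mA tU tV.
have ee (a b c a' b' c' : R) : a' + b' = c' -> a + b - c = a - a' + (b - b') - (c - c').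
  by move=> <-; ring.
rewrite (ee _ _ _ _ _ _ ex).
apply: (@le_trans _ _ (d * K U cU + d * K (V - U) cW + d * K V cV)).
  apply: (le_trans (ler_normB _ _)); apply: lerD; last exact: b3.
  apply: (le_trans (ler_normD _ _)); apply: lerD; [exact: b1|exact: b2].
rewrite -!mulrDr /d mulrAC ler_pdivrMr// ler_wpM2l ?(ltW e0)// /C lerDl; exact: ler01.
Qed.

End Tangent.
End Exactness.

(** * Pairs of symmetries *)

Section Symmetries.
Context {R : realType} {H : completeNormedModType R[i]} (ip : H -> H -> R[i]).
Context (hip : hilbert_inner_product ip).
Context (N : set (H -> H)) (hN : von_neumann_algebra ip N).
Context (tau : (H -> H) -> \bar R) (htau : fns_trace ip N tau).
Local Notation "<< x , y >>" := (rip ip x y).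
Local Notation sa := (sa ip).
Local Notation psd := (psd ip).
Local Notation fc := (fc ip).
Local Notation NP := (NP ip N).
Local Notation FT := (FT ip N tau).
Local Notation TC := (TC ip N tau).
Local Notation ft := (ft tau).
Local Notation rtr := (rtr ip tau).
Local Notation beta := (beta ip tau).
Local Notation gcut := (gcut ip).
Implicit Types (A B T S C U W X Y Z G K Q V D F : bop H) (x y : H) (f g h : R -> R) (p e l L c t d s : R).

Lemma fc_slim T (f_ : nat -> R -> R) f c : sa T -> (forall n, lb (f_ n)) -> lb f ->
  (forall n u, `|f_ n u| <= c) -> (forall u, f_ n u @[n --> \oo] --> f u) ->
  slim (fun n => fc T (f_ n)) (fc T f).
Proof.
move=> sT lf_ lf fb fcv x; apply/cvg_rnormP.
have [E _ ee] := fc_spec hip sT; rewrite (ee _ lf).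
have fbf u : `|f u| <= c.
  have h : `|f_ n u| @[n --> \oo] --> `|f u| by exact: (cvg_norm (fcv u)).
  rewrite -(cvg_lim _ h)//; apply: limr_le; first by apply/cvg_ex; eexists; exact: h.
  by apply: nearW => n; exact: fb.
pose g n u := (f_ n u - f u) ^+ 2.
have lg n : lb (g n) by exact: (lbX 2 (lbB (lf_ n) lf)).
have e n : rnorm (fc T (f_ n) x - fce E f x) = Num.sqrt (\int[pmu E x]_u g n u).
  by rewrite (ee _ (lf_ n)) -bopBE -(fceB hip E (lf_ n) lf) -(fce_rnorm hip E x (lbB (lf_ n) lf)) sqrtr_sqr ger0_norm ?rnorm_ge0.
have h0 : (\int[pmu E x]_u (g n u)%:E)%E @[n --> \oo] --> (\int[pmu E x]_u (0 : R)%:E)%E.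
  apply: (@dominated_cvg _ _ _ (pmu E x) setT measurableT (fun n u => (g n u)%:E) (fun=> 0%:E) (fun=> ((c + c) ^+ 2)%:E)).
  - by move=> n; apply/measurable_EFinP; exact: (lg n).1.
  - move=> u _; apply: cvg_EFin; first exact: nearW.
    have -> : (0 : R) = (f u - f u) ^+ 2 by rewrite subrr expr0n.
    apply: (@cvg_comp _ _ _ _ (fun v : R => v ^+ 2)); last exact: exprn_continuous.
    by apply: cvgB; [exact: fcv|exact: cvg_cst].
  - by move=> u _.
  - by have := pint_integrable hip E x (lb_cst ((c + c) ^+ 2)).
  move=> n u _; rewrite /= lee_fin /g ger0_norm ?sqr_ge0// -[leLHS]real_normK ?num_real//.
  rewrite ler_pXn2r// ?nnegrE//; first by apply: (le_trans (ler_normB _ _)); exact: lerD.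
  by apply: addr_ge0; exact: (le_trans (normr_ge0 (f u))).
rewrite integral0 in h0; move/fine_cvg: h0 => h0.
rewrite (_ : (fun n => _) = fun n => Num.sqrt (\int[pmu E x]_u g n u)); last by apply/funext => n; exact: e.
rewrite -(@sqrtr0 R); apply: (@cvg_comp _ _ _ _ (@Num.sqrt R)); last exact: sqrt_continuous.
exact: h0.
Qed.

(** Unlike [sgnf], this sign is odd and vanishes at 0, so that the square of sg0(A) is the
    projection onto the complement of the kernel of A. *)
Definition sg0 (u : R) : R := \1_(ray 0) u - \1_(ray 0) (- u).
Lemma sg0E u : sg0 u = if u == 0 then 0 else if 0 < u then 1 else -1.
Proof.
rewrite /sg0 !indicE !mem_setE /ray /= !in_itv /= !andbT oppr_gt0.
by case: (ltgtP u 0) => u0; rewrite ?subr0 ?sub0r ?subrr.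
Qed.
Lemma lb_sg0 : lb sg0.
Proof.
have l1 := lb_indic (measurable_ray (0 : R)).
exact: (lbB l1 (lb_comp l1 (lbN (@lb_id R)))).
Qed.

(** A regularized inverse square root: u isg(u^2) tends to sg0(u), and the second factor is a
    function of the square, with which anticommuting operators commute. *)
Definition isg n (v : R) : R := (Num.sqrt v + n.+1%:R^-1)^-1.
Lemma isg_gt0 n (v : R) : 0 < Num.sqrt v + n.+1%:R^-1.
Proof. by rewrite ltr_wpDl ?sqrtr_ge0// invr_gt0. Qed.
Lemma lb_isg n : lb (isg n).
Proof.
apply: lb_continuous => v; apply: cvgV; first by rewrite gt_eqF// isg_gt0.
by apply: cvgD; [exact: sqrt_continuous|exact: cvg_cst].
Qed.
Lemma isg_sqr n u : isg n (u * u) = (`|u| + n.+1%:R^-1)^-1.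
Proof. by rewrite /isg -expr2 sqrtr_sqr. Qed.
Lemma isg_bound n u : `|u * isg n (u * u)| <= 1.
Proof.
have h := isg_gt0 n (u * u).
rewrite normrM /isg normfV (gtr0_norm h) ler_pdivrMr// mul1r -expr2 sqrtr_sqr lerDl.
by rewrite invr_ge0.
Qed.
Lemma cvg_invS : n.+1%:R^-1 @[n --> \oo] --> (0 : R).
Proof. exact: cvg_harmonic. Qed.
Lemma isg_cvg u : u * isg n (u * u) @[n --> \oo] --> sg0 u.
Proof.
rewrite sg0E; have [->|u0] := eqVneq u 0.
  rewrite (_ : (fun n => _) = fun=> 0); first exact: cvg_cst.
  by apply/funext => n; rewrite mul0r.
have -> : (if 0 < u then 1 else -1) = u * (`|u| + 0)^-1.
  rewrite addr0; case: ltP => h; first by rewrite gtr0_norm// divff.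
  by rewrite ler0_norm// invrN mulrN divff.
rewrite (_ : (fun n => _) = fun n => u * (`|u| + n.+1%:R^-1)^-1); last by apply/funext => n; rewrite isg_sqr.
apply: cvgM; first exact: cvg_cst.
apply: cvgV; first by rewrite addr0 normr_eq0.
by apply: cvgD; [exact: cvg_cst|exact: cvg_invS].
Qed.

Lemma fc_sqr T : sa T -> fc T (fun u => u * u) = T * T.
Proof. by move=> sT; rewrite (fcM hip sT (@lb_id R) (@lb_id R)) (fc_id hip). Qed.

Lemma fc_sqr_comp T f : sa T -> lb f -> fc (T * T) f = fc T (fun u => f (u * u)).
Proof.
by move=> sT lf; rewrite -(fc_sqr sT) (fc_comp hip sT lf (lbM (@lb_id R) (@lb_id R))).
Qed.

Lemma sqr_bicom T C : C * T = - (T * C) -> C * (T * T) = T * T * C.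
Proof. by move=> h; rewrite mulrA h mulNr -(mulrA T C T) h mulrN opprK mulrA. Qed.

(** B commutes with A^2, hence with its functions, and sg0(A) is the strong limit of A times
    functions of A^2. *)
Lemma sign_anticomm A B : sa A -> sa B -> B * A = - (A * B) -> B * fc A sg0 = - (fc A sg0 * B).
Proof.
move=> sA sB h; have ls := lbM (@lb_id R) (@lb_id R).
have le n : lb (fun u : R => u * isg n (u * u)) by exact: (lbM (@lb_id R) (lb_comp (lb_isg n) ls)).
have s := fc_slim sA le lb_sg0 isg_bound isg_cvg.
have en n : B * fc A (fun u => u * isg n (u * u)) = - (fc A (fun u => u * isg n (u * u)) * B).
  rewrite (fcM hip sA (@lb_id R) (lb_comp (lb_isg n) ls)) (fc_id hip)// -(fc_sqr_comp sA (lb_isg n)).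
  have sAA : sa (A * A) by case: (psd_sqr hip sA).
  have c := fc_bicom hip sAA (lb_isg n) (sqr_bicom h).
  by rewrite mulrA h mulNr -[A * B * _]mulrA c !mulrA.
have s1 := slimMl (T := B) s; have s2 := slimN (slimMr (T := B) s).
exact: (slim_uniq s1 (slim_ext (fun n => esym (en n)) s2)).
Qed.

Lemma TC_half S : TC (2 *: S) -> TC S.
Proof.
by move=> t; have [] := rtrZ hip hN htau 2^-1 t; rewrite scalerA mulVf ?pnatr_eq0// scale1r.
Qed.

(* Conjugation by [V] changes the sign of [S = B K^2], so [tau(S V^2) = - tau(S V^2)]. *)
Lemma rtr_anticomm B V K : sa B -> N B -> sa V -> N V -> FT (K * K) -> sa K -> B * V = - (V * B) ->
  B * K = K * B -> K * V = V * K -> TC (B * (K * K)) ->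
  TC (B * (K * K) * (V * V)) /\ rtr (B * (K * K) * (V * V)) = 0.
Proof.
move=> sB nB sV nV fK sK bv bk kv tS; set S := B * (K * K).
have SV : S * V = - (V * S).
  by rewrite /S -!mulrA kv [K * (V * K)]mulrA kv !mulrA bv !mulNr -!mulrA.
have [t1 t2] := rtr_cyc hip hN htau sV sV nV nV tS.
have -> : V * S * V + V * S * V = -2 *: (S * (V * V)).
  have -> : V * S * V = - (S * (V * V)) by rewrite [S * _]mulrA SV mulNr opprK.
  by rewrite -opprD -mulr2n -scaler_nat scaleNr.
have e2S : V * V * S + S * (V * V) = 2 *: (S * (V * V)).
  rewrite -(sqr_bicom SV).
  by rewrite -mulr2n -scaler_nat.
rewrite -/S e2S in t2 *; move=> e.
have t : TC (S * (V * V)) by exact: TC_half.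
split; first exact: t.
have [_ e1] := rtrZ hip hN htau (-2) t; have [_ e2] := rtrZ hip hN htau 2 t; rewrite e1 e2 in e.
by move: e; move: (rtr _) => z; lra.
Qed.

Definition eq1 (a u : R) : R := \1_([set a]) u.
Lemma eq1E a u : eq1 a u = if u == a then 1 else 0.
Proof. rewrite /eq1 indicE (_ : (u \in [set a]) = (u == a)); first by case: eqVneq.
by apply/idP/eqP; rewrite inE. Qed.
Lemma lb_eq1 a : lb (eq1 a).
Proof. by apply: lb_indic; exact: measurable_set1. Qed.
Lemma proj_eq1 T a : sa T -> isproj ip (fc T (eq1 a)).
Proof. by move=> sT; apply: (fc_proj hip sT); exact: measurable_set1. Qed.

(** For the direct implication, 1 - eq1 a is a pointwise limit of bounded functions divisible by u -
    a, and these annihilate an eigenvector for a. *)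
Lemma fc_eigen T a x : sa T -> T x = a%:C *: x <-> fc T (eq1 a) x = x.
Proof.
move=> sT; have l1 := lb_eq1 a; have lid := @lb_id R; split=> [h|h]; last first.
  have e : T * fc T (eq1 a) = a *: fc T (eq1 a).
    rewrite -[X in X * _](fc_id hip sT) -(fcM hip sT lid l1) -(fcZ hip sT a l1).
    by congr fc; apply/funext => u; rewrite eq1E; case: eqP => [->|]; rewrite ?mulr1 ?mulr0.
  by rewrite -{1}h -bopME e bopZE h.
pose k n u : R := (u - a) * isg n ((u - a) * (u - a)).
have ls : lb (fun u : R => u - a) by exact: (lbB lid (lb_cst a)).
have lk n : lb (k n) by exact: (lb_comp (lbM lid (lb_comp (lb_isg n) (lbM lid lid))) ls).
pose g n u : R := k n u * k n u.
have lg n : lb (g n) by exact: lbM.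
pose f u : R := sg0 (u - a) * sg0 (u - a).
have lf : lb f by exact: (lbM (lb_comp lb_sg0 ls) (lb_comp lb_sg0 ls)).
have fE u : f u = 1 - eq1 a u.
  rewrite /f sg0E eq1E subr_eq0; case: eqP => _; first by rewrite mulr0 subrr.
  by case: ifP => _; rewrite subr0 ?mulrNN mulr1.
have s : slim (fun n => fc T (g n)) (fc T f).
  apply: (@fc_slim _ _ _ 1) => //.
    move=> n u; rewrite /g normrM; apply: (@le_trans _ _ (1 * 1)); last by rewrite mulr1.
    by apply: ler_pM => //; exact: isg_bound.
  by move=> u; apply: cvgM; exact: isg_cvg.
have z n : fc T (g n) x = 0.
  pose k' u : R := k n u * isg n ((u - a) * (u - a)).
  have lk' : lb k' by exact: (lbM (lk n) (lb_comp (lb_isg n) (lbM ls ls))).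
  have -> : g n = fun u => k' u * (u - a).
    by apply/funext => u; rewrite /g /k' /k; move: (isg _ _) => b; ring.
  rewrite (fcM hip sT lk' ls) (fcB hip sT lid (lb_cst a)) (fc_id hip)// (fc_cst hip)// bopME bopBE scE h subrr.
  exact: bop0.
have := s x; rewrite (_ : (fun n => _) = fun=> 0); last by apply/funext => n; exact: z.
move=> /(seq_cvg_uniq (cvg_cst _)) e.
have e2 : fc T f = 1 - fc T (eq1 a).
  rewrite -sc1 -(fc_cst hip sT 1) -(fcB hip sT (lb_cst 1) l1); congr fc; apply/funext => u; exact: fE.
by move: e; rewrite e2 bopBE bop1E => /esym/eqP; rewrite subr_eq0 => /eqP.
Qed.

Lemma proj_ontoE Q (V : set H) : isproj ip Q -> (forall x, V x <-> Q x = x) ->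
  proj_onto ip V = Q.
Proof.
move=> pQ hV; have pj := isproj_projection hip pQ.
have rQ : range (Q : H -> H) = V.
  apply/seteqP; split=> [y [x _ <-]|y /hV <-]; last by exists y.
  by apply/hV; rewrite -bopME pQ.2.
rewrite /proj_onto; case: xgetP => [P _ [pP rP]|/(_ Q)[]]; last by [].
have [P' eP [sP' PP]] := projection_isproj hip pP; subst P.
congr bfun; have e1 : Q * P' = P'.
  apply: bopext => x; rewrite bopME; apply/hV; rewrite -rP; by exists x.
have e2 : P' * Q = Q.
  apply: bopext => x; rewrite bopME; have : V (Q x) by apply/hV; rewrite -bopME pQ.2.
  by rewrite -rP => -[y _ <-]; rewrite -bopME PP.
have a1 : adjp ip (Q * P') (P' * Q) by exact: (adjpM pQ.1 sP').
have a2 : adjp ip (Q * P') P' by rewrite e1.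
by rewrite -(adjp_uniq hip a1 a2) e2.
Qed.

Section AntiPair.
Context (A B : bop H) (sA : sa A) (nA : N A) (sB : sa B) (nB : N B).
Context (hAB : B * A = - (A * B)) (hsq : A * A + B * B = 1).
Context (fB : FT (gcut (1 / 2) B)).

Let lid := @lb_id R.
Let lsq : lb (fun u : R => u * u). Proof. exact: lbM. Qed.
Definition nz (u : R) : R := 1 - eq1 0 u.
Let lb_nz : lb nz. Proof. exact: (lbB (lb_cst 1) (lb_eq1 0)). Qed.

(** The square of sg0(A) depends on A^2 only, and A^2 = 1 - B^2; so this projection becomes a
    function of B. *)
Lemma sign_sqrE : fc A sg0 * fc A sg0 = fc B (fun u => nz (1 - u * u)).
Proof.
have l1 : lb (fun u : R => 1 - u) by exact: (lbB (lb_cst 1) lid).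
have sBB : sa (B * B) by case: (psd_sqr hip sB).
rewrite -(fcM hip sA lb_sg0 lb_sg0).
have -> : (fun u => sg0 u * sg0 u) = (fun u => nz (u * u)).
  apply/funext => u; rewrite sg0E /nz eq1E mulf_eq0 orbb; case: eqP => _; first by rewrite mulr0 subrr.
  by rewrite subr0; case: ifP => _; rewrite ?mulrNN mulr1.
rewrite -(fc_sqr_comp sA lb_nz) (_ : A * A = fc (B * B) (fun u => 1 - u)).
  by rewrite (fc_comp hip sBB lb_nz l1) (fc_sqr_comp sB (lb_comp lb_nz l1)).
by rewrite (fcB hip sBB (lb_cst 1) lid) (fc_id hip)// (fc_cst hip sBB 1) sc1 -hsq addrK.
Qed.

Definition eigproj (a : R) := fc B (eq1 a).

Lemma FT_eigproj a : `|a| = 1 -> FT (eigproj a).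
Proof.
move=> a1; have l1 := lb_eq1 a; have lc := lb_chi (1 / 2 : R).
have n1 : NP (eigproj a) by apply: (NP_fc hip hN nB sB l1) => u _; rewrite eq1E; case: ifP.
apply: (FT_le hip hN htau n1 fB); apply: (fc_le hip sB l1 lc) => u _.
rewrite eq1E /chi; case: eqP => [->|_]; last exact: chi_ge0.
by rewrite a1 ltr_pdivrMr// mul1r ltr1n.
Qed.

Lemma beta_antipair phi : lb phi -> let K := fc (B * B) phi in FT K ->
  beta B (K * K) = phi 1 ^+ 2 * (ft (eigproj 1) - ft (eigproj (-1))).
Proof.
move=> lp K fK; have sBB : sa (B * B) by case: (psd_sqr hip sB).
have nBB : N (B * B)%R by exact: (NM hN).
have sK : sa K by exact: (fc_sa hip sBB lp).
have nK : N K by exact: (N_fc hip hN nBB sBB lp).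
have KE : K = fc B (fun u => phi (u * u)) by exact: (fc_sqr_comp sB lp).
have lp2 : lb (fun u => phi (u * u)) by exact: (lb_comp lp lsq).
have bk : B * K = K * B by rewrite KE (fc_commT hip).
have sV : sa (fc A sg0) by exact: (fc_sa hip sA lb_sg0).
have nV : N (fc A sg0) by exact: (N_fc hip hN nA sA lb_sg0).
have bv : B * fc A sg0 = - (fc A sg0 * B) by exact: sign_anticomm.
have kv : K * fc A sg0 = fc A sg0 * K.
  have vb : fc A sg0 * B = - (B * fc A sg0) by rewrite bv opprK.
  by rewrite -(fc_bicom hip sBB lp (sqr_bicom vb)).
have [fKK _] := FT_sqr hip hN htau fK.
have [t _] := beta_FT hip hN htau sB nB fKK.
have e2 : B * (K * K) + K * K * B = 2 *: (B * (K * K)).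
  by rewrite -mulrA -bk [K * (B * K)]mulrA -bk -mulrA -mulr2n -scaler_nat.
rewrite e2 in t.
have tS : TC (B * (K * K)) by exact: (TC_half t).
have -> : beta B (K * K) = rtr (B * (K * K)).
  by rewrite /beta e2; have [_ ->] := rtrZ hip hN htau 2 tS; apply: mulKf; rewrite pnatr_eq0.
have [tE rE] := rtr_anticomm sB nB sV nV fKK sK bv bk kv tS.
have f1 : FT (eigproj 1) by apply: FT_eigproj; rewrite normr1.
have f2 : FT (eigproj (-1)) by apply: FT_eigproj; rewrite normrN normr1.
have [t1 r1] := rtr_diff hip hN htau f1 f2 (erefl (eigproj 1 - eigproj (-1))).
have [t2 r2] := rtrZ hip hN htau (phi 1 ^+ 2) t1.
(* Multiplication by the square of sg0(A) removes the points 1 and -1 from the spectrum of B; at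
   these points u phi(u^2)^2 equals phi(1)^2 and -phi(1)^2. *)
have -> : B * (K * K) = B * (K * K) * (fc A sg0 * fc A sg0) + phi 1 ^+ 2 *: (eigproj 1 - eigproj (-1)).
  have ln : lb (fun u : R => nz (1 - u * u)) by exact: (lb_comp lb_nz (lbB (lb_cst 1) lsq)).
  have le : lb (fun u => eq1 1 u - eq1 (-1) u) by exact: (lbB (lb_eq1 1) (lb_eq1 (-1))).
  have lbkk : lb (fun u => u * (phi (u * u) * phi (u * u))) by exact: (lbM lid (lbM lp2 lp2)).
  have bkkE : B * (K * K) = fc B (fun u => u * (phi (u * u) * phi (u * u))).
    by rewrite (fcM hip sB lid (lbM lp2 lp2)) (fcM hip sB lp2 lp2) (fc_id hip sB) -KE.
  rewrite sign_sqrE bkkE -(fcM hip sB lbkk ln) /eigproj -(fcB hip sB (lb_eq1 1) (lb_eq1 (-1))).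
  rewrite -(fcZ hip sB _ le) -(fcD hip sB (lbM lbkk ln) (lbZ _ le)); congr fc; apply/funext => u.
  rewrite /nz !eq1E; have -> : (1 - u * u == 0) = (u == 1) || (u == -1).
    by rewrite -expr2 -eqf_sqr expr1n subr_eq0 eq_sym.
  have n1 : (1 : R) == -1 = false by apply: gt_eqF; exact: lt_trans (ltrN10 R) ltr01.
  have n2 : (-1 : R) == 1 = false by rewrite eq_sym.
  case: (eqVneq u 1) => [->|u1]; first by rewrite n1 /= mulr1; ring.
  by case: (eqVneq u (-1)) => [->|u2] /=; rewrite ?mulrNN ?mulr1; ring.
by have [_ ->] := rtrD hip hN htau tE t2; rewrite rE r2 r1 add0r.
Qed.

End AntiPair.

Definition halfp S : bop H := 2^-1 *: (1 + S).

Lemma halfp_proj S : sa S -> S * S = 1 -> isproj ip (halfp S).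
Proof.
move=> sS S2; split; first by apply: (saZ hip) => //; apply: (saD hip) => //; exact: (sa1 ip).
rewrite /halfp bopAl bopAr scalerA mulrDl mul1r mulrDr mulr1 S2 [S + 1]addrC -mulr2n -[(1 + S) *+ 2]scaler_nat scalerA.
by congr (_ *: _); field.
Qed.

(** Pairing with x gives |Q x|^2 - |P x|^2 = |x|^2, and |Q x| <= |x| then forces P x = 0. *)
Lemma proj_diff_fix P Q x : isproj ip P -> isproj ip Q -> Q x - P x = x <-> Q x = x /\ P x = 0.
Proof.
move=> pP pQ; split=> [h|[-> ->]]; last by rewrite subr0.
have e : rnorm (Q x) ^+ 2 - rnorm (P x) ^+ 2 = rnorm x ^+ 2.
  by rewrite -(isproj_rip hip x pQ) -(isproj_rip hip x pP) -(ripBl hip)// h (ripxx hip).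
have le : rnorm (Q x) <= rnorm x.
  apply: (le_trans (opnormP _ _)); rewrite ler_piMl ?rnorm_ge0//.
  exact: (isproj_norm hip pQ).
have le2 : rnorm (Q x) ^+ 2 <= rnorm x ^+ 2 by rewrite ler_pXn2r ?nnegrE ?rnorm_ge0.
have P0 : P x = 0.
  apply: rnorm_eq0; apply/eqP; rewrite -[_ == _](@expf_eq0 _ _ 2) eq_le sqr_ge0 andbT.
  by move: e le2; move: (_ ^+ 2) (_ ^+ 2) (_ ^+ 2) => a b c; lra.
by split => //; move: h; rewrite P0 subr0.
Qed.

Lemma ind_eigproj P Q : isproj ip P -> isproj ip Q ->
  ind ip tau P Q = ft (eigproj (Q - P) 1) - ft (eigproj (Q - P) (-1)).
Proof.
move=> pP pQ; have sB : sa (Q - P) by exact: (saB hip) pQ.1 pP.1.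
rewrite /ind /ft; congr (fine (tau _) - fine (tau _)); apply: proj_ontoE.
- exact: proj_eq1.
- move=> x /=; rewrite -(fc_eigen _ _ sB) bopBE scale1r; symmetry; exact: proj_diff_fix.
- exact: proj_eq1.
move=> x /=; rewrite -(fc_eigen _ _ sB) bopBE -[(-1)%:C]/(real_complex R (-1)) rmorphN1 scaleN1r.
split=> [[h1 h2]|h]; first by rewrite h1 h2 sub0r.
have /(proj_diff_fix _ pQ pP)[-> ->] : P x - Q x = x by rewrite -opprB h opprK.
by [].
Qed.

End Symmetries.

Lemma continuous_cont_on (R : realType) (f : R -> R) a b : continuous f -> cont_on f a b.
Proof.
move=> cf t _ e e0; have ct : {for t, continuous f} by exact: cf.
move/cvgrPdist_le : ct => /(_ e e0) /nbhs_ballP[d d0 hd]; exists d => // s _ st.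
by rewrite distrC; apply: hd; rewrite /ball /= distrC.
Qed.

(** * The integral between two symmetries and the normalizing constant *)

Section SymmetricIntegral.
Context {R : realType} {H : completeNormedModType R[i]} (ip : H -> H -> R[i]).
Context (hip : hilbert_inner_product ip).
Context (N : set (H -> H)) (hN : von_neumann_algebra ip N).
Context (tau : (H -> H) -> \bar R) (htau : fns_trace ip N tau).
Context (r q : R) (hq0 : 0 < q) (hq1 : q <= 1) (hr : 0 <= r).
Local Notation "<< x , y >>" := (rip ip x y).
Local Notation sa := (sa ip).
Local Notation fc := (fc ip).
Local Notation FT := (FT ip N tau).
Local Notation tame := (tame ip N tau).
Local Notation beta := (beta ip tau).
Local Notation gcut := (gcut ip).
Local Notation kap := (kap r q).
Local Notation k1 := (k1 r q).
Local Notation J := (J ip tau).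
Implicit Types (A B T S C U W X Y Z G K Q V D F : bop H) (x y : H) (t s : R).

Lemma k1_sq (u : R) : -1 <= u <= 1 -> k1 u ^+ 2 = weight_fun r q (1 - u ^+ 2).
Proof.
move=> /andP[u0 u1]; rewrite /k1 kap_sq ger0_norm// subr_ge0 -[u ^+ 2]real_normK ?num_real//.
by rewrite expr_le1// ler_norml u0.
Qed.

Lemma k1_sq_continuous : continuous (fun u : R => k1 u ^+ 2).
Proof.
move=> u; apply: (@continuous_comp _ _ _ k1 (fun v : R => v ^+ 2)); first exact: (k1_continuous hq0 hq1 hr).
exact: exprn_continuous.
Qed.

Lemma CrqE : Crq r q = \int[lebesgue_measure]_(u in `[-1, 1]) (k1 u ^+ 2).
Proof.
by apply: eq_Rintegral => u; rewrite inE /= in_itv /= => hu; rewrite k1_sq.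
Qed.

Lemma Crq_subst : Crq r q = \int[lebesgue_measure]_(s in `[(0 : R), 1]) (k1 (2 * s - 1) ^+ 2 * 2).
Proof.
rewrite CrqE /Rintegral; congr fine.
pose P (s : R) := 2 * s - 1.
have dP (x : R) : is_derive x 1 P 2.
  rewrite /P; apply: is_derive_eq; last by rewrite oppr0 addr0 /GRing.scale /= mulr1.
have eP : derive1 P = fun=> 2 by apply/funext => x; rewrite derive1E; have [] := dP x.
have cP : continuous P.
  by move=> x; apply: cvgB; [apply: cvgM; [exact: cvg_cst|exact: cvg_id]|exact: cvg_cst].
have := @integration_by_substitution_increasing R P (fun u => k1 u ^+ 2) 0 1 ler01.
have -> : P 0 = -1 by rewrite /P mulr0 sub0r.
have -> : P 1 = 1 by rewrite /P mulr1; ring.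
move=> ->; last 1 first.
- exact: continuous_subspaceT k1_sq_continuous.
- by apply: eq_integral => s _; rewrite eP.
- by move=> x y _ _ xy; rewrite /P ltrD2r ltr_pM2l.
- by rewrite eP => x _; exact: cvg_cst.
- by rewrite eP; exact: is_cvg_cst.
- by rewrite eP; exact: is_cvg_cst.
split; first by move=> x _; have [] := dP x.
- by apply: cvg_at_right_filter; exact: cP.
- by apply: cvg_at_left_filter; exact: cP.
Qed.

Lemma Crq_gt0 : 0 < Crq r q.
Proof.
have h2 : (2^-1 : R) < 1 by rewrite invf_lt1 ?ltr1n.
have h0 : 0 < (2^-1 : R) by rewrite invr_gt0.
(* For |u| <= 1/2 the number 1 - u^2 lies in [1/2, 1], where the weight is at least m. *)
pose m := expR (- ((2^-1 : R) `^ (- q^-1))).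
have m0 : 0 < m by exact: expR_gt0.
pose I : set (measurableTypeR R) := `[- 2^-1, 2^-1]%classic.
have mI : measurable I by exact: measurable_itv.
pose g (u : R) : R := m * \1_I u.
have mg (D : set (measurableTypeR R)) : measurable_fun D (g : measurableTypeR R -> measurableTypeR R).
  by apply: measurable_funM; [exact: measurable_cst|exact: measurable_indic].
have ge u : 0 <= g u <= m.
  by rewrite /g indicE; case: (u \in I); rewrite ?mulr1 ?mulr0 ?lexx ?(ltW m0).
have ig : (@lebesgue_measure R).-integrable `[-1, 1] (EFin \o g).
  by apply: (@itv_integrable _ g _ _ m (mg _)) => u _; have /andP[a b] := ge u; rewrite ger0_norm.
have ik : (@lebesgue_measure R).-integrable `[-1, 1] (EFin \o (fun u => k1 u ^+ 2)).
  exact: (cont_on_integrable (continuous_cont_on k1_sq_continuous)).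
rewrite CrqE; apply: (@lt_le_trans _ _ (\int[lebesgue_measure]_(u in `[-1, 1]) g u)); last first.
  apply: itv_integral_le => // u /andP[u0 u1]; rewrite k1_sq ?u0// /g indicE.
  have [uI|uI] := boolP (u \in I); last by rewrite mulr0 weight_ge0.
  rewrite mulr1; have : `|u| <= 2^-1 by move: uI; rewrite inE /I /= in_itv /= ler_norml.
  move=> uh; have ux : 2^-1 <= 1 - u ^+ 2.
    rewrite -[u ^+ 2]real_normK ?num_real// expr2; have n0 := normr_ge0 u.
    by move: uh n0; move: (`|u|) => v; nra.
  have x1 : 1 - u ^+ 2 <= 1 by rewrite gerBl sqr_ge0.
  have x0 := lt_le_trans h0 ux; rewrite /weight_fun gt_eqF//.
  move: (1 - u ^+ 2) x0 x1 ux => x x0 x1 ux.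
  rewrite -[m]mul1r; apply: ler_pM; rewrite ?ler01 ?expR_ge0//.
    rewrite powRN invf_ge1 ?powR_gt0//; have := ge0_ler_powR hr (ltW x0) ler01 x1.
    by rewrite powR1.
  rewrite /m ler_expR lerN2 !powRN lef_pV2 ?posrE ?powR_gt0//.
  by apply: ge0_ler_powR; rewrite ?nnegrE ?invr_ge0 ?(ltW hq0) ?(ltW h0) ?(ltW x0).
rewrite /g RintegralZl//; last first.
  by have := @itv_integrable _ (\1_I : R -> R) (-1) 1 1 (measurable_indic mI); apply => u _; rewrite indicE; case: (u \in I); rewrite ?normr1 ?normr0.
have lI : (@lebesgue_measure R) I = 1%:E.
  have := @lebesgue_measure_itv R `[(- 2^-1), 2^-1]; rewrite /= lte_fin ifT.
    by rewrite -EFinD opprK (_ : 2^-1 + 2^-1 = 1 :> R); [move=> <-|field].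
  by apply: lt_trans h0; rewrite oppr_lt0.
rewrite mulr_gt0// /Rintegral integral_indic// setIidl; first by rewrite [X in fine X](_ : _ = 1%:E)//; exact: lI.
move=> u; rewrite /I /= !in_itv /= => /andP[a b]; apply/andP; split.
  by apply: le_trans a; rewrite lerN2 ltW.
by rewrite (le_trans b) ?ltW.
Qed.

Section Tangent.
Context (F0 : bop H) (nF0 : N F0) (sF0 : sa F0) (hF0 : tame q (1 - F0 * F0)).
Local Notation tang := (tang ip N tau q F0).
Local Notation Msp := (Msp ip N tau q F0).

(* With [A = - (S1 + S2) / 2], [B = (S2 - S1) / 2] and [u = 2s - 1] the segment is
   [F_s = - A + u B], and [1 - F_s^2 = (1 - u^2) B^2]. *)
Lemma J_symmetries S1 S2 : Msp S1 -> Msp S2 -> S1 * S1 = 1 -> S2 * S2 = 1 ->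
  J k1 S1 (S2 - S1) = Crq r q * ind ip tau (halfp S1) (halfp S2).
Proof.
move=> m1 m2 e1 e2; have tU : tang (S2 - S1) by exact: (Msp_diff hip hN htau hq0).
have q20 : 0 < q / 2 by exact: divr_gt0.
have q21 : q / 2 <= 1 by rewrite ler_pdivrMr// mul1r (le_trans hq1)// ler1n.
have s1 : sa S1 by exact: (Msp_sa hip sF0 m1). have s2 : sa S2 by exact: (Msp_sa hip sF0 m2).
have n1 : N S1 by exact: (Msp_N hN nF0 m1). have n2 : N S2 by exact: (Msp_N hN nF0 m2).
pose A := - (2^-1 *: (S1 + S2)); pose B := 2^-1 *: (S2 - S1).
have sA : sa A by apply: (saN hip); apply: (saZ hip); exact: (saD hip).
have sB : sa B by apply: (saZ hip); exact: (saB hip).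
have nA : N A by apply: (NN hN); apply: (NZ hN); exact: (ND hN).
have nB : N B by apply: (NZ hN); exact: (NB hN).
have hAB : B * A = - (A * B).
  rewrite /A /B mulrN mulNr opprK !bopAl !bopAr !mulrDl !mulrDr !mulNr !mulrN e1 e2.
  by move: (S1 * S2) (S2 * S1) => X Y; bopring hip.
have hsq : A * A + B * B = 1.
  rewrite /A /B mulrN mulNr opprK !bopAl !bopAr !mulrDl !mulrDr !mulNr !mulrN e1 e2 !scalerA -scalerDr.
  have e4 X Y : 1 + X + (Y + 1) + (1 - Y + (- X - - 1)) = sc 4 :> bop H.
    by rewrite (_ : 4 = 1 + 1 + 1 + 1 :> R); [rewrite !scD sc1; bopring hip|ring].
  by rewrite e4 /sc scalerA (_ : 2^-1 * 2^-1 * 4 = 1) ?scale1r//; field.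
have fB : FT (gcut (1 / 2) B).
  by apply: (tame_FT_cut hip hN htau q20 q21 _ (tameZ hip hN htau 2^-1 q20 tU.1)); rewrite divr_gt0.
have UB : S2 - S1 = 2 *: B by rewrite scalerA divff ?pnatr_eq0// scale1r.
have eB : halfp S2 - halfp S1 = B by rewrite /halfp -scalerBr opprD addrACA subrr add0r.
have [c [_ _ _ _ hc]] := adm_tang hip hN htau hq0 hq1 hr nF0 sF0 hF0 m1 tU.
have p1 := halfp_proj hip s1 e1; have p2 := halfp_proj hip s2 e2.
rewrite (ind_eigproj hip tau p1 p2) eB; set I := ft tau _ - _.
have e s : 0 <= s <= 1 -> integrand ip tau k1 S1 (S2 - S1) s = k1 (2 * s - 1) ^+ 2 * 2 * I.
  move=> s01; have [fK _] := hc s s01; rewrite /integrand; set u := 2 * s - 1.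
  have sF : sa (S1 + s *: (S2 - S1)) by exact: (seg_sa hip _ s1 (saB hip s2 s1)).
  have hu : -1 <= u <= 1 by move: s01; rewrite /u => /andP[a b]; apply/andP; split; lra.
  have sBB : sa (B * B) by case: (psd_sqr hip sB).
  have lk := lb_kap hq0 hq1 hr; have lid := @lb_id R.
  have eF : S1 + s *: (S2 - S1) = - A + u *: B.
    by rewrite /A /B /u; bopring hip.
  have ek : fc (S1 + s *: (S2 - S1)) k1 = fc (B * B) (fun v => kap ((1 - u ^+ 2) * v)).
    transitivity (fc (1 - (S1 + s *: (S2 - S1)) * (S1 + s *: (S2 - S1))) kap); first exact: (kapFE hip hq0 hq1 hr sF).
    have -> : 1 - (S1 + s *: (S2 - S1)) * (S1 + s *: (S2 - S1)) = (1 - u ^+ 2) *: (B * B).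
      rewrite eF; clearbody A B u.
      rewrite !mulrDl !mulrDr !bopAl !bopAr !mulNr !mulrN opprK hAB.
      rewrite -{1}hsq scalerBl scale1r scalerA expr2.
      by move: (A * A) (B * B) (A * B) => X Y Z; bopring hip.
    rewrite -[X in fc (_ *: X)](fc_id hip sBB) -(fcZ hip sBB _ lid) (fc_comp hip sBB lk (lbZ _ lid)).
    by [].
  rewrite ek in fK *; have lphi : lb (fun v : R => kap ((1 - u ^+ 2) * v)).
    exact: (lb_comp lk (lbZ (1 - u ^+ 2) lid)).
  have h := beta_antipair hip hN htau sA nA sB nB hAB hsq fB lphi fK.
  have [fKK _] := FT_sqr hip hN htau fK; have [t _] := beta_FT hip hN htau sB nB fKK.
  have e4 := betaZl hip hN htau 2 t.
  rewrite UB e4 h mulr1 /k1 -/I; move: (kap (1 - u ^+ 2) ^+ 2) I => a b; ring.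
rewrite Crq_subst /J.
have -> : \int[lebesgue_measure]_(s in `[(0 : R), 1]) integrand ip tau k1 S1 (S2 - S1) s =
  \int[lebesgue_measure]_(s in `[(0 : R), 1]) (k1 (2 * s - 1) ^+ 2 * 2 * I).
  by apply: eq_Rintegral => s; rewrite inE /= in_itv /= => /e.
rewrite RintegralZr//.
apply: cont_on_integrable; apply: continuous_cont_on => s; apply: cvgM; last exact: cvg_cst.
have := @continuous_comp _ _ _ (fun s : R => 2 * s - 1) (fun v => k1 v ^+ 2) s; apply; last exact: k1_sq_continuous.
by apply: cvgB; [apply: cvgM; [exact: cvg_cst|exact: cvg_id]|exact: cvg_cst].
Qed.

End Tangent.
End SymmetricIntegral.

(** * Integrals along paths *)

Section IntervalIntegrals.
Context {R : realType}.
Local Notation mu := (@lebesgue_measure R).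
Implicit Types (f g : R -> R) (a b c x y : R).

Definition has_int f a b x :=
  mu.-integrable `[a, b] (EFin \o f) /\ \int[mu]_(t in `[a, b]) f t = x.

Lemma has_int_cst0 a b : a <= b -> has_int (fun=> 0) a b 0.
Proof. by move=> ab; split; [exact: itv_cst_integrable|rewrite itv_integral_cst// mul0r]. Qed.

Lemma has_int_point c a b p : has_int (fun t => c * \1_([set p]) t) a b 0.
Proof.
have mp : measurable ([set p] : set (measurableTypeR R)) by exact: measurable_set1.
have mI : measurable (`[a, b]%classic : set (measurableTypeR R)) by exact: measurable_itv.
have i1 : mu.-integrable `[a, b] (EFin \o (\1_([set p]) : R -> R)).
  have := @itv_integrable _ (\1_([set p]) : R -> R) a b 1 (measurable_indic mp); apply=> t _.
  by rewrite indicE; case: (t \in _); rewrite ?normr1 ?normr0.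
split; first by have := integrableZl mI c i1.
rewrite (RintegralZl c mI i1) /Rintegral integral_indic//.
rewrite [X in fine X](_ : _ = 0%E) ?mulr0//.
apply/eqP; rewrite eq_le measure_ge0 andbT -(lebesgue_measure_set1 p).
by apply: le_measure; rewrite ?inE//; exact: measurableI.
Qed.

Lemma has_intD f g a b x y : has_int f a b x -> has_int g a b y -> has_int (fun t => f t + g t) a b (x + y).
Proof.
move=> [f1 <-] [g1 <-]; have mI : measurable (`[a, b]%classic : set (measurableTypeR R)) by exact: measurable_itv.
split; last by rewrite (RintegralD mI f1 g1).
by have := integrableD mI f1 g1.
Qed.

Lemma eq_has_int f g a b x : (forall t, a <= t <= b -> f t = g t) -> has_int f a b x -> has_int g a b x.
Proof.
move=> e [f1 <-]; have mI : measurable (`[a, b]%classic : set (measurableTypeR R)) by exact: measurable_itv.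
have e' : {in `[a, b]%classic, f =1 g} by move=> t; rewrite inE /= in_itv /= => /e.
split; last by apply: eq_Rintegral => t /e' ->.
by move: f1; apply: eq_integrable => // t /e' /= ->.
Qed.

(** Integrands are compared off the end points of a piece, where [path_derive] may have its default
    value; correcting two points does not change the integral. *)
Lemma has_int_interior f g a b x : a < b -> (forall t, a < t < b -> f t = g t) ->
  has_int f a b x -> has_int g a b x.
Proof.
move=> ab e hf.
have h := has_intD hf (has_intD (has_int_point (g a - f a) a b a) (has_int_point (g b - f b) a b b)).
rewrite !addr0 in h; apply: eq_has_int h => t /andP[ta tb] /=.
have i (p : R) : (\1_([set p]) t : R) = (t == p)%:R.
  by have := eq1E p t; rewrite /eq1 => ->; case: eqP.
rewrite !i; have [->|ta'] := eqVneq t a; first by rewrite lt_eqF// mulr0 addr0 mulr1 subrKC.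
have [->|tb'] := eqVneq t b; first by rewrite mulr0 add0r mulr1 subrKC.
by rewrite !mulr0 !addr0 e// !lt_neqAle ta tb tb' eq_sym ta'.
Qed.

Lemma has_int_cat f a b c x y : a <= b -> b <= c -> has_int f a b x -> has_int f b c y -> has_int f a c (x + y).
Proof.
move=> ab bc [f1 <-] [f2 <-].
have m1 : measurable (`[a, b]%classic : set (measurableTypeR R)) by exact: measurable_itv.
have m2 : measurable (`]b, c]%classic : set (measurableTypeR R)) by exact: measurable_itv.
have m3 : measurable (`[b, c]%classic : set (measurableTypeR R)) by exact: measurable_itv.
have s23 : `]b, c]%classic `<=` `[b, c]%classic.
  by move=> t; rewrite /= !in_itv /= => /andP[/ltW -> ->].
have f2' := integrableS m3 m2 s23 f2.
have U : `[a, c]%classic = `[a, b]%classic `|` `]b, c]%classic.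
  apply/seteqP; split=> t; rewrite /= !in_itv /=.
    by move=> /andP[ta tc]; have [tb|tb] := leP t b; [left; rewrite ta|right].
  by move=> [/andP[-> /le_trans]|/andP[/ltW bt ->]]; [exact|rewrite (le_trans ab)].
have D : [disjoint `[a, b]%classic & `]b, c]%classic].
  apply/disj_setPS => t [] /=; rewrite !in_itv /= => /andP[_ tb] /andP[bt _].
  by move: bt; rewrite ltNge tb.
have i : mu.-integrable `[a, c] (EFin \o f).
  rewrite U; have /integrableP[mf1 g1] := f1; have /integrableP[mf2 g2] := f2'.
  have mU : measurable_fun (`[a, b]%classic `|` `]b, c]%classic) (EFin \o f) by apply/measurable_funU.
  apply/integrableP; split => //.
  by rewrite ge0_integral_setU//; [exact: lte_add_pinfty|exact: measurableT_comp].
split; first exact: i.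
by rewrite U Rintegral_setU -?U// (Rintegral_itv_obnd_cbnd f2').
Qed.

End IntervalIntegrals.

Section PathIntegral.
Context {R : realType} {H : completeNormedModType R[i]} (ip : H -> H -> R[i]).
Context (hip : hilbert_inner_product ip).
Context (N : set (H -> H)) (hN : von_neumann_algebra ip N).
Context (tau : (H -> H) -> \bar R) (htau : fns_trace ip N tau).
Context (r q : R) (hq0 : 0 < q) (hq1 : q <= 1) (hr : 0 <= r).
Local Notation "<< x , y >>" := (rip ip x y).
Local Notation sa := (sa ip).
Local Notation fc := (fc ip).
Local Notation FT := (FT ip N tau).
Local Notation TC := (TC ip N tau).
Local Notation ft := (ft tau).
Local Notation rtr := (rtr ip tau).
Local Notation tame := (tame ip N tau).
Local Notation beta := (beta ip tau).
Local Notation kap := (kap r q).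
Local Notation k1 := (k1 r q).
Local Notation J := (J ip tau).
Implicit Types (A B T S C U W X Y Z G K Q V D F : bop H) (x y : H) (a b e t s : R).

Lemma cscE (c : R[i]) x : csc c x = c *: x. Proof. by []. Qed.
Lemma adjp_csc (c : R[i]) : adjp ip (csc c) (csc c^*%C).
Proof.
move=> x y; rewrite /rip /= (ipZl hip) (ipZr hip) conjCK.
by [].
Qed.

(** The imaginary part is the trace of (X W - W X) / (2 i). [rtr_polar] with a purely imaginary
    scalar c as second operator turns it into the trace of G (c^* X + X c) G, which is zero. *)
Lemma ctrace_sa X W : sa X -> N X -> FT W -> ctrace ip tau ((X : H -> H) \o W) = (beta X W)%:C.
Proof.
move=> sX nX fW; have sW : sa W by case: fW.1 => _ [].
have [t b] := beta_FT hip hN htau sX nX fW.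
have aXW : adjoint ip (X * W : bop H) = (W * X : bop H)%R by apply: (adjointE hip) => //; exact: adjpM.
rewrite /ctrace comp_bop aXW.
have -> : (2^-1 : R[i]) *: ((X * W)%R + (W * X)%R : H -> H) = (2^-1 *: (X * W + W * X) : bop H)%R.
  by apply/funext => x; rewrite /= rmorphV ?unitfE ?pnatr_eq0// rmorph_nat.
have -> : ((2 * 'i) ^-1 : R[i]) *: ((X * W)%R - (W * X)%R : H -> H) =
   (csc (2 * 'i)^-1 * (X * W - W * X) : bop H)%R by apply/funext => x.
have [G [nG pG GG]] := NP_sqrt hip hN fW.1.
pose c : R[i] := - (2 * 'i)^-1.
have cc : c^*%C = (2 * 'i)^-1.
  rewrite /c rmorphN rmorphV ?unitfE ?mulf_eq0 ?pnatr_eq0 ?neq0Ci// rmorphM rmorph_nat.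
  rewrite [X in (_ * X)^-1](_ : _ = - 'i%R); first by rewrite mulrN invrN opprK.
  by rewrite -complexiE; apply/eqP; rewrite eq_complex /= oppr0 !eqxx.
have [t1 t2 e] := rtr_polar hip hN htau sX (adjp_csc c) nX (N_csc hN c) fW nG pG GG.
have e1 : csc (2 * 'i)^-1 * (X * W - W * X) = X * W * csc c^*%C + csc c * W * X.
  by rewrite cc; apply: bopext => x; rewrite !(bopE, cscE) /c !bopZ scalerBr scaleNr.
have e2 : csc c^*%C * X + X * csc c = 0.
  by rewrite cc; apply: bopext => x; rewrite !(bopE, cscE) /c !bopZ scaleNr subrr.
rewrite -/(rtr (2^-1 *: (X * W + W * X))) -/(rtr (csc (2 * 'i)^-1 * (X * W - W * X))).
rewrite e1 e e2 mulr0 mul0r (rtr0 hip hN htau); have [_ ->] := rtrZ hip hN htau 2^-1 t.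
by [].
Qed.

Lemma lb_weight : lb (weight_fun r q).
Proof.
(* Real powers of a negative number are 1 by convention, so the weight is the constant exp(-1) on
   the negative half-line. *)
have -> : weight_fun r q = fun u => kap u ^+ 2 * (1 - \1_(ray 0) (- u)) + expR (-1) * \1_(ray 0) (- u).
  apply/funext => u; rewrite kap_sq indicE mem_setE /ray /= in_itv /= andbT oppr_gt0.
  have [u0|u0] := ltP u 0; last by rewrite subr0 mulr1 mulr0 addr0 ger0_norm.
  rewrite subrr mulr0 add0r mulr1 /weight_fun lt_eqF// /powR lt_eqF// ln0 ?(ltW u0)//.
  by rewrite !mulr0 expR0 mul1r.
have l1 := lb_comp (lb_indic (measurable_ray (0 : R))) (lbN (@lb_id R)).
apply: lbD; last exact: lbZ.
by apply: lbM; [exact: (lbX 2 (lb_kap hq0 hq1 hr))|exact: (lbB (lb_cst 1) l1)].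
Qed.

Section Tangent.
Context (F0 : bop H) (nF0 : N F0) (sF0 : sa F0) (hF0 : tame q (1 - F0 * F0)).
Local Notation tang := (tang ip N tau q F0).
Local Notation Msp := (Msp ip N tau q F0).
Local Notation tn := (tangent_norm ip N tau F0 q).

Lemma weight_opE F : Msp F ->
  weight_op ip r q (idop - ((F : H -> H) \o F)) = (fc F k1 * fc F k1 : bop H).
Proof.
move=> mF; have sF := Msp_sa hip sF0 mF; have sFF : sa (F * F) by case: (psd_sqr hip sF).
have s1F : sa (1 - F * F) by apply: (saB hip) => //; exact: (sa1 ip).
have la := lb_norm (@lb_id R); have lw := lb_weight; have lk := lb_kap hq0 hq1 hr.
rewrite comp_bop -[idop]/((1 : bop H) : H -> H) sub_bop /weight_op (absopE hip)//.
have sa1 : sa (fc (1 - F * F) (fun u => `|u|)) by exact: (fc_sa hip s1F la).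
rewrite (funcalcE hip)// (fc_comp hip s1F lw la).
have -> : fc F k1 = fc (1 - F * F) kap by exact: (kapFE hip hq0 hq1 hr sF).
rewrite -(fcM hip s1F lk lk); congr bfun; congr fc; apply/funext => u.
by rewrite -expr2 kap_sq.
Qed.

Lemma lt_min2 (x a b : R) : x < Num.min a b -> x < a /\ x < b.
Proof. by rewrite lt_min => /andP[]. Qed.

Lemma J_near A U (c x e : R) : adm ip N tau k1 A U c ->
  (forall s, 0 <= s <= 1 -> `|integrand ip tau k1 A U s - x| <= e) -> `|J k1 A U - x| <= e.
Proof.
move=> ad he; have ck := k1_continuous hq0 hq1 hr.
have i1 := cont_on_integrable (integrand_cont hip hN htau ck ad).
have mI : measurable (`[(0 : R), 1]%classic : set (measurableTypeR R)) by [].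
have i2 := itv_cst_integrable 0 1 x.
have i3 : (@lebesgue_measure R).-integrable `[0, 1] (EFin \o (fun s => integrand ip tau k1 A U s - x)).
  by have := integrableB mI i1 i2.
have -> : J k1 A U - x = \int[lebesgue_measure]_(s in `[(0 : R), 1]) (integrand ip tau k1 A U s - x).
  by rewrite (RintegralB mI i1 i2) itv_integral_cst ?ler01// subr0 mulr1.
apply: (le_trans (le_normr_Rintegral mI i3)).
have -> : e = \int[lebesgue_measure]_(s in `[(0 : R), 1]) e by rewrite itv_integral_cst ?ler01// subr0 mulr1.
apply: itv_integral_le; [by have := integrable_norm i3|exact: itv_cst_integrable|exact: he].
Qed.

Lemma k1_near A G : Msp A -> tang G -> exists2 c, 0 <= c & [/\ FT (fc A k1), ft (fc A k1) <= c &
  forall e, 0 < e -> exists2 d, 0 < d & forall Z s, tang Z -> tn Z < d -> `|s| < d ->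
    let K := fc (A + s *: (G + Z)) k1 in [/\ FT K, ft K <= c & opnorm (K - fc A k1) <= e]].
Proof.
move=> mA tG; have ck := k1_continuous hq0 hq1 hr.
have [d0 [c [d00 c0 hc]]] := FT_segment hip hN htau hq0 hq1 hr nF0 sF0 hF0 mA tG.
have sA := Msp_sa hip sF0 mA; have sG := tang_sa tG.
have t0 : tang 0 by exact: (tang0 hip hN htau).
have [fA bA] : FT (fc A k1) /\ ft (fc A k1) <= c.
  have := hc 0 0 t0; rewrite (tangent_norm0 hip hN htau hq0) normr0 scale0r addr0 ler01; exact.
exists c => //; split => // e e0.
pose M := opnorm A + (opnorm G + 4); have oA := opnorm_ge0 A; have oG := opnorm_ge0 G.
have [w w0 hw] := fc_norm_cont hip M ck e0.
have g0 : 0 < opnorm G + 4 by rewrite ltr_wpDl.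
exists (Num.min (Num.min d0 1) (w / (opnorm G + 4))) => [|Z s tZ]; first by rewrite !lt_min d00 ltr01 divr_gt0.
move=> /lt_min2[/lt_min2[z1 z2] z3] /lt_min2[/lt_min2[h1 h2] h3] K.
have [f b] := hc Z s tZ z1 (ltW h2); split; [exact: f|exact: b|].
have sZ := tang_sa tZ; have sGZ : sa (G + Z) by exact: (saD hip).
have nGZ : opnorm (G + Z) <= opnorm G + 4.
  apply: (le_trans (opnormD _ _)); rewrite lerD2l; apply: (le_trans (opnorm_tangent hip hN htau hq0 hq1 tZ)).
  by rewrite ler_piMr// ltW.
have nS : opnorm (s *: (G + Z)) <= `|s| * (opnorm G + 4).
  by apply: (le_trans (opnormZ_le _ _)); rewrite ler_wpM2l.
apply: hw; [by apply: (saD hip) => //; exact: (saZ hip)|exact: sA| |by rewrite /M lerDl ltW|].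
  apply: (le_trans (opnormD _ _)); rewrite /M lerD2l; apply: (le_trans nS).
  by rewrite ler_piMl// ltW.
rewrite addrAC subrr add0r; apply: (le_lt_trans nS).
by rewrite -ltr_pdivlMr.
Qed.

(** First-order expansion of J at the zero vector, uniform in Z. Along a path Z is the difference
    between the difference quotient and the derivative G, which is small in tangent norm. *)
Lemma J_small A G : Msp A -> tang G -> forall e, 0 < e -> exists2 d, 0 < d &
  forall Z s, tang Z -> tn Z < d -> `|s| < d ->
    `|J k1 A (s *: (G + Z)) - s * beta G (fc A k1 * fc A k1)| <= e * `|s|.
Proof.
move=> mA tG e e0; have [c c0 [fA bA hA]] := k1_near mA tG.
have ck := k1_continuous hq0 hq1 hr; have lk := lb_k1 hq0 hq1 hr.
have sA := Msp_sa hip sF0 mA; have nA := Msp_N hN nF0 mA; have sG := tang_sa tG; have nG := tang_N tG.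
have km := le_trans ler01 (kmax_ge1 r); have oG := opnorm_ge0 G.
pose p1 := opnorm G * (2 * c) + 1; have p10 : 0 < p1 by rewrite ltr_wpDl// mulr_ge0// mulr_ge0.
pose e1 := e / 2 / p1; have e10 : 0 < e1 by rewrite !divr_gt0.
pose p2 := 4 * (kmax r * c) + 1; have p20 : 0 < p2 by rewrite ltr_wpDl// mulr_ge0// mulr_ge0.
pose e2 := e / 2 / p2; have e20 : 0 < e2 by rewrite !divr_gt0.
have [d d0 hd] := hA _ e10.
exists (Num.min d e2) => [|Z s tZ]; first by rewrite lt_min d0.
move=> /lt_min2[z1 z2] /lt_min2[h1 h2].
have sZ := tang_sa tZ; have nZ := tang_N tZ.
have tGZ : tang (G + Z) by exact: (tangD hip hN htau hq0).
have tU : tang (s *: (G + Z)) by exact: (tangZ hip hN htau hq0).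
have sh t : 0 <= t <= 1 -> `|t * s| < d.
  move=> /andP[t0 t1]; apply: le_lt_trans h1; rewrite normrM (ger0_norm t0).
  by rewrite ler_piMl.
have key t : 0 <= t <= 1 -> let K := fc (A + t *: (s *: (G + Z))) k1 in
    [/\ FT K, ft K <= c & opnorm (K - fc A k1) <= e1].
  by move=> t01; rewrite scalerA; exact: (hd Z (t * s) tZ z1 (sh t t01)).
have ad : adm ip N tau k1 A (s *: (G + Z)) c.
  split; [exact: nA|exact: sA|exact: (tang_N tU)|exact: (tang_sa tU)|].
  by move=> t t01; have [f b _] := key t t01.
apply: (J_near ad) => t t01; have [f b k] := key t t01; rewrite /integrand.
have [fAA _] := FT_sqr hip hN htau fA; have [tc _] := beta_FT hip hN htau sG nG fAA.
rewrite -(betaZl hip hN htau s tc).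
have okm : opnorm (fc (A + t *: (s *: (G + Z))) k1) <= kmax r.
  apply: (fc_norm hip (seg_sa hip t sA (tang_sa tU)) lk km) => u _.
  by rewrite (ger0_norm (k1_ge0 r q u)); exact: (kap_max hq0 hq1 hr).
apply: (le_trans (beta_sqr_diff hip hN htau (tang_sa tU) (tang_N tU) (saZ hip s sG) (NZ hN s nG) f fA b bA okm)).
have n1 : opnorm (s *: (G + Z) - s *: G) <= `|s| * (4 * e2).
  rewrite -scalerBr addrAC subrr add0r; apply: (le_trans (opnormZ_le _ _)).
  rewrite ler_wpM2l//; apply: (le_trans (opnorm_tangent hip hN htau hq0 hq1 tZ)).
  by rewrite ler_wpM2l// ltW.
have n2 : opnorm (s *: G) <= `|s| * opnorm G by exact: opnormZ_le.
apply: (@le_trans _ _ (`|s| * (4 * e2) * (kmax r * c) + `|s| * opnorm G * e1 * (2 * c))).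
  apply: lerD; first by rewrite ler_wpM2r// mulr_ge0.
  by rewrite ler_wpM2r ?mulr_ge0//; apply: ler_pM => //; exact: opnorm_ge0.
have -> : `|s| * (4 * e2) * (kmax r * c) + `|s| * opnorm G * e1 * (2 * c) =
   (e2 * (4 * (kmax r * c)) + e1 * (opnorm G * (2 * c))) * `|s|.
  by move: (`|s|) (kmax r) (opnorm G) => x y z; ring.
rewrite ler_wpM2r// [leRHS]splitr; apply: lerD.
  apply: (@le_trans _ _ (e2 * p2)); last by rewrite /e2 divfK// gt_eqF.
  by rewrite ler_wpM2l ?(ltW e20)// lerDl.
apply: (@le_trans _ _ (e1 * p1)); last by rewrite /e1 divfK// gt_eqF.
by rewrite ler_wpM2l ?(ltW e10)// lerDl.
Qed.

(** Continuity of the integrand along a path: s (G + Z) is the increment of the path from A, and G'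
    is the derivative at the nearby point. *)
Lemma beta_k1_cont A G : Msp A -> tang G -> forall e, 0 < e -> exists2 d, 0 < d &
  forall Z G' s, tang Z -> tang G' -> tn Z < d -> tn (G' - G)%R < d -> `|s| < d ->
    `|beta G' (fc (A + s *: (G + Z)) k1 * fc (A + s *: (G + Z)) k1) - beta G (fc A k1 * fc A k1)| <= e.
Proof.
move=> mA tG e e0; have [c c0 [fA bA hA]] := k1_near mA tG.
have lk := lb_k1 hq0 hq1 hr.
have sA := Msp_sa hip sF0 mA; have sG := tang_sa tG; have nG := tang_N tG.
have km := le_trans ler01 (kmax_ge1 r); have oG := opnorm_ge0 G.
pose p1 := opnorm G * (2 * c) + 1; have p10 : 0 < p1 by rewrite ltr_wpDl// mulr_ge0// mulr_ge0.
pose e1 := e / 2 / p1; have e10 : 0 < e1 by rewrite !divr_gt0.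
pose p2 := 4 * (kmax r * c) + 1; have p20 : 0 < p2 by rewrite ltr_wpDl// mulr_ge0// mulr_ge0.
pose e2 := e / 2 / p2; have e20 : 0 < e2 by rewrite !divr_gt0.
have [d d0 hd] := hA _ e10.
exists (Num.min d e2) => [|Z G' s tZ tG']; first by rewrite lt_min d0.
move=> /lt_min2[z1 z2] /lt_min2[g1 g2] /lt_min2[h1 h2]; set K := fc (A + s *: (G + Z)) k1.
have [f b k] := hd Z s tZ z1 h1.
have sGZ : sa (G + Z) by exact: (saD hip) sG (tang_sa tZ).
have okm : opnorm K <= kmax r.
  apply: (fc_norm hip (seg_sa hip s sA sGZ) lk km) => u _.
  by rewrite (ger0_norm (k1_ge0 r q u)); exact: (kap_max hq0 hq1 hr).
apply: (le_trans (beta_sqr_diff hip hN htau (tang_sa tG') (tang_N tG') sG nG f fA b bA okm)).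
have n1 : opnorm (G' - G) <= 4 * e2.
  apply: (le_trans (opnorm_tangent hip hN htau hq0 hq1 (tangB hip hN htau hq0 tG' tG))).
  exact: (ler_wpM2l (ler0n R 4) (ltW g2)).
rewrite [leRHS]splitr; apply: lerD.
  apply: (@le_trans _ _ (e2 * p2)); last by rewrite /e2 divfK// gt_eqF.
  apply: (@le_trans _ _ (4 * e2 * (kmax r * c))); first by rewrite ler_wpM2r// mulr_ge0.
  by rewrite [4 * e2]mulrC -mulrA ler_wpM2l ?(ltW e20)// lerDl.
apply: (@le_trans _ _ (e1 * p1)); last by rewrite /e1 divfK// gt_eqF.
apply: (@le_trans _ _ (opnorm G * e1 * (2 * c))).
  by rewrite ler_wpM2r ?mulr_ge0//; apply: ler_wpM2l.
by rewrite [opnorm G * e1]mulrC -mulrA ler_wpM2l ?(ltW e10)// lerDl.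
Qed.

Definition C1b (F G : R -> bop H) a b := forall t, a <= t <= b ->
  [/\ Msp (F t), tang (G t),
    forall e, 0 < e -> exists2 d, 0 < d & forall s, a <= s <= b -> s != t -> `|s - t| < d ->
      tn ((s - t)^-1 *: (F s - F t) - G t)%R < e &
    forall e, 0 < e -> exists2 d, 0 < d & forall s, a <= s <= b -> `|s - t| < d ->
      tn (G s - G t)%R < e].

Lemma C1b_quot F0' F1 G0 s t : s != t -> Msp F0' -> Msp F1 -> tang G0 ->
  let Z := (s - t)^-1 *: (F1 - F0') - G0 in tang Z /\ F1 - F0' = (s - t) *: (G0 + Z).
Proof.
move=> st m0 m1 tG Z; split.
  by apply: (tangB hip hN htau hq0) => //; apply: (tangZ hip hN htau hq0); exact: (Msp_diff hip hN htau hq0).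
by rewrite /Z [G0 + _]addrC subrK scalerA divff ?scale1r// subr_eq0.
Qed.

Lemma J_zero A : Msp A -> J k1 A 0 = 0.
Proof.
move=> mA; have t0 : tang 0 by exact: (tang0 hip hN htau).
have := J_exact hip hN htau hq0 hq1 hr nF0 sF0 hF0 mA t0 t0; rewrite addr0 subrr => h.
by apply: (addrI (J k1 A 0)); rewrite h addr0.
Qed.

Section Curve.
Context (F G : R -> bop H) (a b : R) (ab : a < b) (hFG : C1b F G a b).

Definition dens t : R := beta (G t) (fc (F t) k1 * fc (F t) k1).

Lemma dens_cont : cont_on dens a b.
Proof.
move=> t tab e e0; have [mF tG h1 h2] := hFG tab.
have [d d0 hd] := beta_k1_cont mF tG e0.
have [d1 d10 hd1] := h1 d d0; have [d2 d20 hd2] := h2 d d0.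
exists (Num.min (Num.min d1 d2) d) => [|s sab]; first by rewrite !lt_min d10 d20.
rewrite !lt_min => /andP[/andP[s1 s2] s3]; have [mS tS _ _] := hFG sab.
have [->|st] := eqVneq s t; first by rewrite subrr normr0 ltW.
have [tZ eZ] := C1b_quot st mF mS tG.
have := hd _ (G s) (s - t) tZ tS (hd1 s sab st s1) (hd2 s sab s2) s3.
have e1 : F t + (F s - F t) = F s by rewrite addrC subrK.
by rewrite -eZ e1.
Qed.

Lemma dens_integral : \int[lebesgue_measure]_(t in `[a, b]) dens t = J k1 (F a) (F b - F a).
Proof.
have aab : a <= a <= b by rewrite lexx ltW.
have [mA _ _ _] := hFG aab.
pose Phi s := J k1 (F a) (F s - F a).
rewrite (@FTC_eps R Phi dens a b ab dens_cont) /Phi.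
  by rewrite subrr J_zero// subr0.
move=> t tab e e0; have [mF tG h1 h2] := hFG tab.
have [d d0 hd] := J_small mF tG e0; have [d1 d10 hd1] := h1 d d0.
exists (Num.min d d1) => [|s sab]; first by rewrite lt_min d0.
rewrite lt_min => /andP[s1 s2]; have [mS tS _ _] := hFG sab.
have [->|st] := eqVneq s t; first by rewrite !subrr mul0r subr0 normr0 mulr0.
have [tZ eZ] := C1b_quot st mF mS tG.
have tU : tang (F t - F a) by exact: (Msp_diff hip hN htau hq0).
have tV : tang (F s - F a) by exact: (Msp_diff hip hN htau hq0).
have ex := J_exact hip hN htau hq0 hq1 hr nF0 sF0 hF0 mA tU tV.
rewrite [F a + _]addrC subrK in ex.
have e1 : F s - F a - (F t - F a) = F s - F t by rewrite opprB addrA subrK.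
rewrite e1 in ex; rewrite -ex [J k1 (F a) _ + _]addrC addrK eZ.
exact: (hd _ (s - t) tZ (hd1 s sab st s2) s1).
Qed.

End Curve.

End Tangent.
End PathIntegral.

(** * Derivatives of paths and the density of the path integral *)

Section PathDerivative.
Context {R : realType} {H : completeNormedModType R[i]} (ip : H -> H -> R[i]).
Context (hip : hilbert_inner_product ip).
Context (N : set (H -> H)) (hN : von_neumann_algebra ip N).
Context (tau : (H -> H) -> \bar R) (htau : fns_trace ip N tau).
Context (r q : R) (hq0 : 0 < q) (hq1 : q <= 1) (hr : 0 <= r).
Local Notation "<< x , y >>" := (rip ip x y).
Local Notation sa := (sa ip).
Local Notation fc := (fc ip).
Local Notation FT := (FT ip N tau).
Local Notation ft := (ft tau).
Local Notation tame := (tame ip N tau).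
Local Notation beta := (beta ip tau).
Local Notation k1 := (k1 r q).
Local Notation J := (J ip tau).
Context (F0 : bop H) (nF0 : N F0) (sF0 : sa F0) (hF0 : tame q (1 - F0 * F0)).
Local Notation tang := (tang ip N tau q F0).
Local Notation Msp := (Msp ip N tau q F0).
Local Notation tn := (tangent_norm ip N tau F0 q).
Local Notation C1b := (C1b ip N tau q F0).
Implicit Types (A B T S C U W X Y Z G K Q V D : bop H) (x y : H) (a b e t s : R).

Lemma cvg_dnbhs_within (f : R -> R) a b t :
  f s @[s --> within [set` `[a, b]] (t^')] --> (0 : R) ->
  forall e, 0 < e -> exists2 d, 0 < d & forall s, a <= s <= b -> s != t -> `|s - t| < d -> f s < e.
Proof.
move=> /cvgrPdist_lt h e e0; have := h e e0; rewrite /within /= => /nbhs_ballP[d d0 hd].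
exists d => // s sab st sd; apply: (le_lt_trans (ler_norm _)); rewrite -normrN -sub0r.
have sI : s \in `[a, b] by rewrite in_itv.
have sB : ball t d s by rewrite /ball /= distrC.
exact: (hd s sB st sI).
Qed.

Lemma cvg_nbhs_within (f : R -> R) a b t :
  f s @[s --> within [set` `[a, b]] (nbhs t)] --> (0 : R) ->
  forall e, 0 < e -> exists2 d, 0 < d & forall s, a <= s <= b -> `|s - t| < d -> f s < e.
Proof.
move=> /cvgrPdist_lt h e e0; have := h e e0; rewrite /within /= => /nbhs_ballP[d d0 hd].
exists d => // s sab sd; apply: (le_lt_trans (ler_norm _)); rewrite -normrN -sub0r.
have sI : s \in `[a, b] by rewrite in_itv.
have sB : ball t d s by rewrite /ball /= distrC.
exact: (hd s sB sI).
Qed.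

Definition lift_path (P : R -> H -> H) (t : R) : bop H := xget 0 [set X : bop H | P t = X].
Lemma lift_pathE (P : R -> H -> H) t (X : bop H) : P t = X -> lift_path P t = X.
Proof.
move=> e; apply: bop_eq; have h : P t = lift_path P t := xgetPex 0 (ex_intro [set X : bop H | P t = X] X e).
by rewrite -h e.
Qed.

Lemma quot_bop (P : R -> H -> H) (G : H -> H) s t (X Y Z : bop H) (c : R) :
  P s = X -> P t = Y -> G = Z -> c%:C *: (P s - P t) - G = (c *: (X - Y) - Z : bop H)%R.
Proof. by move=> -> -> ->; apply/funext => x. Qed.

Lemma C1_onP (P : R -> H -> H) a b : C1_on ip N tau F0 q P a b -> exists F G : R -> bop H,
  (forall t, a <= t <= b -> P t = F t) /\ C1b F G a b.
Proof.
move=> [G0 hG]; pose F := lift_path P; pose G := lift_path G0.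
have tab t : a <= t <= b -> t \in `[a, b] by rewrite in_itv.
have eF t : a <= t <= b -> P t = F t /\ Msp (F t).
  move=> /tab /hG[/(MspP hip hN htau hq0 hq1) [] // X e mX _ _ _]; rewrite /F (lift_pathE e); split => //.
have eG t : a <= t <= b -> G0 t = G t /\ tang (G t).
  by move=> /tab /hG[_ /(tangentP hip hN htau hq0 hq1) [] // X e mX _ _]; rewrite /G (lift_pathE e).
exists F, G; split; first by move=> t /eF[].
move=> t ht; have [_ _ h1 h2] := hG t (tab t ht).
have [e1 mF] := eF t ht; have [e2 tG] := eG t ht; split => // e e0.
  have [d d0 hd] := cvg_dnbhs_within h1 e0; exists d; [exact: d0|move=> s hs st sd].
  have [e3 _] := eF s hs; have := hd s hs st sd.
  by rewrite (quot_bop _ e3 e1 e2).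
have [d d0 hd] := cvg_nbhs_within h2 e0; exists d; [exact: d0|move=> s hs sd].
by have [e3 _] := eG s hs; have := hd s hs sd; rewrite e3 e2 sub_bop.
Qed.

Lemma cvg_dnbhs0 (f : R -> R) :
  f h @[h --> (0 : R)^'] --> (0 : R) <->
  forall e, 0 < e -> exists2 d, 0 < d & forall h, h != 0 -> `|h| < d -> `|f h| < e.
Proof.
split=> [/cvgrPdist_lt h e e0|h].
  have := h e e0 => /nbhs_ballP[d d0 hd]; exists d => // s s0 sd.
  by rewrite -normrN -sub0r; apply: hd => //; rewrite /ball /= sub0r normrN.
apply/cvgrPdist_lt => e e0; have [d d0 hd] := h e e0.
apply/nbhs_ballP; exists d => // s; rewrite /ball /= sub0r normrN => sd s0.
by rewrite sub0r normrN; exact: hd.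
Qed.

(** At interior points the derivative in tangent norm is unique, since [opnorm_tangent] bounds the
    operator norm by it; the choice made by [path_derive] is therefore forced. *)
Lemma path_deriveE (P : R -> H -> H) a b (F G : R -> bop H) t : (forall t, a <= t <= b -> P t = F t) -> C1b F G a b ->
  a < t < b -> path_derive ip N tau F0 q P t = G t.
Proof.
move=> eP hFG /andP[ta tb]; have ht : a <= t <= b by rewrite !ltW.
have [mF tG h1 _] := hFG t ht.
pose w := Num.min (t - a) (b - t); have w0 : 0 < w by rewrite lt_min !subr_gt0 ta.
have inI h : `|h| < w -> a <= t + h <= b.
  rewrite ltr_norml => /andP[l1 /lt_min2[l2 l3]]; apply/andP; split.
    move: l1; rewrite ltrNl => /lt_min2[l4 _].
    by rewrite -lerBlDl -opprB ltW// ltrNl.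
  by rewrite -lerBrDl ltW.
pose Qt h : bop H := h^-1 *: (F (t + h) - F t).
have eQ h (Y : bop H) : `|h| < w -> h^-1%:C *: (P (t + h) - P t) - Y = (Qt h - Y : bop H)%R.
  move=> hw; exact: (quot_bop _ (eP _ (inI h hw)) (eP t ht) erefl).
have tQ h : `|h| < w -> tang (Qt h).
  by move=> hw; have [mS _ _ _] := hFG _ (inI h hw); apply: (tangZ hip hN htau hq0) => //; exact: (Msp_diff hip hN htau hq0).
have limG e : 0 < e -> exists2 d, 0 < d & forall h, h != 0 -> `|h| < d -> `|h| < w -> tn (Qt h - G t)%R < e.
  move=> e0; have [d d0 hd] := h1 e e0; exists d => // h h0 hd' hw.
  have e1 : t + h - t = h by rewrite addrC addrA addNr add0r.
  have := hd (t + h) (inI h hw); rewrite e1 => /(_ _ hd') hh; apply: hh.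
  by rewrite -subr_eq0 e1.
rewrite /path_derive; case: xgetP => [Y _ [tY cY]|/(_ (G t))[]]; last first.
  split; first by apply/(tangentP hip hN htau hq0 hq1) => //; exists (G t).
  apply/cvg_dnbhs0 => e e0; have [d d0 hd] := limG e e0.
  exists (Num.min d w) => [|h h0 /lt_min2[l1 l2]]; first by rewrite lt_min d0.
  rewrite (eQ _ _ l2) ger0_norm; first exact: hd.
  rewrite tangent_normE addr_ge0//; exact: Lip_norm_ge0.
have [Y' eY tY'] := (tangentP hip hN htau hq0 hq1 sF0 _).1 tY; subst Y; congr bfun.
have tD : tang (Y' - G t) by exact: (tangB hip hN htau hq0).
have z : opnorm (Y' - G t) = 0.
  apply/eqP; rewrite eq_le opnorm_ge0 andbT; apply/ler_addgt0Pr => e e0; rewrite add0r.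
  have e8 : 0 < e / 8 by exact: divr_gt0.
  have [d1 d10 hd1] := limG _ e8; have [d2 d20 hd2] := (cvg_dnbhs0 _).1 cY _ e8.
  pose h := Num.min (Num.min d1 d2) w / 2.
  have m0 : 0 < Num.min (Num.min d1 d2) w by rewrite [_ < _]lt_min w0 andbT lt_min d10 d20.
  have hp : 0 < h by exact: divr_gt0.
  have hl : `|h| < Num.min (Num.min d1 d2) w by rewrite gtr0_norm// ltr_pdivrMr// ltr_pMr// ltr1n.
  have [/lt_min2[l1 l2] l3] := lt_min2 hl.
  have b1 := hd1 h (lt0r_neq0 hp) l1 l3.
  have := hd2 h (lt0r_neq0 hp) l2; rewrite (eQ _ _ l3) => b2.
  have -> : Y' - G t = Qt h - G t - (Qt h - Y') by move: (Qt h) (G t) => X Z; bopring hip.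
  apply: (le_trans (opnormD _ _)); rewrite opnormN.
  have o1 := opnorm_tangent hip hN htau hq0 hq1 (tangB hip hN htau hq0 (tQ h l3) tG).
  have o2 := opnorm_tangent hip hN htau hq0 hq1 (tangB hip hN htau hq0 (tQ h l3) tY').
  have b2' := le_lt_trans (ler_norm _) b2.
  apply: (le_trans (lerD o1 o2)).
  apply: (le_trans (lerD (ler_wpM2l (ler0n R 4) (ltW b1)) (ler_wpM2l (ler0n R 4) (ltW b2')))).
  rewrite -mulrDl (_ : 4 + 4 = 8 :> R); last by rewrite -natrD.
  by rewrite mulrCA divff ?mulr1.
by apply: bopext => x; apply/eqP; rewrite -subr_eq0 -bopBE; apply/eqP; exact: opnorm_eq0 z x.
Qed.

Definition path_density (P : R -> H -> H) (t : R) : R[i] :=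
  ctrace ip tau (path_derive ip N tau F0 q P t \o weight_op ip r q (idop - (P t \o P t))).

Lemma C1_density (P : R -> H -> H) a b : a < b -> C1_on ip N tau F0 q P a b -> exists A B,
  [/\ P a = A, P b = B, Msp A, Msp B &
   has_int (fun t => complex.Re (path_density P t)) a b (J k1 A (B - A)) /\
   has_int (fun t => complex.Im (path_density P t)) a b 0].
Proof.
move=> ab hC; have [F [G [eP hFG]]] := C1_onP hC.
have aab : a <= a <= b by rewrite lexx ltW.
have bab : a <= b <= b by rewrite lexx ltW.
have [mA _ _ _] := hFG a aab; have [mB _ _ _] := hFG b bab.
exists (F a), (F b); split; [exact: eP|exact: eP|exact: mA|exact: mB|].
have dE t : a < t < b -> path_density P t = (dens ip tau r q F G t)%:C.
  move=> tab; have /andP[ta tb] := tab; have ht : a <= t <= b by rewrite !ltW.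
  have [mF tG _ _] := hFG t ht.
  rewrite /path_density (path_deriveE eP hFG tab) (eP t ht).
  rewrite (weight_opE hip hq0 hq1 hr sF0 mF).
  have fK : FT (fc (F t) k1) by exact: (FT_kapF hip hN htau hq0 hq1 hr sF0 hF0 mF).
  have [fKK _] := FT_sqr hip hN htau fK.
  exact: (ctrace_sa hip hN htau (tang_sa tG) (tang_N tG) fKK).
have dc := dens_cont hip hN htau hq0 hq1 hr nF0 sF0 hF0 hFG.
have di := dens_integral hip hN htau hq0 hq1 hr nF0 sF0 hF0 ab hFG.
split.
  apply: (has_int_interior ab (f := dens ip tau r q F G)) => [t /dE -> //|].
  by split; [exact: cont_on_integrable|].
apply: (has_int_interior ab (f := fun=> 0)) => [t /dE -> //|].
exact: has_int_cst0 (ltW ab).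
Qed.

End PathDerivative.

Lemma sum_telescope (R : pzRingType) (c : R) (f : nat -> R) n :
  \sum_(i < n) c * (f i.+1 - f i) = c * (f n - f 0%N).
Proof.
by rewrite -mulr_sumr -(big_mkord xpredT (fun i => f i.+1 - f i)) telescope_sumr.
Qed.

(** * Spectral flow *)

Section SpectralFlow.
Context {R : realType} {H : completeNormedModType R[i]} (ip : H -> H -> R[i]).
Context (hip : hilbert_inner_product ip).
Context (N : set (H -> H)) (hN : von_neumann_algebra ip N).
Context (tau : (H -> H) -> \bar R) (htau : fns_trace ip N tau).
Context (r q : R) (hq0 : 0 < q) (hq1 : q <= 1) (hr : 0 <= r).
Local Notation sa := (sa ip).
Local Notation fc := (fc ip).
Local Notation tame := (tame ip N tau).
Local Notation k1 := (k1 r q).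
Local Notation J := (J ip tau).
Context (F0 : bop H) (nF0 : N F0) (sF0 : sa F0) (hF0 : tame q (1 - F0 * F0)).
Local Notation tang := (tang ip N tau q F0).
Local Notation Msp := (Msp ip N tau q F0).
Local Notation tn := (tangent_norm ip N tau F0 q).
Local Notation path_density := (path_density ip N tau r q F0).
Implicit Types (A B T S C U W X Y Z G K Q V D : bop H) (x y : H) (a b e t : R).

Lemma J_chain A B C : Msp A -> Msp B -> Msp C ->
  J k1 A (B - A) + J k1 B (C - B) = J k1 A (C - A).
Proof.
move=> mA mB mC; have tU : tang (B - A) by exact: (Msp_diff hip hN htau hq0).
have tV : tang (C - A) by exact: (Msp_diff hip hN htau hq0).
have := J_exact hip hN htau hq0 hq1 hr nF0 sF0 hF0 mA tU tV.
by rewrite [A + _]addrC subrK (_ : C - A - (B - A) = C - B)// opprB addrA subrK.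
Qed.

Lemma has_int_degenerate (f : R -> R) a : has_int f a a 0.
Proof.
apply: (eq_has_int (f := fun=> f a)) => [t|].
  by rewrite -eq_le => /eqP ->.
by split; [exact: itv_cst_integrable|rewrite itv_integral_cst// subrr mulr0].
Qed.

(** Recursion on the break points: the values on adjacent pieces combine by [J_chain], so the total
    depends on the two end points only. *)
Lemma piecewise_density (P : R -> H -> H) b (s : seq R) : forall a A, itv_partition a b s ->
  (forall i, (i < size s)%N -> C1_on ip N tau F0 q P (nth 0 (a :: s) i) (nth 0 s i)) ->
  P a = A -> Msp A ->
  exists B, [/\ P b = B, Msp B,
    has_int (fun t => complex.Re (path_density P t)) a b (J k1 A (B - A)),
    has_int (fun t => complex.Im (path_density P t)) a b 0 &
    forall t, a <= t <= b -> exists2 F : bop H, P t = F & Msp F].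
Proof.
elim: s => [|c s ih] a A.
  move=> [_ /eqP /= <-] _ eA mA; exists A; split=> //.
  - by rewrite subrr (J_zero hip hN htau hq0 hq1 hr nF0 sF0 hF0 mA); exact: has_int_degenerate.
  - exact: has_int_degenerate.
  - by move=> t; rewrite -eq_le => /eqP <-; exists A.
move=> [/= /andP[ac ps] ls] hC eA mA.
have hc : C1_on ip N tau F0 q P a c := hC 0%N isT.
have [A' [B [eA' eB _ mB [h1 h2]]]] := C1_density hip hN htau hq0 hq1 hr nF0 sF0 hF0 ac hc.
have {eA'} ? : A' = A by apply: bop_eq; rewrite -eA' -eA.
subst A'.
have pcb : itv_partition c b s by split.
have [B' [eB' mB' g1 g2 hM]] := ih c B pcb (fun i hi => hC i.+1 hi) eB mB.
have cb : c <= b.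
  move: ps ls; clear -pcb; elim: s c pcb => [|d s ih] c _ /=; first by move=> _ /eqP ->.
  by move=> /andP[cd ps] ls; apply: (le_trans (ltW cd)); apply: ih.
exists B'; split; [exact: eB'|exact: mB'| | |].
- by rewrite -(J_chain mA mB mB'); exact: (has_int_cat (ltW ac) cb h1 g1).
- by rewrite -[0]addr0; exact: (has_int_cat (ltW ac) cb h2 g2).
- move=> t /andP[ta tb]; have [tc|ct] := leP t c; last by apply: hM; rewrite ltW.
  have [G hG] := hc; have [|mt _ _ _] := hG t; first by rewrite in_itv /= ta.
  by apply/(MspP hip hN htau hq0 hq1 sF0) => //.
Qed.

Definition sgn F : bop H := fc F sgnf.

Lemma signopE F : sa F -> signop ip F = sgn F.
Proof. by move=> sF; exact: (funcalcE hip sF lb_sgnf). Qed.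

Lemma sgn_sq F : sa F -> sgn F * sgn F = 1.
Proof.
move=> sF; rewrite -(fcM hip sF lb_sgnf lb_sgnf) -sc1 -(fc_cst hip sF 1); congr fc; apply/funext => u.
by rewrite /sgnf; case: ifP => _; rewrite ?mulrNN mulr1.
Qed.

Lemma nonneg_projE F : sa F -> nonneg_proj ip F = halfp (sgn F).
Proof.
move=> sF; have l1 : lb (fun u : R => 1 + sgnf u) by exact: (lbD (lb_cst 1) lb_sgnf).
have e : (fun l : R => if 0 <= l then 1 else 0) = fun u : R => 2^-1 * (1 + sgnf u).
  by apply/funext => u; rewrite /sgnf; case: ifP => _; [field|rewrite subrr mulr0].
rewrite /nonneg_proj e (funcalcE hip)//; last exact: lbZ.
by rewrite (fcZ hip sF _ l1) (fcD hip sF (lb_cst 1) lb_sgnf) (fc_cst hip sF 1) sc1.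
Qed.

Lemma Msp_sgn F : Msp F -> Msp (sgn F).
Proof. exact: (Msp_sign hip hN htau hq0 hq1). Qed.

(** The space of admissible operators is affine, so the segment from F to its sign is a C^1 path in
    it with constant derivative. *)
Lemma gammaE F : Msp F ->
  gamma ip N tau F0 r q F = ((Crq r q)^-1 * J k1 F (sgn F - F))%:C.
Proof.
move=> mF; have sF := Msp_sa hip sF0 mF; have mS := Msp_sgn mF.
have tG : tang (sgn F - F) by exact: (Msp_diff hip hN htau hq0).
rewrite /gamma (signopE sF).
set P := fun t : R => _.
have eP t : P t = (F + t *: (sgn F - F) : bop H) by apply/funext => x.
have mP t : Msp (F + t *: (sgn F - F)) by apply: (Msp_tang hip hN htau hq0) => //; exact: (tangZ hip hN htau hq0).
have hC : C1_on ip N tau F0 q P 0 1.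
  exists (fun=> (sgn F - F : bop H)) => t _; split.
  - by apply/(MspP hip hN htau hq0 hq1 sF0) => //; rewrite eP; exists (F + t *: (sgn F - F)).
  - by apply/(tangentP hip hN htau hq0 hq1 sF0) => //; exists (sgn F - F).
  - apply/cvgrPdist_lt => e e0; near=> s.
    have st : s != t by near: s; rewrite near_withinE; near=> s'; move=> _; near: s'; exact: nbhs_dnbhs_neq.
    have -> : (s - t)^-1%:C *: (P s - P t) - (sgn F - F : bop H) = (0 : bop H).
      rewrite (quot_bop _ (eP s) (eP t) erefl) opprD addrACA subrr add0r -scalerBl scalerA.
      by rewrite mulVf ?subr_eq0// scale1r subrr.
    by rewrite (tangent_norm0 hip hN htau hq0) subr0 normr0.
  - apply: cvg_near_cst; near=> s.
    by rewrite sub_bop subrr (tangent_norm0 hip hN htau hq0).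
have [A [B [eA eB _ _ [[_ h1] [_ h2]]]]] := C1_density hip hN htau hq0 hq1 hr nF0 sF0 hF0 ltr01 hC.
have ? : A = F by apply: bop_eq; rewrite -eA eP scale0r addr0.
have ? : B = sgn F by apply: bop_eq; rewrite -eB eP scale1r addrC subrK.
subst A B; rewrite /path_integral /= -/(path_density P).
rewrite h1 h2 rmorphM fmorphV.
by [].
Unshelve. all: by end_near. Qed.

Lemma ind_sgn F F' : Msp F -> Msp F' ->
  ind ip tau (nonneg_proj ip F) (nonneg_proj ip F') = (Crq r q)^-1 * J k1 (sgn F) (sgn F' - sgn F).
Proof.
move=> mF mF'; have sF := Msp_sa hip sF0 mF; have sF' := Msp_sa hip sF0 mF'.
rewrite !nonneg_projE// (J_symmetries hip hN htau hq0 hq1 hr nF0 sF0 hF0 (Msp_sgn mF) (Msp_sgn mF') (sgn_sq sF) (sgn_sq sF')).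
by rewrite mulKf// gt_eqF// (Crq_gt0 hq0 hq1 hr).
Qed.

(** The signs of two points of [Mspace] differ by a tangent vector, which lies in [Kideal], so the
    quotient norm is at most 0. Every partition is therefore fine, already the one with a single
    interval. *)
Lemma nonneg_proj_quotient F F' : Msp F -> Msp F' ->
  quotient_norm ip N tau (nonneg_proj ip F - nonneg_proj ip F') < 1.
Proof.
move=> mF mF'; have sF := Msp_sa hip sF0 mF; have sF' := Msp_sa hip sF0 mF'.
have q20 : 0 < q / 2 by exact: divr_gt0.
have q21 : q / 2 <= 1 by rewrite ler_pdivrMr// mul1r (le_trans hq1)// ler1n.
have tD : tang (sgn F - sgn F') by apply: (Msp_diff hip hN htau hq0); exact: Msp_sgn.
rewrite !nonneg_projE// sub_bop.
have -> : halfp (sgn F) - halfp (sgn F') = 2^-1 *: (sgn F - sgn F').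
  by rewrite /halfp -scalerBr opprD addrACA subrr add0r.
by apply: (le_lt_trans (tame_quotient_norm hip hN htau q20 q21 (tameZ hip hN htau 2^-1 q20 tD.1))); exact: ltr01.
Qed.

Lemma spectral_flow_formula (F1 F2 : bop H) (P : R -> H -> H) : Msp F1 -> Msp F2 ->
  piecewise_C1 ip N tau F0 q P 1 2 -> P 1 = F1 -> P 2 = F2 ->
  exists2 sf : R, is_spectral_flow ip N tau P 1 2 sf &
    sf%:C = (Crq r q)%:C^-1 * path_integral ip N tau F0 r q P 1 2
            + gamma ip N tau F0 r q F2 - gamma ip N tau F0 r q F1.
Proof.
move=> m1 m2 [s ps hC] e1 e2.
have [B [eB _ [_ h1] [_ h2] hM]] := piecewise_density ps hC e1 m1.
have ? : B = F2 by apply: bop_eq; rewrite -eB.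
subst B; have c0 := Crq_gt0 hq0 hq1 hr.
have ms1 := Msp_sgn m1; have ms2 := Msp_sgn m2.
(* The potential at X is J k1 F1 (X - F1). The spectral flow is its difference between the signs of
   F2 and F1: the sum of indices telescopes to it through the signs of the nodes, and the analytic
   side through F1, F2 and the sign of F2. *)
exists ((Crq r q)^-1 * (J k1 F1 (sgn F2 - F1) - J k1 F1 (sgn F1 - F1))); last first.
  rewrite /path_integral /= -/(path_density P) h1 h2 !gammaE//.
  rewrite -(J_chain m1 m2 ms2) -fmorphV -!rmorphM -rmorphD -rmorphB.
  by congr (_%:C); ring.
split=> [|s' [ps' _]].
  exists [:: 2]; split; first by split => //=; rewrite andbT ltr1n.
  move=> i; rewrite ltnS leqn0 => /eqP -> /= u v hu hv.
  have [Fu -> mu] := hM u hu; have [Fv -> mv] := hM v hv.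
  exact: nonneg_proj_quotient.
pose node i := nth 0 (1 :: s') i.
have hnode i : (i < (size s').+1)%N -> exists2 F : bop H, P (node i) = F & Msp F.
  move=> hi; apply: hM; rewrite /node (set_nth_default 2)//.
  by rewrite (itv_partition_nth_ge _ ps')// (itv_partition_nth_le _ ps').
pose L i := lift_path P (node i).
have hL i : (i < (size s').+1)%N -> P (node i) = L i /\ Msp (L i).
  by move=> /hnode[F eF mF]; rewrite /L (lift_pathE eF).
pose psi i := J k1 F1 (sgn (L i) - F1).
have -> : \sum_(i < size s') ind ip tau (nonneg_proj ip (P (nth 0 (1 :: s') i))) (nonneg_proj ip (P (nth 0 s' i))) =
    \sum_(i < size s') (Crq r q)^-1 * (psi i.+1 - psi i).
  apply: eq_bigr => i _; have [ei mi] := hL i (ltnW (ltn_ord i)).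
  have [ei1 mi1] := hL i.+1 (ltn_ord i).
  rewrite -/(node i) -[nth 0 s' i]/(node i.+1) ei ei1 (ind_sgn mi mi1); congr (_ * _).
  by rewrite /psi -(J_chain m1 (Msp_sgn mi) (Msp_sgn mi1)) [J k1 F1 _ + _]addrC addrK.
rewrite (sum_telescope _ psi).
have l0 : L 0%N = F1 by rewrite /L (lift_pathE (X := F1)).
have l1 : L (size s') = F2.
  rewrite /L (lift_pathE (X := F2))// /node -[nth 0 _ _]/(nth 0 (1 :: s') (size s')).
  by rewrite -[size s']/((size (1 :: s')).-1) nth_last /=; case: ps' => _ /eqP ->.
rewrite /psi l0 l1; reflexivity.
Qed.

End SpectralFlow.

Theorem theorem5p7 (R : realType)
  (H : completeNormedModType R[i]) (ip : H -> H -> R[i])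
  (hip : hilbert_inner_product ip)
  (N : set (H -> H)) (hN : von_neumann_algebra ip N)
  (hsep : separable_predual ip N)
  (tau : (H -> H) -> \bar R) (htau : fns_trace ip N tau)
  (A : completeNormedModType R[i]) (mul : A -> A -> A) (one : A) (star : A -> A)
  (hA : unital_banach_star_algebra mul one star)
  (rep : A -> H -> H) (F0 : H -> H) (q r : R)
  (hq0 : 0 < q) (hq1 : q <= 1) (hr : 0 <= r)
  (hmod : odd_pre_BF_module ip N tau mul star rep F0 q)
  (F1 F2 : H -> H)
  (hF1 : Mspace ip N tau F0 q F1) (hF2 : Mspace ip N tau F0 q F2)
  (F : R -> H -> H) (hF : piecewise_C1 ip N tau F0 q F 1 2)
  (hFl : F 1 = F1) (hFr : F 2 = F2) :
  exists2 sf : R, is_spectral_flow ip N tau F 1 2 sf &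
    sf%:C = (Crq r q)%:C^-1 * path_integral ip N tau F0 r q F 1 2
            + gamma ip N tau F0 r q F2 - gamma ip N tau F0 r q F1.
Proof.
have [nF0 aF0 _ lF0] : [/\ N F0, adjoint ip F0 = F0, True & Li0 ip N tau q (idop - (F0 \o F0))].
  by case: hmod.
have [X eX] := N_bop hN nF0; subst F0.
have sX : sa ip X by exact: (adjoint_sa hip aF0).
have sXX : sa ip (1 - X * X) by apply: (saB hip (sa1 ip)); case: (psd_sqr hip sX).
have tX : tame ip N tau q (1 - X * X) by exact: (Li0_tame hip hN htau hq0 hq1 sXX lF0).
have [Y1 e1 m1] := (MspP hip hN htau hq0 hq1 sX F1).1 hF1.
have [Y2 e2 m2] := (MspP hip hN htau hq0 hq1 sX F2).1 hF2.
have h1 : F 1 = Y1 by rewrite hFl.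
have h2 : F 2 = Y2 by rewrite hFr.
rewrite e1 e2; exact (spectral_flow_formula hip hN htau hq0 hq1 hr nF0 sX tX m1 m2 hF h1 h2).
Qed.
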